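(* Let $p,d$ be positive integers. (Real case.) Let $\mathcal{U}\subset\mathbb{R}^d$ be open and let $F:\mathcal{U}\to\mathbb{R}^d$ be a Gaussian random field with almost surely $C^p$ sample paths. Assume that for every $x\in\mathcal{U}$ the Gaussian vector $(\partial^\alpha F(x))_{|\alpha|\le p-1}$ is non-degenerate. (Complex case.) Let $\mathcal{U}\subset\mathbb{C}^d$ be open and let $F:\mathcal{U}\to\mathbb{C}^d$ be a Gaussian random field with almost surely holomorphic sample paths. Assume that for every $x\in\mathcal{U}$ the Gaussian vector $(\partial^\alpha F(x))_{|\alpha|\le p-1}$ is non-degenerate, where $\partial^\alpha$ denotes complex differentiation. In either case, for every compact subset $K\subset\mathcal{U}$, \[\mathbb{E}\left[\#Z(F,K)^p\right]<+\infty.\]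
   Context: For a map $F$ on $\mathcal{U}$ and $K\subset\mathcal{U}$, $Z(F,K)=\{x\in K: F(x)=0\}$, and $\#$ denotes cardinality. Multi-index notation: for $\alpha\in\mathbb{N}^d$, $\partial^\alpha=\partial_1^{\alpha_1}\cdots\partial_d^{\alpha_d}$ and $|\alpha|=\alpha_1+\dots+\alpha_d$. The field $\mathbb{C}$ is identified with $\mathbb{R}^2$, so complex-valued Gaussian fields and vectors are regarded as real Gaussian fields and vectors, and non-degeneracy is meant in this real sense. *)

(* Defs.v *)
From HB Require Import structures.
From mathcomp Require Import all_boot all_order all_algebra.
From mathcomp Require Import all_classical all_reals all_analysis.
From mathcomp Require Import finmap complex.

Set Implicit Arguments.
Unset Strict Implicit.
Unset Printing Implicit Defensive.

Import Order.TTheory GRing.Theory Num.Theory.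
Import numFieldNormedType.Exports.

Local Open Scope classical_set_scope.
Local Open Scope ring_scope.

Section PartialDerivatives.
Context {K : numFieldType} {d : nat}.

Definition unit_dir (i : 'I_d) : 'rV[K]_d := delta_mx 0 i.

(* partial derivative in the i-th variable (over the field K: for K = C this
   is the complex partial derivative, limit taken over complex increments) *)
Definition pderiv (i : 'I_d) (f : 'rV[K]_d -> 'rV[K]_d) : 'rV[K]_d -> 'rV[K]_d :=
  fun x => 'D_(unit_dir i) f x.

Definition multi_deriv (a : 'I_d -> nat) (f : 'rV[K]_d -> 'rV[K]_d) :
    'rV[K]_d -> 'rV[K]_d :=
  foldr (fun i g => iter (a i) (pderiv i) g) f (enum 'I_d).
End PartialDerivatives.

Definition multi_index (d p : nat) :=
  {a : {ffun 'I_d -> 'I_p} | (\sum_(i < d) (a i : nat) < p)%N}.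

Definition mi_fun (d p : nat) (a : multi_index d p) : 'I_d -> nat :=
  fun i => (sval a i : nat).

Definition cont_on {R : realType} {d : nat} (U : set 'rV[R]_d)
    (f : 'rV[R]_d -> 'rV[R]_d) : Prop :=
  forall x, U x -> {for x, continuous f}.

Definition pderivable_on {R : realType} {d : nat} (U : set 'rV[R]_d)
    (f : 'rV[R]_d -> 'rV[R]_d) (i : 'I_d) : Prop :=
  forall x, U x -> derivable f x (unit_dir i).

Fixpoint is_Ck {R : realType} {d : nat} (k : nat) (U : set 'rV[R]_d)
    (f : 'rV[R]_d -> 'rV[R]_d) {struct k} : Prop :=
  cont_on U f /\
  match k with
  | 0 => True
  | k'.+1 => forall i : 'I_d, pderivable_on U f i /\ is_Ck k' U (pderiv i f)
  end.

(* the complex numbers C = R[i], packaged as a numFieldType (so that the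
   normed-space structure of C^d = 'rV[Cnum R]_d is found by inference) *)
Definition Cnum (R : realType) : numFieldType := R[i].

(* f is holomorphic on U \subset C^d: complex (Frechet) differentiable,
   i.e. with a C-linear differential, at every point of U *)
Definition holomorphic_on {R : realType} {d : nat} (U : set 'rV[Cnum R]_d)
    (f : 'rV[Cnum R]_d -> 'rV[Cnum R]_d) : Prop :=
  forall x, U x -> differentiable f x.

Section Gaussian.
Context {dT : measure_display} {T : measurableType dT} {R : realType}.
Variable P : probability T R.

Definition gaussian_rv (X : T -> R) : Prop :=
  measurable_fun setT X /\
  exists m s : R, 0 <= s /\
    forall B : set R, measurable B ->
      P (X @^-1` B) = (if s == 0 then \d_m B else normal_prob m s B).

Definition gaussian_field_R {d : nat} (U : set 'rV[R]_d)
    (F : T -> 'rV[R]_d -> 'rV[R]_d) : Prop :=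
  forall (n : nat) (x : 'I_n -> 'rV[R]_d) (j : 'I_n -> 'I_d) (c : 'I_n -> R),
    (forall k, U (x k)) ->
    gaussian_rv (fun w => \sum_(k < n) c k * F w (x k) 0 (j k)).

Definition re_im (b : bool) (z : Cnum R) : R :=
  if b then complex.Re z else complex.Im z.

(* complex Gaussian field, regarded as a real Gaussian field (C = R^2) *)
Definition gaussian_field_C {d : nat} (U : set 'rV[Cnum R]_d)
    (F : T -> 'rV[Cnum R]_d -> 'rV[Cnum R]_d) : Prop :=
  forall (n : nat) (x : 'I_n -> 'rV[Cnum R]_d) (j : 'I_n -> 'I_d)
      (b : 'I_n -> bool) (c : 'I_n -> R),
    (forall k, U (x k)) ->
    gaussian_rv (fun w => \sum_(k < n) c k * re_im (b k) (F w (x k) 0 (j k))).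

Definition nondegenerate_vec (I : finType) (X : I -> T -> R) : Prop :=
  forall c : I -> R, (exists i, c i != 0) ->
    0 < \sum_i \sum_j c i * c j * fine (covariance P (X i) (X j)).
End Gaussian.

Definition nzeros {R : realType} {V : choiceType} {W : nmodType}
    (f : V -> W) (K : set V) : \bar R :=
  let Z := [set x | K x /\ f x = 0] in
  if pselect (finite_set Z) then ((#|` fset_set Z|%fset)%:R)%:E else +oo%E.

(* Main.v *)
(** By compactness it suffices to bound the factorial moment of order [p] of the number of zeros in
    a small box.  Non-degeneracy of the jets provides Cameron-Martin directions [A_w] close to the
    monomials of degree [< p], so the law of [F] is compared with the average, over a fine grid of
    parameters [t], of the laws of [F + \sum_w t_w A_w]; the density and the size of [F] have finite
    moments by Fernique's theorem.  For a fixed path, one then counts the pairs of a parameter [t]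
    and a [p]-tuple of zeros of the perturbed path: to each such pair correspond polynomial systems
    of degree [p] with a zero near each point of the tuple, with bounded multiplicity, and a
    polynomial system in general position has boundedly many zeros.  The resulting bound does not
    depend on the separation of the zeros, so no singularity at the diagonal has to be integrated.

    In the complex case, that holomorphic paths have continuous derivatives of all orders is obtained
    from Goursat's bisection argument, with increments of primitives in the place of contour
    integrals. *)

Require Import Defs.
From HB Require Import structures.
From mathcomp Require Import all_boot all_order all_algebra.
From mathcomp Require Import all_classical all_reals all_analysis.
From mathcomp Require Import measurable_realfun normal_distribution perm finmap complex ring lra zify.


Set Implicit Arguments.
Unset Strict Implicit.
Unset Printing Implicit Defensive.
Import Order.TTheory GRing.Theory Num.Theory.
Import numFieldNormedType.Exports.
Local Open Scope classical_set_scope.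
Local Open Scope ring_scope.


(** * Scalars *)

(** How a pair becomes a polynomial system: for each tuple one takes a system [PP] of degree
    [q.+1 = p] vanishing on it, and adds a polynomial whose values on the tuple are small multiples
    of the increments of the perturbed field. Dummy parameters matched with the top degree
    coefficients give both sides the same dimension, so that grid points can be counted against each
    other. The obstacle is that interpolation on a tuple degenerates as its points merge. It is met
    by choosing [PP] to nearly maximise the Jacobian determinant at all points of the tuple at once:
    by Cramer's rule its differential then dominates that of every bounded polynomial vanishing on
    the tuple, with a constant [C0] independent of the separation [r]. Cells of tuples are measured
    by this differential, not by a norm. Constants that do blow up with [r] are absorbed by the cell
    size [eps], the accuracy [tau] and the mesh [1 / N], all fixed before the random size [M] of the
    path, which costs a power of [M] only. Finally, the number of zeros is not known to be
    measurable: separated almost zeros at rational points replace it, up to a last application of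
    Fatou's lemma. *)

(* [K] is R or C; [co b] are the real coordinates in the real basis [uu b]. *)
Record scalars (R : realType) (K : numFieldType) := Scalars {
  iota : {rmorphism R -> K};
  nrm : K -> R;
  BB : finType;
  uu : BB -> K;
  co : BB -> K -> R;
  normE : forall z, `|z| = iota (nrm z);
  iota_le : forall x y, (iota x <= iota y) = (x <= y);
  co_add : forall b x y, co b (x + y) = co b x + co b y;
  co_scale : forall b r x, co b (iota r * x) = r * co b x;
  co_nrm : forall b x, `|co b x| <= nrm x;
  co_uu : forall b b', co b (uu b') = (b == b')%:R;
  nrm_uu : forall b, nrm (uu b) = 1;
  co_sum : forall x, x = \sum_b iota (co b x) * uu b
}.

Arguments uu {R K} s b : rename.
Arguments co {R K} s b z : rename.
Arguments co_add {R K} s b x y : rename.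
Arguments co_scale {R K} s b r x : rename.
Arguments co_nrm {R K} s b x : rename.
Arguments co_uu {R K} s b b' : rename.
Arguments nrm_uu {R K} s b : rename.

Section ScalarTheory.
Context {R : realType} {K : numFieldType} (S : scalars R K).
Implicit Types (x y z : K) (r : R).
Local Notation nrm := (nrm S).
Local Notation iota := (iota S).
Local Notation co := (co S).

Lemma iota_inj : injective iota.
Proof. exact: fmorph_inj. Qed.

Lemma nrm_ge0 z : 0 <= nrm z.
Proof. by rewrite -(iota_le S) rmorph0 -normE normr_ge0. Qed.

Lemma nrmM x y : nrm (x * y) = nrm x * nrm y.
Proof. by apply: iota_inj; rewrite rmorphM /= -!normE normrM. Qed.

Lemma nrmD x y : nrm (x + y) <= nrm x + nrm y.
Proof. by rewrite -(iota_le S) rmorphD /= -!normE ler_normD. Qed.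

Lemma nrmN x : nrm (- x) = nrm x.
Proof. by apply: iota_inj; rewrite -!normE normrN. Qed.

Lemma nrm0 : nrm 0 = 0.
Proof. by apply: iota_inj; rewrite -normE normr0 rmorph0. Qed.

Lemma nrm1 : nrm 1 = 1.
Proof. by apply: iota_inj; rewrite -normE normr1 rmorph1. Qed.

Lemma nrm_eq0 x : nrm x = 0 -> x = 0.
Proof.
by move=> x0; apply/eqP; rewrite -normr_eq0 (normE S) x0 rmorph0.
Qed.

Lemma nrmB x y : nrm (x - y) = nrm (y - x).
Proof. by rewrite -nrmN opprB. Qed.

Lemma nrm_iota r : nrm (iota r) = `|r|.
Proof.
apply: iota_inj; rewrite -normE.
have [r0|r0] := leP 0 r.
  by rewrite !ger0_norm// -(rmorph0 iota) iota_le.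
by rewrite !ltr0_norm ?rmorphN//= -(rmorph0 iota) lt_neqAle iota_le ltW// andbT (inj_eq iota_inj) lt_eqF.
Qed.

Lemma nrm_sum (I : finType) (P : pred I) (F : I -> K) :
  nrm (\sum_(i | P i) F i) <= \sum_(i | P i) nrm (F i).
Proof.
elim/big_rec2: _ => [|i y1 y2 _ h]; first by rewrite nrm0.
by apply: le_trans (nrmD _ _) _; rewrite lerD2l.
Qed.

Lemma nrm_sum_le (I : finType) (F : I -> K) (M : R) :
  (forall i, nrm (F i) <= M) -> nrm (\sum_i F i) <= #|I|%:R * M.
Proof.
move=> h; apply: le_trans (nrm_sum _ _) _.
apply: le_trans (ler_sum _ (fun i _ => h i)) _.
by rewrite sumr_const mulr_natl.
Qed.

Lemma nrmV x : nrm x^-1 = (nrm x)^-1.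
Proof.
have [->|x0] := eqVneq x 0; first by rewrite invr0 nrm0 invr0.
have nx0 : nrm x != 0 by apply: contra_neq x0; exact: nrm_eq0.
by apply: (mulfI nx0); rewrite -nrmM !divff// nrm1.
Qed.

Lemma nrmX x n : nrm (x ^+ n) = nrm x ^+ n.
Proof. by elim: n => [|n ih]; rewrite ?expr0 ?nrm1// !exprS nrmM ih. Qed.

Lemma nrm_nat n : nrm n%:R = n%:R.
Proof. by rewrite -(rmorph_nat iota) nrm_iota ger0_norm. Qed.

Lemma nrm_prod (I : finType) (F : I -> K) :
  nrm (\prod_i F i) = \prod_i nrm (F i).
Proof. by rewrite (big_morph nrm nrmM nrm1). Qed.

Lemma nrmDl x y (a b : R) : nrm x <= a -> nrm y <= b -> nrm (x + y) <= a + b.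
Proof. by move=> *; apply: le_trans (nrmD _ _) _; apply: lerD. Qed.

Lemma nrmBl x y (a b : R) : nrm x <= a -> nrm y <= b -> nrm (x - y) <= a + b.
Proof. by move=> xa yb; apply: nrmDl => //; rewrite nrmN. Qed.

Lemma nrmMl x y (a b : R) : nrm x <= a -> nrm y <= b -> nrm (x * y) <= a * b.
Proof. by move=> *; rewrite nrmM ler_pM// nrm_ge0. Qed.

Lemma nrm_lowerD x y : nrm x - nrm y <= nrm (x + y).
Proof. by rewrite lerBlDr -{1}(addrK y x) -(nrmN y); exact: nrmD. Qed.

Lemma co_comb b (f : BB S -> R) : co b (\sum_b' iota (f b') * uu S b') = f b.
Proof.
have cosum (F : BB S -> K) : co b (\sum_b' F b') = \sum_b' co b (F b').
  apply: (big_morph (co b) (co_add S b)).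
  by rewrite -[X in co b X](mul0r (0 : K)) -(rmorph0 iota) co_scale mul0r.
rewrite cosum (bigD1 b)//= co_scale co_uu eqxx mulr1 big1 ?addr0// => b' b'b.
by rewrite co_scale co_uu eq_sym (negbTE b'b) mulr0.
Qed.

Lemma coB b x y : co b (x - y) = co b x - co b y.
Proof. by rewrite co_add -(mulN1r y) -(rmorph1 iota) -rmorphN co_scale mulN1r. Qed.

Lemma nrm_co_le z (M : R) : (forall b, `|co b z| <= M) -> nrm z <= #|BB S|%:R * M.
Proof.
move=> h; rewrite {1}(co_sum S z); apply: nrm_sum_le => b.
by rewrite nrmM nrm_uu mulr1 nrm_iota.
Qed.

(** Completeness is read on the real coordinates, where the limit is the supremum of the lower ends
    [u n - 2 * C / 2 ^+ n]. The explicit geometric rate is what Newton's method and the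
    differentiation of holomorphic functions use. *)
Lemma nrm_complete (z : nat -> K) (C : R) : (forall n, nrm (z n.+1 - z n) <= C / 2 ^+ n) ->
  exists l, forall n, nrm (l - z n) <= #|BB S|%:R * (2 * C) / 2 ^+ n.
Proof.
move=> h.
have C0 : 0 <= C by have := le_trans (nrm_ge0 _) (h 0); rewrite expr0 divr1.
have h2 b n : `|co b (z n.+1) - co b (z n)| <= C / 2 ^+ n.
  by rewrite -coB; exact: le_trans (co_nrm _ _ _) (h n).
have [l hl] : exists l : BB S -> R, forall b n, `|l b - co b (z n)| <= 2 * C / 2 ^+ n.
  suff : forall b, exists l : R, forall n, `|l - co b (z n)| <= 2 * C / 2 ^+ n.
    by move=> /choice[l hl]; exists l.
  move=> b; set u := fun n => co b (z n).
  have hu n m : (n <= m)%N -> `|u m - u n| <= 2 * C / 2 ^+ n - 2 * C / 2 ^+ m.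
    elim: m => [|m ih]; first by rewrite leqn0 => /eqP->; rewrite !subrr normr0.
    rewrite leq_eqVlt => /orP[/eqP->|]; first by rewrite !subrr normr0.
    rewrite ltnS => /ih {}ih.
    rewrite -(subrK (u m) (u m.+1)) -addrA; apply: le_trans (ler_normD _ _) _.
    apply: le_trans (lerD (h2 b m) ih) _.
    have -> : 2 * C / 2 ^+ m.+1 = C / 2 ^+ m.
      by rewrite exprS; field; rewrite expf_neq0.
    have -> : 2 * C / 2 ^+ m = 2 * (C / 2 ^+ m) by rewrite mulrA.
    lra.
  have p2 n : 0 < 2 ^+ n :> R by rewrite exprn_gt0.
  pose A := [set y | exists n, y = u n - 2 * C / 2 ^+ n].
  have ubA n : ubound A (u n + 2 * C / 2 ^+ n).
    move=> y [m ->]; have [nm|/ltnW mn] := leqP n m.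
      have := hu _ _ nm; rewrite ler_norml => /andP[_].
      have : 0 <= 2 * C / 2 ^+ m by rewrite divr_ge0 ?mulr_ge0// ltW.
      have : 0 <= 2 * C / 2 ^+ n by rewrite divr_ge0 ?mulr_ge0// ltW.
      lra.
    have := hu _ _ mn; rewrite ler_norml => /andP[+ _].
    have : 0 <= 2 * C / 2 ^+ m by rewrite divr_ge0 ?mulr_ge0// ltW.
    have : 0 <= 2 * C / 2 ^+ n by rewrite divr_ge0 ?mulr_ge0// ltW.
    lra.
  have A0 : A !=set0 by exists (u 0%N - 2 * C / 2 ^+ 0), 0%N.
  exists (sup A) => n; rewrite ler_distl; apply/andP; split.
    by apply: ub_le_sup; [exists (u 0%N + 2 * C / 2 ^+ 0); exact: ubA|exists n].
  by apply: ge_sup => //; exact: ubA.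
exists (\sum_b iota (l b) * uu S b) => n.
rewrite -mulrA; apply: nrm_co_le => b; rewrite coB co_comb; exact: hl.
Qed.

End ScalarTheory.

(** * Polynomials indexed by words *)

Section SupNorm.
Context {R : realType} {K : numFieldType} (S : scalars R K).
Local Notation nrm := (nrm S).

Definition nv n (x : 'rV[K]_n) : R := \big[Order.max/0]_i nrm (x 0 i).

Lemma nv_ge0 n (x : 'rV[K]_n) : 0 <= nv x.
Proof. by rewrite /nv; elim/big_rec: _ => // i y _ y0; rewrite le_max y0 orbT. Qed.

Lemma le_nv n (x : 'rV[K]_n) i : nrm (x 0 i) <= nv x.
Proof. exact: (@le_bigmax _ _ _ 0 (fun i => nrm (x 0 i))). Qed.

Lemma nv_le n (x : 'rV[K]_n) (M : R) : 0 <= M -> (forall i, nrm (x 0 i) <= M) -> nv x <= M.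
Proof. by move=> M0 h; apply/bigmax_leP; split. Qed.

Lemma nvD n (x y : 'rV[K]_n) : nv (x + y) <= nv x + nv y.
Proof.
apply: nv_le => [|i]; first by rewrite addr_ge0// nv_ge0.
by rewrite mxE; apply: nrmDl; exact: le_nv.
Qed.

Lemma nvN n (x : 'rV[K]_n) : nv (- x) = nv x.
Proof. by apply: eq_bigr => i _; rewrite mxE nrmN. Qed.

Lemma nvB n (x y : 'rV[K]_n) : nv (x - y) = nv (y - x).
Proof. by rewrite -nvN opprB. Qed.

Lemma nv_tri n (y x z : 'rV[K]_n) : nv (x - z) <= nv (x - y) + nv (y - z).
Proof. by rewrite (_ : x - z = (x - y) + (y - z)) ?nvD// addrA subrK. Qed.

Lemma nv0 n : nv (0 : 'rV[K]_n) = 0.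
Proof. by apply/eqP; rewrite eq_le nv_ge0 andbT; apply: nv_le => // i; rewrite mxE nrm0. Qed.

Lemma nvZ n a (x : 'rV[K]_n) : nv (a *: x) = nrm a * nv x.
Proof.
apply/eqP; rewrite eq_le; apply/andP; split.
  by apply: nv_le => [|i]; rewrite ?mulr_ge0 ?nrm_ge0 ?nv_ge0// mxE nrmM ler_wpM2l ?nrm_ge0// le_nv.
have [->|a0] := eqVneq a 0; first by rewrite nrm0 mul0r nv_ge0.
have na : 0 < nrm a by rewrite lt_neqAle nrm_ge0 andbT eq_sym; apply: contra_neq a0; exact: nrm_eq0.
rewrite -ler_pdivlMl//; apply: nv_le => [|i]; first by rewrite mulr_ge0 ?nv_ge0// invr_ge0 nrm_ge0.
by rewrite ler_pdivlMl// -nrmM; have := le_nv (a *: x) i; rewrite mxE.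
Qed.

Lemma nv_eq0 n (x : 'rV[K]_n) : nv x = 0 -> x = 0.
Proof.
move=> x0; apply/rowP => i; rewrite mxE; apply: (@nrm_eq0 _ _ S); apply/eqP.
by rewrite eq_le nrm_ge0 andbT -x0 le_nv.
Qed.

Lemma nv_witness n (x : 'rV[K]_n) (r : R) : 0 < r -> r <= nv x -> exists i, r <= nrm (x 0 i).
Proof.
move=> r0 rx; apply/not_existsP => h.
have hi i : nrm (x 0 i) < r by rewrite ltNge; apply/negP; exact: h.
suff : nv x < r by rewrite ltNge rx.
by apply/bigmax_ltP; split.
Qed.

End SupNorm.

(** Words of length at most [k] in [d] letters. They index monomials redundantly, which is harmless
    since only bounds on some choice of coefficients matter; multiplying by a variable is then
    prepending a letter. *)
Fixpoint J (d k : nat) : finType :=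
  if k is k'.+1 then option ('I_d * J d k')%type else unit.

Section Words.
Context {R : realType} {K : numFieldType} (S : scalars R K) {d : nat}.
Local Notation nrm := (nrm S).
Local Notation nv := (nv S).
Local Notation V := 'rV[K]_d.

Fixpoint wmon k : J d k -> V -> K :=
  match k with
  | 0 => fun _ _ => 1
  | k'.+1 => fun w x => if w is Some (i, w') then x 0 i * wmon w' x else 1
  end.

(* [wmon w y - wmon w x = \sum_j wdd w x y j * (y_j - x_j)] *)
Fixpoint wdd k : J d k -> V -> V -> 'I_d -> K :=
  match k with
  | 0 => fun _ _ _ _ => 0
  | k'.+1 => fun w x y j =>
      if w is Some (i, w') then (i == j)%:R * wmon w' y + x 0 i * wdd w' x y j else 0
  end.

Definition pev k (c : J d k -> K) (x : V) : K := \sum_w c w * wmon w x.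

Lemma wmon_bound k : exists2 C : R, 1 <= C & forall (w : J d k) x, nv x <= 2 -> nrm (wmon w x) <= C.
Proof.
elim: k => [|k [C C1 ih]]; first by exists 1 => // w x _; rewrite /= nrm1.
exists (2 * C) => [|w x x2]; first lra.
case: w => [[i w]|] /=; last by rewrite nrm1; lra.
by apply: nrmMl; [exact: le_trans (le_nv _ _ _) x2|exact: ih].
Qed.

Lemma wmon_dd k (w : J d k) x y : wmon w y - wmon w x = \sum_j wdd w x y j * (y 0 j - x 0 j).
Proof.
elim: k w => [|k ih] w /=.
  by rewrite subrr big1// => j _; rewrite mul0r.
case: w => [[i w]|]; last by rewrite subrr big1// => j _; rewrite mul0r.
rewrite (_ : _ - _ = (y 0 i - x 0 i) * wmon w y + x 0 i * (wmon w y - wmon w x)); last by ring.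
rewrite ih mulr_sumr.
under [RHS]eq_bigr do rewrite mulrDl.
rewrite big_split/=; congr +%R; last by apply: eq_bigr => j _; rewrite mulrA.
rewrite (bigD1 i)//= eqxx mul1r big1 ?addr0 1?mulrC// => j ji.
by rewrite eq_sym (negbTE ji) mul0r mul0r.
Qed.

Lemma wdd_bound k : exists2 C : R, 1 <= C & forall (w : J d k) x y j, nv x <= 2 -> nv y <= 2 ->
  nrm (wdd w x y j) <= C.
Proof.
elim: k => [|k [C C1 ih]]; first by exists 1 => // *; rewrite /= nrm0.
have [C' C'1 hC'] := wmon_bound k.
exists (C' + 2 * C) => [|w x y j x2 y2]; first lra.
case: w => [[i w]|] /=; last by rewrite nrm0; lra.
apply: nrmDl; last by apply: nrmMl; [exact: le_trans (le_nv _ _ _) x2|exact: ih].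
by rewrite -[C']mul1r; apply: nrmMl; [case: eqP; rewrite ?nrm1 ?nrm0|exact: hC'].
Qed.

Lemma wmon_lip k : exists2 C : R, 1 <= C & forall (w : J d k) x y, nv x <= 2 -> nv y <= 2 ->
  nrm (wmon w y - wmon w x) <= C * nv (y - x).
Proof.
have [C C1 hC] := wdd_bound k.
exists (1 + d%:R * C) => [|w x y x2 y2]; first by rewrite lerDl mulr_ge0//; lra.
rewrite wmon_dd; apply: (@le_trans _ _ (d%:R * (C * nv (y - x)))).
  rewrite -[X in X%:R]card_ord; apply: nrm_sum_le => j; apply: nrmMl; first exact: hC.
  by have := le_nv S (y - x) j; rewrite !mxE.
by rewrite mulrA ler_wpM2r ?nv_ge0// lerDr.
Qed.

Lemma wdd_lip k : exists2 C : R, 1 <= C & forall (w : J d k) x y x' y' j,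
  nv x <= 2 -> nv y <= 2 -> nv x' <= 2 -> nv y' <= 2 ->
  nrm (wdd w x y j - wdd w x' y' j) <= C * (nv (x - x') + nv (y - y')).
Proof.
elim: k => [|k [C C1 ih]].
  by exists 1 => // *; rewrite /= subrr nrm0 mul1r addr_ge0// nv_ge0.
have [C1' C1'1 h1] := wmon_lip k; have [C2 C21 h2] := wdd_bound k.
exists (C1' + C2 + 2 * C) => [|w x y x' y' j x2 y2 x'2 y'2]; first lra.
have nx := nv_ge0 S (x - x'); have ny := nv_ge0 S (y - y').
case: w => [[i w]|] /=; last by rewrite subrr nrm0 mulr_ge0//; lra.
set a := wmon _ y; set a' := wmon _ y'; set e := (_ == _)%:R; set b := wdd _ _ _ _; set b' := wdd _ _ _ _.
rewrite (_ : _ - _ = e * (a - a') + ((x - x') 0 i * b + x' 0 i * (b - b'))); last by rewrite !mxE; ring.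
have e1 : nrm (e * (a - a')) <= C1' * nv (y - y').
  rewrite nrmM; apply: (@le_trans _ _ (1 * nrm (a - a'))); last by rewrite mul1r; exact: h1.
  by rewrite ler_wpM2r ?nrm_ge0// /e; case: eqP; rewrite ?nrm1 ?nrm0.
have e2 : nrm ((x - x') 0 i * b) <= nv (x - x') * C2 by apply: nrmMl; [exact: le_nv|exact: h2].
have e3 : nrm (x' 0 i * (b - b')) <= 2 * (C * (nv (x - x') + nv (y - y'))).
  by apply: nrmMl; [exact: le_trans (le_nv _ _ _) x'2|exact: ih].
have := nrmDl e1 (nrmDl e2 e3); move=> /le_trans; apply; nra.
Qed.

Lemma pevS k (c : J d k.+1 -> K) x :
  pev c x = c None + \sum_j x 0 j * pev (fun w => c (Some (j, w))) x.
Proof.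
rewrite /pev (bigD1 None)//= mulr1; congr +%R.
rewrite (reindex_omap (@Some ('I_d * J d k)) id) /=; last by case.
under [RHS]eq_bigr do rewrite mulr_sumr.
rewrite pair_bigA/=; apply: eq_big => [[j w]|[j w] _ /=]; first by rewrite eqxx.
by rewrite mulrCA.
Qed.

(** Words do not represent a polynomial uniquely, so only the existence of a representation with
    small coefficients is recorded. *)
Definition isP k (M : R) (f : V -> K) :=
  exists2 c : J d k -> K, (forall w, nrm (c w) <= M) & forall x, f x = pev c x.

Lemma isP_cst k a : isP k (nrm a) (fun _ => a).
Proof.
case: k => [|k].
  by exists (fun _ => a) => // x; rewrite /pev /= (bigD1 tt)//= big1 ?addr0 ?mulr1// => -[].
exists (fun w => if w is Some _ then 0 else a) => [[w|]|x] //; first by rewrite nrm0 nrm_ge0.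
rewrite pevS big1 ?addr0// => j _; rewrite /pev big1 ?mulr0// => w _.
by rewrite mul0r.
Qed.

Lemma isPD k M M' f g : isP k M f -> isP k M' g -> isP k (M + M') (fun x => f x + g x).
Proof.
move=> [c cM cf] [c' cM' cg]; exists (fun w => c w + c' w) => [w|x].
  exact: nrmDl.
by rewrite cf cg /pev -big_split; apply: eq_bigr => w _; rewrite mulrDl.
Qed.

Lemma isPZ k M f a : isP k M f -> isP k (nrm a * M) (fun x => a * f x).
Proof.
move=> [c cM cf]; exists (fun w => a * c w) => [w|x].
  exact: nrmMl.
by rewrite cf /pev mulr_sumr; apply: eq_bigr => w _; rewrite mulrA.
Qed.

Lemma isP_mulX k M f j : isP k M f -> isP k.+1 M (fun x => x 0 j * f x).
Proof.
move=> [c cM cf].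
exists (fun w : J d k.+1 => if w is Some (i, w') then if i == j then c w' else 0 else 0).
  have M0 : 0 <= M.
    apply: le_trans (nrm_ge0 S (c _)) (cM _).
    by case: (k) => [|k']; [exact: tt|exact: None].
  by case=> [[i w]|]; rewrite ?nrm0//; case: ifP => _; rewrite ?nrm0.
move=> x; rewrite pevS/= add0r (bigD1 j)//= cf eqxx big1 ?addr0// => i ij.
by rewrite (negbTE ij) /pev big1 ?mulr0// => w _; rewrite mul0r.
Qed.

Fixpoint embc k : (J d k -> K) -> J d k.+1 -> K :=
  match k with
  | 0 => fun c w => if w is Some _ then 0 else c tt
  | k'.+1 => fun c w =>
      if w is Some (j, w') then embc (fun w'' => c (Some (j, w''))) w' else c None
  end.

Lemma embcE k (c : J d k -> K) x : pev (embc c) x = pev c x.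
Proof.
elim: k c => [|k ih] c; last first.
  by rewrite !pevS; congr +%R; apply: eq_bigr => j _; rewrite ih.
rewrite pevS big1 ?addr0; last by move=> j _; rewrite /pev big1 ?mulr0// => w _; rewrite mul0r.
by rewrite /pev (bigD1 tt)//= big1 ?addr0 ?mulr1// => -[].
Qed.

Lemma embc_bound k (c : J d k -> K) M : (forall w, nrm (c w) <= M) -> forall w, nrm (embc c w) <= M.
Proof.
elim: k c => [|k ih] c cM /=.
  by case=> [w|//]; rewrite nrm0; exact: le_trans (nrm_ge0 _ _) (cM tt).
by case=> [[j w]|]; [apply: ih => w'|]; exact: cM.
Qed.

Lemma isP_emb k M f : isP k M f -> isP k.+1 M f.
Proof.
move=> [c cM cf]; exists (embc c); first exact: embc_bound.
by move=> x; rewrite embcE.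
Qed.

Lemma isP_le k M M' f : M <= M' -> isP k M f -> isP k M' f.
Proof. by move=> MM' [c cM cf]; exists c => // w; exact: le_trans (cM w) MM'. Qed.

Lemma isP_mulXB k M f j a : isP k M f -> isP k.+1 (M + nrm a * M) (fun x => (x 0 j - a) * f x).
Proof.
move=> h; have := isPD (isP_mulX j h) (isP_emb (isPZ (- a) h)); rewrite nrmN.
move=> [c cM cf]; exists c => // x; rewrite -cf; ring.
Qed.

(** * Interpolation property *)

(** The bound [M] holds whatever the mutual distances of the points, even when some coincide: this
    uniformity is what survives at the diagonal. The error [tau] is there because integrals are
    handled as Riemann sums. *)
Definition Int (E : set V) (k : nat) (M : R) (f : V -> K) :=
  forall x : 'I_k.+1 -> V, (forall i, E (x i)) -> forall tau : R, 0 < tau ->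
  exists2 c : J d k -> K, (forall w, nrm (c w) <= M) &
    forall i, nrm (f (x i) - pev c (x i)) <= tau.

Definition unitbox (E : set V) := forall x, E x -> nv x <= 1.

Lemma Int_ext E k M f g : f =1 g -> Int E k M f -> Int E k M g.
Proof.
move=> fg h x xE tau t0; have [c cM hc] := h x xE tau t0; exists c => // i; by rewrite -fg.
Qed.

Lemma Int_le E k M M' f : M <= M' -> Int E k M f -> Int E k M' f.
Proof.
move=> MM' h x xE tau t0; have [c cM hc] := h x xE tau t0; exists c => // i.
exact: le_trans (cM i) MM'.
Qed.

(** Newton interpolation: with [a] the first point, write [x_j f = a_j f + (x_j - a_j) f]. The first
    term is interpolated at all points in degree [k]; in the second, [f] is interpolated at the
    other points in degree [k - 1], and the factor vanishes at [a]. *)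
Lemma Int_mulX E k M f j : unitbox E -> 0 <= M ->
  (forall l, (l <= k)%N -> Int E l M f) -> Int E k (3 * M) (fun x => x 0 j * f x).
Proof.
move=> uE M0 hf x xE tau t0.
have xb i l : nrm (x i 0 l) <= 1 by exact: le_trans (le_nv _ _ _) (uE _ (xE i)).
have t2 : 0 < tau / 3 by lra.
have [c cM hc] := hf k (leqnn k) x xE _ t2.
have pc : isP k M (pev c) by exists c.
have h0 : isP k (nrm (x ord0 0 j) * M) (fun y => x ord0 0 j * pev c y) by exact: isPZ.
case: k x xE xb hf c cM hc pc h0 => [|k] x xE xb hf c cM hc pc h0.
  have [c' c'M h'] := h0; exists c' => [w|i].
    apply: le_trans (c'M w) _; have := xb ord0 j; have := nrm_ge0 S (x ord0 0 j); nra.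
  rewrite -h' (ord1 i) -mulrBr nrmM; apply: (@le_trans _ _ (1 * (tau / 3))); last lra.
  by rewrite ler_pM ?nrm_ge0//; rewrite -[ord0](ord1 ord0).
have [c1 c1M hc1] := hf k (leqnSn k) (fun i => x (lift ord0 i)) (fun i => xE _) _ t2.
have p1 : isP k M (pev c1) by exists c1.
have [c' c'M h'] := isPD h0 (isP_mulXB j (x ord0 0 j) p1).
exists c' => [w|i].
  apply: le_trans (c'M w) _; have := xb ord0 j; have := nrm_ge0 S (x ord0 0 j); nra.
rewrite -h'; have [i' ->|->] := unliftP ord0 i.
  set y := x (lift ord0 i').
  rewrite (_ : _ - _ = x ord0 0 j * (f y - pev c y) + (y 0 j - x ord0 0 j) * (f y - pev c1 y)); last by ring.
  rewrite (_ : tau = 1 * (tau / 3) + 2 * (tau / 3)); last by lra.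
  apply: nrmDl; first by apply: nrmMl; [exact: xb|exact: hc].
  by apply: nrmMl; [rewrite (_ : 2 = 1 + 1)//; apply: nrmBl; exact: xb|exact: hc1].
rewrite subrr mul0r addr0 -mulrBr nrmM; apply: (@le_trans _ _ (1 * (tau / 3))); last lra.
by apply: ler_pM; rewrite ?nrm_ge0.
Qed.

Lemma Int_cst E k a : Int E k (nrm a) (fun _ => a).
Proof.
have [c cM h] := isP_cst k a; move=> x xE tau t0; exists c => // i.
by rewrite -h subrr nrm0 ltW.
Qed.

(** Together with [Int_mulX] it trades the monomials of degree [q.+1], on a configuration of [q.+1]
    points, for polynomials of degree [q] with bounded coefficients. *)
Lemma Int_wmon l k : exists2 C : R, 1 <= C & forall E, unitbox E -> forall (w : J d l) m, (m <= k)%N -> Int E m C (wmon w).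
Proof.
elim: l => [|l [C C1 ih]].
  by exists 1 => // E uE w m _; rewrite /= -{1}(nrm1 S); exact: Int_cst.
exists (3 * C) => [|E uE w m mk]; first lra.
case: w => [[i w]|] /=; last first.
  by apply: (@Int_le _ _ 1); [lra|rewrite -{1}(nrm1 S); exact: Int_cst].
by apply: Int_mulX => //; [lra|move=> m' m'm; apply: ih => //; exact: leq_trans mk].
Qed.

(** A product of factors [(x_j - z_j) / (y_j - z_j)], one for each [z], where [j] is a coordinate in
    which [y] and [z] differ by at least [r]. This is where constants depending on [r] originate. *)
Lemma lagrange_words (r : R) m : 0 < r -> exists2 C : R, 1 <= C & forall (y : V) (ys : seq V),
  size ys = m -> nv y <= 1 -> (forall z, z \in ys -> nv z <= 1 /\ r <= nv (y - z)) ->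
  exists2 c : J d m -> K, (forall w, nrm (c w) <= C) &
    pev c y = 1 /\ forall z, z \in ys -> pev c z = 0.
Proof.
move=> r0; elim: m => [|m [C C1 ih]].
  exists 1 => // y [|//] _ _ _; have [c cM h] := isP_cst 0 (1 : K).
  by exists c => [w|]; [rewrite -(nrm1 S)|split=> //; rewrite -h].
exists (2 * C + 2 * C / r) => [|y [//|z ys] [sz] yb hys].
  have : 0 <= 2 * C / r by rewrite divr_ge0// ?ltW//; lra.
  lra.
have [zb yz] := hys z (mem_head _ _).
have [c cM [cy cys]] := ih y ys sz yb (fun z' zys => hys z' (@mem_behead _ (z :: ys) z' zys)).
have [j] := nv_witness r0 yz; rewrite !mxE => rj.
have j0 : y 0 j - z 0 j != 0.
  by apply/eqP => e; move: rj; rewrite e nrm0 leNgt r0.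
have pc : isP m C (pev c) by exists c.
have [c' c'M h'] := isPZ (y 0 j - z 0 j)^-1 (isP_mulXB j (z 0 j) pc).
exists c' => [w|].
  apply: le_trans (c'M w) _; rewrite nrmV.
  apply: (@le_trans _ _ (r^-1 * (C + 1 * C))).
    apply: ler_pM; rewrite ?invr_ge0 ?nrm_ge0//.
    - by rewrite addr_ge0 ?mulr_ge0 ?nrm_ge0//; lra.
    - by rewrite lef_pV2// posrE (lt_le_trans r0).
    - by rewrite lerD2l ler_wpM2r//; [lra|exact: le_trans (le_nv _ _ _) zb].
  have -> : r^-1 * (C + 1 * C) = 2 * C / r by ring.
  by rewrite lerDr; lra.
split; first by rewrite -h' cy mulr1 mulVf.
move=> x; rewrite inE => /orP[/eqP->|xys]; rewrite -h'.
  by rewrite subrr mul0r mulr0.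
by rewrite cys// !mulr0.
Qed.

End Words.

(** * Polynomials vanishing on a configuration *)

(** An optional letter in front of a word of length at most [q], for polynomials of degree at most
    [q.+1]. The words without a leading letter are kept apart because the parameters of the field
    act on them; the others carry the dummy coordinates. *)
Definition JJ (d q : nat) : finType := (option 'I_d * J d q)%type.

Section Vanishing.
Context {R : realType} {K : numFieldType} (S : scalars R K) {d q : nat}.
Local Notation nrm := (nrm S).
Local Notation nv := (nv S).
Local Notation iota := (iota S).
Local Notation V := 'rV[K]_d.
Local Notation JJ := (JJ d q).

Definition xmon (w : JJ) (x : V) : K :=
  if w.1 is Some i then x 0 i * wmon w.2 x else wmon w.2 x.
Definition xdd (w : JJ) (x y : V) (j : 'I_d) : K :=
  if w.1 is Some i then (i == j)%:R * wmon w.2 y + x 0 i * wdd w.2 x y j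
  else wdd w.2 x y j.
Definition xev (c : JJ -> K) (x : V) : K := \sum_w c w * xmon w x.
Definition xD (c : JJ -> K) (x y : V) (j : 'I_d) : K := \sum_w c w * xdd w x y j.
Definition dv (c : JJ -> K) (x v : V) : K := \sum_j xD c x x j * v 0 j.

(** Radius 2 leaves room for Newton's iterates around points of the unit box. A single constant
    serves for values, divided differences, directional derivatives, their variation with the base
    point, and the first order Taylor remainder. *)
Definition xbounds (C : R) := 1 <= C /\ forall (c : JJ -> K) (M : R), 0 <= M -> (forall w, nrm (c w) <= M) ->
  [/\ forall x, nv x <= 2 -> nrm (xev c x) <= C * M,
      forall x y j, nv x <= 2 -> nv y <= 2 -> nrm (xD c x y j) <= C * M,
      forall x v, nv x <= 2 -> nrm (dv c x v) <= C * M * nv v,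
      forall x y v, nv x <= 2 -> nv y <= 2 -> nrm (dv c x v - dv c y v) <= C * M * nv (x - y) * nv v &
      (forall x y, nv x <= 2 -> nv y <= 2 -> nrm (xev c y - xev c x) <= C * M * nv (y - x)) /\
      forall z x y, nv z <= 2 -> nv x <= 2 -> nv y <= 2 ->
        nrm (xev c y - xev c x - dv c z (y - x)) <= C * M * (nv (x - z) + nv (y - z)) * nv (y - x)].

Lemma xev_dd c x y : xev c y - xev c x = \sum_j xD c x y j * (y - x) 0 j.
Proof.
rewrite /xev -sumrB.
transitivity (\sum_w \sum_j c w * (xdd w x y j * (y - x) 0 j)); last first.
  rewrite exchange_big; apply: eq_bigr => j _; rewrite /xD mulr_suml.
  by apply: eq_bigr => w _; rewrite mulrA.
apply: eq_bigr => -[oo w] _; rewrite -mulrBr -mulr_sumr; congr *%R.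
under eq_bigr do rewrite !mxE.
case: oo => [i|] /=; last exact: wmon_dd.
exact: (@wmon_dd K d q.+1 (Some (i, w))).
Qed.

Lemma xbounds_ex : exists C, xbounds C.
Proof.
have [C1 C11 h1] := @wmon_bound _ _ S d q.+1; have [C1' C11' h1'] := @wmon_bound _ _ S d q.
have [C2 C21 h2] := @wdd_bound _ _ S d q.+1; have [C2' C21' h2'] := @wdd_bound _ _ S d q.
have [C3 C31 h3] := @wdd_lip _ _ S d q.+1; have [C3' C31' h3'] := @wdd_lip _ _ S d q.
pose n : R := #|JJ|%:R; have n0 : 0 <= n by [].
have hm (w : JJ) x : nv x <= 2 -> nrm (xmon w x) <= C1 + C1'.
  case: w => [[i|] w] x2; last by apply: (@le_trans _ _ C1'); [exact: h1'|lra].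
  by apply: (@le_trans _ _ C1); [exact: (h1 (Some (i, w)))|lra].
have hd (w : JJ) x y j : nv x <= 2 -> nv y <= 2 -> nrm (xdd w x y j) <= C2 + C2'.
  case: w => [[i|] w] x2 y2; last by apply: (@le_trans _ _ C2'); [exact: h2'|lra].
  by apply: (@le_trans _ _ C2); [exact: (h2 (Some (i, w)))|lra].
have hl (w : JJ) x y x' y' j : nv x <= 2 -> nv y <= 2 -> nv x' <= 2 -> nv y' <= 2 ->
    nrm (xdd w x y j - xdd w x' y' j) <= (C3 + C3') * (nv (x - x') + nv (y - y')).
  have n1 := nv_ge0 S (x - x'); have n2 := nv_ge0 S (y - y').
  case: w => [[i|] w] x2 y2 x'2 y'2.
    by apply: (@le_trans _ _ (C3 * (nv (x - x') + nv (y - y')))); [exact: (h3 (Some (i, w)))|nra].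
  by apply: (@le_trans _ _ (C3' * (nv (x - x') + nv (y - y')))); [exact: h3'|nra].
pose B : R := C1 + C1' + (C2 + C2') + (C3 + C3').
pose m : R := 1 + n + d%:R + d%:R * n.
have d0 : 0 <= d%:R :> R by [].
have dn0 : 0 <= d%:R * n by rewrite mulr_ge0.
have ddn0 : 0 <= d%:R * (d%:R * n) by rewrite mulr_ge0.
pose C := 2 * B * m; exists C; have m1 : 1 <= m by rewrite /m; lra.
have B1 : 1 <= B by rewrite /B; lra.
split=> [|c M M0 cM]; first by rewrite /C; nra.
have ev x : nv x <= 2 -> nrm (xev c x) <= C * M.
  move=> x2; apply: (@le_trans _ _ (n * (M * (C1 + C1')))).
    by apply: nrm_sum_le => w; apply: nrmMl => //; exact: hm.
  rewrite [M * _]mulrC mulrA ler_wpM2r//.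
  rewrite /C (_ : 2 * B * m = 2 * (m * B)); last by ring.
  have : n * (C1 + C1') <= m * B by apply: ler_pM => //; rewrite /m /B; lra.
  have : 0 <= m * B by rewrite mulr_ge0//; lra.
  lra.
have D1 x y j : nv x <= 2 -> nv y <= 2 -> nrm (xD c x y j) <= n * B * M.
  move=> x2 y2; apply: (@le_trans _ _ (n * (M * (C2 + C2')))).
    by apply: nrm_sum_le => w; apply: nrmMl => //; exact: hd.
  rewrite [M * _]mulrC mulrA ler_wpM2r// ler_wpM2l//; rewrite /B; lra.
have L1 x y x' y' j : nv x <= 2 -> nv y <= 2 -> nv x' <= 2 -> nv y' <= 2 ->
    nrm (xD c x y j - xD c x' y' j) <= n * (M * (B * (nv (x - x') + nv (y - y')))).
  move=> x2 y2 x'2 y'2; rewrite /xD -sumrB; apply: nrm_sum_le => w; rewrite -mulrBr.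
  apply: nrmMl => //; apply: le_trans (hl w _ _ _ _ _ x2 y2 x'2 y'2) _.
  by rewrite ler_wpM2r ?addr_ge0 ?nv_ge0// /B; lra.
have nB : n * B * M <= C * M.
  rewrite ler_wpM2r// /C (_ : 2 * B * m = 2 * (m * B)); last by ring.
  have : n * B <= m * B by apply: ler_wpM2r; [lra|rewrite /m; lra].
  have : 0 <= m * B by rewrite mulr_ge0//; lra.
  lra.
have dsum (F : 'I_d -> K) (v : V) (G : R) : 0 <= G -> (forall j, nrm (F j) <= G) ->
    nrm (\sum_j F j * v 0 j) <= d%:R * G * nv v.
  move=> G0 h; rewrite -mulrA -[X in X%:R * _]card_ord; apply: nrm_sum_le => j.
  by apply: nrmMl => //; exact: le_nv.
have nBM : 0 <= n * B * M by rewrite !mulr_ge0//; lra.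
have dC : d%:R * (n * B * M) <= C * M.
  have -> : d%:R * (n * B * M) = d%:R * n * B * M by ring.
  rewrite ler_wpM2r// /C (_ : 2 * B * m = 2 * (m * B)); last by ring.
  have : d%:R * n * B <= m * B by apply: ler_wpM2r; [lra|rewrite /m; lra].
  have : 0 <= m * B by rewrite mulr_ge0//; lra.
  lra.
have dC2 : 2 * (d%:R * (n * B * M)) <= C * M.
  have -> : 2 * (d%:R * (n * B * M)) = (2 * B * (d%:R * n)) * M by ring.
  by rewrite ler_wpM2r// /C ler_wpM2l//; rewrite /m; lra.
have E1 (u : R) : d%:R * (n * (M * (B * u))) = d%:R * (n * B * M) * u by ring.
split=> //.
- by move=> x y j x2 y2; exact: le_trans (D1 _ _ _ x2 y2) nB.
- move=> x v x2; apply: le_trans (dsum _ _ _ nBM (fun j => D1 x x j x2 x2)) _.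
  by rewrite ler_wpM2r ?nv_ge0.
- move=> x y v x2 y2; rewrite /dv -sumrB; under eq_bigr do rewrite -mulrBl.
  have h j := L1 x x y y j x2 x2 y2 y2.
  apply: le_trans (dsum _ _ _ _ h) _; first by rewrite !mulr_ge0 ?addr_ge0 ?nv_ge0//; lra.
  rewrite ler_wpM2r ?nv_ge0//.
  rewrite E1 -mulr2n -[X in _ * X]mulr_natl mulrCA mulrA.
  by rewrite ler_wpM2r ?nv_ge0.
split=> [x y x2 y2|z x y z2 x2 y2].
  rewrite xev_dd; apply: le_trans (dsum _ _ _ nBM (fun j => D1 x y j x2 y2)) _.
  by rewrite ler_wpM2r ?nv_ge0.
rewrite xev_dd /dv -sumrB; under eq_bigr do rewrite -mulrBl.
have h j := L1 x y z z j x2 y2 z2 z2.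
apply: le_trans (dsum _ _ _ _ h) _; first by rewrite !mulr_ge0 ?addr_ge0 ?nv_ge0//; lra.
rewrite ler_wpM2r ?nv_ge0//.
rewrite E1.
by rewrite ler_wpM2r ?addr_ge0 ?nv_ge0.
Qed.

Lemma xevD c c' x : xev (fun w => c w + c' w) x = xev c x + xev c' x.
Proof. by rewrite /xev -big_split; apply: eq_bigr => w _; rewrite mulrDl. Qed.
Lemma xevZ a c x : xev (fun w => a * c w) x = a * xev c x.
Proof. by rewrite /xev mulr_sumr; apply: eq_bigr => w _; rewrite mulrA. Qed.
Lemma xevB c c' x : xev (fun w => c w - c' w) x = xev c x - xev c' x.
Proof. by rewrite /xev -sumrB; apply: eq_bigr => w _; rewrite mulrBl. Qed.
Lemma xev_sum (I : finType) (F : I -> JJ -> K) x :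
  xev (fun w => \sum_i F i w) x = \sum_i xev (F i) x.
Proof.
rewrite /xev exchange_big; apply: eq_bigr => w _; rewrite mulr_suml.
by [].
Qed.
Lemma xDD c c' x y j : xD (fun w => c w + c' w) x y j = xD c x y j + xD c' x y j.
Proof. by rewrite /xD -big_split; apply: eq_bigr => w _; rewrite mulrDl. Qed.
Lemma xDZ a c x y j : xD (fun w => a * c w) x y j = a * xD c x y j.
Proof. by rewrite /xD mulr_sumr; apply: eq_bigr => w _; rewrite mulrA. Qed.
Lemma dvD c c' x v : dv (fun w => c w + c' w) x v = dv c x v + dv c' x v.
Proof. by rewrite /dv -big_split; apply: eq_bigr => w _; rewrite xDD mulrDl. Qed.
Lemma dvZ a c x v : dv (fun w => a * c w) x v = a * dv c x v.
Proof. by rewrite /dv mulr_sumr; apply: eq_bigr => w _; rewrite xDZ mulrA. Qed.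
Lemma dvB c c' x v : dv (fun w => c w - c' w) x v = dv c x v - dv c' x v.
Proof.
rewrite -mulN1r -dvZ -dvD; apply: eq_bigr => j _; congr (_ * _).
by apply: eq_bigr => w _; rewrite mulN1r.
Qed.

Lemma sum_JJ (F : JJ -> K) :
  \sum_w F w = \sum_w F (None, w) + \sum_i \sum_w F (Some i, w).
Proof.
transitivity (\sum_(w : JJ) (fun a b => F (a, b)) w.1 w.2).
  by apply: eq_bigr => -[].
rewrite -(pair_bigA _ (fun a b => F (a, b)))/= (bigD1 None)//=; congr +%R.
rewrite (reindex_omap (@Some 'I_d) id) /=; last by case.
by apply: eq_bigl => i; rewrite eqxx.
Qed.

Lemma xev_low (c : J d q -> K) x :
  xev (fun w => if w.1 is Some _ then 0 else c w.2) x = pev c x.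
Proof.
rewrite /xev sum_JJ/= [X in _ + X]big1 ?addr0// => i _.
by rewrite big1// => w _; rewrite mul0r.
Qed.

Lemma xev_pev (c : J d q.+1 -> K) (M : R) : (forall w, nrm (c w) <= M) ->
  exists2 c' : JJ -> K, (forall w, nrm (c' w) <= M) & forall x, xev c' x = pev c x.
Proof.
move=> cM; have [c0 c0M c0E] := isP_cst S (d := d) q (c None).
exists (fun w => if w.1 is Some i then c (Some (i, w.2)) else c0 w.2).
  by case=> [[i|] w]//=; exact: le_trans (c0M w) (cM None).
move=> x; rewrite pevS (c0E x) /xev sum_JJ/=; congr +%R; apply: eq_bigr => i _.
by rewrite /pev mulr_sumr; apply: eq_bigr => w _; rewrite /xmon/= mulrCA.
Qed.

Definition conf := 'I_q.+1 -> V.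
Definition inbox (x : conf) := forall i, nv (x i) <= 1.
Definition rsep (r : R) (x : conf) := forall i j, i != j -> r <= nv (x i - x j).
Definition Tx (x : conf) (c : JJ -> K) := forall i, xev c (x i) = 0.
Definition Ub (c : JJ -> K) := forall w, nrm (c w) <= 1.

Lemma lagrange_conf (r : R) : 0 < r -> exists2 C : R, 1 <= C & forall x, inbox x -> rsep r x -> forall i,
  exists2 c : J d q -> K, (forall w, nrm (c w) <= C) & forall j, pev c (x j) = (i == j)%:R.
Proof.
move=> r0; have [C C1 h] := lagrange_words S (d := d) q r0; exists C => // x xb xs i.
have sz : size [seq x j | j <- enum (predC1 i)] = q.
  by rewrite size_map -cardE cardC1 card_ord.
have [|c cM [ci cz]] := h (x i) _ sz (xb i).
  by move=> z /mapP[j]; rewrite mem_enum inE eq_sym => ij ->; split; [exact: xb|exact: xs].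
exists c => // j; case: eqP => [<-//|/eqP ij]; apply: cz; apply: map_f.
by rewrite mem_enum inE eq_sym.
Qed.

(** Subtracts the Lagrange interpolant of the values on the configuration. The constant depends on
    [r], so the lemma is applied with [tau] small in terms of [r]. *)
Lemma correct_conf (r : R) : 0 < r -> exists2 C : R, 1 <= C & forall x, inbox x -> rsep r x ->
  forall c (tau : R), (forall i, nrm (xev c (x i)) <= tau) ->
  exists2 c', Tx x c' & forall w, nrm (c w - c' w) <= C * tau.
Proof.
move=> r0; have [C C1 h] := lagrange_conf r0; exists (q.+1%:R * C).
  by apply: (le_trans C1); rewrite ler_peMl ?ler1n//; lra.
move=> x xb xs c tau ct; have t0 := le_trans (nrm_ge0 _ _) (ct ord0).
have /choice[L hL] : forall i, exists L : J d q -> K,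
  (forall w, nrm (L w) <= C) /\ forall j, pev L (x j) = (i == j)%:R.
  by move=> i; have [L] := h x xb xs i; exists L.
pose e i (w : JJ) : K := xev c (x i) * (if w.1 is Some _ then 0 else L i w.2).
exists (fun w => c w - \sum_i e i w).
  move=> j; rewrite xevB xev_sum (bigD1 j)//= big1 ?addr0; last first.
    by move=> i ij; rewrite xevZ xev_low (hL i).2 (negbTE ij) mulr0.
  by rewrite xevZ xev_low (hL j).2 eqxx mulr1 subrr.
move=> w; rewrite opprB addrC subrK -mulrA -[X in X%:R]card_ord.
apply: nrm_sum_le => i; rewrite [C * _]mulrC; apply: nrmMl => //.
by case: (w.1) => [_|]; [rewrite nrm0; lra|exact: (hL i).1].
Qed.

(** Take [(x_k - a_k) L / C], with [a] the [i]-th point and [L] its Lagrange polynomial. These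
    witnesses show that the Jacobian determinants to be maximised are not identically zero, and that
    differentials of vanishing polynomials see every direction. *)
Lemma lower_conf (r : R) : 0 < r -> exists2 C : R, 1 <= C & forall x, inbox x -> rsep r x ->
  forall i k, exists c, [/\ Tx x c, Ub c & forall v, dv c (x i) v = iota C^-1 * v 0 k].
Proof.
move=> r0; have [C C1 h] := lagrange_conf r0; exists C => // x xb xs i k.
have [L LM hL] := h x xb xs i.
have C0 : 0 < C by lra.
have Ci : nrm (iota C^-1) = C^-1 by rewrite nrm_iota ger0_norm// invr_ge0 ltW.
pose c (w : JJ) : K := if w.1 is Some j then (j == k)%:R * (iota C^-1 * L w.2) else - (x i 0 k) * (iota C^-1 * L w.2).
have LC w : nrm (iota C^-1 * L w) <= 1.
  by rewrite nrmM Ci ler_pdivrMl// mulr1.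
have sumc (F : JJ -> K) : \sum_w c w * F w =
    \sum_w iota C^-1 * L w * (F (Some k, w) - x i 0 k * F (None, w)).
  rewrite sum_JJ (bigD1 k)//= [X in _ + (_ + X)]big1 ?addr0; last first.
    by move=> j jk; rewrite big1// => w _; rewrite /c/= (negbTE jk) !mul0r.
  rewrite -big_split; apply: eq_bigr => w _; rewrite /c/= eqxx mul1r; ring.
exists c; split.
- move=> j; rewrite /xev sumc.
  transitivity (iota C^-1 * (x j 0 k - x i 0 k) * pev L (x j)).
    by rewrite /pev mulr_sumr; apply: eq_bigr => w _; rewrite /xmon/= -mulrBl !mulrA; congr (_ * _); rewrite mulrAC.
  by rewrite hL; case: eqP => [->|_]; rewrite ?subrr ?mulr0 ?mul0r.
- case=> [[j|] w]; rewrite /c/=.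
    by case: eqP => _; rewrite ?mul1r// mul0r nrm0.
  rewrite mulNr nrmN -[1]mulr1; apply: nrmMl => //; exact: le_trans (le_nv _ _ _) (xb i).
- move=> v; rewrite /dv (bigD1 k)//= [X in _ + X]big1 ?addr0; last first.
    move=> j jk; rewrite /xD sumc big1 ?mul0r// => w _; rewrite /xdd/=.
    by rewrite eq_sym (negbTE jk) mul0r add0r subrr mulr0.
  congr (_ * _); rewrite /xD sumc.
  transitivity (iota C^-1 * pev L (x i)); last by rewrite hL eqxx mulr1.
  by rewrite /pev mulr_sumr; apply: eq_bigr => w _; rewrite /xdd/= eqxx mul1r addrK mulrA.
Qed.

End Vanishing.

(** * A dominating system, and zeros of perturbed systems *)

Section Domination.
Context {R : realType} {K : numFieldType} (S : scalars R K) {d q : nat}.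
Local Notation nrm := (nrm S).
Local Notation nv := (nv S).
Local Notation iota := (iota S).
Local Notation V := 'rV[K]_d.
Local Notation JJ := (JJ d q).

(** Induction on the degree: [f - f(s0)] is divisible by [X - s0], and the quotient stays small at
    the other nodes because distinct integers differ by at least 1. Integer nodes in a bounded range
    keep the constant a function of [N] and [n]. *)
Lemma poly_small (N n : nat) : exists2 C : R, 1 <= C & forall f : {poly K}, (size f <= n.+1)%N ->
  forall (e : R) (ss : seq nat), uniq ss -> size ss = n.+1 ->
  (forall s, s \in ss -> (s <= N)%N /\ nrm f.[s%:R] <= e) ->
  forall s, (s <= N)%N -> nrm f.[s%:R] <= C * e.
Proof.
elim: n => [|n [C C1 ih]].
  exists 1 => // f fs e [//|s0 [|//]] _ _ h s _.
  have [_] := h s0 (mem_head _ _); rewrite mul1r.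
  by rewrite (size1_polyC fs) !hornerC.
exists (1 + N%:R * (2 * C)) => [|f fs e [//|s0 ss] /=/andP[s0ss us] [sz] h s sN].
  by rewrite lerDl !mulr_ge0//; lra.
have [s0N fs0] := h s0 (mem_head _ _).
have e0 := le_trans (nrm_ge0 _ _) fs0.
have /factor_theorem[g fg] : root (f - f.[s0%:R]%:P) s0%:R.
  by rewrite /root !hornerE subrr.
have fE t : f.[t] = f.[s0%:R] + g.[t] * (t - s0%:R).
  by have /(congr1 (horner^~ t)) := fg; rewrite !hornerE => <-; rewrite addrC subrK.
have gs : (size g <= n.+1)%N.
  have [->|g0] := eqVneq g 0; first by rewrite size_poly0.
  have : (size (f - f.[s0%:R]%:P)%R <= n.+2)%N.
    apply: leq_trans (size_polyD _ _) _; rewrite geq_max fs size_polyN.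
    by apply: leq_trans (size_polyC_leq1 _) _.
  by rewrite fg size_Mmonic ?monicXsubC// size_XsubC addn2.
have bd (s1 : nat) : (s1 <= N)%N -> nrm (s1%:R - s0%:R : K) <= N%:R.
  move=> s1N; have [le|/ltnW le] := leqP s0 s1.
    by rewrite -natrB// nrm_nat ler_nat (leq_trans (leq_subr _ _)).
  by rewrite nrmB -natrB// nrm_nat ler_nat (leq_trans (leq_subr _ _)).
rewrite fE mulrDl mul1r; apply: nrmDl => //.
rewrite -[N%:R * _ * e]mulrA [N%:R * _]mulrC; apply: nrmMl; last exact: bd.
have -> : 2 * C * e = C * (2 * e) by ring.
apply: (ih g gs (2 * e) ss us sz) => // s1 s1ss.
have [s1N fs1] : (s1 <= N)%N /\ nrm f.[s1%:R] <= e by apply: h; rewrite inE s1ss orbT.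
split=> //.
have ne : s1 != s0 by apply: contraNneq s0ss => <-.
have d1 : 1 <= nrm (s1%:R - s0%:R : K).
  have [le|gt] := ltnP s0 s1.
    by rewrite -natrB 1?ltnW// nrm_nat ler1n subn_gt0.
  by rewrite nrmB -natrB// nrm_nat ler1n subn_gt0 ltn_neqAle ne.
have -> : g.[s1%:R] = (f.[s1%:R] - f.[s0%:R]) / (s1%:R - s0%:R).
  rewrite fE addrC addKr mulfK//; apply/eqP => z; move: d1; rewrite z nrm0; lra.
rewrite nrmM nrmV ler_pdivrMr; last lra.
apply: le_trans (nrmBl fs1 fs0) _.
have : 0 <= 2 * e by lra.
move=> e2; apply: (@le_trans _ _ (2 * e)); first lra.
by rewrite ler_peMr.
Qed.

Definition Jac (P : 'I_d -> JJ -> K) (x : V) : 'M[K]_d := \matrix_(l, j) xD (P l) x x j.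
Definition Jv (P : 'I_d -> JJ -> K) (x v : V) : V := \row_l dv (P l) x v.
Definition good (x : conf (K := K) (d := d) (q := q)) (P : 'I_d -> JJ -> K) :=
  forall l, Tx x (P l) /\ Ub S (P l).

Lemma Jac_comb a b P Q x : Jac (fun l w => a * P l w + b * Q l w) x = a *: Jac P x + b *: Jac Q x.
Proof. by apply/matrixP => l j; rewrite !mxE xDD !xDZ. Qed.

(* Two systems can be combined without losing the size of finitely many Jacobian determinants:
   each determinant is a polynomial of degree [d] in the mixing parameter. *)
Lemma det_mix (n : nat) : exists2 c : R, 0 < c <= 1 & forall (I : finType) (A B : I -> 'M[K]_d) (D : I -> R),
  (#|I| <= n)%N -> (forall i, 0 < D i) -> (forall i, D i <= nrm (\det (A i)) \/ D i <= nrm (\det (B i))) ->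
  exists2 s : nat, (s <= n * d)%N & forall i, c * D i <= nrm (\det ((1 - s%:R) *: A i + s%:R *: B i)).
Proof.
pose N := (n * d).+1; have [C C1 hC] := poly_small N d.
exists (C *+ 2)^-1.
  by rewrite invr_gt0 mulrn_wgt0//=; [rewrite invf_le1; rewrite -mulr_natl; lra|lra].
move=> I A B D nI D0 h.
pose f i : {poly K} := \det (map_mx polyC (A i) + 'X *: map_mx polyC (B i - A i)).
have fE i t : (f i).[t] = \det ((1 - t) *: A i + t *: B i).
  rewrite -horner_evalE /f -det_map_mx; congr determinant; apply/matrixP => k l.
  by rewrite !mxE /= horner_evalE !hornerE; ring.
have fs i : (size (f i) <= d.+1)%N.
  apply: leq_trans (size_sum _ _ _) _; apply/bigmax_leqP => s _.
  rewrite size_Msign.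
  apply: leq_trans (size_poly_prod_leq _ _) _.
  rewrite leq_subLR card_ord addnS ltnS.
  apply: (@leq_trans (\sum_(i0 < d) 2)%N); last by rewrite !sum_nat_const !card_ord; lia.
  apply: leq_sum => k _; rewrite !mxE.
  apply: leq_trans (size_polyD _ _) _; rewrite geq_max.
  rewrite (leq_trans (size_polyC_leq1 _))//=.
  apply: leq_trans (size_polyMleq _ _) _; rewrite size_polyX.
  by rewrite -subn1 leq_subLR leq_add2l size_polyC_leq1.
(* At most [d] bad values for each [i]: a polynomial of degree [d] small at [d.+1] of the integers
   would be small at 0 and at 1. So one of the [(n * d).+1] candidates is good for every [i]. *)
pose bad i := [set s : 'I_N | nrm (f i).[(s : nat)%:R] < (C *+ 2)^-1 * D i]%SET.
have badle i : (#|bad i| <= d)%N.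
  rewrite leqNgt; apply/negP => lt.
  pose ss := map (@nat_of_ord N) (take d.+1 (enum (bad i))).
  have uss : uniq ss by rewrite map_inj_uniq ?take_uniq ?enum_uniq//; exact: val_inj.
  have sz : size ss = d.+1 by rewrite size_map size_takel// -cardE.
  have H := hC _ (fs i) ((C *+ 2)^-1 * D i) ss uss sz.
  have {}H s : (s <= N)%N -> nrm (f i).[s%:R] <= D i / 2.
    move=> sN; have -> : D i / 2 = C * ((C *+ 2)^-1 * D i).
      by rewrite -mulr_natl invfM; field; lra.
    apply: H => // t /mapP[u /mem_take]; rewrite mem_enum inE => hu ->; split; last exact: ltW.
    by rewrite -ltnS; exact: ltn_trans (ltn_ord u) _.
  have [h1|h1] := h i.
    have := H 0%N (leq0n _); rewrite fE subr0 scale1r scale0r addr0.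
    have := D0 i; lra.
  have := H 1%N isT; rewrite fE subrr scale1r scale0r add0r.
  have := D0 i; lra.
have [s hs] : exists s : 'I_N, s \notin (\bigcup_i bad i)%SET.
  apply/existsP; rewrite -negb_forall; apply/negP => /forallP hall.
  have : (#|(\bigcup_i bad i)%SET| <= n * d)%N.
    apply: (@leq_trans (#|I| * d)%N); last by rewrite leq_mul2r nI orbT.
    rewrite -sum_nat_const; apply: (@leq_trans (\sum_i #|bad i|)%N); last exact: leq_sum.
    elim/big_rec2: _ => [|i u v _ ih]; first by rewrite cards0.
    by apply: leq_trans (leq_card_setU _ _) _; rewrite leq_add2l.
  rewrite leqNgt => /negP; apply.
  rewrite (_ : (\bigcup_i bad i)%SET = [set: 'I_N]%SET) ?cardsT ?card_ord//.
  by apply/setP => t; rewrite inE hall.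
exists s; first by rewrite -ltnS; exact: ltn_ord.
move=> i; rewrite -fE leNgt; apply: contra hs => hlt.
by apply/bigcupP; exists i => //; rewrite inE.
Qed.

Lemma det_bound (A : 'M[K]_d) (M : R) : (forall i j, nrm (A i j) <= M) ->
  nrm (\det A) <= #|{: {perm 'I_d}}|%:R * M ^+ d.
Proof.
move=> h; apply: nrm_sum_le => s.
rewrite nrmM nrmX nrmN nrm1 expr1n mul1r nrm_prod -[X in _ ^+ X]card_ord -prodr_const.
by apply: ler_prod => i _; rewrite nrm_ge0 h.
Qed.

(** An extremal volume, in the spirit of Auerbach bases: a system close to it has a differential
    that dominates all the others. *)
Definition detsup (x : conf (K := K) (d := d) (q := q)) (i : 'I_q.+1) : R :=
  sup [set nrm (\det (Jac P (x i))) | P in good x].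

Lemma good0 x : good x (fun _ _ => 0).
Proof.
split=> [i|w]; last by rewrite nrm0.
by rewrite /xev big1// => w _; rewrite mul0r.
Qed.

Lemma detsup_has x i : inbox S x -> has_sup [set nrm (\det (Jac P (x i))) | P in good x].
Proof.
move=> xb; have [C [C1 hC]] := @xbounds_ex _ _ S d q.
split; first by exists (nrm (\det (Jac (fun _ _ => 0) (x i)))), (fun _ _ => 0) => //; exact: good0.
exists (#|{: {perm 'I_d}}|%:R * (C * 1) ^+ d) => _ [P gP <-].
apply: det_bound => l j; rewrite mxE; have [_ uP] := gP l.
have x2 : nv (x i) <= 2 by apply: le_trans (xb i) _; lra.
by have [_ h _ _ _] := hC (P l) 1 ler01 uP; exact: h.
Qed.

Lemma le_detsup x i P : inbox S x -> good x P -> nrm (\det (Jac P (x i))) <= detsup x i.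
Proof. by move=> xb gP; apply: ub_le_sup; [have [] := detsup_has i xb|exists P]. Qed.

Lemma detsup_adherent x i : inbox S x -> 0 < detsup x i ->
  exists2 P, good x P & detsup x i / 2 <= nrm (\det (Jac P (x i))).
Proof.
move=> xb D0; have e0 : 0 < detsup x i / 2 by lra.
have [_ [P gP <-]] := sup_adherent e0 (detsup_has i xb).
rewrite -/(detsup x i) => lt; exists P => //; lra.
Qed.

Definition nondeg_conf (x : conf (K := K) (d := d) (q := q)) := forall i, 0 < detsup x i.

(** A system nearly maximal at the first [k] points is mixed by [det_mix] with one nearly maximal at
    the next point. The loss at each of the [q.+1] mixings does not depend on the configuration. *)
Lemma near_max_dets (k : nat) : exists2 c : R, 0 < c <= 1 & forall x, inbox S x -> nondeg_conf x ->
  exists2 P, good x P & forall i : 'I_q.+1, (i < k)%N -> c * detsup x i <= nrm (\det (Jac P (x i))).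
Proof.
elim: k => [|k [c /andP[c0 c1] ih]].
  by exists 1 => [|x xb nd]; [rewrite ltr01 lexx|exists (fun _ _ => 0) => //; exact: good0].
(* The mixture [(1 - s) P + s Q] has coefficients at most [2 * N + 1]; multiplying by [kap] brings
   them back to 1 and costs [kap ^+ d] in the determinant. *)
pose n := q.+1; pose N := (n * d)%N; pose kap : R := (2 * N + 1)%:R^-1.
have [cm /andP[cm0 cm1] hm] := det_mix n.
have kap0 : 0 < kap by rewrite invr_gt0 ltr0n addn1.
have kap1 : kap <= 1 by rewrite invf_le1 ?ler1n ?ltr0n addn1.
exists (kap ^+ d * (cm * (c / 2))).
  apply/andP; split; first by rewrite !mulr_gt0 ?exprn_gt0 ?invr_gt0.
  have : kap ^+ d <= 1 by rewrite exprn_ile1 ?(ltW kap0).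
  have : 0 <= kap ^+ d by rewrite exprn_ge0 ?(ltW kap0).
  have : 0 <= cm * (c / 2) by rewrite !mulr_ge0 ?ltW ?invr_gt0.
  have : cm * (c / 2) <= 1 by nra.
  nra.
move=> x xb nd; have [P gP hP] := ih x xb nd.
have [qk|kq] := leqP q.+1 k.
  exists P => // i _; apply: le_trans (hP i (leq_trans (ltn_ord i) qk)).
  rewrite ler_wpM2r ?(ltW (nd i))//.
  have : kap ^+ d <= 1 by rewrite exprn_ile1 ?(ltW kap0).
  have : 0 <= kap ^+ d by rewrite exprn_ge0 ?(ltW kap0).
  have : 0 <= cm * (c / 2) by rewrite !mulr_ge0 ?ltW ?invr_gt0.
  have : cm * (c / 2) <= c by nra.
  nra.
pose ik := Ordinal kq.
have [Q gQ hQ] := detsup_adherent xb (nd ik).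
pose I := {i : 'I_q.+1 | (i <= k)%N}.
pose A (i : I) := Jac P (x (val i)); pose B (i : I) := Jac Q (x (val i)).
have [|i||s sN hs] := hm I A B (fun i => c / 2 * detsup x (val i)).
- by rewrite card_sig (leq_trans (max_card _))// card_ord.
- by rewrite mulr_gt0 ?nd ?divr_gt0.
- case=> i ik'; rewrite /A /B /=; have D0 := nd i.
  have [lt|ge] := ltnP i k; [left|right].
    by apply: le_trans (hP i lt); rewrite ler_wpM2r ?ltW//; lra.
  have -> : i = ik by apply/val_inj/anti_leq; rewrite /= ik'.
  apply: le_trans hQ; rewrite mulrAC [_ * detsup _ _]mulrC mulrAC -mulrA; have := nd ik => D1; nra.
pose a : K := (1 - s%:R) * iota kap; pose b : K := s%:R * iota kap.
have ik0 : nrm (iota kap) = kap by rewrite nrm_iota gtr0_norm.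
exists (fun l w => a * P l w + b * Q l w).
  move=> l; have [TP UP] := gP l; have [TQ UQ] := gQ l; split.
    by move=> i; rewrite xevD !xevZ TP TQ !mulr0 addr0.
  move=> w; apply: (@le_trans _ _ ((1 + s%:R) * kap * 1 + s%:R * kap * 1)).
    apply: nrmDl; apply: nrmMl => //; apply: nrmMl; rewrite ?ik0// ?nrm_nat//.
    by apply: nrmBl; rewrite ?nrm1 ?nrm_nat.
  rewrite !mulr1 -mulrDl ler_pdivrMr ?mul1r ?ltr0n ?addn1//.
  have : s%:R <= N%:R :> R by rewrite ler_nat.
  rewrite -addn1 natrD natrM; lra.
move=> i; rewrite ltnS => ik'.
rewrite Jac_comb /a /b ![_ * iota kap]mulrC -!scalerA -scalerDr detZ nrmM nrmX ik0.
rewrite -mulrA ler_wpM2l ?exprn_ge0 ?(ltW kap0)//.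
by have := hs (exist _ i ik'); rewrite /= mulrA.
Qed.

(** Cramer's rule: the differential of [f] is a combination of the rows of [Jac P] whose
    coefficients are quotients of determinants. Each numerator is the determinant of a system still
    in [good], hence at most [detsup], and the denominator is at least [c * detsup]. The unknown
    [detsup] cancels, so [C0] is the same for all configurations. *)
Lemma dom_conf : exists2 C0 : R, 1 <= C0 & forall x, inbox S x -> nondeg_conf x ->
  exists2 P, good x P & forall i c v, Tx x c -> Ub S c ->
    nrm (dv c (x i) v) <= C0 * nv (Jv P (x i) v).
Proof.
have [c /andP[c0 c1] h] := near_max_dets q.+1.
exists (1 + d%:R / c) => [|x xb nd]; first by rewrite lerDl divr_ge0// ltW.
have [P gP hP] := h x xb nd; exists P => // i f v Tf Uf.
set L := Jac P (x i); pose r : 'rV[K]_d := \row_j xD f (x i) (x i) j.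
have D0 := nd i; have hL := hP i (ltn_ord i); rewrite -/L in hL.
have cD : 0 < c * detsup x i by rewrite mulr_gt0.
have key : \det L * dv f (x i) v = \sum_l (r *m \adj L) 0 l * Jv P (x i) v 0 l.
  transitivity ((r *m \adj L *m L *m v^T) 0 0).
    rewrite -(mulmxA r) mul_adj_mx mul_mx_scalar -scalemxAl mxE; congr (_ * _).
    by rewrite /dv mxE; apply: eq_bigr => j _; rewrite !mxE.
  rewrite -mulmxA mxE; apply: eq_bigr => l _; congr (_ * _).
  by rewrite !mxE /dv; apply: eq_bigr => j _; rewrite !mxE.
have cof l : nrm ((r *m \adj L) 0 l) <= detsup x i.
  pose P' l' := if l' == l then f else P l'.
  have gP' : good x P' by move=> l'; rewrite /P'; case: eqP.
  apply: le_trans (le_detsup i xb gP').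
  rewrite le_eqVlt; apply/orP; left; apply/eqP; congr nrm.
  rewrite (expand_det_row _ l) mxE; apply: eq_bigr => j _.
  rewrite !mxE /P' eqxx; congr (_ * _); rewrite /cofactor; congr (_ * _).
  congr determinant; apply/matrixP => a b; rewrite !mxE.
  by rewrite eq_sym (negbTE (neq_lift _ _)).
have : nrm (\det L) * nrm (dv f (x i) v) <= d%:R * (detsup x i * nv (Jv P (x i) v)).
  rewrite -nrmM key -[X in X%:R * _]card_ord; apply: nrm_sum_le => l; apply: nrmMl => //.
  exact: le_nv.
move=> H; have n1 := nrm_ge0 S (dv f (x i) v); have n2 := nv_ge0 S (Jv P (x i) v).
have : c * detsup x i * nrm (dv f (x i) v) <= d%:R * (detsup x i * nv (Jv P (x i) v)).
  by apply: le_trans H; rewrite ler_wpM2r.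
have -> : c * detsup x i * nrm (dv f (x i) v) = detsup x i * (c * nrm (dv f (x i) v)) by rewrite -mulrA mulrCA.
rewrite [d%:R * _]mulrCA ler_pM2l// => H2.
rewrite mulrDl mul1r; apply: (@le_trans _ _ (d%:R / c * nv (Jv P (x i) v))); last by rewrite lerDr.
by rewrite mulrAC ler_pdivlMr// mulrC.
Qed.

End Domination.

(** * Newton's method with a frozen Jacobian *)

Section Newton.
Context {R : realType} {K : numFieldType} (S : scalars R K) {d q : nat}.
Local Notation nrm := (nrm S).
Local Notation nv := (nv S).
Local Notation iota := (iota S).
Local Notation V := 'rV[K]_d.
Local Notation JJ := (JJ d q).

Lemma le_geom (a b c : R) : (forall n, a <= b + c / 2 ^+ n) -> a <= b.
Proof.
move=> h; rewrite leNgt; apply/negP => ba.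
have ab : 0 < a - b by lra.
pose n := Num.bound `|c / (a - b)|.
have hn : `|c / (a - b)| < n%:R by rewrite archi_boundP.
have : c / (a - b) < 2 ^+ n.
  apply: le_lt_trans (ler_norm _) _; apply: lt_trans hn _.
  by rewrite -natrX ltr_nat ltn_expl.
rewrite ltr_pdivrMr// => lt.
have := h n; have p2 : 0 < 2 ^+ n :> R by rewrite exprn_gt0.
rewrite leNgt => /negP; apply; rewrite -ltrBrDl ltr_pdivrMr// mulrC; exact: lt.
Qed.

Lemma JvE (P : 'I_d -> JJ -> K) x v : Jv P x v = v *m (Jac P x)^T.
Proof.
by apply/rowP => l; rewrite !mxE; apply: eq_bigr => j _; rewrite !mxE mulrC.
Qed.

Lemma JvB (P : 'I_d -> JJ -> K) x v w : Jv P x (v - w) = Jv P x v - Jv P x w.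
Proof. by rewrite !JvE mulmxBl. Qed.

(** The Jacobian is frozen at [x] and errors are measured by [Jv P x], the metric of the cells. The
    zero is thus found at distance [2 * th] in that metric without loss from the lower bound [c1],
    which only has to satisfy smallness conditions relative to [th]. *)
Lemma newton : exists2 CN : R, 1 <= CN & forall (P : 'I_d -> JJ -> K) (x : V) (y0 : 'I_d -> K) (c1 th : R),
  (forall l w, nrm (P l w) <= 2) -> nv x <= 1 -> 0 < c1 ->
  (forall v, c1 * nv v <= nv (Jv P x v)) -> 0 <= th -> CN * th <= c1 ^+ 2 -> CN * th <= c1 ->
  (forall l, nrm (xev (P l) x - y0 l) <= th) ->
  exists2 z, (forall l, xev (P l) z = y0 l) & nv (Jv P x (z - x)) <= 2 * th.
Proof.
have [C [C1 hC]] := @xbounds_ex _ _ S d q; exists (16 * C) => [|P x y0 c1 th PM x1 c10 low th0 t2 t1 hx]; first lra.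
pose L := (Jac P x)^T.
have Lu : L \in unitmx.
  rewrite unitmxE unitfE; apply/negP => /det0P[v v0 vL].
  have := low v; rewrite JvE vL nv0 pmulr_rle0// => nv0'.
  by move/eqP: v0; apply; apply: (@nv_eq0 _ _ S); apply/eqP; rewrite eq_le nv0' nv_ge0.
pose ev (z : V) : V := \row_l (xev (P l) z - y0 l).
pose N z := z - ev z *m invmx L.
have NJ z : Jv P x (N z - z) = - ev z.
  by rewrite JvE /N addrC addKr mulNmx -mulmxA mulVmx// mulmx1.
have p2 n : 0 < 2 ^+ n :> R by rewrite exprn_gt0.
pose zz n := iter n N x.
pose a := th / c1.
have a0 : 0 <= a by rewrite divr_ge0// ltW.
have a1 : 16 * C * a <= 1 by rewrite mulrA ler_pdivrMr// mul1r.
have a2 : a <= 1 / 16 by nra.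
have ac : 16 * C * a <= c1.
  rewrite mulrA ler_pdivrMr//; move: t2; rewrite expr2; lra.
(* Residuals are halved at each step: by the Taylor remainder the new one is at most [8 * C * a]
   times the step length [a / 2 ^+ n], and [16 * C * a <= c1]. *)
have inv n : [/\ nv (ev (zz n)) <= th / 2 ^+ n,
   nv (zz n - x) <= 2 * a - 2 * a / 2 ^+ n & nv (Jv P x (zz n - x)) <= 2 * th - 2 * th / 2 ^+ n].
  elim: n => [|n [e1 e2 e3]].
    rewrite /zz /= subrr JvE mul0mx nv0 expr0 !divr1 !subrr; split=> //.
    by apply: nv_le => // l; rewrite mxE.
  have dz : nv (Jv P x (zz n.+1 - zz n)) <= th / 2 ^+ n by rewrite NJ nvN.
  have dz1 : nv (zz n.+1 - zz n) <= a / 2 ^+ n.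
    rewrite /a mulrAC ler_pdivlMr// mulrC; apply: le_trans (low _) _; exact: dz.
  have h2 (u : R) : 2 * u / 2 ^+ n.+1 = u / 2 ^+ n by rewrite exprS; field; exact: lt0r_neq0.
  have h3 (u : R) : 2 * u / 2 ^+ n = 2 * (u / 2 ^+ n) by rewrite mulrA.
  have s1 : nv (zz n.+1 - x) <= 2 * a - 2 * a / 2 ^+ n.+1.
    apply: le_trans (nv_tri S (zz n) _ _) _; apply: le_trans (lerD dz1 e2) _.
    rewrite h2 h3; lra.
  have an m : 0 <= 2 * a / 2 ^+ m by apply: divr_ge0; [rewrite mulr_ge0|exact: ltW].
  have e2' : nv (zz n - x) <= 2 * a by have := an n; lra.
  have s1' : nv (zz n.+1 - x) <= 2 * a by have := an n.+1; lra.
  have bx : nv (zz n) <= 2.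
    by rewrite -(subrK x (zz n)); apply: le_trans (nvD _ _ _) _; lra.
  have bx' : nv (zz n.+1) <= 2.
    by rewrite -(subrK x (zz n.+1)); apply: le_trans (nvD _ _ _) _; lra.
  split=> //; last first.
    rewrite (_ : zz n.+1 - x = (zz n.+1 - zz n) - (x - zz n)); last by rewrite opprB addrA subrK.
    rewrite JvB; apply: le_trans (nvD _ _ _) _; rewrite nvN.
    rewrite (_ : Jv P x (x - zz n) = - Jv P x (zz n - x)); last first.
      by rewrite !JvE -mulNmx opprB.
    rewrite nvN; apply: le_trans (lerD dz e3) _; rewrite h2 h3; lra.
  apply: nv_le => [|l]; first by rewrite divr_ge0// ltW.
  have [_ _ _ _ [_ hT]] := hC (P l) 2 ltac:(lra) (PM l).
  have := hT x (zz n) (zz n.+1) ltac:(lra) bx bx'.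
  have -> : dv (P l) x (zz n.+1 - zz n) = - (xev (P l) (zz n) - y0 l).
    by have /rowP/(_ l) := NJ (zz n); rewrite !mxE.
  rewrite (_ : _ - _ - - _ = (ev (zz n.+1)) 0 l); last by rewrite mxE; ring.
  move=> /le_trans; apply.
  apply: (@le_trans _ _ (C * 2 * (4 * a) * (a / 2 ^+ n))).
    apply: ler_pM; rewrite ?nv_ge0//; first by rewrite !mulr_ge0 ?addr_ge0 ?nv_ge0//; lra.
    by apply: ler_wpM2l; lra.
  have -> : th / 2 ^+ n.+1 = c1 / 2 * (a / 2 ^+ n).
    by rewrite /a exprS; field; rewrite lt0r_neq0//= lt0r_neq0.
  by rewrite ler_wpM2r ?divr_ge0 ?(ltW (p2 n))//; lra.
have inc n j : nrm (zz n.+1 0 j - zz n 0 j) <= a / 2 ^+ n.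
  have := le_nv S (zz n.+1 - zz n) j; rewrite !mxE => /le_trans; apply.
  rewrite /a mulrAC ler_pdivlMr// mulrC; apply: le_trans (low _) _.
  by rewrite NJ nvN; have [] := inv n.
have /choice[zl hzl] : forall j, exists l, forall n, nrm (l - zz n 0 j) <= #|BB S|%:R * (2 * a) / 2 ^+ n.
  by move=> j; apply: nrm_complete => n; exact: inc.
pose z : V := \row_j zl j; pose b := #|BB S|%:R * (2 * a).
have b0 : 0 <= b by rewrite /b mulr_ge0// mulr_ge0.
have hz n : nv (z - zz n) <= b / 2 ^+ n.
  by apply: nv_le => [|j]; [rewrite divr_ge0// ltW|rewrite !mxE; exact: hzl].
have an n : 0 <= 2 * a / 2 ^+ n by apply: divr_ge0; [rewrite mulr_ge0|exact: ltW].
have zx n : nv (zz n) <= 3 / 2.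
  rewrite -(subrK x (zz n)); apply: le_trans (nvD _ _ _) _.
  have [_ h _] := inv n; have := an n; lra.
have zb : nv z <= 2.
  apply: (@le_geom _ _ b) => n; rewrite -(subrK (zz n) z).
  by apply: le_trans (nvD _ _ _) _; have := hz n; have := zx n; lra.
exists z => [l|].
  apply/eqP; rewrite -subr_eq0; apply/eqP; apply: (@nrm_eq0 _ _ S); apply/eqP.
  rewrite eq_le nrm_ge0 andbT; apply: (@le_geom _ _ (C * 2 * b + th)) => n.
  have [_ _ _ _ [hL _]] := hC (P l) 2 ltac:(lra) (PM l).
  have zn2 : nv (zz n) <= 2 by have := zx n; lra.
  have h1 := hL (zz n) z zn2 zb.
  have [h2 _ _] := inv n; have h3 := le_trans (le_nv S _ l) h2; rewrite mxE in h3.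
  rewrite (_ : _ - y0 l = (xev (P l) z - xev (P l) (zz n)) + (xev (P l) (zz n) - y0 l)); last by ring.
  rewrite add0r mulrDl; apply: nrmDl => //; apply: le_trans h1 _.
  by rewrite -[X in _ <= X]mulrA; apply: ler_wpM2l => //; lra.
pose D := C * 2.
apply: (@le_geom _ _ (D * b)) => n.
rewrite (_ : z - x = (z - zz n) - (x - zz n)); last by rewrite opprB addrA subrK.
rewrite JvB (_ : Jv P x (x - zz n) = - Jv P x (zz n - x)); last by rewrite !JvE -mulNmx opprB.
rewrite opprK addrC; apply: le_trans (nvD _ _ _) _; apply: lerD.
  have [_ _ h] := inv n; have : 0 <= 2 * th / 2 ^+ n by apply: divr_ge0; [rewrite mulr_ge0|exact: ltW].
  lra.
have D0 : 0 <= D by rewrite /D; lra.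
apply: nv_le => [|l]; first by apply: divr_ge0; [exact: mulr_ge0|exact: ltW].
rewrite mxE; have [_ _ h _ _] := hC (P l) 2 ltac:(lra) (PM l).
have x2 : nv x <= 2 by lra.
apply: le_trans (h x (z - zz n) x2) _; rewrite -[X in _ <= X]mulrA; apply: ler_wpM2l; last exact: hz.
by rewrite /D; lra.
Qed.

End Newton.

(** * Zeros of a polynomial system in general position *)

Section Bezout.
Context {R : realType} {K : numFieldType} (S : scalars R K) {d q : nat}.
Local Notation nrm := (nrm S).
Local Notation V := 'rV[K]_d.
Local Notation JJ := (JJ d q).

Lemma digits_inj (b m : nat) (f g : 'I_m -> nat) : (forall i, f i < b)%N -> (forall i, g i < b)%N ->
  (\sum_i f i * b ^ i = \sum_i g i * b ^ i)%N -> f =1 g.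
Proof.
elim: m f g => [|m ih] f g fb gb; first by move=> _ [].
have b0 : (0 < b)%N by apply: leq_trans (fb ord0); rewrite ltnS.
rewrite !big_ord_recl /= expn0 !muln1.
have sh (h : 'I_m.+1 -> nat) : (\sum_(i < m) h (lift ord0 i) * b ^ bump 0 i = (\sum_(i < m) h (lift ord0 i) * b ^ i) * b)%N.
  by rewrite big_distrl/=; apply: eq_bigr => i _; rewrite /bump /= add1n expnSr mulnA.
rewrite !sh => e.
have e0 : f ord0 = g ord0.
  by have := congr1 (modn^~ b) e; rewrite /= !(addnC (_ ord0)) !modnMDl !modn_small.
have e1 : (\sum_(i < m) f (lift ord0 i) * b ^ i = \sum_(i < m) g (lift ord0 i) * b ^ i)%N.
  by move/eqP: e; rewrite e0 eqn_add2l eqn_pmul2r// => /eqP.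
have := ih (fun i => f (lift ord0 i)) (fun i => g (lift ord0 i)) (fun i => fb _) (fun i => gb _) e1.
by move=> h i; have [j ->|->] := unliftP ord0 i; [exact: h|].
Qed.

Definition emon n (e : {ffun 'I_d -> 'I_n}) (x : V) : K := \prod_i x 0 i ^+ e i.
(** Degrees are bounded in each variable separately: exponents form a box, so monomials are easy to
    count and products merely add the bounds. *)
Definition isE n (f : V -> K) := exists c : {ffun 'I_d -> 'I_n} -> K, forall x, f x = \sum_e c e * emon e x.

Lemma isE_ext n f g : f =1 g -> isE n f -> isE n g.
Proof. by move=> fg [c h]; exists c => x; rewrite -fg. Qed.

Lemma isE_mon n (a : 'I_d -> nat) : (forall i, a i < n)%N -> isE n (fun x => \prod_i x 0 i ^+ a i).
Proof.
move=> an; pose e : {ffun 'I_d -> 'I_n} := [ffun i => Ordinal (an i)].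
exists (fun e' => (e' == e)%:R) => x; rewrite (bigD1 e)//= eqxx mul1r [X in _ + X]big1 ?addr0.
  by rewrite /emon; apply: eq_bigr => i _; rewrite ffunE.
by move=> e' /negbTE ->; rewrite mul0r.
Qed.

Lemma isE_sum n (I : finType) (F : I -> V -> K) (a : I -> K) : (forall i, isE n (F i)) ->
  isE n (fun x => \sum_i a i * F i x).
Proof.
move=> /choice[c h]; exists (fun e => \sum_i a i * c i e) => x.
under eq_bigr do rewrite h mulr_sumr.
rewrite exchange_big; apply: eq_bigr => e _; rewrite mulr_suml.
by apply: eq_bigr => i _; rewrite mulrA.
Qed.

Lemma isE_mul n m f g : isE n f -> isE m g -> isE (n + m) (fun x => f x * g x).
Proof.
move=> [c hc] [c' hc'].
apply: (@isE_ext _ (fun x => \sum_(p : {ffun 'I_d -> 'I_n} * {ffun 'I_d -> 'I_m}) (c p.1 * c' p.2) * \prod_i x 0 i ^+ (p.1 i + p.2 i))).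
  move=> x; rewrite hc hc' mulr_suml.
  rewrite -(pair_bigA _ (fun e e' => c e * c' e' * \prod_i x 0 i ^+ (e i + e' i)))/=.
  apply: eq_bigr => e _; rewrite mulr_sumr; apply: eq_bigr => e' _.
  under eq_bigr do rewrite exprD.
  by rewrite big_split/= /emon; ring.
apply: isE_sum => p; apply: isE_mon => i.
by rewrite -addnS; apply: leq_add; [apply: ltnW; exact: ltn_ord|exact: ltn_ord].
Qed.

Lemma isE_le n m f : (n <= m)%N -> isE n f -> isE m f.
Proof.
move=> nm [c hc]; apply: (@isE_ext _ (fun x => \sum_e c e * \prod_i x 0 i ^+ e i)); first by move=> x; rewrite hc.
by apply: isE_sum => e; apply: isE_mon => i; exact: leq_trans (ltn_ord _) nm.
Qed.

Lemma isE_cst1 n : (0 < n)%N -> isE n (fun _ => 1).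
Proof.
move=> n0; apply: (@isE_ext _ (fun x : V => \prod_i x 0 i ^+ 0)); last exact: isE_mon.
by move=> x; rewrite big1.
Qed.

Lemma isE_X j k : isE k.+1 (fun x => x 0 j ^+ k).
Proof.
apply: (@isE_ext _ (fun x : V => \prod_i x 0 i ^+ (if i == j then k else 0%N))).
  move=> x; rewrite (bigD1 j)//= eqxx big1 ?mulr1// => i /negbTE ->; exact: expr0.
by apply: isE_mon => i; case: ifP.
Qed.

Lemma isE_pow n f k : isE n f -> isE (k * n + 1) (fun x => f x ^+ k).
Proof.
move=> h; elim: k => [|k ih].
  by apply: (@isE_ext _ (fun _ => 1)) => //; exact: isE_cst1.
rewrite mulSn -addnA; apply: (@isE_ext _ (fun x => f x * f x ^+ k)); first by move=> x; rewrite exprS.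
exact: isE_mul.
Qed.

Lemma isE_wmon k (w : J d k) : isE (2 * k + 1) (wmon w).
Proof.
elim: k w => [|k ih] w /=; first exact: isE_cst1.
case: w => [[i w]|]; last by apply: isE_cst1; rewrite addn1.
rewrite (_ : 2 * k.+1 + 1 = 2 + (2 * k + 1))%N; last lia.
by apply: isE_mul => //; apply: isE_ext (isE_X i 1) => x; rewrite expr1.
Qed.

Lemma isE_xev (c : JJ -> K) : isE (2 * q + 3) (xev c).
Proof.
apply: isE_sum => -[[i|] w]; rewrite /xmon/=; last by apply: isE_le (isE_wmon w); lia.
rewrite (_ : 2 * q + 3 = 2 + (2 * q + 1))%N; last lia.
by apply: isE_mul (isE_wmon w); apply: isE_ext (isE_X i 1) => x; rewrite expr1.
Qed.

Lemma isE_prod (s : seq 'I_d) n (F : 'I_d -> V -> K) : (forall i, isE n (F i)) ->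
  isE (size s * n + 1) (fun x => \prod_(i <- s) F i x).
Proof.
move=> h; elim: s => [|i s ih].
  by apply: (@isE_ext _ (fun _ => 1)) => [x|]; [rewrite big_nil|exact: isE_cst1].
rewrite /= mulSn -addnA; apply: (@isE_ext _ (fun x => F i x * \prod_(j <- s) F j x)).
  by move=> x; rewrite big_cons.
exact: isE_mul.
Qed.

Lemma lin_dep (I E : finType) (c : I -> E -> K) : (#|E| < #|I|)%N ->
  exists2 a : I -> K, (exists i, a i != 0) & forall e, \sum_i a i * c i e = 0.
Proof.
move=> lt; pose M : 'M[K]_(#|I|, #|E|) := \matrix_(i, e) c (enum_val i) (enum_val e).
have : kermx M != 0.
  rewrite kermx_eq0 /row_free; apply: contraTneq lt => <-.
  by rewrite -leqNgt rank_leq_col.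
move=> /rowV0Pn[v /sub_kermxP vM v0].
exists (fun i => v 0 (enum_rank i)).
  have [i vi] : exists i, v 0 i != 0.
    apply/not_existsP => h; move/eqP: v0; apply; apply/rowP => i; rewrite mxE.
    by apply/eqP; rewrite -[_ == _]negbK; apply/negP; exact: h.
  by exists (enum_val i); rewrite enum_valK.
move=> e; have := congr1 (fun A : 'rV_#|E| => A 0 (enum_rank e)) vM; rewrite !mxE => h; rewrite -[RHS]h {h}.
rewrite [RHS](reindex (@enum_rank I)) /=; last first.
  by exists enum_val => i _; rewrite ?enum_rankK ?enum_valK.
by apply: eq_bigr => i _; rewrite !mxE !enum_rankK.
Qed.

Lemma small_nonroot (G : {poly K}) (th : R) : 0 < th -> G != 0 ->
  exists2 s : K, nrm s <= th & G.[s] != 0.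
Proof.
move=> th0 G0; apply/not_exists2P => h.
have hr n : root G (iota S (th / n.+1%:R)).
  have [h1|h1] := h (iota S (th / n.+1%:R)).
    case: h1; rewrite nrm_iota ger0_norm ?divr_ge0// ?(ltW th0)//.
    by rewrite ler_pdivrMr// ler_peMr ?(ltW th0)// ler1n.
  by rewrite /root; move/negP: h1; rewrite negbK.
pose rs := [seq iota S (th / n.+1%:R) | n <- seq.iota 0 (size G)].
have := @max_poly_roots _ G rs G0; rewrite size_map size_iota ltnn; move=> H; apply: notF; apply: H.
  by apply/allP => _ /mapP[n _ ->].
rewrite map_inj_in_uniq ?iota_uniq// => n m _ _ /iota_inj /(mulfI (lt0r_neq0 th0)) /invr_inj /eqP.
by rewrite eqr_nat eqSS => /eqP.
Qed.

(* Dimension count: the functions [P^beta x_j^k] outnumber the monomials of their degree, so some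
   nontrivial relation holds between [P] and [x_j], and it bounds the number of values of [x_j] on
   the generic fibre of [P]. *)
Lemma bezout : exists Bz : nat, forall (P : 'I_d -> JJ -> K) (th : R), 0 < th ->
  exists2 y0 : 'I_d -> K, (forall l, nrm (y0 l) <= th) &
    forall zs : seq V, uniq zs -> (forall z, z \in zs -> forall l, xev (P l) z = y0 l) -> (size zs <= Bz)%N.
Proof.
(* [Q] bounds the exponents in one equation and [N] those in [x_j ^+ k * \prod_l P_l ^+ beta_l] for
   [k] and all [beta_l] below [b]. As [N <= b * D], there are at most [b ^ d * D ^ d] monomials
   against [b ^ d * b] functions, and [b] exceeds [D ^ d]. *)
pose Q := (2 * q + 3)%N; pose D := (d * (Q + 1) + 2)%N; pose b := (D ^ d).+1.
exists (b ^ d)%N => P th0 th0'.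
pose th := Num.min th0 1; have th1 : th <= 1 by rewrite ge_min lexx orbT.
have th' : 0 < th by rewrite lt_min th0' ltr01.
pose N := (b + (d * (b * Q + 1) + 1))%N.
pose I : finType := ({ffun 'I_d -> 'I_b} * 'I_b)%type.
have hI j (i : I) : isE N (fun x => x 0 j ^+ i.2 * \prod_l xev (P l) x ^+ i.1 l).
  apply: isE_mul; first by apply: isE_le (isE_X j i.2); exact: ltn_ord.
  have sd : size (index_enum 'I_d) = d by rewrite -[RHS]card_ord cardT enumT.
  rewrite -[X in isE (X * _ + 1)]sd.
  apply: isE_prod => l; apply: isE_le (isE_pow (i.1 l) (isE_xev (P l))).
  by rewrite leq_add2r leq_mul2r ltnW ?orbT// ltn_ord.
have card : (#|{ffun 'I_d -> 'I_N}| < #|I|)%N.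
  rewrite card_prod !card_ffun !card_ord.
  apply: (@leq_ltn_trans ((b * D) ^ d)).
    by case: (posnP d) => [->//|d0]; rewrite leq_exp2r// /N /D mulnDr; nia.
  by rewrite expnMn ltn_mul2l expn_gt0 /= /b ltnS leqnn.
have rel j : exists2 a : I -> K, (exists i, a i != 0) &
    forall x : V, \sum_i a i * (x 0 j ^+ i.2 * \prod_l xev (P l) x ^+ i.1 l) = 0.
  have /choice[c hc] := hI j; have [a a0 ha] := lin_dep c card; exists a => // x.
  under eq_bigr do rewrite hc mulr_sumr.
  rewrite exchange_big big1// => e _.
  by under eq_bigr do rewrite mulrA; rewrite -mulr_suml ha mul0r.
have /choice[a ha] : forall j, exists a : I -> K, (exists i, a i != 0) /\
    forall x : V, \sum_i a i * (x 0 j ^+ i.2 * \prod_l xev (P l) x ^+ i.1 l) = 0.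
  by move=> j; have [a ? ?] := rel j; exists a.
have /choice[i0 hi0] : forall j, exists i, a j i != 0 by move=> j; exact: (ha j).1.
pose code (be : {ffun 'I_d -> 'I_b}) := (\sum_l be l * b ^ l)%N.
have code_inj : injective code.
  move=> be be' /digits_inj h; apply/ffunP => l; apply: val_inj; apply: h => l'; exact: ltn_ord.
(* Along the curve [y_l = s ^+ (b ^ l)] the product [\prod_l y_l ^+ beta_l] becomes
   [s ^+ code beta]. Uniqueness of digits in base [b] excludes cancellations, so for some [k] the
   coefficient of [x_j ^+ k] is a nonzero polynomial in [s]. *)
pose G j k : {poly K} := \sum_be (a j (be, k))%:P * 'X^(code be).
have G0 j : G j (i0 j).2 != 0.
  apply/eqP => /(congr1 (fun g : {poly K} => g`_(code (i0 j).1))).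
  rewrite coef0 coef_sum (bigD1 (i0 j).1)//= coefCM coefXn eqxx mulr1 big1 ?addr0; last first.
    by move=> be bei; rewrite coefCM coefXn (inj_eq code_inj) eq_sym (negbTE bei) mulr0.
  by rewrite -surjective_pairing => /eqP; rewrite (negbTE (hi0 j)).
have [s hs Gs] : exists2 s : K, nrm s <= th & (\prod_j G j (i0 j).2).[s] != 0.
  by apply: small_nonroot => //; apply/prodf_neq0 => j _; exact: G0.
have Gjs j : (G j (i0 j).2).[s] != 0.
  by move: Gs; rewrite horner_prod => /prodf_neq0; exact.
exists (fun l : 'I_d => s ^+ (b ^ l)) => [l|zs uzs hz].
  rewrite nrmX; apply: (@le_trans _ _ (nrm s)).
    have s1 : nrm s <= 1 by exact: le_trans hs th1.
    by rewrite -[X in _ <= X]expr1 ler_wiXn2l ?nrm_ge0// expn_gt0.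
  by apply: le_trans hs _; rewrite ge_min lexx.
pose H j : {poly K} := \sum_k (G j k).[s]%:P * 'X^k.
have H0 j : H j != 0.
  apply/eqP => /(congr1 (fun g : {poly K} => g`_(i0 j).2)).
  rewrite coef0 coef_sum (bigD1 (i0 j).2)//= coefCM coefXn eqxx mulr1 big1 ?addr0; last first.
    move=> k ki; rewrite coefCM coefXn; case: eqP => [e|]; rewrite ?mulr0//.
    by case/negP: ki; apply/eqP/val_inj.
  by move/eqP; rewrite (negbTE (Gjs j)).
have Hs j : (size (H j) <= b)%N.
  apply: leq_trans (size_sum _ _ _) _; apply/bigmax_leqP => k _.
  by rewrite mul_polyC (leq_trans (size_scale_leq _ _))// size_polyXn ltn_ord.
have Hr j (z : V) : z \in zs -> root (H j) (z 0 j).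
  move=> zz; apply/eqP; rewrite -[RHS]((ha j).2 z) horner_sum.
  rewrite [RHS](eq_bigr (fun i : I => (fun be k => a j (be, k) * (z 0 j ^+ k * \prod_l xev (P l) z ^+ (be : {ffun _}) l)) i.1 i.2)); last by case.
  rewrite -(pair_bigA _ (fun be k => a j (be, k) * (z 0 j ^+ (k : 'I_b) * \prod_l xev (P l) z ^+ be l)))/=.
  rewrite exchange_big; apply: eq_bigr => k _.
  rewrite hornerM hornerC hornerXn /G horner_sum mulr_suml; apply: eq_bigr => be _.
  rewrite hornerM hornerC hornerXn [z 0 j ^+ _ * _]mulrC mulrA; congr (_ * _ * _).
  rewrite /code (eq_bigr (fun l : 'I_d => (b ^ l * be l)%N)); last by move=> l _; rewrite mulnC.
  rewrite expr_sum; apply: eq_bigr => l _; rewrite hz//; exact: exprM.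
pose r (j : 'I_d) := undup (map (fun z : V => z 0 j) zs).
have rb j : (size (r j) <= b)%N.
  have := @max_poly_roots _ (H j) (r j) (H0 j).
  have -> : all (root (H j)) (r j).
    by apply/allP => u; rewrite mem_undup => /mapP[z zz ->]; exact: Hr.
  rewrite undup_uniq => /(_ isT isT) /ltnW /leq_trans; exact.
pose f (z : V) : {ffun 'I_d -> 'I_b} := [ffun j => inord (index (z 0 j) (r j))].
have finj : {in zs &, injective f}.
  move=> z z' zz zz' /ffunP e; apply/rowP => j.
  have zr (u : V) : u \in zs -> u 0 j \in r j by move=> uz; rewrite mem_undup; apply/mapP; exists u.
  have := congr1 val (e j); rewrite !ffunE /= !inordK ?ltnS; last first.
  - by rewrite -ltnS; apply: leq_trans (rb j); rewrite index_mem zr.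
  - by rewrite -ltnS; apply: leq_trans (rb j); rewrite index_mem zr.
  by move=> /(congr1 (nth 0 (r j))); rewrite !nth_index ?zr.
have : uniq (map f zs) by rewrite map_inj_in_uniq.
move=> /card_uniqP; rewrite size_map => <-; apply: leq_trans (max_card _) _.
by rewrite card_ffun !card_ord.
Qed.

End Bezout.

(** * Cells around configurations *)

Section Cells.
Context {R : realType} {K : numFieldType} (S : scalars R K) {d q : nat}.
Local Notation nrm := (nrm S).
Local Notation nv := (nv S).
Local Notation iota := (iota S).
Local Notation V := 'rV[K]_d.
Local Notation JJ := (JJ d q).
Local Notation conf := (conf (K := K) (d := d) (q := q)).

Variables (r Cb C0 Ccr Clow : R) (PP : conf -> 'I_d -> JJ -> K).
Hypothesis r_gt0 : 0 < r.
Hypothesis hCb : xbounds S (d := d) (q := q) Cb.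
Hypothesis C0_ge1 : 1 <= C0.
Hypothesis Ccr_ge1 : 1 <= Ccr.
Hypothesis Clow_ge1 : 1 <= Clow.
Definition admconf (x : conf) := inbox S x /\ rsep S r x.
Hypothesis PPgood : forall x, admconf x -> good S x (PP x).
Hypothesis PPdom : forall x, admconf x -> forall i c v, Tx x c -> Ub S c ->
    nrm (dv c (x i) v) <= C0 * nv (Jv (PP x) (x i) v).
Hypothesis hcr : forall x, admconf x -> forall c (tau : R), (forall i, nrm (xev c (x i)) <= tau) ->
  exists2 c', Tx x c' & forall w, nrm (c w - c' w) <= Ccr * tau.
Hypothesis hlow : forall x, admconf x ->
  forall i k, exists c, [/\ Tx x c, Ub S c & forall v, dv c (x i) v = iota Clow^-1 * v 0 k].

Definition cl : R := (C0 * Clow)^-1.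

Lemma cl_gt0 : 0 < cl.
Proof.
have K0 := C0_ge1; have K1 := Ccr_ge1; have K2 := Clow_ge1.
by rewrite invr_gt0 mulr_gt0//; lra.
Qed.
Lemma cl_le1 : cl <= 1.
Proof.
have K0 := C0_ge1; have K1 := Ccr_ge1; have K2 := Clow_ge1.
have cC : 0 < C0 * Clow by rewrite mulr_gt0//; lra.
by rewrite invf_le1//; nra.
Qed.

(** The coordinate forms provided by [hlow] are themselves dominated, so the metric of a cell
    controls the norm. The factor [cl] depends on [r]; it absorbs error terms and makes cells
    narrow, and does not enter the final constant. *)
Lemma low_cell x i v : admconf x -> cl * nv v <= nv (Jv (PP x) (x i) v).
Proof.
have K0 := C0_ge1; have K1 := Ccr_ge1; have K2 := Clow_ge1.
move=> ax; have cC : 0 < C0 * Clow by rewrite mulr_gt0//; lra.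
rewrite ler_pdivrMl//; apply: nv_le => [|k]; first by rewrite mulr_ge0 ?nv_ge0// ltW.
have [c [Tc Uc hc]] := hlow ax i k.
have := PPdom ax i v Tc Uc; rewrite hc nrmM nrm_iota ger0_norm; last by rewrite invr_ge0; lra.
rewrite ler_pdivrMl; last lra.
by rewrite mulrCA mulrA.
Qed.

Lemma inbox2 x i : admconf x -> nv (x i) <= 2.
Proof. by move=> -[xb _]; have := xb i; lra. Qed.

Lemma dv_dom x i c v (B : R) : admconf x -> 0 < B -> Tx x c -> (forall w, nrm (c w) <= B) ->
  nrm (dv c (x i) v) <= B * C0 * nv (Jv (PP x) (x i) v).
Proof.
have K0 := C0_ge1; have K1 := Ccr_ge1; have K2 := Clow_ge1.
move=> ax B0 Tc cB.
have Uc : Ub S (fun w => iota B^-1 * c w).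
  by move=> w; rewrite nrmM nrm_iota gtr0_norm ?invr_gt0// ler_pdivrMl// mulr1.
have Tc' : Tx x (fun w => iota B^-1 * c w) by move=> j; rewrite xevZ Tc mulr0.
have := PPdom ax i v Tc' Uc; rewrite dvZ nrmM nrm_iota gtr0_norm ?invr_gt0// ler_pdivrMl//.
by rewrite mulrA.
Qed.

(** An equation of [PP x] almost vanishes on the nearby [y]. Corrected to vanish there, it has
    coefficients at most 2 and is dominated by [PP y], which gives [2 * C0]; the errors,
    proportional to [h], are absorbed by [low_cell] into one more [C0]. *)
Lemma compare_cells x y (h : R) i v : admconf x -> admconf y -> (forall j, nv (x j - y j) <= h) ->
  Ccr * Cb * h <= 1 -> (Cb + Cb * Ccr * Cb) * h <= cl ->
  nv (Jv (PP x) (x i) v) <= 3 * C0 * nv (Jv (PP y) (y i) v).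
Proof.
have K0 := C0_ge1; have K1 := Ccr_ge1; have K2 := Clow_ge1.
move=> ax ay xy h1 h2; have [Cb1 hb] := hCb.
have n0 := nv_ge0 S (Jv (PP y) (y i) v); have v0 := nv_ge0 S v.
have h0 : 0 <= h := le_trans (nv_ge0 S _) (xy i).
apply: nv_le => [|l]; first by rewrite !mulr_ge0//; lra.
rewrite mxE; set f := PP x l; have [Tf Uf] := PPgood ax l.
have [_ _ hdv hdvl [hlip _]] := hb f 1 ler01 Uf.
have fy j : nrm (xev f (y j)) <= Cb * h.
  have := hlip (x j) (y j) (inbox2 j ax) (inbox2 j ay); rewrite Tf subr0 mulr1.
  move=> /le_trans; apply; rewrite ler_wpM2l//; first lra.
  by rewrite nvB.
have [f' Tf' ff'] := hcr ay fy.
pose mu := Ccr * (Cb * h).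
have mu0 : 0 <= mu by rewrite !mulr_ge0//; lra.
have mu1 : mu <= 1 by rewrite /mu mulrA.
have f'2 w : nrm (f' w) <= 2.
  have e := ff' w; rewrite nrmB -/mu in e.
  by rewrite -(subrK (f w) (f' w)); apply: le_trans (nrmDl e (Uf w)) _; lra.
have e1 := dv_dom i v ay (ltr0Sn _ _) Tf' f'2.
have [_ _ hdv' _ _] := hb (fun w => f w - f' w) mu mu0 ff'.
have e2 := hdv' (y i) v (inbox2 i ay); rewrite dvB in e2.
have e3 := hdvl (x i) (y i) v (inbox2 i ax) (inbox2 i ay).
have -> : dv f (x i) v = (dv f (x i) v - dv f (y i) v) + ((dv f (y i) v - dv f' (y i) v) + dv f' (y i) v) by ring.
apply: le_trans (nrmDl e3 (nrmDl e2 e1)) _.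
have e4 := low_cell i v ay.
have : Cb * 1 * nv (x i - y i) * nv v <= Cb * h * nv v.
  by rewrite mulr1 ler_wpM2r// ler_wpM2l ?xy//; lra.
have : (Cb + Cb * Ccr * Cb) * h * nv v <= cl * nv v by rewrite ler_wpM2r.
have -> : (Cb + Cb * Ccr * Cb) * h * nv v = Cb * h * nv v + Cb * mu * nv v by rewrite /mu; ring.
have : nv (Jv (PP y) (y i) v) <= C0 * nv (Jv (PP y) (y i) v) by rewrite ler_peMl.
lra.
Qed.

(** Cells are anisotropic, with the metric taken at the centre [x], the last argument. The relation
    is therefore not symmetric. *)
Definition closeto (eps : R) (y x : conf) := forall i, nv (Jv (PP x) (x i) (y i - x i)) <= eps.

Lemma closeto_dist eps x y : admconf x -> closeto eps y x -> forall i, nv (y i - x i) <= eps / cl.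
Proof.
have K0 := C0_ge1; have K1 := Ccr_ge1; have K2 := Clow_ge1.
move=> ax h i; rewrite ler_pdivlMr ?cl_gt0// mulrC.
exact: le_trans (low_cell i _ ax) (h i).
Qed.

(* If [f] is interpolable and almost vanishes on [x'], its values on a nearby configuration [x]
   are controlled by polynomials vanishing on [x'], hence by the size of the cell. *)
Lemma slab_bound (E : set V) (M eps tau : R) (f : V -> K) (x x' : conf) : 1 <= M -> 0 < eps -> 0 < tau ->
  admconf x -> admconf x' -> (forall i, E (x i)) -> (forall i, E (x' i)) -> closeto eps x' x ->
  Ccr * Cb * (eps / cl) <= 1 -> (Cb + Cb * Ccr * Cb) * (eps / cl) <= cl ->
  2 * Cb * (eps / cl) ^+ 2 <= eps -> tau * (1 + 2 * Cb * Ccr) <= eps -> 2 * Ccr * tau <= 1 ->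
  Int S E q.+1 M f -> (forall i, nrm (f (x' i)) <= tau) ->
  forall i, nrm (f (x i)) <= 8 * C0 ^+ 2 * M * eps.
Proof.
have K0 := C0_ge1; have K1 := Ccr_ge1; have K2 := Clow_ge1.
move=> M1 e0 t0 ax ax' xE x'E cl1 h1 h2 h3 h4 h5 hf hz i; have [Cb1 hb] := hCb.
(* Interpolation takes place at [q.+2] points: the whole configuration [x'] and the single point
   [x i]. *)
pose pts (k : 'I_q.+2) := if unlift ord0 k is Some j then x' j else x i.
have pE k : E (pts k) by rewrite /pts; case: unlift.
have [c cM hc] := hf pts pE _ t0.
have [c' c'M c'E] := xev_pev cM.
have hx : nrm (f (x i) - xev c' (x i)) <= tau.
  by have := hc ord0; rewrite /pts unlift_none -c'E.
have hx' j : nrm (xev c' (x' j)) <= 2 * tau.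
  have := hc (lift ord0 j); rewrite /pts liftK -c'E => h.
  rewrite (_ : xev c' (x' j) = f (x' j) - (f (x' j) - xev c' (x' j))); last by ring.
  by apply: le_trans (nrmBl (hz j) h) _; lra.
have [c2 Tc2 hc2] := hcr ax' hx'.
have c2M w : nrm (c2 w) <= 2 * M.
  have e := hc2 w; rewrite nrmB in e.
  by rewrite -(subrK (c' w) (c2 w)); apply: le_trans (nrmDl e (c'M w)) _; lra.
have dist := closeto_dist ax cl1.
set h := eps / cl in h1 h2 h3 dist.
have hh j : nv (x' j - x j) <= h by exact: dist.
have M2 : 0 < 2 * M by lra.
have [_ _ _ _ [_ hT]] := hb c2 (2 * M) (ltW M2) c2M.
have T := hT (x' i) (x' i) (x i) (inbox2 i ax') (inbox2 i ax') (inbox2 i ax).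
rewrite Tc2 subr0 subrr nv0 add0r in T.
have D := dv_dom i (x i - x' i) ax' M2 Tc2 c2M.
have cmp := compare_cells i (x i - x' i) ax' ax hh h1 h2.
have JN : nv (Jv (PP x) (x i) (x i - x' i)) <= eps.
  by rewrite -opprB JvE mulNmx nvN -JvE; exact: cl1.
have [hev _ _ _ _] := hb (fun w => c' w - c2 w) (Ccr * (2 * tau)) ltac:(rewrite !mulr_ge0//; lra) hc2.
have e1 := hev (x i) (inbox2 i ax); rewrite xevB in e1.
rewrite (_ : f (x i) = (f (x i) - xev c' (x i)) + ((xev c' (x i) - xev c2 (x i)) +
  ((xev c2 (x i) - dv c2 (x' i) (x i - x' i)) + dv c2 (x' i) (x i - x' i)))); last by ring.
apply: le_trans (nrmDl hx (nrmDl e1 (nrmDl T D))) _.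
have n1 := nv_ge0 S (x i - x' i).
have nh : nv (x i - x' i) <= h by rewrite nvB.
have a1 : Cb * (2 * M) * nv (x i - x' i) * nv (x i - x' i) <= M * (2 * Cb * h ^+ 2).
  have -> : M * (2 * Cb * h ^+ 2) = Cb * (2 * M) * h * h by ring.
  by apply: ler_pM => //; [rewrite !mulr_ge0//; lra|rewrite ler_wpM2l// mulr_ge0//; lra].
(* The 6 in this main term is the factor 2 of [c2M] times the 3 of [compare_cells]. The correction
   to [c2] and the second order remainder each add at most one more, whence 8. *)
have a2 : 2 * M * C0 * nv (Jv (PP x') (x' i) (x i - x' i)) <= M * (6 * C0 ^+ 2 * eps).
  have -> : M * (6 * C0 ^+ 2 * eps) = 2 * M * C0 * (3 * C0 * eps) by ring.
  rewrite ler_wpM2l//; first by rewrite !mulr_ge0//; lra.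
  by apply: le_trans cmp _; rewrite ler_wpM2l//; lra.
have a3 : M * (2 * Cb * h ^+ 2) <= M * eps by rewrite ler_wpM2l//; lra.
have C2 : 1 <= C0 ^+ 2 by rewrite -(expr1n _ 2) lerXn2r ?nnegrE//; lra.
have Me : eps <= M * eps by rewrite ler_peMl//; lra.
have a4 : M * eps <= C0 ^+ 2 * (M * eps) by rewrite ler_peMl// mulr_ge0//; lra.
have -> : 8 * C0 ^+ 2 * M * eps = 2 * (C0 ^+ 2 * (M * eps)) + M * (6 * C0 ^+ 2 * eps) by ring.
have h4' : tau + Cb * (Ccr * (2 * tau)) <= eps.
  by rewrite (_ : _ + _ = tau * (1 + 2 * Cb * Ccr)); [|ring].
lra.
Qed.

(** [eta] has coefficients at most [1 / (8 * C0)] and nearly vanishes on [x]. Made to vanish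
    exactly, it has coefficients at most [1 / (4 * C0)], so its differential is at most a quarter of
    that of [PP x]. The perturbed system keeps half of the differential, as Newton's method
    requires. *)
Lemma PP_perturbed x i (P : 'I_d -> JJ -> K) (eta : 'I_d -> JJ -> K) (th del : R) : admconf x ->
  0 <= th -> 0 <= del -> (forall l w, nrm (eta l w) <= (8 * C0)^-1) ->
  (forall l j, nrm (xev (eta l) (x j)) <= th) ->
  (forall l w, nrm (P l w - (PP x l w + eta l w)) <= del) ->
  Ccr * th <= (8 * C0)^-1 -> 16 * Cb * Ccr * th <= cl -> 16 * Cb * del <= cl ->
  forall v, nv (Jv (PP x) (x i) v) <= 2 * nv (Jv P (x i) v).
Proof.
have K0 := C0_ge1; have K1 := Ccr_ge1; have K2 := Clow_ge1.
move=> ax th0 del0 eb ev Pd t1 t2 d1 v; have [Cb1 hb] := hCb.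
set L := nv (Jv (PP x) (x i) v); have L0 : 0 <= L := nv_ge0 S _.
have Lv := low_cell i v ax; rewrite -/L in Lv; have v0 := nv_ge0 S v.
suff key l : nrm (dv (PP x l) (x i) v) <= nv (Jv P (x i) v) + L / 2.
  have : L <= nv (Jv P (x i) v) + L / 2.
    by apply: nv_le => [|l]; [rewrite addr_ge0 ?nv_ge0//; lra|rewrite mxE].
  lra.
have [e' Te' he'] := hcr ax (ev l).
have i8 : 0 < (8 * C0)^-1 by rewrite invr_gt0; lra.
have e'b w : nrm (e' w) <= (4 * C0)^-1.
  have -> : (4 * C0)^-1 = (8 * C0)^-1 + (8 * C0)^-1 by field; lra.
  rewrite -(subrK (eta l w) (e' w)); apply: nrmDl (eb l w).
  by rewrite nrmB; apply: le_trans (he' w) _.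
have i4 : 0 < (4 * C0)^-1 by rewrite invr_gt0; lra.
have e1 := dv_dom i v ax i4 Te' e'b; rewrite -/L in e1.
have {}e1 : nrm (dv e' (x i) v) <= L / 4.
  by apply: le_trans e1 _; rewrite le_eqVlt; apply/orP; left; apply/eqP; field; lra.
have [_ _ h2 _ _] := hb (fun w => eta l w - e' w) (Ccr * th) ltac:(rewrite mulr_ge0//; lra) he'.
have e2 := h2 (x i) v (inbox2 i ax); rewrite dvB in e2.
have [_ _ h3 _ _] := hb (fun w => P l w - (PP x l w + eta l w)) del del0 (Pd l).
have e3 := h3 (x i) v (inbox2 i ax); rewrite dvB dvD in e3.
have e4 : nrm (dv (P l) (x i) v) <= nv (Jv P (x i) v) by have := le_nv S (Jv P (x i) v) l; rewrite mxE.
have -> : dv (PP x l) (x i) v = dv (P l) (x i) v - ((dv (eta l) (x i) v - dv e' (x i) v) + (dv e' (x i) v + (dv (P l) (x i) v - (dv (PP x l) (x i) v + dv (eta l) (x i) v)))) by ring.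
apply: le_trans (nrmBl e4 (nrmDl e2 (nrmDl e1 e3))) _.
rewrite lerD2l.
have : 16 * Cb * Ccr * th * nv v <= cl * nv v by rewrite ler_wpM2r.
have : 16 * Cb * del * nv v <= cl * nv v by rewrite ler_wpM2r.
have -> : 16 * Cb * Ccr * th * nv v = 16 * (Cb * (Ccr * th) * nv v) by ring.
have -> : 16 * Cb * del * nv v = 16 * (Cb * del * nv v) by ring.
lra.
Qed.

End Cells.

(** The order of the quantifiers is the point: [C0] comes before [r], whereas [Clow] and the choice
    [PP] come after. Polynomials from [lower_conf] form a system with scalar Jacobian, which proves
    [nondeg_conf]. *)
Lemma dominating_choice {R : realType} {K : numFieldType} (S : scalars R K) (d q : nat) :
  exists2 C0 : R, 1 <= C0 & forall r : R, 0 < r -> exists Clow : R, 1 <= Clow /\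
  (forall x, admconf S (d := d) (q := q) r x -> forall i k, exists c, [/\ Tx x c, Ub S c & forall v, dv c (x i) v = iota S Clow^-1 * v 0 k]) /\
  exists PP : conf -> 'I_d -> JJ d q -> K, forall x, admconf S r x -> good S x (PP x) /\
    forall i c v, Tx x c -> Ub S c -> nrm S (dv c (x i) v) <= C0 * nv S (Jv (PP x) (x i) v).
Proof.
have [C0 C01 hd] := @dom_conf _ _ S d q; exists C0 => // r r0.
have [Clow Cl1 hl] := @lower_conf _ _ S d q r r0; exists Clow; split=> //; split.
  by move=> x [xb xs]; exact: hl.
suff : forall x : conf, exists P : 'I_d -> JJ d q -> K, admconf S r x -> good S x P /\
    forall i c v, Tx x c -> Ub S c -> nrm S (dv c (x i) v) <= C0 * nv S (Jv P (x i) v).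
  by move=> /choice[PP hP]; exists PP.
move=> x; have [ax|nax] := pselect (admconf S r x); last by exists (fun _ _ => 0).
have [xb xs] := ax.
have [|P gP hP] := hd x xb; last by exists P.
move=> i; have /choice[P hP] := hl x xb xs i.
apply: (@lt_le_trans _ _ (nrm S (\det (Jac P (x i))))); last first.
  by apply: le_detsup => // l; have [] := hP l.
have -> : Jac P (x i) = (iota S Clow^-1)%:M.
  apply/matrixP => l j; rewrite !mxE; have [_ _ h] := hP l.
  have := h (delta_mx 0 j); rewrite /dv (bigD1 j)//= big1 ?addr0; last first.
    by move=> k kj; rewrite mxE (negbTE kj) mulr0.
  rewrite mxE !eqxx mulr1 => ->; rewrite mxE eqxx /=.
  by case: eqP; rewrite ?mulr1 ?mulr0.
rewrite det_scalar nrmX nrm_iota exprn_gt0// normr_gt0 invr_eq0; lra.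
Qed.

(** * Grids of parameters and of polynomial systems *)

Section Grid.
Context {R : realType} {K : numFieldType} (S : scalars R K) {d q : nat}.
Local Notation nrm := (nrm S).
Local Notation nv := (nv S).
Local Notation iota := (iota S).
Local Notation co := (co S).
Local Notation uu := (uu S).
Local Notation V := 'rV[K]_d.
Local Notation JJ := (JJ d q).

Definition idx : finType := (JJ * 'I_d * BB S)%type.
Definition tpar : finType := (J d q * 'I_d * BB S)%type.
Definition lowi (a : tpar) : idx := ((None, a.1.1), a.1.2, a.2).
(** With steps [1 / N], [gv] ranges over [[-1, 1]] and [hn] over [[-2, 2]], the latter because a
    perturbed system has coefficients at most 2. *)
Definition gv (N : nat) (k : 'I_(2 * N).+1) : R := k%:R / N%:R - 1.
Definition hn (N : nat) (k : 'I_(4 * N).+1) : R := k%:R / N%:R - 2.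
Definition grid (N : nat) : finType := {ffun idx -> 'I_(2 * N).+1}.
Definition pgrid (N : nat) : finType := {ffun idx -> 'I_(4 * N).+1}.

(* Only the coordinates [lowi a] enter the perturbed field; the others are
   dummy coordinates, matched with the top degree coefficients. *)
Definition pfield N (G : V -> V) (A : tpar -> V -> V) (g : grid N) (x : V) : V :=
  G x + \sum_a iota (gv (g (lowi a))) *: A a x.

Definition Pol N (h : pgrid N) (l : 'I_d) (W : JJ) : K := \sum_b iota (hn (h (W, l, b))) * uu b.

Definition rnd N (c : 'I_d -> JJ -> K) : pgrid N :=
  [ffun i => inord (Num.truncn (N%:R * (co i.2 (c i.1.2 i.1.1) + 2)))].

Lemma gv_bound N (k : 'I_(2 * N).+1) : (0 < N)%N -> `|gv k| <= 1.
Proof.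
move=> N0; have N0' : 0 < N%:R :> R by rewrite ltr0n.
have : k%:R <= (2 * N)%:R :> R by rewrite ler_nat -ltnS ltn_ord.
rewrite natrM => kN; rewrite /gv ler_distl subrr divr_ge0//= ler_pdivrMr//; lra.
Qed.

Lemma rnd_hn N c l W b : (0 < N)%N -> nrm (c l W) <= 2 ->
  `|hn (rnd N c (W, l, b)) - co b (c l W)| <= N%:R^-1.
Proof.
move=> N0 c2; have N0' : 0 < N%:R :> R by rewrite ltr0n.
have := le_trans (co_nrm S b (c l W)) c2; rewrite ler_norml => /andP[h1 h2].
set y := co b (c l W) in h1 h2 *.
have y0 : 0 <= N%:R * (y + 2) by rewrite mulr_ge0//; lra.
have /andP[t1 t2] := truncn_itv y0.
have t3 : (Num.truncn (N%:R * (y + 2)) < (4 * N).+1)%N.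
  rewrite ltnS -(ler_nat R); apply: le_trans t1 _.
  by rewrite natrM mulrC ler_wpM2r//; lra.
rewrite /hn /rnd ffunE /= inordK//.
set T := Num.truncn _ in t1 t2 t3 *.
have e1 : T%:R / N%:R <= y + 2 by rewrite ler_pdivrMr// mulrC.
have e2 : y + 2 <= T%:R / N%:R + N%:R^-1.
  have -> : T%:R / N%:R + N%:R^-1 = T.+1%:R / N%:R :> R by rewrite -natr1 mulrDl mul1r.
  by rewrite ler_pdivlMr// mulrC ltW.
have i0 : 0 <= N%:R^-1 :> R by rewrite invr_ge0.
by rewrite ler_norml; apply/andP; split; lra.
Qed.

Lemma Pol_rnd N c l W : (0 < N)%N -> nrm (c l W) <= 2 ->
  nrm (Pol (rnd N c) l W - c l W) <= #|BB S|%:R / N%:R.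
Proof.
move=> N0 c2; rewrite {1}(co_sum S (c l W)) /Pol -sumrB; apply: nrm_sum_le => b.
by rewrite -mulrBl nrmM nrm_uu mulr1 -rmorphB nrm_iota; exact: rnd_hn.
Qed.

Lemma rnd_eq N c c' l W b : (0 < N)%N -> nrm (c l W) <= 2 -> nrm (c' l W) <= 2 ->
  rnd N c = rnd N c' -> `|co b (c l W - c' l W)| <= 2 / N%:R.
Proof.
move=> N0 c2 c2' e; have h1 := rnd_hn b N0 c2; have h2 := rnd_hn b N0 c2'.
rewrite e in h1; rewrite coB.
rewrite (_ : _ - _ = (hn (rnd N c' (W, l, b)) - co b (c' l W)) - (hn (rnd N c' (W, l, b)) - co b (c l W))); last by ring.
apply: le_trans (ler_normB _ _) _; lra.
Qed.

(* [eta g] is a polynomial perturbation whose values on [x] are the increments of the field: it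
   absorbs the defect between [A] and the monomials, and the top degree monomials, by interpolation. *)
Lemma eta_ex (E : set V) (kap0 Cm tau lam : R) (x : conf (q := q)) N (G : V -> V) (A : tpar -> V -> V) (g0 : grid N) :
  (0 < N)%N -> 0 <= kap0 -> 2 * #|tpar|%:R * kap0 <= 1 -> 1 <= Cm -> 0 < tau -> 0 < lam ->
  (forall i, E (x i)) ->
  (forall a l, Int S E q kap0 (fun y => A a y 0 l - (if a.1.2 == l then uu a.2 * wmon a.1.1 y else 0))) ->
  (forall (j : 'I_d) (w : J d q), Int S E q Cm (fun y => y 0 j * wmon w y)) ->
  let n2 := #|{: 'I_d * J d q}|%:R in let nB := #|BB S|%:R in
  exists eta : grid N -> 'I_d -> JJ -> K,
  [/\ forall g l W, nrm (eta g l W) <= lam * (2 * nB + 1 + n2 * (nB * Cm)),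
      forall g l i, nrm (xev (eta g l) (x i)) <=
        lam * (nrm (pfield G A g (x i) 0 l - pfield G A g0 (x i) 0 l) + (2 * #|tpar|%:R + n2 * nB) * tau) &
      forall g g' (del : R), 0 <= del -> (forall l W b, `|co b (eta g l W - eta g' l W)| <= del) ->
        forall i, `|gv (g i) - gv (g' i)| <= 2 * (1 + n2 * (nB * Cm)) * (del / lam)].
Proof.
move=> N0 k0 kT Cm1 t0 lam0 xE hA hX n2 nB.
have /choice[kap hkap] : forall al : tpar * 'I_d, exists c : J d q -> K, (forall w, nrm (c w) <= kap0) /\
    forall i, nrm (A al.1 (x i) 0 al.2 - (if al.1.1.2 == al.2 then uu al.1.2 * wmon al.1.1.1 (x i) else 0) - pev c (x i)) <= tau.
  by move=> [a l]; have [c ? ?] := hA a l x xE _ t0; exists c.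
have /choice[kap' hkap'] : forall jw : 'I_d * J d q, exists c : J d q -> K, (forall w, nrm (c w) <= Cm) /\
    forall i, nrm (x i 0 jw.1 * wmon jw.2 (x i) - pev c (x i)) <= tau.
  by move=> [j w]; have [c ? ?] := hX j w x xE _ t0; exists c.
pose D (g : grid N) (a : tpar) : R := gv (g (lowi a)) - gv (g0 (lowi a)).
pose lo (g : grid N) (l : 'I_d) (w : J d q) : K := \sum_b iota (D g (w, l, b)) * uu b.
pose up (g : grid N) (l : 'I_d) (jw : 'I_d * J d q) : K := \sum_b iota (gv (g ((Some jw.1, jw.2), l, b))) * uu b.
(* On [x] the increment of the field is the sum of the monomials [lo] and of the defects of [A],
   interpolated by [kap]. The top coefficients [up] are free: their contribution on [x] is cancelled
   by its interpolant [kap']. *)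
pose bx g l w : K := lo g l w + \sum_a iota (D g a) * kap (a, l) w - \sum_jw up g l jw * kap' jw w.
pose eta g l (W : JJ) : K := iota lam * (if W.1 is Some j then up g l (j, W.2) else bx g l W.2).
have il : nrm (iota lam) = lam by rewrite nrm_iota gtr0_norm.
have D2 g a : `|D g a| <= 2.
  by apply: le_trans (ler_normB _ _) _; rewrite (_ : 2 = 1 + 1)// lerD ?gv_bound.
have lob g l w : nrm (lo g l w) <= nB * 2.
  by apply: nrm_sum_le => b; rewrite nrmM nrm_uu mulr1 nrm_iota.
have upb g l jw : nrm (up g l jw) <= nB.
  by rewrite -[nB]mulr1; apply: nrm_sum_le => b; rewrite nrmM nrm_uu mulr1 nrm_iota gv_bound.
have nB0 : 0 <= nB by [].
have n20 : 0 <= n2 by [].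
have nBC : 0 <= nB * Cm by rewrite mulr_ge0//; lra.
have n2B : 0 <= n2 * (nB * Cm) by rewrite mulr_ge0.
exists eta; split.
- move=> g l [[j|] w]; rewrite /eta /= nrmM il ler_wpM2l ?(ltW lam0)//.
    by apply: le_trans (upb g l (j, w)) _; lra.
  rewrite [2 * nB]mulrC; apply: nrmBl; last first.
    by apply: nrm_sum_le => jw; apply: nrmMl => //; exact: (hkap' jw).1.
  apply: nrmDl => //; apply: le_trans (_ : #|tpar|%:R * (2 * kap0) <= 1); last lra.
  by apply: nrm_sum_le => a; apply: nrmMl; [rewrite nrm_iota|exact: (hkap (a, l)).1].
- move=> g l i.
  have pevsum (I : finType) (F : I -> J d q -> K) (a : I -> K) y : pev (fun w => \sum_k a k * F k w) y = \sum_k a k * pev (F k) y.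
    rewrite /pev; under eq_bigr do rewrite mulr_suml.
    rewrite exchange_big; apply: eq_bigr => k _; rewrite mulr_sumr.
    by apply: eq_bigr => w _; rewrite mulrA.
  pose e1 a := A a (x i) 0 l - (if a.1.2 == l then uu a.2 * wmon a.1.1 (x i) else 0) - pev (kap (a, l)) (x i).
  pose e2 jw := x i 0 jw.1 * wmon jw.2 (x i) - pev (kap' jw) (x i).
  have losum : \sum_w lo g l w * wmon w (x i) =
      \sum_a iota (D g a) * (if a.1.2 == l then uu a.2 * wmon a.1.1 (x i) else 0).
    rewrite [RHS](eq_bigr (fun a => (fun u b => iota (D g (u, b)) * (if u.2 == l then uu b * wmon u.1 (x i) else 0)) a.1 a.2)); last by case.
    rewrite -(pair_bigA _ (fun (u : J d q * 'I_d) b => iota (D g (u, b)) * (if u.2 == l then uu b * wmon u.1 (x i) else 0)))/=.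
    rewrite [RHS](eq_bigr (fun u => (fun w l' => \sum_b iota (D g (w, l', b)) * (if l' == l then uu b * wmon w (x i) else 0)) u.1 u.2)); last by case.
    rewrite -(pair_bigA _ (fun w l' => \sum_b iota (D g (w, l', b)) * (if l' == l then uu b * wmon w (x i) else 0)))/=.
    apply: eq_bigr => w _; rewrite (bigD1 l)//= [X in _ + X]big1 ?addr0; last first.
      by move=> l' /negbTE ->; rewrite big1// => b _; rewrite mulr0.
    by rewrite eqxx /lo mulr_suml; apply: eq_bigr => b _; rewrite mulrA.
  have fE : pfield G A g (x i) 0 l - pfield G A g0 (x i) 0 l = \sum_a iota (D g a) * A a (x i) 0 l.
    rewrite /pfield !mxE opprD addrACA subrr add0r !summxE -sumrB; apply: eq_bigr => a _.
    by rewrite !mxE -mulrBl -rmorphB.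
  have xE' : xev (eta g l) (x i) = iota lam * (pfield G A g (x i) 0 l - pfield G A g0 (x i) 0 l
      - \sum_a iota (D g a) * e1 a + \sum_jw up g l jw * e2 jw).
    rewrite /eta (xevZ (iota lam) (fun W : JJ => if W.1 is Some j then up g l (j, W.2) else bx g l W.2)); congr (_ * _).
    rewrite /xev sum_JJ /= fE.
    have -> : \sum_w bx g l w * xmon (None, w) (x i) = \sum_w lo g l w * wmon w (x i)
        + \sum_a iota (D g a) * pev (kap (a, l)) (x i) - \sum_jw up g l jw * pev (kap' jw) (x i).
      rewrite -!pevsum /pev -big_split -sumrB; apply: eq_bigr => w _.
      by rewrite /bx /xmon /= !mulrDl mulNr.
    rewrite losum.
    have -> : \sum_j \sum_w up g l (j, w) * xmon (Some j, w) (x i) = \sum_jw up g l jw * (x i 0 jw.1 * wmon jw.2 (x i)).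
      by rewrite pair_bigA; apply: eq_bigr => -[].
    have -> : \sum_jw up g l jw * e2 jw = \sum_jw up g l jw * (x i 0 jw.1 * wmon jw.2 (x i)) - \sum_jw up g l jw * pev (kap' jw) (x i).
      by rewrite -sumrB; apply: eq_bigr => jw _; rewrite /e2 mulrBr.
    have -> : \sum_a iota (D g a) * e1 a = \sum_a iota (D g a) * A a (x i) 0 l -
       \sum_a iota (D g a) * (if a.1.2 == l then uu a.2 * wmon a.1.1 (x i) else 0) - \sum_a iota (D g a) * pev (kap (a, l)) (x i).
      by rewrite -!sumrB; apply: eq_bigr => a _; rewrite /e1 !mulrBr.
    ring.
  rewrite xE' nrmM il ler_wpM2l ?(ltW lam0)// mulrDl addrA; apply: nrmDl.
    apply: nrmBl => //; rewrite -mulrA mulrCA; apply: nrm_sum_le => a; apply: nrmMl; first by rewrite nrm_iota.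
    exact: (hkap (a, l)).2.
  rewrite -mulrA; apply: nrm_sum_le => jw; apply: nrmMl => //; exact: (hkap' jw).2.
move=> g g' del del0 h.
(* Injectivity: by the hypothesis on [kap0] the defects move a low coefficient by at most half of
   the largest difference [m]. So [m] is bounded by [m / 2] plus terms of size [del / lam], and the
   half is absorbed. *)
pose m := \big[Order.max/0]_a `|D g a - D g' a|.
have mD a : `|D g a - D g' a| <= m by exact: (@le_bigmax _ _ _ 0 (fun a => `|D g a - D g' a|)).
have dl0 : 0 <= del / lam by rewrite divr_ge0// ltW.
have hco l W b : `|co b ((if W.1 is Some j then up g l (j, W.2) else bx g l W.2) - (if W.1 is Some j then up g' l (j, W.2) else bx g' l W.2))| <= del / lam.
  have := h l W b; rewrite /eta -mulrBr co_scale normrM (gtr0_norm lam0).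
  by rewrite ler_pdivlMr// mulrC.
have hup l j w b : `|gv (g ((Some j, w), l, b)) - gv (g' ((Some j, w), l, b))| <= del / lam.
  by have := hco l (Some j, w) b; rewrite /= coB /up !co_comb.
have upd l jw : nrm (up g l jw - up g' l jw) <= nB * (del / lam).
  rewrite /up -sumrB; apply: nrm_sum_le => b; rewrite -mulrBl nrmM nrm_uu mulr1 -rmorphB nrm_iota.
  by case: jw => j w; exact: hup.
have hlo w l b : `|D g (w, l, b) - D g' (w, l, b)| <= del / lam + m / 2 + n2 * (nB * Cm) * (del / lam).
  have h1 := hco l (None, w) b; rewrite /= in h1.
  set X := bx g l w - bx g' l w in h1.
  have X1 : X = (lo g l w - lo g' l w) + (\sum_a iota (D g a - D g' a) * kap (a, l) w) - (\sum_jw (up g l jw - up g' l jw) * kap' jw w).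
    rewrite /X /bx.
    have -> : \sum_a iota (D g a - D g' a) * kap (a, l) w = \sum_a iota (D g a) * kap (a, l) w - \sum_a iota (D g' a) * kap (a, l) w.
      by rewrite -sumrB; apply: eq_bigr => a _; rewrite rmorphB mulrBl.
    have -> : \sum_jw (up g l jw - up g' l jw) * kap' jw w = \sum_jw up g l jw * kap' jw w - \sum_jw up g' l jw * kap' jw w.
      by rewrite -sumrB; apply: eq_bigr => a _; rewrite mulrBl.
    ring.
  have -> : D g (w, l, b) - D g' (w, l, b) = co b (lo g l w - lo g' l w) by rewrite coB /lo !co_comb.
  have -> : lo g l w - lo g' l w = X - (\sum_a iota (D g a - D g' a) * kap (a, l) w) + (\sum_jw (up g l jw - up g' l jw) * kap' jw w).
    by rewrite X1; ring.
  rewrite co_add coB; apply: le_trans (ler_normD _ _) _; apply: lerD.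
    apply: le_trans (ler_normB _ _) _; apply: lerD => //.
    apply: le_trans (co_nrm _ _ _) _; apply: (@le_trans _ _ (#|tpar|%:R * (m * kap0))).
      by apply: nrm_sum_le => a; apply: nrmMl; [rewrite nrm_iota|exact: (hkap (a, l)).1].
    have m0 : 0 <= m by exact: le_trans (normr_ge0 _) (mD (w, l, b)).
    by have : 2 * #|tpar|%:R * kap0 * m <= 1 * m; [rewrite ler_wpM2r|lra].
  apply: le_trans (co_nrm _ _ _) _.
  rewrite -mulrA; apply: nrm_sum_le => jw.
  rewrite mulrAC; apply: nrmMl; [exact: upd|exact: (hkap' jw).1].
have m0 : 0 <= m.
  by rewrite /m; elim/big_rec: _ => // a y _ y0; rewrite le_max y0 orbT.
have mle : m <= 2 * (1 + n2 * (nB * Cm)) * (del / lam).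
  have : m <= del / lam + m / 2 + n2 * (nB * Cm) * (del / lam).
    apply/bigmax_leP; split; last by case=> -[w l] b _; exact: hlo.
    by have := mulr_ge0 n2B dl0; lra.
  set u := del / lam; set v := n2 * _ => hm.
  have -> : 2 * (1 + v) * u = 2 * u + 2 * (v * u) by ring.
  lra.
case=> [[[[j|] w] l] b].
  apply: le_trans (hup l j w b) _.
  have := mulr_ge0 n2B dl0.
  set u := del / lam; set v := n2 * _ => hv.
  have -> : 2 * (1 + v) * u = 2 * u + 2 * (v * u) by ring.
  rewrite -/u in dl0; lra.
apply: le_trans mle; have := mD (w, l, b); rewrite /D /lowi /=.
by rewrite (_ : _ - _ - _ = gv (g ((None, w), l, b)) - gv (g' ((None, w), l, b))); last by ring.
Qed.

End Grid.

(** * The deterministic counting bound *)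

(** As [cls] need not be symmetric, the greedy choice only excludes that two members lie in the
    cells of each other; the covering is by cells centred at members. *)
Lemma greedy_separated (T : eqType) (cls : rel T) (s : seq T) : (forall x, cls x x) ->
  exists X : seq T, [/\ uniq X, {subset X <= s}, forall y, y \in s -> exists2 x, x \in X & cls y x &
    forall x y, x \in X -> y \in X -> x != y -> ~~ cls x y \/ ~~ cls y x].
Proof.
move=> rfl; elim: s => [|y s [X [uX Xs cX sX]]].
  by exists [::]; split.
have [/hasP[x xX yx]|/hasPn h] := boolP (has (cls y) X).
  exists X; split=> // [z /Xs|z]; rewrite inE; first by move=> ->; rewrite orbT.
  by move=> /orP[/eqP->|/cX//]; exists x.
exists (y :: X); split=> [|z|z|a b].
- rewrite /= uX andbT; apply/negP => yX; have := h y yX; by rewrite rfl.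
- by rewrite !inE => /orP[->//|/Xs ->]; rewrite orbT.
- rewrite inE => /orP[/eqP->|/cX[x xX zx]]; first by exists y; rewrite ?mem_head.
  by exists x => //; rewrite inE xX orbT.
rewrite !inE => /orP[/eqP->|aX] /orP[/eqP->|bX]; rewrite ?eqxx// => ab.
- by left; exact: h.
- by right; exact: h.
- exact: sX.
Qed.

Lemma card_fiber (A B : finType) (D : {set A}) (f : A -> B) (m : nat) :
  (forall b, #|[set a in D | f a == b]%SET| <= m)%N -> (#|D| <= m * #|(f @: D)%SET|)%N.
Proof.
move=> h; rewrite -sum1_card (partition_big_imset f) /= mulnC -sum_nat_const.
apply: leq_sum => b _; apply: leq_trans (h b).
by rewrite -sum1_card; apply: eq_leq; apply: eq_bigl => a; rewrite !inE.
Qed.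

Lemma card_near (I : finType) (n w : nat) (D : {set {ffun I -> 'I_n}}) :
  (forall g g', g \in D -> g' \in D -> forall i, (g i <= g' i + w)%N) -> (#|D| <= (2 * w).+1 ^ #|I|)%N.
Proof.
move=> h; have [->|[g0 g0D]] := set_0Vmem D; first by rewrite cards0.
pose f (g : {ffun I -> 'I_n}) : {ffun I -> 'I_(2 * w).+1} := [ffun i => inord (g i + w - g0 i)].
rewrite -[X in (_ <= X ^ _)%N]card_ord -card_ffun -(@card_in_imset _ _ f).
  exact: max_card.
move=> g g' gD g'D /ffunP e; apply/ffunP => i; apply: val_inj.
have a1 := h _ _ gD g0D i; have a2 := h _ _ g0D gD i.
have b1 := h _ _ g'D g0D i; have b2 := h _ _ g0D g'D i.
have := congr1 val (e i); rewrite !ffunE /=.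
move: a1 a2 b1 b2; move: (nat_of_ord (g i)) (nat_of_ord (g' i)) (nat_of_ord (g0 i)) => u u' v a1 a2 b1 b2.
by rewrite !inordK; lia.
Qed.

Section CoreBound.
Context {R : realType} {K : numFieldType} (S : scalars R K) {d q : nat}.
Local Notation nrm := (nrm S).
Local Notation nv := (nv S).
Local Notation iota := (iota S).
Local Notation co := (co S).
Local Notation uu := (uu S).
Local Notation V := 'rV[K]_d.
Local Notation JJ := (JJ d q).
Local Notation grid := (grid S (d := d) (q := q)).
Local Notation pgrid := (pgrid S (d := d) (q := q)).
Local Notation idx := (idx S (d := d) (q := q)).
Local Notation tpar := (tpar S (d := d) (q := q)).
Local Notation conf := (conf (K := K) (d := d) (q := q)).
Local Notation fconf := {ffun 'I_q.+1 -> V}.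

(* One cell: [Theta] sends the parameters whose field almost vanishes on [x] to polynomial systems
   with a zero close to each point of [x]. *)
Lemma cell_map (Cb C0 Ccr Clow CN Cm kap0 r M eps tau th lam : R) (PP : conf -> 'I_d -> JJ -> K)
    (N w : nat) (E : set V) (G : V -> V) (A : tpar -> V -> V) (x : conf) (Dx : {set grid N}) :
  let n2 := #|{: 'I_d * J d q}|%:R in let nB := #|BB S|%:R in
  let cl := cl C0 Clow in
  xbounds S (d := d) (q := q) Cb -> 1 <= C0 -> 1 <= Ccr -> 1 <= Clow ->
  (forall y : conf, admconf S r y -> good S y (PP y)) ->
  (forall y : conf, admconf S r y -> forall i c v, Tx y c -> Ub S c -> nrm (dv c (y i) v) <= C0 * nv (Jv (PP y) (y i) v)) ->
  (forall y : conf, admconf S r y -> forall c (t : R), (forall i, nrm (xev c (y i)) <= t) ->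
    exists2 c', Tx y c' & forall W, nrm (c W - c' W) <= Ccr * t) ->
  (forall y : conf, admconf S r y -> forall i k, exists c, [/\ Tx y c, Ub S c & forall v, dv c (y i) v = iota Clow^-1 * v 0 k]) ->
  1 <= CN -> (forall (P : 'I_d -> JJ -> K) (y : V) (y0 : 'I_d -> K) (c1 t : R),
    (forall l W, nrm (P l W) <= 2) -> nv y <= 1 -> 0 < c1 ->
    (forall v, c1 * nv v <= nv (Jv P y v)) -> 0 <= t -> CN * t <= c1 ^+ 2 -> CN * t <= c1 ->
    (forall l, nrm (xev (P l) y - y0 l) <= t) ->
    exists2 z, (forall l, xev (P l) z = y0 l) & nv (Jv P y (z - y)) <= 2 * t) ->
  admconf S r x -> (forall i, E (x i)) -> (0 < N)%N -> 0 <= kap0 -> 2 * #|tpar|%:R * kap0 <= 1 -> 1 <= Cm ->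
  0 < tau -> 0 < lam -> 0 < th ->
  (forall a l, Int S E q kap0 (fun y => A a y 0 l - (if a.1.2 == l then uu a.2 * wmon a.1.1 y else 0))) ->
  (forall (j : 'I_d) (W : J d q), Int S E q Cm (fun y => y 0 j * wmon W y)) ->
  (forall g, g \in Dx -> forall i l, nrm (pfield G A g (x i) 0 l) <= 8 * C0 ^+ 2 * M * eps) ->
  lam * (2 * nB + 1 + n2 * (nB * Cm)) <= (8 * C0)^-1 ->
  lam * (16 * C0 ^+ 2 * M * eps + (2 * #|tpar|%:R + n2 * nB) * tau) <= th / 4 ->
  2 * (1 + n2 * (nB * Cm)) * (2 / lam) <= w%:R ->
  Ccr * th <= (8 * C0)^-1 -> 16 * Cb * Ccr * th <= cl -> CN * th <= (cl / 2) ^+ 2 -> CN * th <= cl / 2 ->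
  16 * Cb * (nB / N%:R) <= cl -> Cb * (nB / N%:R) <= th / 4 -> nB / N%:R <= 1 / 2 ->
  exists Theta : grid N -> pgrid N,
   (forall h, #|[set g in Dx | Theta g == h]%SET| <= (2 * w).+1 ^ #|idx|)%N /\
   forall g, g \in Dx -> forall y0 : 'I_d -> K, (forall l, nrm (y0 l) <= th / 2) ->
     exists z : fconf, (forall i l, xev (Pol (Theta g) l) (z i) = y0 l) /\
       forall i, nv (Jv (PP x) (x i) (z i - x i)) <= 4 * th.
Proof.
move=> n2 nB cl hCb C01 Ccr1 Clow1 PPg PPd hcr hlow CN1 hN ax xE N0 k0 kT Cm1 t0 lam0 th0 hA hX hD l1 l2 hw e1 e2 e3 e4 d1 d2 d3.
have [D0|[g0 g0D]] := set_0Vmem Dx.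
  exists (fun=> [ffun=> ord0]); split=> [h|g]; last by rewrite D0 inE.
  apply: (@leq_trans #|Dx|); last by rewrite D0 cards0.
  by apply: subset_leq_card; apply/fintype.subsetP => g; rewrite inE => /andP[].
have [eta [eb ev einj]] := eta_ex G g0 N0 k0 kT Cm1 t0 lam0 xE hA hX.
rewrite -/n2 -/nB in eb ev einj.
have [Cb1 hb] := hCb.
have [_ UP] : (forall l, Tx x (PP x l)) /\ forall l, Ub S (PP x l) by split=> l; have [] := PPg x ax l.
have i8 : (8 * C0)^-1 <= 1 / 8.
  by rewrite invfM div1r ler_piMr// invf_le1; lra.
(* The map to polynomial systems before rounding: the system vanishing on [x], shifted by a
   polynomial that approximates on [x] the scaled increments from a reference parameter [g0] of the
   slab. *)
pose c g l W := PP x l W + eta g l W.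
have c2 g l W : nrm (c g l W) <= 3 / 2.
  apply: le_trans (nrmDl (UP l W) (eb g l W)) _; lra.
have c2' g l W : nrm (c g l W) <= 2 by apply: le_trans (c2 _ _ _) _; lra.
exists (fun g => rnd S N (c g)); split.
  move=> h; apply: card_near => g g'; rewrite !inE => /andP[_ /eqP gh] /andP[_ /eqP g'h] i.
  have N0' : 0 < N%:R :> R by rewrite ltr0n.
  have iN : 0 <= 2 / N%:R :> R by rewrite divr_ge0.
  have := einj g g' _ iN; move=> /(_ _ i).
  have -> : `|gv (g i) - gv (g' i)| = `|(g i)%:R - (g' i)%:R| / N%:R :> R.
    rewrite /gv (_ : _ - _ = ((g i)%:R - (g' i)%:R) / N%:R); last by ring.
    by rewrite normrM [X in _ * X]ger0_norm// invr_ge0 ltW.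
  rewrite ler_pdivrMr// => H.
  have {}H : `|(g i)%:R - (g' i)%:R| <= w%:R :> R.
    apply: le_trans (H _) _.
      move=> l W b; have := rnd_eq b N0 (c2' g l W) (c2' g' l W) (etrans gh (esym g'h)).
      by rewrite /c opprD addrACA subrr add0r.
    apply: le_trans hw; rewrite le_eqVlt; apply/orP; left; apply/eqP; field.
    by rewrite !lt0r_neq0.
  rewrite -(ler_nat R) natrD -lerBlDl; apply: le_trans (ler_norm _) H.
move=> g gD y0 y0b.
set P := Pol (rnd S N (c g)).
have del0 : 0 <= nB / N%:R by rewrite divr_ge0.
have Pd l W : nrm (P l W - (PP x l W + eta g l W)) <= nB / N%:R by exact: (@Pol_rnd _ _ S d q N (c g) l W N0 (c2' g l W)).
have P2 l W : nrm (P l W) <= 2.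
  rewrite -(subrK (c g l W) (P l W)); apply: le_trans (nrmDl (Pd l W) (c2 g l W)) _; lra.
have evb l i : nrm (xev (eta g l) (x i)) <= th / 4.
  apply: le_trans (ev g l i) _; apply: le_trans l2; rewrite ler_wpM2l ?(ltW lam0)// lerD2r.
  by apply: le_trans (nrmBl (hD g gD i l) (hD g0 g0D i l)) _; lra.
have th4 : 0 <= th / 4 by lra.
have q1 : Ccr * (th / 4) <= (8 * C0)^-1 by have : 0 <= Ccr * th; [rewrite mulr_ge0//; lra|lra].
have q2 : 16 * Cb * Ccr * (th / 4) <= cl by have : 0 <= 16 * Cb * Ccr * th; [rewrite !mulr_ge0//; lra|lra].
have JJP i v := PP_perturbed hCb C01 Ccr1 Clow1 PPd hcr hlow i ax th4 del0 (fun l W => le_trans (eb g l W) l1) evb Pd q1 q2 d1 v.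
have cl0 : 0 < cl := cl_gt0 C01 Ccr1 Clow1.
have [xb _] := ax.
(* At [x i] the rounded system is within [th] of the target: [th / 4] from rounding, [th / 4] from
   [eta] and [th / 2] from [y0]. The lower bound for Newton's method is [cl / 2], the factor 2 being
   that of [PP_perturbed]. *)
have zi i : exists z, (forall l, xev (P l) z = y0 l) /\ nv (Jv (PP x) (x i) (z - x i)) <= 4 * th.
  have [||v|||||z z1 z2] := hN P (x i) y0 (cl / 2) th P2; rewrite ?(ltW th0)//; last first.
  - by exists z; split=> //; apply: le_trans (JJP i _) _; lra.
  - move=> l; have [hev _ _ _ _] := hb (fun W => P l W - (PP x l W + eta g l W)) _ del0 (Pd l).
    have x2 : nv (x i) <= 2 by have := xb i; lra.
    have := hev (x i) x2; rewrite xevB xevD (PPg x ax l).1 add0r => h.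
    rewrite (_ : _ - y0 l = (xev (P l) (x i) - xev (eta g l) (x i)) + (xev (eta g l) (x i) - y0 l)); last by ring.
    by apply: le_trans (nrmDl h (nrmBl (evb l i) (y0b l))) _; lra.
  - have := low_cell C01 Ccr1 Clow1 PPd hlow i v ax; rewrite -/cl; have := JJP i v; lra.
  - lra.
have /choice[z hz] := zi.
exists [ffun i => z i]; split=> i; rewrite ffunE; last exact: (hz i).2.
exact: (hz i).1.
Qed.

End CoreBound.

(* [c] is the lower bound on the cells, [th] the accuracy at which zeros are sought. *)
Record core_consts (R : realType) (Cb C0 Ccr CN c r nB : R) (eps th tau : R) (N : nat) : Prop := CoreConsts {
  cc_eps : 0 < eps; cc_th : 0 < th; cc_tau : 0 < tau; cc_N : (0 < N)%N;
  cc_s1 : Ccr * Cb * (eps / c) <= 1;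
  cc_s2 : (Cb + Cb * Ccr * Cb) * (eps / c) <= c;
  cc_s3 : 2 * Cb * (eps / c) ^+ 2 <= eps;
  cc_s4 : tau * (1 + 2 * Cb * Ccr) <= eps;
  cc_s5 : 2 * Ccr * tau <= 1;
  cc_s6 : eps / c + eps / c < r;
  cc_e1 : Ccr * th <= (8 * C0)^-1;
  cc_e2 : 16 * Cb * Ccr * th <= c;
  cc_e3 : CN * th <= (c / 2) ^+ 2;
  cc_e4 : CN * th <= c / 2;
  cc_d1 : 16 * Cb * (nB / N%:R) <= c;
  cc_d2 : Cb * (nB / N%:R) <= th / 4;
  cc_d3 : nB / N%:R <= 1 / 2;
  cc_t1 : 4 * th + 3 * C0 * (4 * th) <= eps;
  cc_t2 : 4 * th + 4 * th <= eps
}.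

Lemma core_consts_grid (R : realType) (Cb c th nB : R) : 1 <= Cb -> 0 < c -> 0 < th -> 0 <= nB ->
  exists N : nat, [/\ (0 < N)%N, 16 * Cb * (nB / N%:R) <= c, Cb * (nB / N%:R) <= th / 4 & nB / N%:R <= 1 / 2].
Proof.
move=> Cb1 c0 th0 nB0.
have p1 : 0 <= 16 * Cb / c by apply: divr_ge0; lra.
have p2 : 0 <= 4 * Cb / th by apply: divr_ge0; lra.
have h0 : 0 <= nB * (16 * Cb / c + 4 * Cb / th + 2) by apply: mulr_ge0 => //; lra.
pose N := (Num.bound (nB * (16 * Cb / c + 4 * Cb / th + 2))).+1; exists N.
have Nbig : nB * (16 * Cb / c + 4 * Cb / th + 2) <= N%:R.
  by apply: ltW; apply: lt_trans (archi_boundP h0) _; rewrite ltr_nat.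
have N0' : 0 < N%:R :> R by rewrite ltr0n.
have dN (a b : R) : 0 < b -> 0 <= a -> a / b <= 16 * Cb / c + 4 * Cb / th + 2 -> a * (nB / N%:R) <= b.
  move=> b0 a0 h; rewrite mulrA ler_pdivrMr// mulrC.
  rewrite -ler_pdivrMl// mulrCA; apply: le_trans Nbig; rewrite ler_wpM2l//.
  by rewrite mulrC.
split=> //.
- by apply: dN => //; lra.
- apply: dN; [by lra|by lra|].
  rewrite (_ : Cb / (th / 4) = 4 * Cb / th); last by field; exact: lt0r_neq0.
  by lra.
- rewrite -[nB / _]mul1r; apply: dN; [by lra|exact: ler01|].
  by rewrite (_ : 1 / (1 / 2) = 2); [lra|field].
Qed.

(** Second order terms must be beaten by the lower bound [c], so [eps] is [c ^+ 2] times a small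
    factor. Then [th] is a fraction of [eps] independent of [r], and [N] and [tau] come last.
    Nothing here depends on the size of the path. *)
Lemma core_consts_ex (R : realType) (Cb C0 Ccr CN c r nB nT C1 Clam : R) :
  1 <= Cb -> 1 <= C0 -> 1 <= Ccr -> 1 <= CN -> 0 < c -> c <= 1 -> 0 < r -> 0 <= nB -> 0 <= nT ->
  1 <= C1 -> 768 * C0 * C1 <= Clam ->
  exists eps th tau N, core_consts Cb C0 Ccr CN c r nB eps th tau N /\
    th = 12 * C1 * eps / Clam /\ nT * tau <= eps.
Proof.
move=> Cb1 C01 Ccr1 CN1 c0 c1 r0 nB0 nT0 C11 hClam.
pose B := 3 + Cb + Cb * Ccr * Cb + 2 * Cb + Ccr * Cb + Ccr * C0 + CN.
have B3 : 0 <= Cb * Ccr * Cb by apply: mulr_ge0; [apply: mulr_ge0|]; lra.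
have B4 : 0 <= Ccr * Cb by apply: mulr_ge0; lra.
have B5 : 0 <= Ccr * C0 by apply: mulr_ge0; lra.
have b0 : 3 <= B by rewrite /B; lra.
have b1 : Ccr * Cb <= B by rewrite /B; lra.
have b2 : Cb + Cb * Ccr * Cb <= B by rewrite /B; lra.
have b3 : 2 * Cb <= B by rewrite /B; lra.
have b4 : Ccr * C0 <= B by rewrite /B; lra.
have b5 : CN <= B by rewrite /B; lra.
clearbody B.
pose r' := Num.min r 1; have r'0 : 0 < r' by rewrite lt_min r0 ltr01.
have r'1 : r' <= 1 by rewrite ge_min lexx orbT.
have r'r : r' <= r by rewrite ge_min lexx.
clearbody r'.
pose eps := c ^+ 2 * r' / B.
have eps0 : 0 < eps by apply: divr_gt0; [rewrite mulr_gt0 ?exprn_gt0|lra].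
have c20 : 0 <= c ^+ 2 by rewrite exprn_ge0// ltW.
have ceB (a : R) : 0 <= a -> a <= B -> a * eps <= c ^+ 2 * r'.
  move=> a0 aB; rewrite /eps mulrCA -[X in _ <= X]mulr1 ler_wpM2l//.
    by rewrite mulr_ge0// ltW.
  by rewrite ler_pdivrMr ?mul1r//; lra.
clearbody eps.
have c2r : c ^+ 2 * r' <= c ^+ 2 by rewrite ler_piMr.
have c2c : c ^+ 2 <= c by rewrite expr2 ler_piMr// ltW.
have ch (a : R) : 0 <= a -> a <= B -> a * (eps / c) <= c.
  move=> a0 aB; rewrite mulrA ler_pdivrMr// -expr2; exact: le_trans (ceB a a0 aB) c2r.
have eps1 : eps <= 1.
  have b1' : 1 <= B by lra.
  by have := ceB 1 ler01 b1'; rewrite mul1r; lra.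
have C0C1 : C1 <= C0 * C1 by rewrite ler_peMl//; lra.
have Clam0 : 0 < Clam by lra.
pose th := 12 * C1 * eps / Clam.
have th0 : 0 < th by apply: divr_gt0 => //; apply: mulr_gt0 => //; lra.
(* Since 768 is 64 times 12, the hypothesis on [Clam] is exactly this margin, from which the
   comparisons of [th] with [eps] follow. *)
have th64 : 64 * C0 * th <= eps.
  rewrite /th mulrA ler_pdivrMr//.
  rewrite (_ : 64 * C0 * (12 * C1 * eps) = 768 * C0 * C1 * eps); last by ring.
  by rewrite [eps * _]mulrC ler_wpM2r ?(ltW eps0).
have thE : th = 12 * C1 * eps / Clam by [].
clearbody th.
have thC0 : th <= C0 * th by rewrite ler_peMl// ltW.
have the : 64 * th <= eps by lra.
have [N [N0 d1 d2 d3]] := core_consts_grid Cb1 c0 th0 nB0.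
have B6 : 0 <= 2 * Cb * Ccr by apply: mulr_ge0; lra.
pose den := 1 + 2 * Cb * Ccr + 2 * Ccr + nT.
have den1 : 1 <= den by rewrite /den; lra.
have den2 : 1 + 2 * Cb * Ccr <= den by rewrite /den; lra.
have den3 : 2 * Ccr <= den by rewrite /den; lra.
have den4 : nT <= den by rewrite /den; lra.
clearbody den.
have tau0 : 0 < eps / den by apply: divr_gt0 => //; lra.
have tauc (a : R) : 0 <= a -> a <= den -> a * (eps / den) <= eps.
  by move=> a0 ad; rewrite mulrA ler_pdivrMr; [rewrite mulrC ler_wpM2l// ltW|lra].
exists eps, th, (eps / den), N; split; last by split=> //; exact: tauc.
split=> //.
- by apply: le_trans (ch _ B4 b1) c1.
- by apply: ch => //; lra.
- have h2 : 2 * Cb * (eps / c) <= c by apply: ch => //; lra.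
  have h3 : 2 * Cb * (eps / c) / c <= 1 by rewrite ler_pdivrMr// mul1r.
  rewrite (_ : _ * _ ^+ 2 = eps * (2 * Cb * (eps / c) / c)); last by field; exact: lt0r_neq0.
  by rewrite ler_piMr// ltW.
- by rewrite mulrC; apply: tauc => //; lra.
- by apply: le_trans (tauc _ _ den3) eps1; lra.
- have h3 : 3 * eps <= c ^+ 2 * r' by apply: ceB; lra.
  have h4 : 3 * (eps / c) <= r'.
    rewrite mulrA ler_pdivrMr//; apply: le_trans h3 _.
    by rewrite mulrC ler_wpM2l// ltW.
  have h5 : 0 < eps / c by rewrite divr_gt0.
  by lra.
- rewrite -[X in _ <= X]mul1r ler_pdivlMr; last lra.
  have h := ceB _ B5 b4.
  rewrite (_ : Ccr * th * (8 * C0) = Ccr * C0 * (8 * th)); last by ring.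
  apply: (@le_trans _ _ (Ccr * C0 * eps)); last by lra.
  by rewrite ler_wpM2l//; lra.
- apply: (@le_trans _ _ (Ccr * Cb * eps)).
    rewrite (_ : 16 * Cb * Ccr * th = Ccr * Cb * (16 * th)); last by ring.
    by rewrite ler_wpM2l//; lra.
  by have := ceB _ B4 b1; lra.
- have h : CN * eps <= c ^+ 2 * r' by apply: ceB => //; lra.
  have h2 : CN * (64 * th) <= CN * eps by rewrite ler_wpM2l//; lra.
  by rewrite expr_div_n (_ : 2 ^+ 2 = 4); [lra|ring].
- have h : CN * eps <= c ^+ 2 * r' by apply: ceB => //; lra.
  have h2 : CN * (64 * th) <= CN * eps by rewrite ler_wpM2l//; lra.
  by lra.
- by lra.
- by lra.
Qed.

(** [M] is seen by [lam] and [w] alone. Increments of size [M * eps] are scaled by [lam], of order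
    [1 / M], down to the accuracy [th]; in exchange, parameters sharing a polynomial system may be
    [w] grid steps apart, with [w] of order [M]. This is the origin of the power of [M] in the final
    bound. *)
Lemma core_consts_M (R : realType) (C0 C1 Clam Ceta W0 M eps th tau nT : R) (w : nat) :
  1 <= C0 -> C1 = 8 * C0 ^+ 2 -> 1 <= Ceta -> 0 <= W0 -> Clam = 768 * C0 * C1 + 8 * C0 * Ceta + 1 -> 1 <= M ->
  0 < eps -> th = 12 * C1 * eps / Clam -> nT * tau <= eps -> w = (Num.truncn (2 * W0 * Clam * M)).+1 ->
  let lam := (Clam * M)^-1 in
  [/\ 0 < lam, lam * Ceta <= (8 * C0)^-1, lam * (16 * C0 ^+ 2 * M * eps + nT * tau) <= th / 4,
      W0 * (2 / lam) <= w%:R & (2 * w).+1%:R <= (4 * W0 * Clam + 3) * M].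
Proof.
move=> C01 C1E Ceta1 W00 ClamE M1 eps0 thE t1 wE lam.
have C02 : 1 <= C0 ^+ 2 by rewrite -(expr1n _ 2) lerXn2r ?nnegrE//; lra.
have C11 : 1 <= C1 by rewrite C1E; lra.
have p1 : 0 <= 768 * C0 * C1 by apply: mulr_ge0; lra.
have p2 : 0 <= 8 * C0 * Ceta by apply: mulr_ge0; lra.
have Clam1 : 1 <= Clam by lra.
have CM0 : 0 < Clam * M by apply: mulr_gt0; lra.
have Wr0 : 0 <= 2 * W0 * Clam * M by apply: mulr_ge0; [apply: mulr_ge0|]; lra.
have lam0 : 0 < lam by rewrite invr_gt0.
split=> //.
- have lC : lam <= Clam^-1.
    by rewrite lef_pV2 ?posrE//; [rewrite ler_peMr//; lra|lra].
  apply: (@le_trans _ _ (Clam^-1 * Ceta)); first by rewrite ler_wpM2r//; lra.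
  rewrite mulrC ler_pdivrMr; last lra.
  rewrite -ler_pdivrMl; last by rewrite invr_gt0; lra.
  by rewrite invrK ClamE; lra.
- have C1M : 1 <= C1 * M by rewrite -[1]mulr1 ler_pM.
  have e1 : eps <= C1 * M * eps by rewrite ler_peMl// ltW.
  apply: (@le_trans _ _ (lam * (3 * (C1 * M * eps)))).
    rewrite ler_wpM2l ?(ltW lam0)//.
    have -> : 16 * C0 ^+ 2 * M * eps = 2 * (C1 * M * eps) by rewrite C1E; ring.
    by lra.
  rewrite thE /lam le_eqVlt; apply/orP; left; apply/eqP; field.
  by apply/andP; split; apply: lt0r_neq0; lra.
- have /andP[_ /ltW hh] := truncn_itv Wr0; rewrite -wE in hh.
  by rewrite /lam invrK (_ : W0 * _ = 2 * W0 * Clam * M)//; ring.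
have /andP[h _] := truncn_itv Wr0.
rewrite -natr1 natrM wE -natr1; apply: (@le_trans _ _ (4 * W0 * Clam * M + 3)); first lra.
by rewrite (_ : (4 * W0 * Clam + 3) * M = 4 * W0 * Clam * M + 3 * M); [lra|ring].
Qed.

Lemma expr_regroup (R : comPzRingType) (a M b c : R) n :
  (a * M) ^+ n * (b * (2 * c) ^+ n) = a ^+ n * b * 2 ^+ n * M ^+ n * c ^+ n.
Proof. rewrite !exprMn; ring. Qed.

Lemma grid_card_le (N : nat) : ((4 * N).+1 <= 2 * (2 * N).+1)%N.
Proof. lia. Qed.

(** * Counting parameters against polynomial systems *)

Section CoreTheorem.
Context {R : realType} {K : numFieldType} (S : scalars R K) {d q : nat}.
Local Notation nrm := (nrm S).
Local Notation nv := (nv S).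
Local Notation iota := (iota S).
Local Notation co := (co S).
Local Notation uu := (uu S).
Local Notation V := 'rV[K]_d.
Local Notation JJ := (JJ d q).
Local Notation grid := (grid S (d := d) (q := q)).
Local Notation pgrid := (pgrid S (d := d) (q := q)).
Local Notation idx := (idx S (d := d) (q := q)).
Local Notation tpar := (tpar S (d := d) (q := q)).
Local Notation conf := (conf (K := K) (d := d) (q := q)).
Local Notation fconf := {ffun 'I_q.+1 -> V}.

Lemma count_zero_tuples (T : eqType) (X : seq T) (Bz : nat) (Zset : V -> Prop) (z : T -> fconf) :
  uniq X -> (forall zs : seq V, uniq zs -> (forall u, u \in zs -> Zset u) -> (size zs <= Bz)%N) ->
  (forall x i, x \in X -> Zset (z x i)) -> {in X &, injective z} -> (size X <= Bz.+1 ^ q.+1)%N.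
Proof.
move=> uX hB hz zinj.
pose zs := undup (flatten [seq [seq z x i | i <- enum 'I_q.+1] | x <- X]).
have mem x i : x \in X -> z x i \in zs.
  move=> xX; rewrite mem_undup; apply/flattenP; exists [seq z x i | i <- enum 'I_q.+1].
    by apply/mapP; exists x.
  by apply/mapP; exists i => //; rewrite mem_enum.
have zb : (size zs <= Bz)%N.
  apply: hB => [|u]; first exact: undup_uniq.
  by rewrite mem_undup => /flattenP[s /mapP[x xX ->] /mapP[i _ ->]]; exact: hz.
pose f x : {ffun 'I_q.+1 -> 'I_Bz.+1} := [ffun i => inord (index (z x i) zs)].
have finj : {in X &, injective f}.
  move=> x y xX yX /ffunP e; apply: zinj => //; apply/ffunP => i.
  have lt u : u \in zs -> (index u zs < Bz.+1)%N.
    by move=> uz; apply: leq_trans (_ : size zs <= _)%N; rewrite ?index_mem// leqW.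
  have := congr1 val (e i); rewrite !ffunE /= !inordK ?lt ?mem//.
  by move=> /(congr1 (nth 0 zs)); rewrite !nth_index ?mem.
have : uniq (map f X) by rewrite map_inj_in_uniq.
move=> /card_uniqP; rewrite size_map => <-; apply: leq_trans (max_card _) _.
by rewrite card_ffun !card_ord.
Qed.

(** [C] and [e] precede [r], so that [r] can tend to 0 later on; [N] and [tau] depend on [r] but not
    on the path. Pairs of a cell and a parameter in its slab are counted in two ways: they outnumber
    the tuples, and they are controlled by pairs of a cell and a polynomial system. *)
Theorem core_bound (kap0 : R) : 0 <= kap0 -> 2 * #|tpar|%:R * kap0 <= 1 ->
  exists C e, 0 <= C /\ forall r : R, 0 < r -> exists N tau, [/\ (0 < N)%N, 0 < tau &
  forall (E : set V) (M : R) (G : V -> V) (A : tpar -> V -> V) (Z : grid N -> seq V),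
  unitbox S E -> 1 <= M ->
  (forall (g : grid N) l, Int S E q.+1 M (fun x => pfield G A g x 0 l)) ->
  (forall a l, Int S E q kap0 (fun y => A a y 0 l - (if a.1.2 == l then uu a.2 * wmon a.1.1 y else 0))) ->
  (forall g, uniq (Z g)) ->
  (forall g x, x \in Z g -> E x /\ forall l, nrm (pfield G A g x 0 l) <= tau) ->
  (forall g x y, x \in Z g -> y \in Z g -> x != y -> r <= nv (x - y)) ->
  (\sum_g (size (Z g)) ^_ q.+1)%:R <= C * M ^+ e * #|grid N|%:R].
Proof.
move=> k0 kT.
have [Cb hCb] := @xbounds_ex _ _ S d q.
have [C0 C01 hdom] := dominating_choice S d q.
have [Bz hBz] := @bezout _ _ S d q.
have [CN CN1 hN] := @newton _ _ S d q.
have [Cw Cw1 hCw] := @Int_wmon _ _ S d q q.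
pose Cm := 3 * Cw; have Cm1 : 1 <= Cm by rewrite /Cm; lra.
pose n2 : R := #|{: 'I_d * J d q}|%:R; pose nB : R := #|BB S|%:R; pose nT : R := 2 * #|tpar|%:R + n2 * nB.
have nBC : 0 <= n2 * (nB * Cm) by rewrite !mulr_ge0//; lra.
have nB0 : 0 <= nB by [].
have nT0 : 0 <= nT by rewrite addr_ge0 ?mulr_ge0.
pose Ceta := 2 * nB + 1 + n2 * (nB * Cm); pose W0 := 2 * (1 + n2 * (nB * Cm)).
have Ceta1 : 1 <= Ceta by rewrite /Ceta; lra.
have W00 : 0 <= W0 by rewrite /W0; lra.
pose C1 := 8 * C0 ^+ 2; pose Clam := 768 * C0 * C1 + 8 * C0 * Ceta + 1.
have C02 : 1 <= C0 ^+ 2 by rewrite -(expr1n _ 2) lerXn2r ?nnegrE//; lra.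
have C11 : 1 <= C1 by rewrite /C1; lra.
have C0e : 0 <= 8 * C0 * Ceta by apply: mulr_ge0; lra.
have Cl768 : 768 * C0 * C1 <= Clam by rewrite /Clam; lra.
have C3 : 0 <= 4 * W0 * Clam + 3.
  have h : 0 <= 768 * C0 * C1 by apply: mulr_ge0; lra.
  have : 0 <= 4 * W0 * Clam by apply: mulr_ge0; [lra|rewrite /Clam; lra].
  lra.
pose n := #|idx|.
exists ((4 * W0 * Clam + 3) ^+ n * (Bz.+1 ^ q.+1)%:R * 2 ^+ n), n; split.
  by rewrite !mulr_ge0 ?exprn_ge0.
move=> r r0.
have [Clow [Cl1 [hlow [PP hPP]]]] := hdom r r0.
have [Ccr Ccr1 hcr'] := @correct_conf _ _ S d q r r0.
have hcr : forall y : conf, admconf S r y -> forall c (t : R), (forall i, nrm (xev c (y i)) <= t) ->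
    exists2 c', Tx y c' & forall W, nrm (c W - c' W) <= Ccr * t by move=> y [yb ys]; exact: hcr'.
pose c := cl C0 Clow; have c0 : 0 < c := cl_gt0 C01 Ccr1 Cl1; have c1 : c <= 1 := cl_le1 C01 Ccr1 Cl1.
have PPg y : admconf S r y -> good S y (PP y) by move=> /hPP[].
have PPd y : admconf S r y -> forall i f v, Tx y f -> Ub S f -> nrm (dv f (y i) v) <= C0 * nv (Jv (PP y) (y i) v).
  by move=> /hPP[].
have [eps [th [tau [N [cc [thE t1]]]]]] := core_consts_ex hCb.1 C01 Ccr1 CN1 c0 c1 r0 nB0 nT0 C11 Cl768.
exists N, tau; have N0 := cc_N cc; have tau0 := cc_tau cc; have eps0 := cc_eps cc; have th0 := cc_th cc.
split=> // E M G A Z uE M1 hF hA uZ hZ sZ.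
have [lam0 l1 l2 hw w3] := core_consts_M C01 erefl Ceta1 W00 erefl M1 eps0 thE t1 erefl.
set lam := (Clam * M)^-1 in lam0 l1 l2 hw; set w := (Num.truncn _).+1 in hw w3.
have hX (j : 'I_d) (W : J d q) : Int S E q Cm (fun y => y 0 j * wmon W y).
  by apply: Int_mulX => // [|l lq]; [exact: le_trans ler01 Cw1|exact: hCw].
pose Lg g : seq fconf := [seq [ffun i => ssval (f i)] | f : {ffun 'I_q.+1 -> seq_sub (Z g)} <- enum [set f : {ffun 'I_q.+1 -> seq_sub (Z g)} | injectiveb f]%SET].
have Lgs g : size (Lg g) = (size (Z g)) ^_ q.+1.
  by rewrite size_map -cardE card_inj_ffuns card_seq_sub// card_ord.
have Lgu g : uniq (Lg g).
  rewrite map_inj_uniq ?enum_uniq// => f f' /ffunP e; apply/ffunP => i; apply: val_inj.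
  by have := e i; rewrite !ffunE.
have LgZ g y : y \in Lg g -> (forall i, y i \in Z g) /\ injective y.
  move=> /mapP[f]; rewrite mem_enum inE => /injectiveP fi ->; split=> [i|i j].
    by rewrite ffunE; exact: ssvalP.
  by rewrite !ffunE => /val_inj /fi.
have Lga g (y : fconf) : y \in Lg g -> admconf S r y.
  move=> /LgZ[yZ yi]; split=> [i|i j ij].
    by apply: uE; exact: (hZ g _ (yZ i)).1.
  by apply: (sZ g) => //; apply: contra_neq ij => /yi.
have LgE g (y : fconf) : y \in Lg g -> forall i, E (y i) by move=> /LgZ[yZ _] i; exact: (hZ g _ (yZ i)).1.
(* Tuples of all parameters are pooled, so that one family of cells serves every parameter. *)
pose All := flatten [seq Lg g | g <- enum (grid N)].
have AllP y : y \in All -> exists g, y \in Lg g.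
  by move=> /flattenP[s /mapP[g _ ->] yL]; exists g.
have inAll g y : y \in Lg g -> y \in All.
  by move=> yL; apply/flattenP; exists (Lg g) => //; apply/mapP; exists g => //; rewrite mem_enum.
pose cls (y x : fconf) := `[< closeto S PP eps y x >].
have [|X [uX XA cX sX]] := @greedy_separated _ cls All.
  move=> x; apply/asboolP => i; rewrite subrr JvE mul0mx nv0; exact: ltW.
have Xa x : x \in X -> admconf S r x by move=> /XA /AllP[g]; exact: Lga.
have XE x : x \in X -> forall i, E (x i) by move=> /XA /AllP[g]; exact: LgE.
pose slab (x : fconf) : {set grid N} := [set g | [forall i, forall l, nrm (pfield G A g (x i) 0 l) <= 8 * C0 ^+ 2 * M * eps]]%SET.
have s1 := cc_s1 cc; have s2 := cc_s2 cc.
(* Two tuples of one path in the same cell have corresponding points closer than [r], hence equal: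
   tuples inject into cells. By [slab_bound] the parameter lies in the slab of each cell so
   reached. *)
have step1 g : (size (Lg g) <= count (fun x => g \in slab x) X)%N.
  have /choice[phi hphi] : forall y, exists x, y \in All -> x \in X /\ cls y x.
    move=> y; have [yA|_] := boolP (y \in All); last by exists y.
    by have [x] := cX y yA; exists x.
  rewrite -size_filter -(size_map phi); apply: uniq_leq_size.
    rewrite map_inj_in_uniq// => y y' yL y'L e; apply/ffunP => i.
    have [xX /asboolP c1'] := hphi y (inAll _ _ yL); have [_ /asboolP c2'] := hphi y' (inAll _ _ y'L).
    rewrite -e in c2'.
    have dy := closeto_dist C01 Ccr1 Cl1 PPd hlow (Xa _ xX) c1' i.
    have dy' := closeto_dist C01 Ccr1 Cl1 PPd hlow (Xa _ xX) c2' i.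
    rewrite -/c in dy dy'.
    apply/eqP/negP => /negP ne; have := sZ g _ _ ((LgZ _ _ yL).1 i) ((LgZ _ _ y'L).1 i) ne.
    apply/negP; rewrite -ltNge; apply: le_lt_trans (nv_tri S (phi y i) _ _) _.
    by apply: le_lt_trans (cc_s6 cc); rewrite [nv (phi y i - y' i)]nvB; exact: lerD.
  move=> x /mapP[y yL ->]; have [xX /asboolP c1'] := hphi y (inAll _ _ yL).
  rewrite mem_filter xX andbT inE; apply/forallP => i; apply/forallP => l.
  apply: (slab_bound hCb C01 Ccr1 Cl1 PPg PPd hcr hlow M1 eps0 tau0 (Xa _ xX) (Lga _ _ yL) (XE _ xX) (LgE _ _ yL) c1' s1 s2 (cc_s3 cc) (cc_s4 cc) (cc_s5 cc) (hF g l)).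
  by move=> j; exact: (hZ g _ ((LgZ _ _ yL).1 j)).2.
have Th x : exists Th : grid N -> pgrid N, x \in X ->
   (forall h, #|[set g in slab x | Th g == h]%SET| <= (2 * w).+1 ^ #|idx|)%N /\
   forall g, g \in slab x -> forall y0 : 'I_d -> K, (forall l, nrm (y0 l) <= th / 2) ->
     exists z : fconf, (forall i l, xev (Pol (Th g) l) (z i) = y0 l) /\
       forall i, nv (Jv (PP x) (x i) (z i - x i)) <= 4 * th.
  have [xX|_] := boolP (x \in X); last by exists (fun=> [ffun=> ord0]).
  have hD g : g \in slab x -> forall i l, nrm (pfield G A g (x i) 0 l) <= 8 * C0 ^+ 2 * M * eps.
    by rewrite inE => /forallP h i l; move/forallP: (h i); exact.
  have [Th h] := cell_map hCb C01 Ccr1 Cl1 PPg PPd hcr hlow CN1 hN (Xa x xX) (XE x xX) N0 k0 kT Cm1 tau0 lam0 th0 hA hX hD l1 l2 hw (cc_e1 cc) (cc_e2 cc) (cc_e3 cc) (cc_e4 cc) (cc_d1 cc) (cc_d2 cc) (cc_d3 cc).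
  by exists Th.
have {Th} /choice[Th hTh] := Th.
(* The generic value [y0] is common to all cells that reach [h]. Each of them provides a tuple of
   solutions of [Pol h = y0] near its centre; a tuple shared by two cells would put each centre in
   the cell of the other, against the greedy choice. *)
have step4 (h : pgrid N) : (count (fun x => h \in (Th x @: slab x)%SET) X <= Bz.+1 ^ q.+1)%N.
  rewrite -size_filter; set X' := seq.filter _ X.
  have th2 : 0 < th / 2 by rewrite divr_gt0.
  have [y0 y0b hy0] := hBz (Pol h) _ th2.
  have /choice[z hz] : forall x : fconf, exists z : fconf, x \in X' -> (forall i l, xev (Pol h l) (z i) = y0 l) /\
       forall i, nv (Jv (PP x) (x i) (z i - x i)) <= 4 * th.
    move=> x; have [|_] := boolP (x \in X'); last by exists x.
    rewrite mem_filter => /andP[/imsetP[g gs ->] xX].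
    by have [z h1] := (hTh x xX).2 g gs y0 y0b; exists z.
  apply: (@count_zero_tuples _ X' Bz (fun u => forall l, xev (Pol h l) u = y0 l) z); first exact: filter_uniq.
  - by move=> zs uzs hzs; apply: hy0 => // u uz; exact: hzs.
  - by move=> x i xX' l; exact: (hz x xX').1.
  move=> x y xX' yX' e; apply/eqP/negP => /negP ne.
  have xX : x \in X by move: xX'; rewrite mem_filter => /andP[].
  have yX : y \in X by move: yX'; rewrite mem_filter => /andP[].
  have zx i := (hz x xX').2 i; have zy i := (hz y yX').2 i; rewrite -e in zy.
  have dist (u v : fconf) : u \in X -> v \in X ->
     (forall i, nv (Jv (PP u) (u i) (z x i - u i)) <= 4 * th) ->
     (forall i, nv (Jv (PP v) (v i) (z x i - v i)) <= 4 * th) -> closeto S PP eps v u.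
    move=> uX' vX hu hv i.
    have lu j := low_cell C01 Ccr1 Cl1 PPd hlow j (z x j - u j) (Xa u uX').
    have lv j := low_cell C01 Ccr1 Cl1 PPd hlow j (z x j - v j) (Xa v vX).
    have uv j : nv (u j - v j) <= eps / c.
      rewrite ler_pdivlMr// mulrC.
      apply: (@le_trans _ _ (c * (nv (u j - z x j) + nv (z x j - v j)))).
        by rewrite ler_wpM2l ?nv_tri// ltW.
      rewrite mulrDr nvB; apply: le_trans (cc_t2 cc).
      by apply: lerD; [exact: le_trans (lu j) (hu j)|exact: le_trans (lv j) (hv j)].
    have cmp := compare_cells hCb C01 Ccr1 Cl1 PPg PPd hcr hlow i (z x i - v i) (Xa u uX') (Xa v vX) uv s1 s2.
    rewrite (_ : v i - u i = (z x i - u i) - (z x i - v i)); last by rewrite opprB [RHS]addrC addrA subrK.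
    rewrite JvB; apply: le_trans (nvD _ _ _) _; rewrite nvN.
    apply: le_trans (cc_t1 cc); apply: lerD; first exact: hu.
    apply: le_trans cmp _; rewrite ler_wpM2l//.
    by rewrite mulr_ge0// (le_trans ler01 C01).
  have [|] := sX x y xX yX ne; move=> /negP; apply; apply/asboolP.
    exact: dist.
  exact: dist.
(* From tuples to slabs by [step1], from slabs to systems with fibres of at most [(2 * w).+1 ^ n]
   parameters, and from systems to cells by [step4]. *)
have key : (\sum_g (size (Z g)) ^_ q.+1 <= (2 * w).+1 ^ n * (Bz.+1 ^ q.+1 * (4 * N).+1 ^ n))%N.
  apply: (@leq_trans (\sum_(x <- X) #|slab x|)%N).
    apply: (@leq_trans (\sum_g \sum_(x <- X) (g \in slab x))%N).
      by apply: leq_sum => g _; rewrite -Lgs; apply: leq_trans (step1 g) _; rewrite -sum1_count big_mkcond.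
    rewrite exchange_big; apply: leq_sum => x _; rewrite -sum1_card; apply: eq_leq; rewrite [RHS]big_mkcond.
    by apply: eq_bigr => g _; case: (g \in _).
  apply: (@leq_trans (\sum_(x <- X) (2 * w).+1 ^ n * #|(Th x @: slab x)%SET|)%N).
    rewrite big_seq [leqRHS]big_seq; apply: leq_sum => x xX.
    by apply: card_fiber => h; exact: (hTh x xX).1.
  rewrite -big_distrr leq_mul2l; apply/orP; right.
  apply: (@leq_trans (\sum_(h : pgrid N) count (fun x => h \in (Th x @: slab x)%SET) X)%N).
    under [leqRHS]eq_bigr do rewrite -sum1_count big_mkcond.
    rewrite exchange_big; apply: leq_sum => x _; rewrite -sum1_card; apply: eq_leq; rewrite [LHS]big_mkcond.
    by apply: eq_bigr => g _; case: (g \in _).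
  apply: (@leq_trans (\sum_(h : pgrid N) Bz.+1 ^ q.+1)%N); first exact: leq_sum.
  by rewrite sum_nat_const mulnC leq_mul2l card_ffun card_ord leqnn orbT.
apply: le_trans (_ : ((2 * w).+1 ^ n * (Bz.+1 ^ q.+1 * (4 * N).+1 ^ n))%:R <= _); first by rewrite ler_nat.
have -> : #|grid N| = ((2 * N).+1 ^ n)%N by rewrite card_ffun card_ord.
rewrite !natrM !natrX.
have N4 : (4 * N).+1%:R <= 2 * (2 * N).+1%:R :> R.
  by rewrite -natrM ler_nat; exact: grid_card_le.
apply: (@le_trans _ _ (((4 * W0 * Clam + 3) * M) ^+ n * (Bz.+1%:R ^+ q.+1 * (2 * (2 * N).+1%:R) ^+ n))).
  apply: ler_pM; rewrite ?exprn_ge0 ?mulr_ge0 ?exprn_ge0//.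
    by apply: lerXn2r => //; rewrite nnegrE//; exact: le_trans w3.
  rewrite ler_wpM2l ?exprn_ge0//; apply: lerXn2r => //; rewrite nnegrE// mulr_ge0//.
by rewrite expr_regroup.
Qed.

End CoreTheorem.

(** * Jets and interpolation *)

Section Jets.
Context {R : realType} {K : numFieldType} (S : scalars R K) {d : nat}.
Local Notation nrm := (nrm S).
Local Notation nv := (nv S).
Local Notation iota := (iota S).
Local Notation V := 'rV[K]_d.
Local Notation mi := ('I_d -> nat).

Definition msize (be : mi) := (\sum_i be i)%N.
Definition incr (be : mi) (j : 'I_d) : mi := fun i => (be i + (i == j))%N.
Definition pt (a x : V) (t : R) : V := a + iota t *: (x - a).

(** The fundamental theorem of calculus along the [j]-th axis, with Riemann sums for the integral: a
    finite linear relation followed by a limit is transported by covariances, which are linear and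
    continuous under pointwise limits. *)
Definition riemann (a x : V) (j : 'I_d) (F f : V -> K) := forall tau : R, 0 < tau ->
  exists n0, forall n, (n0 <= n)%N -> (0 < n)%N ->
    nrm (F x - F a - (x 0 j - a 0 j) * (iota n%:R^-1 * \sum_(m < n) f (pt a x (m%:R / n%:R)))) <= tau.

(* Derivatives are only taken in decreasing order of the variables, as in [multi_deriv]. *)
Record jets (rho : R) (k : nat) (M : R) (f : mi -> V -> K) : Prop := Jets {
  jets_bound : forall be x, (msize be <= k)%N -> nv x <= rho -> nrm (f be x) <= M;
  jets_riemann : forall be (j : 'I_d) (a x : V), (msize be < k)%N -> (forall i : 'I_d, (i < j)%N -> be i = 0%N) ->
    nv a <= rho -> nv x <= rho -> (forall i, i != j -> a 0 i = x 0 i) ->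
    riemann a x j (f be) (f (incr be j))
}.

Lemma msize_incr be j : msize (incr be j) = (msize be).+1.
Proof.
rewrite /msize big_split /= -addn1; congr addn.
by rewrite (bigD1 j)//= eqxx big1 // => i /negbTE ->.
Qed.

Lemma nv_pt a x t (rho : R) : nv a <= rho -> nv x <= rho -> 0 <= t <= 1 -> nv (pt a x t) <= rho.
Proof.
move=> ha hx /andP[t0 t1]; rewrite (_ : pt a x t = iota (1 - t) *: a + iota t *: x); last first.
  by rewrite /pt rmorphB rmorph1 scalerBl scale1r scalerBr addrA addrAC.
apply: le_trans (nvD _ _ _) _; rewrite !nvZ !nrm_iota !ger0_norm ?subr_ge0//.
have h1 : (1 - t) * nv a <= (1 - t) * rho by rewrite ler_wpM2l// subr_ge0.
have h2 : t * nv x <= t * rho by rewrite ler_wpM2l.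
lra.
Qed.

(** [sig] freezes all but the first [m] coordinates and rescales those; [mix] exchanges the
    coordinates of [a] for those of [x] one at a time. Points of the broken path from [a] to [x] are
    of the form [sig], so the family of functions treated in [interp] is stable under its
    induction. *)
Definition sig (m : nat) (b : V) (s : 'I_d -> R) (x : V) : V :=
  \row_i (b 0 i + (if (i < m)%N then iota (s i) * x 0 i else 0)).
Definition mix (a x : V) (j : nat) : V := \row_i (if (i < j)%N then x 0 i else a 0 i).

Lemma nv_mix a x j rho : nv a <= rho -> nv x <= rho -> nv (mix a x j) <= rho.
Proof.
move=> ha hx; apply: nv_le => [|i]; first exact: le_trans (nv_ge0 _ _) ha.
by rewrite mxE; case: ifP => _; apply: le_trans (le_nv _ _ _) _.
Qed.

Lemma isP_sum k M (I : finType) (F : I -> V -> K) : 0 <= M -> (forall i, isP S k M (F i)) ->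
  isP S k (#|I|%:R * M) (fun x => \sum_i F i x).
Proof.
move=> M0 /(_ _)/cid2 h.
exists (fun w => \sum_i s2val (h i) w) => [w|x]; first by apply: nrm_sum_le => i; case: (h i).
rewrite /pev; under [RHS]eq_bigr do rewrite mulr_suml.
by rewrite exchange_big; apply: eq_bigr => i _; case: (h i).
Qed.

(** Newton interpolation with integral remainder: along a broken path from the first node [a], the
    increment of [f] is a sum of [x_j - a_j] times averages of derivatives, and the averages are
    interpolated at the remaining nodes. No difference of nodes is divided by, hence a constant free
    of their distances. On the [j]-th segment the coordinates after [j] are frozen, so later
    derivatives are in variables at most [j], in the order for which [jets] provides them. *)
Lemma interp (k : nat) l : exists2 C : R, 1 <= C & forall (rho M : R) (f : mi -> V -> K), rho <= 1 -> jets rho k M f ->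
  forall be m b s, (msize be + l <= k)%N -> (forall i : 'I_d, (i.+1 < m)%N -> be i = 0%N) ->
  (forall i, 0 <= s i <= 1) -> (forall x, nv x <= rho -> nv (sig m b s x) <= rho) ->
  Int S [set x | nv x <= rho] l (C * M) (fun x => f be (sig m b s x)).
Proof.
elim: l => [|l [C C1 ih]].
  exists 1 => // rho M f rho1 [fb _] be m b s; rewrite addn0 => bk _ _ hs x xE tau t0.
  have [c cM cE] := isP_cst S (d := d) 0 (f be (sig m b s (x ord0))).
  exists c => [w|i]; last by rewrite (ord1 i) -cE subrr nrm0 ltW.
  by apply: le_trans (cM w) _; rewrite mul1r; apply: fb => //; exact: hs (xE ord0).
exists (1 + d%:R * (2 * C)) => [|rho M f rho1 jf be m b s bk hbe hs hsig x xE tau tau0].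
  by rewrite lerDl !mulr_ge0//; lra.
have [fb fr] := jf; pose a := x ord0; pose h y := f be (sig m b s y).
have aE : nv a <= rho := xE ord0.
have M0 : 0 <= M by apply: le_trans (nrm_ge0 S _) (fb be a _ aE); lia.
have rho0 : 0 <= rho by apply: le_trans (nv_ge0 S _) aE.
have D0 : 0 < 1 + d%:R * 3 :> R by rewrite ltr_wpDr// mulr_ge0.
pose t1 := tau / (1 + d%:R * 3); have t10 : 0 < t1 by rewrite divr_gt0.
pose X (i : 'I_l.+1) := x (lift ord0 i).
have XE i : nv (X i) <= rho := xE (lift ord0 i).
have rie (ij : 'I_l.+1 * 'I_d) : exists n0, (ij.2 < m)%N -> forall n, (n0 <= n)%N -> (0 < n)%N ->
   let p := sig m b s (mix a (X ij.1) ij.2) in let p' := sig m b s (mix a (X ij.1) ij.2.+1) in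
   nrm (f be p' - f be p - (p' 0 ij.2 - p 0 ij.2) * (iota n%:R^-1 * \sum_(u < n) f (incr be ij.2) (pt p p' (u%:R / n%:R)))) <= t1.
  case: ij => i j /=; have [jm|_] := boolP (j < m)%N; last by exists 0%N.
  have [|i' ij|||i' ij|n0 hn0] := fr be j (sig m b s (mix a (X i) j)) (sig m b s (mix a (X i) j.+1)) _ _ _ _ _ t1 t10.
  - by rewrite -addn1; apply: leq_trans bk; rewrite leq_add2l.
  - by apply: hbe; exact: leq_ltn_trans jm.
  - by apply: hsig; exact: nv_mix.
  - by apply: hsig; exact: nv_mix.
  - rewrite !mxE; case: ifP => // i'm; congr (_ + _ * _).
    have -> // : (i' < j.+1)%N = (i' < j)%N.
    by rewrite ltnS [LHS]leq_eqVlt (_ : ((i' : nat) == j) = false)//; exact: negbTE.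
  - by exists n0.
have {rie} /choice[n0 hn0] := rie.
pose n := (\max_ij n0 ij).+1; have n_gt0 : (0 < n)%N by [].
have n0n ij : (n0 ij <= n)%N by apply: leqW; exact: leq_bigmax.
have nR : 0 < n%:R :> R by rewrite ltr0n.
have un (u : 'I_n) : 0 <= (u%:R / n%:R : R) <= 1.
  by rewrite divr_ge0//= ler_pdivrMr// mul1r ler_nat ltnW.
(* The integrand at the [u]-th point of the [j]-th segment, as a function of the end point: earlier
   coordinates are free, coordinate [j] is scaled by [u / n], later ones keep the values of [a]. *)
pose b' (j : 'I_d) (u : 'I_n) : V := \row_i (b 0 i + (if (i < m)%N then
   if (i < j)%N then 0 else if i == j then iota (s j * (1 - u%:R / n%:R)) * a 0 j else iota (s i) * a 0 i else 0)).
pose s' (j : 'I_d) (u : 'I_n) (i : 'I_d) : R := if i == j then s j * (u%:R / n%:R) else s i.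
have ptE (j : 'I_d) (u : 'I_n) y : (j < m)%N ->
    pt (sig m b s (mix a y j)) (sig m b s (mix a y j.+1)) (u%:R / n%:R) = sig j.+1 (b' j u) (s' j u) y.
  move=> jm; apply/rowP => i; rewrite !mxE /s' ltnS.
  have [im|im] := ltnP i m; last first.
    by rewrite subrr mulr0 !addr0 ifF ?addr0//; apply/negbTE; rewrite -ltnNge (leq_trans jm).
  have [->|ij] := eqVneq i j.
    by rewrite ltnn leqnn !rmorphM rmorphB rmorph1; ring.
  have -> : (i <= j)%N = (i < j)%N.
    by rewrite [LHS]leq_eqVlt (_ : ((i : nat) == j) = false)//; exact: negbTE.
  case: ifP => _ /=; first by rewrite addr0 subrr mulr0 addr0.
  by rewrite subrr mulr0 !addr0.
have cju (ju : 'I_d * 'I_n) : exists c : J d l -> K, (ju.1 < m)%N -> (forall w, nrm (c w) <= C * M) /\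
   forall i, nrm (f (incr be ju.1) (sig ju.1.+1 (b' ju.1 ju.2) (s' ju.1 ju.2) (X i)) - pev c (X i)) <= t1.
  case: ju => j u /=; have [jm|_] := boolP (j < m)%N; last by exists (fun=> 0).
  have [|i ij|i|y yr|c cM hc] := ih rho M f rho1 jf (incr be j) j.+1 (b' j u) (s' j u) _ _ _ _ X XE t1 t10.
  - by rewrite msize_incr addSn -addnS.
  - rewrite /incr hbe ?add0n; last exact: leq_trans jm.
    by case: eqP => // e; move: ij; rewrite e ltnn.
  - rewrite /s'; case: ifP => _ //; have /andP[? ?] := hs j; have /andP[? ?] := un u.
    by rewrite mulr_ge0//= mulr_ile1.
  - by rewrite -(ptE j u y jm); apply: nv_pt => //; apply: hsig; exact: nv_mix.
  - by exists c.
have {cju} /choice[c hc] := cju.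
pose Q (j : 'I_d) (y : V) : K := if (j < m)%N then iota (s j) * ((y 0 j - a 0 j) * (iota n%:R^-1 * \sum_(u < n) pev (c (j, u)) y)) else 0.
have CM0 : 0 <= C * M by rewrite mulr_ge0//; lra.
have nn1 : nrm (iota n%:R^-1) * (n%:R * (C * M)) = C * M.
  by rewrite nrm_iota ger0_norm ?invr_ge0 ?(ltW nR)// mulrA mulVf ?mul1r// lt0r_neq0.
have isQ j : isP S l.+1 (2 * (C * M)) (Q j).
  rewrite /Q; have [jm|jm] := boolP (j < m)%N; last first.
    by apply: isP_le (isP_cst _ _ _); rewrite nrm0 mulr_ge0.
  have h1 : isP S l (n%:R * (C * M)) (fun y => \sum_(u < n) pev (c (j, u)) y).
    rewrite -[X in X%:R * _]card_ord; apply: isP_sum => // u; exists (c (j, u)) => //.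
    exact: (hc (j, u) jm).1.
  have := isPZ (iota (s j)) (isP_mulXB j (a 0 j) (isPZ (iota n%:R^-1) h1)).
  apply: isP_le; rewrite nn1 nrm_iota.
  have /andP[sj0 sj1] := hs j; rewrite (ger0_norm sj0).
  have aj : nrm (a 0 j) * (C * M) <= 1 * (C * M).
    by rewrite ler_wpM2r//; apply: le_trans (le_nv _ _ _) (le_trans aE rho1).
  apply: (@le_trans _ _ (1 * (C * M + nrm (a 0 j) * (C * M)))); last lra.
  by rewrite ler_wpM2r// addr_ge0// mulr_ge0 ?nrm_ge0.
have ha : nrm (h a) <= M by apply: fb; [lia|exact: hsig].
have [cc ccM ccE] := isPD (isP_cst S (d := d) l.+1 (h a)) (isP_sum (mulr_ge0 (ler0n _ 2) CM0) isQ).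
exists cc => [w|i].
  apply: le_trans (ccM w) _; rewrite card_ord [leRHS]mulrDl mul1r; apply: lerD => //.
  by rewrite !mulrA.
rewrite -ccE; have [i' ->|->] := unliftP ord0 i; last first.
  rewrite -/a big1 ?addr0 ?subrr ?nrm0 ?(ltW tau0)// => j _.
  by rewrite /Q; case: ifP => // _; rewrite subrr mul0r mulr0.
rewrite -/(X i') -/(h (X i')).
have tel : h (X i') - h a = \sum_(j < d) (h (mix a (X i') j.+1) - h (mix a (X i') j)).
  rewrite -(big_mkord xpredT (fun j => h (mix a (X i') j.+1) - h (mix a (X i') j))) telescope_sumr//.
  congr (h _ - h _); apply/rowP => j; rewrite !mxE ?ltn_ord//.
rewrite opprD addrA tel -sumrB.
have tE : tau = d%:R * (3 * t1) + t1.
  by rewrite /t1; field; rewrite lt0r_neq0.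
rewrite tE; apply: (@le_trans _ _ (d%:R * (3 * t1))); last by rewrite lerDl ltW.
rewrite -[X in X%:R * _]card_ord; apply: nrm_sum_le => j; rewrite /Q.
have [jm|mj] := ltnP j m; last first.
  rewrite subr0 (_ : h _ = h (mix a (X i') j)) ?subrr ?nrm0; first by rewrite mulr_ge0// ltW.
  congr (f be _); apply/rowP => u; rewrite !mxE; case: ifP => // um; congr (_ + _ * _).
  by have uj := leq_trans um mj; rewrite uj ltnS (ltnW uj).
have r1 := hn0 (i', j) jm n (n0n _) n_gt0; rewrite /= in r1.
rewrite (_ : sig m b s (mix a (X i') j.+1) 0 j - sig m b s (mix a (X i') j) 0 j = iota (s j) * (X i' 0 j - a 0 j)) in r1; last first.
  by rewrite !mxE jm ltnS leqnn ltnn; ring.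
rewrite /h; set u1 := f be _ in r1 *; set u2 := f be _ in r1 *.
set S1 := \sum_(u < n) _ in r1; set S2 := \sum_(u < n) _.
rewrite (_ : _ - _ = (u1 - u2 - iota (s j) * (X i' 0 j - a 0 j) * (iota n%:R^-1 * S1)) + iota (s j) * (X i' 0 j - a 0 j) * (iota n%:R^-1 * (S1 - S2))); last by ring.
rewrite (_ : 3 * t1 = t1 + 2 * t1); last by ring.
apply: nrmDl => //; have /andP[sj0 sj1] := hs j.
apply: nrmMl.
  rewrite -[2]mul1r; apply: nrmMl; first by rewrite nrm_iota ger0_norm.
  by rewrite (_ : 2 = 1 + 1)//; apply: nrmBl; apply: le_trans (le_nv _ _ _) (le_trans _ rho1).
rewrite nrmM nrm_iota ger0_norm ?invr_ge0 ?(ltW nR)// ler_pdivrMl//.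
rewrite /S1 /S2 -sumrB -[X in X%:R * _]card_ord; apply: nrm_sum_le => u.
by rewrite ptE//; exact: (hc (j, u) jm).2.
Qed.

Lemma jets_Int (k : nat) : exists2 C : R, 1 <= C & forall (rho M : R) f, rho <= 1 -> jets rho k M f ->
  Int S [set x | nv x <= rho] k (C * M) (f (fun=> 0%N)).
Proof.
have [C C1 h] := interp k k; exists C => // rho M f r1 jf.
have s0 : msize (fun=> 0%N) = 0%N by rewrite /msize big1.
have sE x : sig d (0 : V) (fun=> 1) x = x.
  by apply/rowP => i; rewrite !mxE ltn_ord rmorph1 mul1r add0r.
have := h rho M f r1 jf (fun=> 0%N) d 0 (fun=> 1); rewrite s0 add0n => /(_ (leqnn _) (fun _ _ => erefl)).
move=> H x xE tau t0.
have [|y|c cM hc] := H _ _ x xE tau t0; first by move=> i; rewrite ler01 lexx.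
  by rewrite sE.
by exists c => // i; have := hc i; rewrite sE.
Qed.

End Jets.

(** * Monomials and dense points *)

Section Monomials.
Context {R : realType} {K : numFieldType} (S : scalars R K) {d : nat}.
Local Notation nrm := (nrm S).
Local Notation nv := (nv S).
Local Notation iota := (iota S).
Local Notation V := 'rV[K]_d.
Local Notation mi := ('I_d -> nat).

Lemma riemann_unif (a x : V) (j : 'I_d) (F f : V -> K) :
  (forall eps : R, 0 < eps -> exists2 de : R, 0 < de & forall s t : R, 0 <= s <= 1 -> 0 <= t <= 1 -> `|t - s| <= de ->
     nrm (F (pt S a x t) - F (pt S a x s) - iota (t - s) * ((x 0 j - a 0 j) * f (pt S a x s))) <= eps * `|t - s|) ->
  riemann S a x j F f.
Proof.
move=> h tau tau0; have [de de0 hde] := h tau tau0.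
exists (Num.truncn de^-1).+1 => n nn n0.
have n0' : 0 < n%:R :> R by rewrite ltr0n.
have nde : n%:R^-1 <= de.
  rewrite -[de]invrK lef_pV2 ?posrE ?invr_gt0//; apply: le_trans (ltW (truncnS_gt _)) _.
  by rewrite ler_nat.
pose p (m : nat) := pt S a x (m%:R / n%:R).
have tel : F x - F a = \sum_(m < n) (F (p m.+1) - F (p m)).
  rewrite -(big_mkord xpredT (fun m => F (p m.+1) - F (p m))) telescope_sumr//.
  rewrite /p /pt mul0r divff ?gt_eqF// rmorph0 rmorph1 scale0r scale1r addr0.
  by rewrite addrCA subrr addr0.
rewrite tel mulrCA !mulr_sumr -sumrB.
have -> : tau = n%:R * (tau / n%:R) by rewrite mulrCA mulfV ?mulr1// gt_eqF.
rewrite -[X in X%:R * _]card_ord; apply: nrm_sum_le => m.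
have dm : m.+1%:R / n%:R - m%:R / n%:R = n%:R^-1 :> R by rewrite -mulrBl -natr1 addrAC subrr add0r mul1r.
have m01 (k : nat) : (k <= n)%N -> 0 <= (k%:R / n%:R : R) <= 1.
  by move=> kn; rewrite divr_ge0//= ler_pdivrMr// mul1r ler_nat.
have := hde (m%:R / n%:R) (m.+1%:R / n%:R) (m01 _ (ltnW (ltn_ord m))) (m01 _ (ltn_ord m)).
by rewrite dm ger0_norm ?invr_ge0 ?(ltW n0')//; apply.
Qed.

Lemma riemannD (a x : V) (j : 'I_d) (F f G g : V -> K) : riemann S a x j F f -> riemann S a x j G g ->
  riemann S a x j (fun y => F y + G y) (fun y => f y + g y).
Proof.
move=> hF hG tau tau0; have t2 : 0 < tau / 2 by rewrite divr_gt0.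
have [n1 h1] := hF _ t2; have [n2 h2] := hG _ t2; exists (maxn n1 n2) => n.
rewrite geq_max => /andP[nn1 nn2] n0; rewrite big_split /=.
have := nrmDl (h1 n nn1 n0) (h2 n nn2 n0); rewrite -splitr; congr (nrm _ <= _); ring.
Qed.

Lemma riemannZ (a x : V) (j : 'I_d) (F f : V -> K) c : riemann S a x j F f -> riemann S a x j (fun y => c * F y) (fun y => c * f y).
Proof.
move=> hF tau tau0; have c0 : 0 < nrm c + 1 by rewrite ltr_wpDl// nrm_ge0.
have [n1 h1] := hF _ (divr_gt0 tau0 c0); exists n1 => n nn n0.
rewrite -mulr_sumr (_ : _ - _ = c * (F x - F a - (x 0 j - a 0 j) * (iota n%:R^-1 * \sum_(m < n) f (pt S a x (m%:R / n%:R))))); last by ring.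
rewrite nrmM; have := h1 n nn n0; set y := nrm _ => hy.
apply: (@le_trans _ _ ((nrm c + 1) * (tau / (nrm c + 1)))); last by rewrite mulrCA mulfV ?mulr1// gt_eqF.
by rewrite ler_pM ?nrm_ge0// lerDl.
Qed.

Fixpoint wcont k : J d k -> mi :=
  match k with
  | 0 => fun _ _ => 0%N
  | k'.+1 => fun w i => if w is Some (j, w') then ((i == j) + wcont w' i)%N else 0%N
  end.

Lemma wmonE k (w : J d k) x : wmon (K := K) w x = \prod_i x 0 i ^+ wcont w i.
Proof.
elim: k w => [|k ih] w /=; first by rewrite big1.
case: w => [[j w]|]; last by rewrite big1.
rewrite ih; under [RHS]eq_bigr do rewrite exprD.
rewrite big_split /= [X in _ = X * _](bigD1 j)//= eqxx expr1 [X in _ = _ * X * _]big1 ?mulr1// => i /negbTE ->.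
by rewrite expr0.
Qed.

Lemma msize_wcont k (w : J d k) : (msize (wcont w) <= k)%N.
Proof.
rewrite /msize; elim: k w => [|k ih] w /=; first by rewrite big1.
case: w => [[j w]|]; last by rewrite big1.
rewrite big_split /= [X in (X + _)%N](bigD1 j)//= eqxx [X in (_ + X + _)%N]big1 ?addn0 ?add1n ?ltnS//.
by move=> i /negbTE ->.
Qed.

(** The derivative of order [be] of the monomial with exponents [al]; the falling factorial makes it
    vanish when [be] exceeds [al] in some variable. *)
Definition mon (al be : mi) (x : V) : K := \prod_i (((al i) ^_ (be i))%:R * x 0 i ^+ (al i - be i)).

Lemma mon0 al be : mon al be 0 = if [forall i, al i == be i] then \prod_i ((al i)`!)%:R else 0.
Proof.
case: forallP => [h|/forallP]; last first.
  rewrite negb_forall => /existsP[i hi]; rewrite /mon (bigD1 i)//= mxE.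
  have [ab|ab] := ltnP (al i) (be i); first by rewrite ffact_small// !mul0r.
  by rewrite expr0n subn_eq0 leqNgt ltn_neqAle eq_sym hi ab /= mulr0 mul0r.
by apply: eq_bigr => i _; have /eqP <- := h i; rewrite subnn expr0 mulr1 ffactnn.
Qed.

Lemma pow_taylor n : exists2 C : R, 0 <= C & forall u v : K, nrm u <= 1 -> nrm v <= 1 ->
  nrm (v ^+ n - u ^+ n - n%:R * u ^+ n.-1 * (v - u)) <= C * nrm (v - u) ^+ 2.
Proof.
elim: n => [|n [C C0 ih]].
  by exists 0 => // u v _ _; rewrite !expr0 subrr !mul0r subrr nrm0.
exists (C + n%:R) => [|u v u1 v1]; first by rewrite addr_ge0.
have -> : v ^+ n.+1 - u ^+ n.+1 - n.+1%:R * u ^+ n * (v - u) =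
   v * (v ^+ n - u ^+ n - n%:R * u ^+ n.-1 * (v - u)) + n%:R * u ^+ n.-1 * (v - u) ^+ 2.
  case: n {ih} => [|n]; rewrite -?natr1 ?exprS /= ?expr0; ring.
rewrite mulrDl; apply: nrmDl.
  rewrite -[leRHS]mul1r; apply: nrmMl => //; exact: ih.
apply: nrmMl; last by rewrite nrmX.
rewrite -[leRHS]mulr1; apply: nrmMl; first by rewrite nrm_nat.
by rewrite nrmX exprn_ile1 ?nrm_ge0.
Qed.

Lemma mon_riemann (al be : mi) (j : 'I_d) (a x : V) : nv a <= 1 -> nv x <= 1 -> (forall i, i != j -> a 0 i = x 0 i) ->
  riemann S a x j (mon al be) (mon al (incr be j)).
Proof.
move=> a1 x1 ax; apply: riemann_unif => eps eps0.
set n := (al j - be j)%N; have [C C0 hC] := pow_taylor n.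
pose c := (\prod_(i | i != j) (((al i) ^_ (be i))%:R * a 0 i ^+ (al i - be i))) * ((al j) ^_ (be j))%:R.
have monE t : mon al be (pt S a x t) = c * (pt S a x t 0 j) ^+ n.
  rewrite /mon (bigD1 j)//= -/n mulrC /c -[RHS]mulrA; congr (_ * _).
  by apply: eq_bigr => i ij; rewrite !mxE ax// subrr mulr0 addr0.
have monE' t : mon al (incr be j) (pt S a x t) = c * (n%:R * (pt S a x t 0 j) ^+ n.-1).
  rewrite /mon (bigD1 j)//= mulrC /c -[RHS]mulrA; congr (_ * _).
    apply: eq_bigr => i ij; rewrite !mxE ax// subrr mulr0 addr0 /incr (negbTE ij) addn0 //.
  by rewrite /incr eqxx addn1 ffactnSr natrM -/n subnS -/n mulrA.
pose D := nrm c * (C * nrm (x 0 j - a 0 j) ^+ 2) + 1.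
have D0 : 0 < D by rewrite ltr_wpDl// !mulr_ge0 ?nrm_ge0// exprn_ge0 ?nrm_ge0.
exists (eps / D) => [|s t s01 t01 st]; first by rewrite divr_gt0.
have p1 u : 0 <= u <= 1 -> nrm (pt S a x u 0 j) <= 1.
  by move=> u01; apply: le_trans (le_nv _ _ _) _; exact: nv_pt.
have dE : pt S a x t 0 j - pt S a x s 0 j = iota (t - s) * (x 0 j - a 0 j) by rewrite !mxE rmorphB; ring.
rewrite !monE monE' (_ : _ - _ = c * ((pt S a x t 0 j) ^+ n - (pt S a x s 0 j) ^+ n - n%:R * (pt S a x s 0 j) ^+ n.-1 * (pt S a x t 0 j - pt S a x s 0 j))); last by rewrite dE; ring.
rewrite nrmM; apply: le_trans (ler_wpM2l (nrm_ge0 _ _) (hC _ _ (p1 s s01) (p1 t t01))) _.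
rewrite dE nrmM nrm_iota exprMn.
have -> : nrm c * (C * (`|t - s| ^+ 2 * nrm (x 0 j - a 0 j) ^+ 2)) = nrm c * (C * nrm (x 0 j - a 0 j) ^+ 2) * `|t - s| * `|t - s| by ring.
rewrite ler_wpM2r//; apply: (@le_trans _ _ (D * (eps / D))); last by rewrite mulrCA mulfV ?mulr1// gt_eqF.
by rewrite ler_pM ?lerDl// !mulr_ge0 ?nrm_ge0// exprn_ge0 ?nrm_ge0.
Qed.

(** Points with rational real coordinates: a countable dense set on which suprema and events can be
    expressed. *)
Definition dpt (r : {ffun 'I_d * BB S -> rat}) : V := \row_i \sum_b iota (ratr (r (i, b))) * uu S b.

Lemma dpt_dense (x : V) (de : R) : 0 < de -> exists r, nv (dpt r - x) <= de.
Proof.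
move=> de0; pose nB : R := #|BB S|%:R + 1.
have nB0 : 0 < nB by rewrite ltr_wpDl.
have h (ib : 'I_d * BB S) : exists q : rat, `|ratr q - co S ib.2 (x 0 ib.1)| <= de / nB.
  have := @rat_in_itvoo R (co S ib.2 (x 0 ib.1) - de / nB) (co S ib.2 (x 0 ib.1) + de / nB).
  case=> [|q]; first by have : 0 < de / nB; [rewrite divr_gt0|lra].
  by rewrite in_itv /= => /andP[h1 h2]; exists q; rewrite ler_distl !ltW//; lra.
have {h} /choice[f hf] := h.
exists [ffun ib => f ib]; apply: nv_le => [|i]; first exact: ltW.
have -> : de = nB * (de / nB) by rewrite mulrCA mulfV ?mulr1// gt_eqF.
apply: (@le_trans _ _ (#|BB S|%:R * (de / nB))); last by rewrite ler_wpM2r ?lerDl// divr_ge0 ?ltW.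
apply: nrm_co_le => b; rewrite !mxE coB.
rewrite (_ : \sum_b _ = \sum_b iota (ratr (f (i, b))) * uu S b); last by apply: eq_bigr => b' _; rewrite ffunE.
by rewrite co_comb; exact: hf (i, b).
Qed.

(** [x] is first contracted towards 0, which leaves room for the rational point to stay in the box
    even when [x] is on its boundary. *)
Lemma dpt_dense_box (x : V) (rho de : R) : 0 < rho -> nv x <= rho -> 0 < de ->
  exists r, nv (dpt r) <= rho /\ nv (dpt r - x) <= de.
Proof.
move=> rho0 xr de0; pose eta := Num.min 1 (de / (2 * rho)).
have r2 : 0 < 2 * rho by rewrite mulr_gt0.
have eta0 : 0 < eta by rewrite lt_min ltr01 divr_gt0.
have eta1 : eta <= 1 by rewrite ge_min lexx.
have etad : eta * rho <= de / 2.
  apply: (@le_trans _ _ (de / (2 * rho) * rho)); first by rewrite ler_wpM2r ?(ltW rho0)// ge_min lexx orbT.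
  by rewrite (_ : de / (2 * rho) * rho = de / 2)//; field; rewrite gt_eqF.
pose x' := iota (1 - eta) *: x.
have er0 : 0 < eta * rho by rewrite mulr_gt0.
have [r hr] := dpt_dense x' er0; exists r; split.
  rewrite -(subrK x' (dpt r)); apply: le_trans (nvD _ _ _) _; rewrite {2}/x' nvZ nrm_iota ger0_norm ?subr_ge0//.
  have : (1 - eta) * nv x <= (1 - eta) * rho by rewrite ler_wpM2l ?subr_ge0.
  move: hr; set u := nv _; lra.
have -> : dpt r - x = (dpt r - x') + iota (- eta) *: x.
  by rewrite /x' rmorphB rmorph1 rmorphN scalerBl scale1r scaleNr opprB addrA addrAC addrK.
apply: le_trans (nvD _ _ _) _; rewrite nvZ nrm_iota normrN (gtr0_norm eta0).
have : eta * nv x <= eta * rho by rewrite ler_wpM2l// ltW.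
move: hr; set u := nv _; lra.
Qed.

End Monomials.

(** * Integrable functions *)

Section L1.
Context {dT : measure_display} {T : measurableType dT} {R : realType}.
Variable mu : {measure set T -> \bar R}.
Implicit Types (f g : T -> R).

Definition L1 f := mu.-integrable setT (EFin \o f).

Lemma L1_meas f : L1 f -> measurable_fun setT f.
Proof. by move=> /measurable_int /measurable_EFinP. Qed.

Lemma eq_L1 f g : f =1 g -> L1 f -> L1 g.
Proof. by move=> /funext->. Qed.

Lemma L1D f g : L1 f -> L1 g -> L1 (fun x => f x + g x).
Proof. by move=> lf lg; have := integrableD measurableT lf lg. Qed.

Lemma L1Z c f : L1 f -> L1 (fun x => c * f x).
Proof. by move=> lf; have := integrableZl measurableT c lf. Qed.

Lemma L1B f g : L1 f -> L1 g -> L1 (fun x => f x - g x).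
Proof.
move=> lf /(L1Z (-1)) lg; apply: eq_L1 (L1D lf lg) => x /=.
by rewrite mulN1r.
Qed.

Lemma L1_le f g : measurable_fun setT f -> (forall x, `|f x| <= g x) -> L1 g -> L1 f.
Proof.
move=> mf fg lg; apply: le_integrable lg => //; first exact/measurable_EFinP.
by move=> x _; rewrite /= lee_fin (le_trans (fg x))// ler_norm.
Qed.

Lemma L1_sum (I : Type) (s : seq I) (F : I -> T -> R) : L1 (fun=> 0) ->
  (forall i, L1 (F i)) -> L1 (fun x => \sum_(i <- s) F i x).
Proof.
move=> l0 lF; elim: s => [|i s ih]; first by apply: eq_L1 l0 => x; rewrite big_nil.
by apply: eq_L1 (L1D (lF i) ih) => x; rewrite big_cons.
Qed.

Lemma EED f g : L1 f -> L1 g -> \int[mu]_x (f x + g x) = \int[mu]_x f x + \int[mu]_x g x.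
Proof. by move=> lf lg; exact: RintegralD. Qed.

Lemma EEZ c f : L1 f -> \int[mu]_x (c * f x) = c * \int[mu]_x f x.
Proof. by move=> lf; exact: RintegralZl. Qed.

Lemma EEB f g : L1 f -> L1 g -> \int[mu]_x (f x - g x) = \int[mu]_x f x - \int[mu]_x g x.
Proof. by move=> lf lg; exact: RintegralB. Qed.

Lemma EE_le f g : L1 f -> L1 g -> (forall x, f x <= g x) -> \int[mu]_x f x <= \int[mu]_x g x.
Proof. by move=> lf lg fg; apply: le_Rintegral => // x _; exact: fg. Qed.

Lemma eq_EE f g : f =1 g -> \int[mu]_x f x = \int[mu]_x g x.
Proof. by move=> /funext->. Qed.

Lemma EE_fin f : L1 f -> (\int[mu]_x (f x)%:E)%E = (\int[mu]_x f x)%:E.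
Proof. by move=> lf; rewrite fineK//; exact: integrable_fin_num. Qed.

Lemma meas_lim (f_ : nat -> T -> R) f : (forall n, measurable_fun setT (f_ n)) ->
  (forall x, f_ n x @[n --> \oo] --> f x) -> measurable_fun setT f.
Proof. by move=> mf h; apply: (measurable_fun_cvg (h := f_)) => // x _; exact: h. Qed.

Lemma dct (f_ : nat -> T -> R) f g : (forall n, L1 (f_ n)) ->
  (forall x, f_ n x @[n --> \oo] --> f x) -> (forall n x, `|f_ n x| <= g x) -> L1 g ->
  L1 f /\ \int[mu]_x f_ n x @[n --> \oo] --> \int[mu]_x f x.
Proof.
move=> lf cf fg lg.
have mf : measurable_fun setT f by apply: meas_lim cf => n; exact: L1_meas.
have [||||| h1 _ h2] := @dominated_convergence _ T R mu setT measurableT (fun n => EFin \o f_ n) (EFin \o f) (EFin \o g).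
- by move=> n; apply/measurable_EFinP; exact: L1_meas.
- exact/measurable_EFinP.
- by apply: aeW => x _; apply/cvg_EFin; [exact: nearW|exact: cf].
- exact: lg.
- by apply: aeW => x n _; rewrite /= lee_fin.
split => //.
have hE n : (\int[mu]_x (f_ n x)%:E)%E = (\int[mu]_x f_ n x)%:E by apply: EE_fin.
rewrite /= (_ : (fun n => _) = (fun n => (\int[mu]_x f_ n x)%:E)) in h2; last by apply/funext.
by rewrite (EE_fin h1) in h2; have /fine_cvgP[] := h2.
Qed.

Lemma EE_ge0 f : (forall x, 0 <= f x) -> 0 <= \int[mu]_x f x.
Proof. by move=> h; apply: Rintegral_ge0 => x _. Qed.

Lemma L1_fin_ge0 f : measurable_fun setT f -> (forall x, 0 <= f x) ->
  (\int[mu]_x (f x)%:E < +oo)%E -> L1 f.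
Proof.
move=> mf f0 h; apply/integrableP; split; first exact/measurable_EFinP.
rewrite (_ : (\int[mu]_x _)%E = (\int[mu]_x (f x)%:E)%E)//.
by apply: eq_integral => x _; rewrite /= ger0_norm.
Qed.

End L1.

(** * Functions generated by trigonometric ones under bounded limits *)

Section TrigClass.
Context {R : realType} {I : Type}.
Local Notation Y := (I -> R).

Definition lin (s : seq (R * I)) (y : Y) : R := \sum_(c <- s) c.1 * y c.2.

Lemma lin_cat s t y : lin (s ++ t) y = lin s y + lin t y.
Proof. by rewrite /lin big_cat. Qed.

Lemma lin_scale a s y : lin [seq (a * c.1, c.2) | c <- s] y = a * lin s y.
Proof. by rewrite /lin big_map mulr_sumr; apply: eq_bigr => c _; rewrite mulrA. Qed.

(** Plays the part of the monotone class theorem: the class contains the indicators of events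
    generated by the coordinates, and two laws with the same exponential moments agree on it. *)
Inductive tm : (Y -> R) -> Prop :=
| tm_cos s : tm (fun y => cos (lin s y))
| tm_sin s : tm (fun y => sin (lin s y))
| tm_add f g : tm f -> tm g -> tm (fun y => f y + g y)
| tm_scale c f : tm f -> tm (fun y => c * f y)
| tm_lim (f_ : nat -> Y -> R) f C : (forall n, tm (f_ n)) -> (forall n y, `|f_ n y| <= C) ->
    (forall y, f_ n y @[n --> \oo] --> f y) -> tm f.

Lemma eq_tm f g : f =1 g -> tm f -> tm g.
Proof. by move=> /funext->. Qed.

Lemma lim_norm_le (u : nat -> R) (l C : R) : (forall n, `|u n| <= C) -> u n @[n --> \oo] --> l -> `|l| <= C.
Proof.
move=> uC ul; apply: (ler_cvg_to (cvg_norm ul) (cvg_cst C)).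
by apply: nearW => n; exact: uC.
Qed.

Lemma tm_bounded f : tm f -> exists2 C, 0 <= C & forall y, `|f y| <= C.
Proof.
elim=> {f} [s|s|f g _ [C C0 hC] _ [D D0 hD]|c f _ [C C0 hC]|f_ f C _ _ hC cf].
- by exists 1 => // y; rewrite ler_norml cos_geN1 cos_le1.
- by exists 1 => // y; rewrite ler_norml sin_geN1 sin_le1.
- by exists (C + D) => [|y]; [exact: addr_ge0|apply: le_trans (ler_normD _ _) (lerD _ _)].
- by exists (`|c| * C) => [|y]; [exact: mulr_ge0|rewrite normrM ler_wpM2l].
- exists C => [|y]; first exact: le_trans (normr_ge0 _) (hC 0%N (fun=> 0)).
  exact: lim_norm_le (fun n => hC n y) (cf y).
Qed.

Let mulc (h : Y -> R) : (forall y, `|h y| <= 1) ->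
  (forall s, tm (fun y => h y * cos (lin s y))) -> (forall s, tm (fun y => h y * sin (lin s y))) ->
  forall g, tm g -> tm (fun y => h y * g y).
Proof.
move=> h1 hc hs g; elim=> {g} // [f g _ hf _ hg|c f _ hf|f_ f C _ hf hC cf].
- by apply: eq_tm (tm_add hf hg) => y; rewrite mulrDr.
- by apply: eq_tm (tm_scale c hf) => y; rewrite mulrCA.
- apply: (tm_lim (C := C) hf) => [n y|y]; last by apply: cvgMr; exact: cf.
  by rewrite normrM -[leRHS]mul1r ler_pM.
Qed.

(** Products of sines and cosines are linearised by the addition formulas; sums and limits are then
    treated one factor at a time. *)
Lemma tm_mul f g : tm f -> tm g -> tm (fun y => f y * g y).
Proof.
have half : 2^-1 = 1 / 2 :> R by rewrite mul1r.
move=> tf tg; elim: tf => {f} [s|s|f f' _ hf _ hf'|c f _ hf|f_ f C tf hf hC cf].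
- apply: mulc tg => [y|t|t]; first by rewrite ler_norml cos_geN1 cos_le1.
    apply: eq_tm (tm_scale 2^-1 (tm_add (tm_cos (s ++ t)) (tm_cos (s ++ [seq (-1 * c.1, c.2) | c <- t])))) => y.
    by rewrite !lin_cat lin_scale mulN1r cosB cosD half; field.
  apply: eq_tm (tm_scale 2^-1 (tm_add (tm_sin (t ++ s)) (tm_sin (t ++ [seq (-1 * c.1, c.2) | c <- s])))) => y.
  by rewrite !lin_cat lin_scale mulN1r sinB sinD half; field.
- apply: mulc tg => [y|t|t]; first by rewrite ler_norml sin_geN1 sin_le1.
    apply: eq_tm (tm_scale 2^-1 (tm_add (tm_sin (s ++ t)) (tm_sin (s ++ [seq (-1 * c.1, c.2) | c <- t])))) => y.
    by rewrite !lin_cat lin_scale mulN1r sinB sinD half; field.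
  apply: eq_tm (tm_scale 2^-1 (tm_add (tm_cos (s ++ [seq (-1 * c.1, c.2) | c <- t])) (tm_scale (-1) (tm_cos (s ++ t))))) => y.
  by rewrite !lin_cat lin_scale mulN1r cosB cosD half; field.
- by apply: eq_tm (tm_add hf hf') => y; rewrite mulrDl.
- by apply: eq_tm (tm_scale c hf) => y; rewrite mulrA.
- have [D D0 hD] := tm_bounded tg.
  apply: (tm_lim (C := C * D) hf) => [n y|y]; last by apply: cvgMl; exact: cf.
  by rewrite normrM ler_pM.
Qed.

Lemma tm_cst c : tm (fun=> c).
Proof. by apply: eq_tm (tm_scale c (tm_cos [::])) => y; rewrite /lin big_nil cos0 mulr1. Qed.

(* Iterating [p u = (3u - u^3)/2] drives every [u] in [-1,1] to the sign of [u]. *)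
Let p (u : R) := (3 * u - u ^+ 3) / 2.

(** For positive [u] the distance to 1 decays like [1 / (n * u)]; this crude rate is an invariant
    that a polynomial inequality propagates. *)
Let p_it n u : `|u| <= 1 -> [/\ `|iter n p u| <= 1, (0 <= u -> u <= iter n p u) &
   0 <= u -> (1 - iter n p u) * (1 + n%:R * u / 2) <= 1].
Proof.
move=> u1; elim: n => [|n [h1 h2 h3]].
  by split => //= u0; rewrite mul0r mul0r addr0 mulr1; lra.
rewrite iterS; set v := iter n p u in h1 h2 h3 *.
move: h1; rewrite ler_norml => /andP[v1 v2].
have pv : 1 - p v = (1 - v) * (1 - v * (v + 1) / 2) by rewrite /p; field.
have pv2 : 1 + p v = (1 + v) * (1 - v * (v - 1) / 2) by rewrite /p; field.
have a1 : `|p v| <= 1.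
  rewrite ler_norml; apply/andP; split.
    suff : 0 <= 1 + p v by lra.
    by rewrite pv2 mulr_ge0//; nra.
  suff : 0 <= 1 - p v by lra.
  by rewrite pv mulr_ge0//; nra.
split => // u0; have uv := h2 u0; have {}h3 := h3 u0.
  by rewrite /p; nra.
have v0 : 0 <= v by lra.
have n0 : 0 <= n%:R * u / 2 by rewrite !mulr_ge0.
have -> : 1 + n.+1%:R * u / 2 = 1 + n%:R * u / 2 + u / 2 by rewrite -natr1; field.
rewrite pv; set N := n%:R * u / 2 in h3 n0 *.
have u1' : u <= 1 by move: u1; rewrite ler_norml => /andP[].
apply: le_trans _ h3; rewrite -mulrA ler_wpM2l; [|lra|].
  by lra.
have : (1 - v * (v + 1) / 2) <= 1 - v / 2 by nra.
move=> h; apply: (@le_trans _ _ ((1 - v / 2) * (1 + N + u / 2))).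
  by rewrite ler_wpM2r//; lra.
have : u * (1 + N) <= v * (1 + N) by rewrite ler_wpM2r//; lra.
nra.
Qed.

Let pN n u : iter n p (- u) = - iter n p u.
Proof. by elim: n => [//|n ih]; rewrite !iterS ih /p; field. Qed.

Let p_sg u : `|u| <= 1 -> iter n p u @[n --> \oo] --> Num.sg u.
Proof.
wlog u0 : u / 0 <= u.
  move=> H u1; have [/H|u0] := leP 0 u; first exact.
  have := H (- u); rewrite normrN sgrN oppr_ge0 => /(_ (ltW u0) u1) h.
  rewrite -[Num.sg u]opprK (_ : (fun n => _) = (fun n => - iter n p (- u))); last first.
    by apply/funext => n; rewrite pN opprK.
  exact: cvgN h.
move=> u1; have [->|un0] := eqVneq u 0.
  have p0 n : iter n p 0 = 0 by elim: n => [//|n ih]; rewrite iterS ih /p; field.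
  by rewrite sgr0 (_ : (fun n => _) = fun=> 0); [exact: cvg_cst|exact/funext].
have {un0}u0 : 0 < u by rewrite lt_neqAle eq_sym un0.
rewrite gtr0_sg//; apply/cvgrPdist_le => e e0.
exists (Num.truncn (2 / (u * e))).+1 => // n /= Nn.
have [+ _ /(_ (ltW u0)) h] := p_it n u1; rewrite ler_norml => /andP[_ v1].
rewrite ger0_norm ?subr_ge0//.
have n1 : 2 / (u * e) <= n%:R by apply: le_trans (ltW (truncnS_gt _)) _; rewrite ler_nat.
have : 2 <= n%:R * (u * e) by rewrite -ler_pdivrMr// mulr_gt0.
move=> n2; have n0 : 0 <= n%:R * u / 2 by rewrite !mulr_ge0// ltW.
rewrite leNgt; apply/negP => lt_e.
have : e * (1 + n%:R * u / 2) < 1.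
  by apply: lt_le_trans h; rewrite ltr_pM2r//; lra.
move: n2; rewrite mulrA; lra.
Qed.

Lemma tm_iter n f : tm f -> tm (fun y => iter n p (f y)).
Proof.
move=> tf; elim: n => [//|n ih].
apply: eq_tm (tm_scale 2^-1 (tm_add (tm_scale 3 ih) (tm_scale (-1) (tm_mul ih (tm_mul ih ih))))) => y.
by rewrite iterS /p /= mulN1r -expr2 -exprS mulrC.
Qed.

(** For large [L] the argument of [sin ((y_i - a) / L)] lies in []-1, 1[], so the sine has the sign
    of [y_i - a], and that sign is the limit of the iterates of [p]. *)
Lemma tm_sg_sub (i : I) (a : R) : tm (fun y => Num.sg (y i - a)).
Proof.
pose g (L : nat) (y : Y) := sin ((y i - a) / L.+1%:R).
have g1 L y : `|g L y| <= 1 by rewrite ler_norml sin_geN1 sin_le1.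
have tg L : tm (g L).
  apply: eq_tm (tm_add (tm_scale (cos (a / L.+1%:R)) (tm_sin [:: (L.+1%:R^-1, i)])) (tm_scale (- sin (a / L.+1%:R)) (tm_cos [:: (L.+1%:R^-1, i)]))) => y.
  by rewrite /g mulrBl sinB /lin big_seq1 /= [_^-1 * _]mulrC; ring.
apply: (@tm_lim (fun L y => Num.sg (g L y)) _ 1) => [L|L y|y].
- apply: (@tm_lim (fun n y => iter n p (g L y)) _ 1) => [n|n y|y]; first exact: tm_iter.
    by have [] := p_it n (g1 L y).
  exact: p_sg.
- by rewrite normr_sg; case: eqP.
- apply/cvgrPdist_le => e e0.
  have [N hN] : exists N : nat, `|y i - a| < N%:R by exists (Num.truncn `|y i - a|).+1; exact: truncnS_gt.
  exists N => // L /= NL; rewrite (_ : Num.sg (g L y) = Num.sg (y i - a)) ?subrr ?normr0 ?(ltW e0)//.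
  have L0 : 0 < L.+1%:R :> R by [].
  have : `|(y i - a) / L.+1%:R| < 1.
    rewrite normrM normfV (gtr0_norm L0) ltr_pdivrMr// mul1r; apply: lt_le_trans hN _.
    by rewrite ler_nat ltnW.
  have pi1 : 1 < pi :> R by have := pi_ge2 R; lra.
  rewrite ltr_norml => /andP[h1 h2]; rewrite /g.
  have [z|z|->] := ltgtP (y i - a) 0; last by rewrite mul0r sin0.
    have z' : (y i - a) / L.+1%:R < 0 by rewrite pmulr_llt0 ?invr_gt0.
    rewrite !ltr0_sg// -oppr_gt0 -sinN; apply: sin_gt0_pi; move: h1 h2 z'; set q := _ / _; lra.
  have z' : 0 < (y i - a) / L.+1%:R by rewrite divr_gt0.
  rewrite !gtr0_sg//; apply: sin_gt0_pi; move: h1 h2 z'; set q := _ / _; lra.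
Qed.

Definition cyl (A : set Y) := tm \1_A.

Lemma cyl_gt i a : cyl [set y | a < y i].
Proof.
apply: eq_tm (tm_scale 2^-1 (tm_add (tm_sg_sub i a) (tm_mul (tm_sg_sub i a) (tm_sg_sub i a)))) => y.
rewrite indicE; set u := y i - a.
have -> : (y \in [set y | a < y i]) = (0 < u) by rewrite /u subr_gt0; apply/idP/idP => h; [exact: (set_mem h)|exact: mem_set].
by case: (ltgtP 0 u) => [h|h|<-]; rewrite ?(gtr0_sg h) ?(ltr0_sg h) ?sgr0 /=; field.
Qed.

Lemma cylT : cyl setT.
Proof. by apply: eq_tm (tm_cst 1) => y; rewrite indicT. Qed.

Lemma cylC A : cyl A -> cyl (~` A).
Proof.
move=> cA; apply: eq_tm (tm_add (tm_cst 1) (tm_scale (-1) cA)) => y.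
by rewrite !indicE in_setC; case: (y \in A) => /=; ring.
Qed.

Lemma cylI A B : cyl A -> cyl B -> cyl (A `&` B).
Proof.
move=> cA cB; apply: eq_tm (tm_mul cA cB) => y.
by rewrite !indicE in_setI; case: (y \in A); case: (y \in B) => /=; ring.
Qed.

Lemma cylU A B : cyl A -> cyl B -> cyl (A `|` B).
Proof. by move=> cA cB; rewrite -(setCK (A `|` B)) setCU; apply/cylC/cylI; exact: cylC. Qed.

Lemma cyl_bigcup (A : nat -> set Y) : (forall n, cyl (A n)) -> cyl (\bigcup_n A n).
Proof.
move=> cA; pose B n := \big[setU/set0]_(k < n) A k.
have cB n : cyl (B n).
  rewrite /B; elim/big_ind: _ => [|X Z hX hZ|//]; last exact: cylU.
  by rewrite -setCT; apply/cylC/cylT.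
apply: (@tm_lim (fun n => \1_(B n)) _ 1) => // [n y|y].
  by rewrite indicE; case: (y \in _) => /=; rewrite ?normr1 ?normr0.
apply/cvgrPdist_le => e e0.
have [[n _ yn]|yA] := pselect ((\bigcup_n A n) y).
  exists n.+1 => // k /= nk.
  have yU : (\bigcup_n A n) y by exists n.
  have yB : B k y by rewrite /B -bigcup_mkord; exists n.
  by rewrite !indicE (mem_set yU) (mem_set yB) subrr normr0 ltW.
apply: nearW => k.
have yB : ~ B k y by rewrite /B -bigcup_mkord => -[j _ yj]; apply: yA; exists j.
by rewrite !indicE (memNset yA) (memNset yB) subrr normr0 ltW.
Qed.

Lemma cyl_lt i a : cyl [set y | y i < a].
Proof.
apply: eq_tm (tm_scale 2^-1 (tm_add (tm_scale (-1) (tm_sg_sub i a)) (tm_mul (tm_sg_sub i a) (tm_sg_sub i a)))) => y.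
rewrite indicE; set u := y i - a.
have -> : (y \in [set y | y i < a]) = (u < 0) by rewrite /u subr_lt0; apply/idP/idP => h; [exact: (set_mem h)|exact: mem_set].
by case: (ltgtP 0 u) => [h|h|<-]; rewrite ?(gtr0_sg h) ?(ltr0_sg h) ?sgr0 /=; field.
Qed.

Lemma cyl_abs_gt i a : cyl [set y | a < `|y i|].
Proof.
suff -> : [set y | a < `|y i|] = [set y | a < y i] `|` [set y | y i < - a].
  exact: cylU (cyl_gt _ _) (cyl_lt _ _).
apply/seteqP; split => y /=.
  by rewrite lter_normr ltrNr => /orP.
by rewrite lter_normr ltrNr => ?; apply/orP.
Qed.
End TrigClass.

Section ExpBounds.
Context {R : realType}.
Implicit Types x u h : R.

Lemma expR_cosh x : expR `|x| <= expR x + expR (- x).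
Proof.
have [x0|x0] := leP 0 x; first by rewrite ger0_norm// lerDl expR_ge0.
by rewrite ltr0_norm// lerDr expR_ge0.
Qed.

Lemma expRm1_le x : expR x - 1 <= x * expR x.
Proof.
have := expR_ge1Dx (- x); rewrite expRN => h.
have e0 := expR_gt0 x; have := ler_wpM2r (ltW e0) h; rewrite mulVf ?gt_eqF//; lra.
Qed.

Lemma expRm1_abs u : `|expR u - 1| <= `|u| * expR `|u|.
Proof.
have h1 := expRm1_le u; have h2 := expR_ge1Dx u; have e0 := expR_gt0 u.
have h3 : `|u| <= `|u| * expR `|u|.
  by rewrite ler_peMr// -(@expR0 R) ler_expR.
rewrite ler_norml; apply/andP; split.
  have := ler_norm (- u); rewrite normrN; lra.
apply: le_trans h1 _; apply: (@le_trans _ _ (`|u| * expR u)).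
  by rewrite ler_wpM2r ?ler_norm// ltW.
by rewrite ler_wpM2l// ler_expR ler_norm.
Qed.

Lemma diffq_bound (n : nat) x : `|n.+1%:R * (expR (n.+1%:R^-1 * x) - 1)| <= expR (2 * `|x|).
Proof.
have n0 : 0 < n.+1%:R :> R by [].
have n1 : n.+1%:R^-1 <= 1 :> R by rewrite invf_le1// ler1n.
rewrite normrM (gtr0_norm n0); apply: le_trans (ler_wpM2l (ltW n0) (expRm1_abs _)) _.
rewrite normrM ger0_norm ?invr_ge0// mulrA mulVKf ?gt_eqF//.
rewrite mulr2n mulrDl mul1r expRD; apply: ler_pM => //; rewrite ?expR_ge0//.
  by have := expR_ge1Dx `|x|; lra.
by rewrite ler_expR -[leRHS]mul1r ler_wpM2r.
Qed.

Lemma expm1_div_cvg (h x : nat -> R) (l : R) : (forall n, 0 < h n) -> h n @[n --> \oo] --> (0 : R) ->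
  x n @[n --> \oo] --> l -> (h n)^-1 * (expR (h n * x n) - 1) @[n --> \oo] --> l.
Proof.
move=> h0 ch cx.
have c0 : h n * x n @[n --> \oo] --> (0 : R).
  by rewrite -(mul0r l); exact: cvgM.
have c1 : x n * expR (h n * x n) @[n --> \oo] --> l.
  rewrite -[X in _ --> X]mulr1 -[X in _ * X](@expR0 R); apply: cvgM => //.
  by apply: (cvg_comp _ expR c0); exact: continuous_expR.
apply: squeeze_cvgr cx c1; apply: nearW => n; have hn := h0 n.
apply/andP; split.
  by rewrite -ler_pdivrMl ?invr_gt0// invrK lerBrDl expR_ge1Dx.
by rewrite -ler_pdivlMl ?invr_gt0// invrK mulrA; exact: expRm1_le.
Qed.

Lemma diffq_cvg x : n.+1%:R * (expR (n.+1%:R^-1 * x) - 1) @[n --> \oo] --> x.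
Proof.
rewrite (_ : (fun n => _) = fun n => (n.+1%:R^-1)^-1 * (expR (n.+1%:R^-1 * x) - 1)).
  by apply: expm1_div_cvg => // [|]; [exact: cvg_harmonic|exact: cvg_cst].
by apply/funext => n; rewrite invrK.
Qed.

Lemma exp_series_le x n : series (exp_coeff `|x|) n <= expR `|x|.
Proof.
apply: nondecreasing_cvgn_le; last exact: is_cvg_series_exp_coeff.
by apply: nondecreasing_series => k *; apply: exp_coeff_ge0.
Qed.

End ExpBounds.

(** * Laws with the same exponential moments *)

Section Agree.
Context {R : realType} {I : Type}.
Context {d1 d2 : measure_display} {T1 : measurableType d1} {T2 : measurableType d2}.
Variables (mu1 : {measure set T1 -> \bar R}) (mu2 : {measure set T2 -> \bar R}).
Variables (w1 : T1 -> R) (w2 : T2 -> R) (Y1 : I -> T1 -> R) (Y2 : I -> T2 -> R).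
Hypotheses (w1_ge0 : forall x, 0 <= w1 x) (w2_ge0 : forall x, 0 <= w2 x).

Definition goodf d (T : measurableType d) (mu : {measure set T -> \bar R}) (w : T -> R) (Y : I -> T -> R) (f : (I -> R) -> R) :=
  measurable_fun setT (fun x => f (Y^~ x)) /\ L1 mu (fun x => w x * f (Y^~ x)).

(** Equality of two weighted integrals, together with the measurability and integrability that the
    inductions carry along. The weights make room for a Cameron-Martin density on one side. *)
Definition agree f := [/\ goodf mu1 w1 Y1 f, goodf mu2 w2 Y2 f &
  \int[mu1]_x (w1 x * f (Y1^~ x)) = \int[mu2]_x (w2 x * f (Y2^~ x))].

Hypothesis agree_exp : forall s, agree (fun y => expR (lin s y)).

Let eq_agree f g : f =1 g -> agree f -> agree g.
Proof. by move=> /funext->. Qed.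

Let goodD d (T : measurableType d) (mu : {measure set T -> \bar R}) w Y f g :
  goodf mu w Y f -> goodf mu w Y g -> goodf mu w Y (fun y => f y + g y).
Proof.
move=> [mf lf] [mg lg]; split; first exact: measurable_funD.
by apply: eq_L1 (L1D lf lg) => x; rewrite mulrDr.
Qed.

Let goodZ d (T : measurableType d) (mu : {measure set T -> \bar R}) w Y c f :
  goodf mu w Y f -> goodf mu w Y (fun y => c * f y).
Proof.
move=> [mf lf]; split; first exact: measurable_funM.
by apply: eq_L1 (L1Z c lf) => x; rewrite mulrCA.
Qed.

Let agreeD f g : agree f -> agree g -> agree (fun y => f y + g y).
Proof.
move=> [f1 f2 fE] [g1 g2 gE]; split; [exact: goodD|exact: goodD|].
under eq_EE do rewrite mulrDr; rewrite EED; [|exact: f1.2|exact: g1.2].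
by under [RHS]eq_EE do rewrite mulrDr; rewrite EED ?fE ?gE//; [exact: f2.2|exact: g2.2].
Qed.

Let agreeZ c f : agree f -> agree (fun y => c * f y).
Proof.
move=> [f1 f2 fE]; split; [exact: goodZ|exact: goodZ|].
under eq_EE do rewrite mulrCA; rewrite EEZ; last exact: f1.2.
by under [RHS]eq_EE do rewrite mulrCA; rewrite EEZ ?fE//; exact: f2.2.
Qed.

Let good_lim d (T : measurableType d) (mu : {measure set T -> \bar R}) (w : T -> R) Y
    (f_ : nat -> (I -> R) -> R) (f h : (I -> R) -> R) : (forall x, 0 <= w x) ->
  (forall n, goodf mu w Y (f_ n)) -> (forall y, f_ n y @[n --> \oo] --> f y) ->
  (forall n y, `|f_ n y| <= h y) -> goodf mu w Y h ->
  goodf mu w Y f /\ \int[mu]_x (w x * f_ n (Y^~ x)) @[n --> \oo] --> \int[mu]_x (w x * f (Y^~ x)).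
Proof.
move=> w0 gf cf fh gh.
have [|x|n x||l c] := @dct _ T R mu (fun n x => w x * f_ n (Y^~ x)) (fun x => w x * f (Y^~ x)) (fun x => w x * h (Y^~ x)).
- by move=> n; have [] := gf n.
- by apply: cvgMr; exact: cf.
- by rewrite normrM ger0_norm// ler_wpM2l.
- exact: gh.2.
split => //; split => //.
by apply: (meas_lim (f_ := fun n x => f_ n (Y^~ x))) => // n; exact: (gf n).1.
Qed.

Let agree_lim (f_ : nat -> (I -> R) -> R) (f h : (I -> R) -> R) : (forall n, agree (f_ n)) -> (forall y, f_ n y @[n --> \oo] --> f y) ->
  (forall n y, `|f_ n y| <= h y) -> agree h -> agree f.
Proof.
move=> af cf fh [h1 h2 _].
have [|g1 c1] := good_lim w1_ge0 _ cf fh h1; first by move=> n; have [] := af n.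
have [|g2 c2] := good_lim w2_ge0 _ cf fh h2; first by move=> n; have [] := af n.
split => //; apply: cvg_unique c1 _ => //.
rewrite (_ : (fun n => _) = (fun n => \int[mu2]_x (w2 x * f_ n (Y2^~ x)))) //.
by apply/funext => n; have [] := af n.
Qed.

Let agree_cosh t s : agree (fun y => expR (t * lin s y) + expR (- (t * lin s y))).
Proof.
apply: agreeD.
  by apply: eq_agree (agree_exp [seq (t * c.1, c.2) | c <- s]) => y; rewrite lin_scale.
by apply: eq_agree (agree_exp [seq (- t * c.1, c.2) | c <- s]) => y; rewrite lin_scale mulNr.
Qed.

Let agree_expm1 k h t s : agree (fun y => (expR (h * lin s y) - 1) ^+ k * expR (t * lin s y)).
Proof.
elim: k t => [|k ih] t.
  by apply: eq_agree (agree_exp [seq (t * c.1, c.2) | c <- s]) => y; rewrite lin_scale mul1r.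
apply: eq_agree (agreeD (ih (t + h)) (agreeZ (-1) (ih t))) => y.
by rewrite mulrDl expRD exprS; ring.
Qed.

(** Powers of a linear form are limits of powers of difference quotients of exponentials, dominated
    by a hyperbolic cosine of the same form. *)
Let agree_pow k s : agree (fun y => lin s y ^+ k).
Proof.
apply: (agree_lim (f_ := fun n y => (n.+1%:R * (expR (n.+1%:R^-1 * lin s y) - 1)) ^+ k)
   (h := fun y => expR ((2 * k%:R) * lin s y) + expR (- ((2 * k%:R) * lin s y)))) => [n|y|n y|].
- apply: eq_agree (agreeZ (n.+1%:R ^+ k) (agree_expm1 k (n.+1%:R^-1) 0 s)) => y.
  by rewrite exprMn mul0r expR0 mulr1.
- have h := @exprn_continuous R k (lin s y).
  exact: (cvg_comp _ _ (@diffq_cvg R (lin s y)) h).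
- rewrite normrX; apply: le_trans (lerXn2r _ _ _ (diffq_bound _ _)) _; rewrite ?nnegrE ?expR_ge0//.
  rewrite -expRM_natr; apply: le_trans _ (expR_cosh _).
  by rewrite normrM ger0_norm ?mulr_ge0// mulrAC.
- exact: agree_cosh.
Qed.

Let agree_ser (a : nat -> R) (F : R -> R) s : (forall n x, `|a n * x ^+ n| <= exp_coeff `|x| n) ->
  (forall x, series (fun n => a n * x ^+ n) n @[n --> \oo] --> F x) -> agree (fun y => F (lin s y)).
Proof.
move=> ab cF.
apply: (agree_lim (f_ := fun n y => series (fun n => a n * lin s y ^+ n) n)
  (h := fun y => expR (1 * lin s y) + expR (- (1 * lin s y)))) => [n|y|n y|]; last exact: agree_cosh.
- elim: n => [|n ih].
    apply: eq_agree (agreeZ 0 (agree_exp [::])) => y.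
    by rewrite mul0r seriesEnat /= big_nil.
  apply: eq_agree (agreeD ih (agreeZ (a n) (agree_pow n s))) => y.
  by rewrite !seriesEnat /= big_nat_recr.
- exact: cF.
- rewrite mul1r; apply: le_trans _ (expR_cosh _); apply: le_trans _ (exp_series_le _ n).
  rewrite !seriesEnat /=; apply: le_trans (ler_norm_sum _ _ _) _.
  by apply: ler_sum => i _.
Qed.

(** The partial sums of the series of cosine and sine are dominated by [expR |x|], so agreement
    passes from powers to trigonometric functions and then to bounded limits. *)
Lemma tm_agree f : tm f -> agree f.
Proof.
elim=> {f} [s|s|f g _ hf _ hg|c f _ hf|f_ f C _ hf hC cf].
- apply: (agree_ser s (a := fun n => (~~ odd n)%:R * (-1) ^+ n./2 * n`!%:R^-1)) => [n x|x].
    rewrite !normrM normrX normrN1 expr1n mulr1 /exp_coeff /= normrX mulrC mulrA.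
    have f0 : 0 <= n`!%:R^-1 :> R by rewrite invr_ge0.
    rewrite (ger0_norm f0) ler_wpM2r//.
    by case: odd => /=; rewrite ?normr0 ?normr1 ?mulr0 ?mulr1// exprn_ge0.
  have := @is_cvg_series_cos_coeff R x; rewrite unlock.
  by rewrite (_ : cos_coeff x = (fun n => (~~ odd n)%:R * (-1) ^+ n./2 * n`!%:R^-1 * x ^+ n)) // cos_coeffE.
- apply: (agree_ser s (a := fun n => (odd n)%:R * (-1) ^+ n.-1./2 * n`!%:R^-1)) => [n x|x].
    rewrite !normrM normrX normrN1 expr1n mulr1 /exp_coeff /= normrX mulrC mulrA.
    have f0 : 0 <= n`!%:R^-1 :> R by rewrite invr_ge0.
    rewrite (ger0_norm f0) ler_wpM2r//.
    by case: odd => /=; rewrite ?normr0 ?normr1 ?mulr0 ?mulr1// exprn_ge0.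
  have := @is_cvg_series_sin_coeff R x; rewrite unlock.
  by rewrite (_ : sin_coeff x = (fun n => (odd n)%:R * (-1) ^+ n.-1./2 * n`!%:R^-1 * x ^+ n)) // sin_coeffE.
- exact: agreeD.
- exact: agreeZ.
- apply: agree_lim hf cf (hC) _.
  apply: eq_agree (agreeZ C (agree_exp [::])) => y.
  by rewrite /lin big_nil expR0 mulr1.
Qed.

End Agree.

(** * Gaussian variables *)

Lemma measurable_expZ {dT : measure_display} {T : measurableType dT} {R : realType} (t : R) (f : T -> R) :
  measurable_fun setT f -> measurable_fun setT (fun x => expR (t * f x)).
Proof. by move=> mf; apply: (measurableT_comp (@measurable_expR R)); exact: measurable_funM. Qed.

Section NormalMgf.
Context {R : realType}.
Local Notation mu := (@lebesgue_measure R).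
Import HBNNSimple.

(** [normal_prob] is given by its density on sets; the formula for functions follows from simple
    functions and monotone convergence. *)
Lemma ge0_integral_normal (m s : R) (g : R -> R) : measurable_fun setT g -> (forall x, 0 <= g x) ->
  (\int[normal_prob m s]_x (g x)%:E = \int[mu]_x (g x * normal_pdf m s x)%:E)%E.
Proof.
move=> mg g0.
have mEg : measurable_fun [set: R] (EFin \o g) by exact/measurable_EFinP.
pose g_ := nnsfun_approx measurableT mEg.
have mpdf := measurable_normal_pdf m s.
have mg_ n : measurable_fun setT (g_ n) by exact: measurable_funP.
have nd x a b : (a <= b)%N -> g_ a x <= g_ b x.
  by move=> ab; have /lefP := nd_nnsfun_approx measurableT mEg ab; exact.
have cg x : (EFin \o g_^~ x) @ \oo --> (g x)%:E.
  by apply: cvg_nnsfun_approx => // y _; rewrite lee_fin.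
transitivity (limn (fun n => \int[normal_prob m s]_x (g_ n x)%:E)%E).
  rewrite -monotone_convergence//.
  - by apply: eq_integral => x _; apply/esym/cvg_lim => //; exact: cg.
  - by move=> n; apply/measurable_EFinP; exact: mg_.
  - by move=> n x _; rewrite lee_fin.
  - by move=> x _ a b ab; rewrite lee_fin; exact: nd.
transitivity (limn (fun n => \int[mu]_x (g_ n x * normal_pdf m s x)%:E)%E); last first.
  rewrite -monotone_convergence//.
  - apply: eq_integral => x _; apply/cvg_lim => //.
    rewrite EFinM (_ : (fun n => _) = (fun n => (g_ n x)%:E * (normal_pdf m s x)%:E)%E) //.
    by apply: cvgeZr => //; exact: cg.
  - by move=> n; apply/measurable_EFinP; apply: measurable_funM => //; exact: mg_.
  - by move=> n x _; rewrite lee_fin mulr_ge0 ?normal_pdf_ge0.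
  - move=> x _ a b ab; rewrite lee_fin ler_wpM2r ?normal_pdf_ge0//.
    exact: nd.
suff -> : (fun n => \int[normal_prob m s]_x (g_ n x)%:E)%E = (fun n => \int[mu]_x (g_ n x * normal_pdf m s x)%:E)%E by [].
apply/funext => n.
under eq_integral do rewrite fimfunE -fsumEFin//.
under [RHS]eq_integral.
  move=> x _; rewrite fimfunE EFinM -fsumEFin// ge0_mule_fsuml; last first.
    by move=> k; rewrite nnfun_muleindic_ge0.
  over.
have mA k : measurable (g_ n @^-1` [set k]) by [].
have mI k : measurable_fun [set: R] (\1_(g_ n @^-1` [set k]) : R -> R) by apply: measurable_indic; exact: mA.
rewrite [LHS]ge0_integral_fsum//; last 2 first.
- by move=> k; apply/measurable_EFinP; apply: measurable_funM => //; exact: mI.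
- by move=> k x _; rewrite nnfun_muleindic_ge0.
rewrite [RHS]ge0_integral_fsum//; last 2 first.
- move=> k; under eq_fun do rewrite -EFinM.
  by apply/measurable_EFinP; apply: measurable_funM => //; apply: measurable_funM => //; exact: mI.
- by move=> k x _; rewrite mule_ge0 ?nnfun_muleindic_ge0// lee_fin normal_pdf_ge0.
apply: eq_fsbigr => k _.
have [k0|k0] := leP 0 k; last first.
  rewrite preimage_nnfun0// !integral0_eq//= => x _; first by rewrite indic0 mulr0 mul0e.
  by rewrite indic0 mulr0.
under eq_integral do rewrite EFinM.
rewrite ge0_integralZl//; last by apply/measurable_EFinP; exact: mI.
rewrite integral_indic//; last exact: mA.
rewrite setIT /normal_prob /=.
rewrite [X in (_ * X)%E]integral_mkcond -ge0_integralZl//; last 2 first.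
- rewrite restrict_EFin.
  apply/measurable_EFinP/measurable_restrict => //; [exact: mA|exact: measurable_funS mpdf].
- by move=> x _; rewrite /patch; case: ifP; rewrite ?lee_fin ?normal_pdf_ge0.
apply: eq_integral => x _; rewrite /patch indicE.
by case: ifP => _; rewrite /= ?mulr1 ?mulr0 ?mule0 ?mul0e// EFinM.
Qed.

Let complete_square (x m s t : R) : s != 0 -> t * x + - (x - m) ^+ 2 / (s ^+ 2 * 2) =
  t * m + t ^+ 2 * s ^+ 2 / 2 + - (x - (m + t * s ^+ 2)) ^+ 2 / (s ^+ 2 * 2).
Proof. by move=> s0; field. Qed.

Lemma normal_mgf (m s t : R) : s != 0 ->
  (\int[normal_prob m s]_x (expR (t * x))%:E = (expR (t * m + t ^+ 2 * s ^+ 2 / 2))%:E)%E.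
Proof.
move=> s0.
have mE : measurable_fun [set: R] (fun x : R => expR (t * x)) := measurable_expZ t (@measurable_id _ _ _).
rewrite (ge0_integral_normal m s mE (fun x => expR_ge0 _)).
transitivity (\int[mu]_x ((expR (t * m + t ^+ 2 * s ^+ 2 / 2))%:E * (normal_pdf (m + t * s ^+ 2) s x)%:E))%E.
  apply: eq_integral => x _; rewrite -EFinM; congr EFin.
  rewrite !normal_pdfE// mulrCA [RHS]mulrCA; congr (_ * _).
  by rewrite /normal_fun -mulr_natr -!expRD complete_square.
rewrite ge0_integralZl//.
- by rewrite integral_normal_pdf mule1.
- by apply/measurable_EFinP; exact: measurable_normal_pdf.
- by move=> x _; rewrite lee_fin normal_pdf_ge0.
Qed.

End NormalMgf.

Section Gauss.
Context {dT : measure_display} {T : measurableType dT} {R : realType}.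
Variable P : probability T R.
Local Notation L1 := (L1 P).
Implicit Types X Y Z : T -> R.

(** The normal law of mean [m] and variance [v] through its exponential moments: degenerate laws are
    included, and limits or changes of density become computations with exponents. *)
Definition gmgf Y (m v : R) := [/\ measurable_fun setT Y, 0 <= v &
  forall t, L1 (fun w => expR (t * Y w)) /\ \int[P]_w expR (t * Y w) = expR (t * m + t ^+ 2 * v / 2)].

Lemma gaussian_rv_gmgf Y : gaussian_rv P Y -> exists m v, gmgf Y m v.
Proof.
move=> [mY [m [s [s0 h]]]]; exists m, (s ^+ 2); split => //; first exact: sqr_ge0.
move=> t.
have me : measurable_fun [set: R] (fun x => expR (t * x)).
  exact: (measurable_expZ t (@measurable_id _ _ _)).
have meY : measurable_fun setT (fun w => expR (t * Y w)) by exact: (measurableT_comp me).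
have E : (\int[P]_w (expR (t * Y w))%:E = (expR (t * m + t ^+ 2 * s ^+ 2 / 2))%:E)%E.
  pose Y' : {mfun T >-> measurableTypeR R} := HB.pack Y (isMeasurableFun.Build _ _ T (measurableTypeR R) Y mY).
  transitivity (\int[pushforward P Y']_x (expR (t * x))%:E)%E.
    by rewrite ge0_integral_pushforward//; exact/measurable_EFinP.
  have [s00|s00] := eqVneq s 0.
    transitivity (\int[\d_(m : measurableTypeR R)]_x (expR (t * x))%:E)%E.
      by apply: eq_measure_integral => A mA _; have := h A mA; rewrite s00 eqxx.
    rewrite integral_dirac//=; last exact/measurable_EFinP.
    by rewrite diracT mul1e s00 expr0n mulr0 mul0r addr0.
  transitivity (\int[normal_prob m s]_x (expR (t * x))%:E)%E; last exact: normal_mgf.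
  apply: eq_measure_integral => A mA _.
  by have := h A mA; rewrite (negbTE s00).
split; last by rewrite /Rintegral E.
by apply: L1_fin_ge0 => //; rewrite E ltry.
Qed.

End Gauss.

Section GaussMoments.
Context {dT : measure_display} {T : measurableType dT} {R : realType}.
Variable P : probability T R.
Local Notation L1 := (L1 P).
Implicit Types X Y Z : T -> R.

Lemma L1_cst (c : R) : L1 (fun=> c).
Proof. exact: finite_measure_integrable_cst. Qed.

Lemma EE_cst (c : R) : \int[P]_w c = c.
Proof. have P1 : (P : {measure set T -> \bar R}) setT = 1%E := probability_setT P.
by rewrite /Rintegral integral_cst// P1 mule1. Qed.

Definition gmean Y := \int[P]_w Y w.
Definition gcov Y Z := \int[P]_w (Y w * Z w) - gmean Y * gmean Z.

Lemma gmgf_cosh Y m v t : gmgf P Y m v -> L1 (fun w => expR (t * Y w) + expR (- (t * Y w))).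
Proof.
move=> [_ _ h]; apply: L1D; first exact: (h t).1.
by apply: eq_L1 (h (- t)).1 => w; rewrite mulNr.
Qed.

Lemma sqr_le_exp (x : R) : x ^+ 2 <= 2 * (expR x + expR (- x)).
Proof.
have := expR_ge1Dxn 1 (normr_ge0 x); rewrite real_normK ?num_real// => h.
rewrite (_ : (2`!%:R : R) = 2) // in h.
by have := expR_cosh x; lra.
Qed.

Lemma gmgf_sqr Y m v : gmgf P Y m v -> L1 (fun w => Y w ^+ 2).
Proof.
move=> gY; have [mY _ _] := gY; apply: L1_le (L1Z 2 (gmgf_cosh 1 gY)).
  exact: measurable_funX.
by move=> w; rewrite ger0_norm ?sqr_ge0// mul1r sqr_le_exp.
Qed.

Lemma L1_sqr Y : measurable_fun setT Y -> L1 (fun w => Y w ^+ 2) -> L1 Y.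
Proof.
move=> mY l2; apply: L1_le (L1D (L1_cst 1) l2) => // w.
by rewrite ler_norml; apply/andP; split; nra.
Qed.

Lemma L1_mul Y Z : measurable_fun setT Y -> measurable_fun setT Z ->
  L1 (fun w => Y w ^+ 2) -> L1 (fun w => Z w ^+ 2) -> L1 (fun w => Y w * Z w).
Proof.
move=> mY mZ lY lZ; apply: L1_le (L1D lY lZ); first exact: measurable_funM.
by move=> w; rewrite ler_norml; apply/andP; split; nra.
Qed.

(** The quotients [q n] converge to [Y] under a common exponential bound, and their first two
    moments are explicit in the exponential moments; their limits give mean and variance. *)
Lemma gmgf_moments Y m v : gmgf P Y m v -> gmean Y = m /\ gcov Y Y = v.
Proof.
move=> gY; have [mY v0 h] := gY.
pose q n w := n.+1%:R * (expR (n.+1%:R^-1 * Y w) - 1).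
have ch := @cvg_harmonic R.
have mq n : measurable_fun setT (q n).
  by apply: measurable_funM => //; apply: measurable_funB => //; exact: measurable_expZ.
have qb n w : `|q n w| <= expR (2 * Y w) + expR (- (2 * Y w)).
  apply: le_trans (diffq_bound _ _) _.
  by apply: le_trans _ (expR_cosh _); rewrite normrM ger0_norm.
have qb2 n w : `|q n w ^+ 2| <= expR (4 * Y w) + expR (- (4 * Y w)).
  rewrite normrX; apply: le_trans (lerXn2r _ _ _ (diffq_bound _ _)) _; rewrite ?nnegrE ?expR_ge0//.
  rewrite -expRM_natr; apply: le_trans _ (expR_cosh _).
  by rewrite normrM (ger0_norm (ler0n _ 4)) ler_expR mulrAC ler_wpM2r//; lra.
have cq w : q n w @[n --> \oo] --> Y w by exact: diffq_cvg.
pose a n : R := m + n.+1%:R^-1 * (v / 2).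
have aE n : n.+1%:R^-1 * m + n.+1%:R^-1 ^+ 2 * v / 2 = n.+1%:R^-1 * a n by rewrite /a; ring.
have ca : a n @[n --> \oo] --> m.
  rewrite -[X in _ --> X]addr0 -[X in _ + X](mul0r (v / 2)).
  by apply: cvgD; [exact: cvg_cst|apply: cvgMl; exact: ch].
have lq n : L1 (q n) by apply: L1_le (mq n) (qb n) (gmgf_cosh 2 gY).
have lq2 n : L1 (fun w => q n w ^+ 2).
  by apply: L1_le (qb2 n) (gmgf_cosh 4 gY); exact: measurable_funX.
have Eq n : \int[P]_w q n w = n.+1%:R * (expR (n.+1%:R^-1 * a n) - 1).
  rewrite EEZ; last by apply: L1B; [exact: (h _).1|exact: L1_cst].
  rewrite EEB; [|exact: (h _).1|exact: L1_cst].
  by rewrite EE_cst (h _).2 aE.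
have cE : (n.+1%:R * (expR (n.+1%:R^-1 * a n) - 1)) @[n --> \oo] --> m.
  rewrite (_ : (fun n => _) = fun n => (n.+1%:R^-1)^-1 * (expR (n.+1%:R^-1 * a n) - 1)).
    by apply: expm1_div_cvg => //; exact: cvg_harmonic.
  by apply/funext => n; rewrite invrK.
have [_ c1] := dct lq cq qb (gmgf_cosh 2 gY).
have mE : gmean Y = m.
  apply: cvg_unique c1 _ => //; rewrite (_ : (fun n => _) = fun n => n.+1%:R * (expR (n.+1%:R^-1 * a n) - 1)) //.
  exact/funext.
split => //; rewrite /gcov mE.
have cq2 w : q n w ^+ 2 @[n --> \oo] --> Y w ^+ 2.
  by rewrite expr2; apply: cvgM; exact: cq.
have [_ c2] := dct lq2 cq2 qb2 (gmgf_cosh 4 gY).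
have Eq2 n : \int[P]_w (q n w ^+ 2) = (n.+1%:R * (expR (n.+1%:R^-1 * a n) - 1)) ^+ 2 +
   expR (n.+1%:R^-1 * a n) ^+ 2 * ((n.+1%:R^-1 ^+ 2)^-1 * (expR (n.+1%:R^-1 ^+ 2 * v) - 1)).
  have -> : \int[P]_w (q n w ^+ 2) = \int[P]_w (n.+1%:R ^+ 2 * (expR (2 * n.+1%:R^-1 * Y w) + (-2 * expR (n.+1%:R^-1 * Y w) + 1))).
    apply: eq_EE => w; rewrite /q exprMn; congr (_ * _).
    by rewrite -[2 * _ * _]mulrA mulr2n mulrDl mul1r expRD; ring.
  have l1 := (h (n.+1%:R^-1)).1; have l2 := (h (2 * n.+1%:R^-1)).1.
  rewrite EEZ; last by apply: L1D => //; apply: L1D; [exact: L1Z|exact: L1_cst].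
  rewrite EED//; last by apply: L1D; [exact: L1Z|exact: L1_cst].
  rewrite EED; [|exact: L1Z|exact: L1_cst].
  rewrite EEZ// EE_cst !(h _).2 aE.
  have -> : 2 * n.+1%:R^-1 * m + (2 * n.+1%:R^-1) ^+ 2 * v / 2 = n.+1%:R^-1 * a n + n.+1%:R^-1 * a n + n.+1%:R^-1 ^+ 2 * v.
    by rewrite /a; field.
  rewrite !expRD; set E1 := expR (_ * a n); set E2 := expR _.
  have -> : (n.+1%:R^-1 ^+ 2)^-1 = n.+1%:R ^+ 2 :> R by rewrite exprVn invrK.
  by move: (n.+1%:R : R) E1 E2 => N E1 E2; ring.
have cE2 : expR (n.+1%:R^-1 * a n) @[n --> \oo] --> (1 : R).
  rewrite -[X in _ --> X](@expR0 R) -[X in _ --> expR X](mul0r m).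
  apply: (cvg_comp _ expR); last exact: continuous_expR.
  by apply: cvgM => //; exact: ch.
have c3 : \int[P]_w (q n w ^+ 2) @[n --> \oo] --> m ^+ 2 + 1 ^+ 2 * v.
  rewrite (_ : (fun n => _) = fun n => (n.+1%:R * (expR (n.+1%:R^-1 * a n) - 1)) ^+ 2 +
   expR (n.+1%:R^-1 * a n) ^+ 2 * ((n.+1%:R^-1 ^+ 2)^-1 * (expR (n.+1%:R^-1 ^+ 2 * v) - 1))); last exact/funext.
  apply: cvgD; first by rewrite expr2; apply: cvgM.
  apply: cvgM; first by rewrite expr2; apply: cvgM.
  apply: (@expm1_div_cvg R (fun n => n.+1%:R^-1 ^+ 2) (fun=> v)) => [n||]; last exact: cvg_cst.
    by rewrite exprn_gt0// invr_gt0.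
  by rewrite -[X in _ --> X](mulr0 0); apply: cvgM; exact: ch.
rewrite -expr2 (_ : \int[P]_w (Y w * Y w) = m ^+ 2 + 1 ^+ 2 * v); first by ring.
by rewrite (eq_EE _ (fun w => esym (expr2 (Y w)))); exact: cvg_unique c2 c3.
Qed.

End GaussMoments.

(** * Pointwise limits of Gaussian variables *)

Section GaussLimit.
Context {dT : measure_display} {T : measurableType dT} {R : realType}.
Variable P : probability T R.
Local Notation L1 := (L1 P).
Implicit Types X Y Z : T -> R.

(* Paley-Zygmund applied to [expR (s * Y)]. *)
Lemma gmgf_tight Y (m v K : R) (B : set T) : gmgf P Y m v -> 0 < K -> measurable B ->
  (forall w, ~ B w -> `|Y w| <= K) -> \int[P]_w (\1_B w) <= expR (- 4) / 4 ->
  `|m| <= 2 * K /\ v <= 4 * K ^+ 2.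
Proof.
move=> [mY v0 h] K0 mB hB PB.
have lB : L1 \1_B.
  apply: L1_le (L1_cst P 1); first exact: measurable_indic.
  by move=> w; rewrite indicE; case: (w \in B); rewrite ?normr1 ?normr0.
have key s : s ^+ 2 * v <= 4 -> s * m + s ^+ 2 * v / 2 <= 1 + `|s| * K.
  move=> sv; pose x := expR (s * m + s ^+ 2 * v / 2).
  have x0 : 0 < x := expR_gt0 _.
  have e2E : expR (2 * s * m + (2 * s) ^+ 2 * v / 2) = x ^+ 2 * expR (s ^+ 2 * v).
    by rewrite /x -expRM_natl -expRD; congr expR; field.
  have e2 : expR (s ^+ 2 * v) <= expR 4 by rewrite ler_expR.
  have e4 : expR (- 4) * expR 4 = 1 :> R by rewrite -expRD addNr expR0.
  have e40 : 0 < expR 4 :> R := expR_gt0 _.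
  (* [la] balances the two terms of [y <= la / 2 * y ^+ 2 + 1 / (2 * la)] on [B]: since [B] has
     measure at most [expR (- 4) / 4], each contributes at most [x / 4], which leaves
     [x <= 2 * expR (|s| * K)]. *)
  pose la := (2 * x * expR 4)^-1; have la0 : 0 < la by rewrite invr_gt0 !mulr_gt0.
  have laE : la * (2 * x * expR 4) = 1 by rewrite mulVf// gt_eqF// !mulr_gt0.
  have lW := (h s).1; have lW2 := (h (2 * s)).1.
  have bnd w : expR (s * Y w) <= expR (`|s| * K) + (la / 2 * expR (2 * s * Y w) + (2 * la)^-1 * \1_B w).
    have a0 := expR_gt0 (`|s| * K); have y0 := expR_gt0 (s * Y w).
    have -> : expR (2 * s * Y w) = expR (s * Y w) ^+ 2.
      by rewrite -expRM_natl mulrA.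
    rewrite indicE; have [wB|wB] := pselect (B w).
      rewrite (mem_set wB) mulr1; move: y0; set y := expR (s * Y w) => y0.
      have : 0 <= (la * y - 1) ^+ 2 * (2 * la)^-1 by rewrite mulr_ge0 ?sqr_ge0// invr_ge0 mulr_ge0// ltW.
      have -> : (la * y - 1) ^+ 2 * (2 * la)^-1 = la / 2 * y ^+ 2 + (2 * la)^-1 - y.
        by field; rewrite gt_eqF.
      lra.
    rewrite (memNset wB) mulr0 addr0.
    have : expR (s * Y w) <= expR (`|s| * K).
      rewrite ler_expR; apply: le_trans (ler_norm _) _; rewrite normrM ler_wpM2l//; exact: hB.
    have : 0 <= la / 2 * expR (s * Y w) ^+ 2 by rewrite !mulr_ge0 ?sqr_ge0// ltW.
    lra.
  have lR : L1 (fun w => la / 2 * expR (2 * s * Y w) + (2 * la)^-1 * \1_B w).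
    by apply: L1D; exact: L1Z.
  have := EE_le lW (L1D (L1_cst P (expR (`|s| * K))) lR) bnd.
  rewrite EED//; last exact: L1_cst.
  rewrite EED; [|exact: L1Z|exact: L1Z].
  rewrite !EEZ// EE_cst !(h _).2 e2E -/x => hx.
  have h1 : la / 2 * (x ^+ 2 * expR (s ^+ 2 * v)) <= x / 4.
    apply: (@le_trans _ _ (la / 2 * (x ^+ 2 * expR 4))).
      by rewrite !ler_wpM2l ?sqr_ge0// ?mulr_ge0// ltW.
    have -> : la / 2 * (x ^+ 2 * expR 4) = x / 4 * (la * (2 * x * expR 4)) by field.
    by rewrite laE mulr1.
  have h2 : (2 * la)^-1 * \int[P]_w (\1_B w) <= x / 4.
    have -> : (2 * la)^-1 = x * expR 4 by rewrite /la invfM invrK; field.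
    apply: (@le_trans _ _ (x * expR 4 * (expR (- 4) / 4))).
      by rewrite ler_wpM2l// mulr_ge0// ltW.
    by rewrite -mulrA [expR 4 * _]mulrA [expR 4 * _]mulrC e4 mul1r.
  have : x <= 2 * expR (`|s| * K) by lra.
  move=> hx2; rewrite -ler_expR -/x expRD; apply: le_trans hx2 _.
  rewrite ler_wpM2r ?expR_ge0//; have := expR_ge1Dx (1 : R); lra.
have vK : v <= 4 * K ^+ 2.
  rewrite leNgt; apply/negP => vK.
  have {}v0 : 0 < v by apply: le_lt_trans vK; rewrite mulr_ge0// sqr_ge0.
  (* The bound [key] at [2 / r] and at [- (2 / r)], once added, is free of the mean; each has
     [s ^+ 2 * v = 4], the largest value allowed. *)
  pose r := Num.sqrt v; have r0 : 0 < r by rewrite sqrtr_gt0.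
  have rv : r ^+ 2 = v by rewrite sqr_sqrtr// ltW.
  have rK : 2 * K < r by rewrite -(ltr_pXn2r (n := 2)) ?nnegrE ?(ltW r0) ?rv// ?exprMn ?mulr_ge0 ?(ltW K0)//; move: vK; lra.
  have rr : r / r = 1 by rewrite divff// gt_eqF.
  have s2 s : s = 2 / r \/ s = - (2 / r) -> s ^+ 2 * v = 4.
    by move=> [->|->]; rewrite ?sqrrN -rv exprMn exprVn mulrAC -mulrA divff ?mulr1 ?expf_neq0 ?gt_eqF//; ring.
  have k1 := key (2 / r); have k2 := key (- (2 / r)).
  rewrite s2 in k1; last by left.
  rewrite s2 in k2; last by right.
  have {}k1 := k1 (lexx _); have {}k2 := k2 (lexx _).
  have r20 : 0 < 2 / r by rewrite divr_gt0.
  rewrite normrN (gtr0_norm r20) in k2; rewrite (gtr0_norm r20) in k1.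
  have : 2 / r * K < 1 by rewrite mulrAC ltr_pdivrMr// mul1r.
  rewrite mulNr in k2; move: k1 k2; set u := _ * m; lra.
split => //.
have ks s : s = K^-1 \/ s = - K^-1 -> s * m <= 2.
  move=> hs; have s2 : s ^+ 2 = K^-1 ^+ 2 by case: hs => ->; rewrite ?sqrrN.
  have sn : `|s| * K = 1.
    by case: hs => ->; rewrite ?normrN gtr0_norm ?invr_gt0// mulVf// gt_eqF.
  have sv : s ^+ 2 * v <= 4.
    by rewrite s2 exprVn ler_pdivrMl ?exprn_gt0// mulrC.
  have := key s sv; rewrite sn.
  have : 0 <= s ^+ 2 * v / 2 by rewrite mulr_ge0// mulr_ge0// sqr_ge0.
  lra.
have k1 := ks _ (or_introl erefl); have k2 := ks _ (or_intror erefl).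
rewrite mulNr in k2; rewrite -ler_pdivrMr// -(ger0_norm (ltW K0)) -normf_div ler_norml mulrC.
by move: k1 k2; set u := _ * m; lra.
Qed.

Lemma measurable_normgt Y (a : R) : measurable_fun setT Y -> measurable (setT `&` [set w | a < `|Y w|]).
Proof.
move=> mY.
have mN : measurable_fun setT (fun w => `|Y w|) by exact: (measurableT_comp (@normr_measurable R setT)).
have := mN measurableT _ (measurable_itv `]a, +oo[).
by congr measurable; congr setI; apply/seteqP; split => w /=; rewrite in_itv /= andbT.
Qed.

Lemma L1_lim_bound (f_ : nat -> T -> R) (f : T -> R) (C : R) : (forall n, L1 (f_ n)) ->
  (forall n w, 0 <= f_ n w) -> (forall w, f_ n w @[n --> \oo] --> f w) ->
  (forall n, \int[P]_w f_ n w <= C) -> L1 f /\ \int[P]_w f w <= C.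
Proof.
move=> lf f0 cf fC.
have mf : measurable_fun setT f by apply: meas_lim cf => n; exact: L1_meas (lf n).
have f_ge0 w : 0 <= f w.
  by apply: (ler_cvg_to (cvg_cst 0) (cf w)); apply: nearW => n; exact: f0.
have le_C : (\int[P]_w (f w)%:E <= C%:E)%E.
  have mEf n : measurable_fun setT (fun w => (f_ n w)%:E) by apply/measurable_EFinP; exact: L1_meas (lf n).
  have Ef0 n w : setT w -> (0 <= (f_ n w)%:E)%E by rewrite lee_fin.
  have := fatou P measurableT mEf Ef0.
  rewrite (_ : (\int[P]_x limn_einf _)%E = (\int[P]_w (f w)%:E)%E); last first.
    apply: eq_integral => w _; apply: (cvg_limn_einf_sup _).1.
    by apply: cvg_EFin; [exact: nearW|exact: cf].
  move=> H; apply: le_trans H _.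
  rewrite limn_einf_lim; apply: lime_le; first exact: is_cvg_einfs.
  apply: nearW => n; apply: (@le_trans _ _ (\int[P]_w (f_ n w)%:E)%E); last by rewrite (EE_fin (lf n)) lee_fin.
  by apply: ereal_inf_lbound; exists n => /=.
have lF : L1 f by apply: L1_fin_ge0 => //; apply: le_lt_trans le_C (ltry _).
by split => //; rewrite -lee_fin -(EE_fin lF).
Qed.

Lemma cvg_bounded (u : nat -> R) (l : R) : u n @[n --> \oo] --> l -> exists K : R, forall n, `|u n| <= K.
Proof.
move=> cu; have /cvg_seq_bounded[M [Mr hM]] : cvgn u by apply/cvg_ex; exists l.
by exists (M + 1) => n; apply: (hM (M + 1)) => //; rewrite ltrDl.
Qed.

Lemma dist_chain (a b c e u : R) : `|a - b| <= u / 4 -> `|c - e| <= u / 4 -> `|b - e| <= u / 2 -> `|a - c| <= u.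
Proof. by rewrite !ler_distl => /andP[? ?] /andP[? ?] /andP[? ?]; apply/andP; split; lra. Qed.

(** Convergent sequences are bounded, so the events [B k] shrink to the empty set and [gmgf_tight]
    bounds all means and variances. Exponential moments are then uniformly integrable and converge;
    their logarithms at 1 and -1 give the limits of [m_] and [v_]. *)
Lemma gmgf_lim (Y_ : nat -> T -> R) (m_ v_ : nat -> R) Y : (forall n, gmgf P (Y_ n) (m_ n) (v_ n)) ->
  (forall w, Y_ n w @[n --> \oo] --> Y w) ->
  exists m v, [/\ gmgf P Y m v, m_ n @[n --> \oo] --> m & v_ n @[n --> \oo] --> v].
Proof.
move=> gY cY.
have mY n : measurable_fun setT (Y_ n) by have [] := gY n.
have mYl : measurable_fun setT Y by exact: meas_lim cY.
pose B k := \bigcup_n [set w | k.+1%:R < `|Y_ n w|].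
have mB k : measurable (B k).
  apply: bigcup_measurable => n _; rewrite -[X in measurable X]setTI.
  exact: measurable_normgt (mY n).
have lB k : L1 \1_(B k).
  apply: L1_le (L1_cst P 1); first exact: measurable_indic.
  by move=> w; rewrite indicE; case: (w \in _); rewrite ?normr1 ?normr0.
have [_ cB] : L1 (fun=> 0) /\ \int[P]_w (\1_(B k) w) @[k --> \oo] --> \int[P]_w 0.
  apply: (dct lB (g := fun=> 1)) => [w|k w|]; last exact: L1_cst.
    have [K hK] := cvg_bounded (cY w).
    apply/cvgrPdist_le => e e0; exists (Num.truncn K) => // k /= Kk.
    rewrite indicE memNset ?subrr ?normr0 ?(ltW e0)// => -[n _ /=].
    apply/negP; rewrite -leNgt; apply: le_trans (hK n) _; apply: le_trans (ltW (truncnS_gt _)) _.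
    by rewrite ler_nat ltnS.
  by rewrite indicE; case: (w \in _); rewrite ?normr1 ?normr0.
rewrite EE_cst in cB.
have c0 : 0 < expR (- 4) / 4 :> R by rewrite divr_gt0 ?expR_gt0.
have [k0 _ hk] : \forall k \near \oo, `|0 - \int[P]_w (\1_(B k) w)| <= expR (- 4) / 4.
  by have /cvgrPdist_le := cB; apply.
pose K : R := k0.+1%:R; have K0 : 0 < K by [].
have PB : \int[P]_w (\1_(B k0) w) <= expR (- 4) / 4.
  by have := hk k0 (leqnn _); rewrite /= sub0r normrN; apply: le_trans; exact: ler_norm.
have tight n : `|m_ n| <= 2 * K /\ v_ n <= 4 * K ^+ 2.
  apply: (gmgf_tight (gY n) K0 (mB k0) _ PB) => w wB.
  by rewrite leNgt; apply/negP => h; apply: wB; exists n.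
pose C (t : R) := `|t| * (2 * K) + t ^+ 2 * (2 * K ^+ 2).
have aC t n : `|t * m_ n + t ^+ 2 * v_ n / 2| <= C t.
  have [h1 h2] := tight n; have [_ v0 _] := gY n.
  apply: le_trans (ler_normD _ _) (lerD _ _); first by rewrite normrM ler_wpM2l.
  rewrite ger0_norm; last by rewrite mulr_ge0// mulr_ge0// sqr_ge0.
  by rewrite -mulrA ler_wpM2l ?sqr_ge0//; lra.
have EC t n : \int[P]_w expR (t * Y_ n w) <= expR (C t).
  by have [_ _ h] := gY n; rewrite (h t).2 ler_expR; apply: le_trans (ler_norm _) (aC _ _).
have lY t n : L1 (fun w => expR (t * Y_ n w)) by have [_ _ h] := gY n; exact: (h t).1.
have ce t w : expR (t * Y_ n w) @[n --> \oo] --> expR (t * Y w).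
  have c1 : t * Y_ n w @[n --> \oo] --> t * Y w by apply: cvgMr; exact: cY.
  by apply: (cvg_comp _ expR c1); exact: continuous_expR.
have lim t : L1 (fun w => expR (t * Y w)) /\ \int[P]_w expR (t * Y w) <= expR (C t).
  by apply: (L1_lim_bound (lY t)) (EC t) => // n w; exact: expR_ge0.
(* [x / (1 + de * x)] is bounded and within [de * x^2] of [x]: uniform integrability. *)
have cE t : \int[P]_w expR (t * Y_ n w) @[n --> \oo] --> \int[P]_w expR (t * Y w).
  apply/cvgrPdist_le => e e0.
  pose D := expR (C (2 * t)); have D0 : 0 < D := expR_gt0 _.
  pose de := e / (4 * D); have de0 : 0 < de by rewrite divr_gt0// mulr_gt0.
  pose g (x : R) := x / (1 + de * x).
  have pos x : 0 <= x -> 0 < 1 + de * x by move=> x0; rewrite ltr_pwDl// mulr_ge0// ltW.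
  have gx x : 0 <= x -> 0 <= x - g x <= de * x ^+ 2.
    move=> x0; have px := pos x x0; have -> : x - g x = de * x ^+ 2 / (1 + de * x) by rewrite /g; field; rewrite gt_eqF.
    have xx : 0 <= de * x ^+ 2 by rewrite mulr_ge0 ?sqr_ge0// ltW.
    rewrite (divr_ge0 xx (ltW px)) /= ler_pdivrMr// ler_peMr// lerDl mulr_ge0//; exact: ltW.
  have g0 x : 0 <= x -> 0 <= g x <= de^-1.
    move=> x0; have px := pos x x0; rewrite (divr_ge0 x0 (ltW px)) /= ler_pdivrMr// mulrDr mulr1 mulrA mulVf ?gt_eqF// mul1r.
    by rewrite lerDr invr_ge0 ltW.
  have gm Z : measurable_fun setT Z -> measurable_fun setT (fun w => g (expR (t * Z w))).
    move=> mZ; have : continuous (fun u : R => g (expR (t * u))).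
      move=> u; have cu : expR (t * x) @[x --> u] --> expR (t * u).
        have c1 : t * x @[x --> u] --> t * u by apply: cvgMr; exact: cvg_id.
        by apply: (cvg_comp _ expR c1); exact: continuous_expR.
      have nz : 1 + de * expR (t * u) != 0 by rewrite gt_eqF// pos ?expR_ge0.
      apply: cvgM => //; apply: cvgV => //; apply: cvgD; first exact: cvg_cst.
      exact: cvgMr.
    by move=> /continuous_measurable_fun mg; exact: (measurableT_comp mg).
  have lg Z : measurable_fun setT Z -> L1 (fun w => g (expR (t * Z w))).
    move=> mZ; apply: L1_le (L1_cst P de^-1); first exact: gm.
    by move=> w; have /andP[? ?] := g0 _ (expR_ge0 (t * Z w)); rewrite ger0_norm.
  have gap Z : measurable_fun setT Z -> L1 (fun w => expR (t * Z w)) -> L1 (fun w => expR (2 * t * Z w)) ->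
      \int[P]_w expR (2 * t * Z w) <= D -> `|\int[P]_w expR (t * Z w) - \int[P]_w g (expR (t * Z w))| <= e / 4.
    move=> mZ l1 l2 h2; have l3 := lg Z mZ; rewrite -EEB//.
    have h3 w := gx _ (expR_ge0 (t * Z w)).
    rewrite ger0_norm; last by apply: EE_ge0 => w; have /andP[] := h3 w.
    apply: (@le_trans _ _ (\int[P]_w (de * expR (2 * t * Z w)))).
      apply: EE_le; [exact: L1B|exact: L1Z|move=> w].
      have /andP[_] := h3 w; by rewrite -expRM_natl mulrA.
    rewrite EEZ//; apply: (@le_trans _ _ (de * D)); first by rewrite ler_wpM2l// ltW.
    by rewrite /de (_ : e / (4 * D) * D = e / 4)//; field; rewrite gt_eqF.
  have [_ cg] : L1 (fun w => g (expR (t * Y w))) /\ \int[P]_w g (expR (t * Y_ n w)) @[n --> \oo] --> \int[P]_w g (expR (t * Y w)).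
    apply: (dct (fun n => lg _ (mY n)) (g := fun=> de^-1)) => [w|n w|]; last exact: L1_cst.
      have nz : 1 + de * expR (t * Y w) != 0 by rewrite gt_eqF// pos ?expR_ge0.
      apply: cvgM => //; apply: cvgV => //; apply: cvgD; first exact: cvg_cst.
      exact: cvgMr.
    by have /andP[? ?] := g0 _ (expR_ge0 (t * Y_ n w)); rewrite ger0_norm.
  have e2 : 0 < e / 2 by rewrite divr_gt0.
  have /cvgrPdist_le/(_ _ e2)[N _ hN] := cg; exists N => // n /hN /=.
  have := gap _ (mY n) (lY t n) (lY (2 * t) n) (EC (2 * t) n).
  have := gap _ mYl (lim t).1 (lim (2 * t)).1 (lim (2 * t)).2.
  by move=> h1 h2 h3; exact: dist_chain h1 h2 h3.
have Ee n t : \int[P]_w expR (t * Y_ n w) = expR (t * m_ n + t ^+ 2 * v_ n / 2).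
  by have [_ _ h] := gY n; exact: (h t).2.
have Epos t : 0 < \int[P]_w expR (t * Y w).
  apply: (@lt_le_trans _ _ (expR (- C t))); first exact: expR_gt0.
  apply: (ler_cvg_to (cvg_cst _) (cE t)); apply: nearW => n.
  by rewrite Ee ler_expR; have := aC t n; rewrite ler_norml => /andP[].
have ca t : t * m_ n + t ^+ 2 * v_ n / 2 @[n --> \oo] --> ln (\int[P]_w expR (t * Y w)).
  have h := cvg_comp _ (@ln R) (cE t) (continuous_ln (Epos t)).
  rewrite (_ : (fun n => _) = (fun n => ln (\int[P]_w expR (t * Y_ n w)))); first exact: h.
  by apply/funext => n; rewrite Ee expRK.
pose l1 := ln (\int[P]_w expR (1 * Y w)); pose l2 := ln (\int[P]_w expR (-1 * Y w)).
have cm : m_ n @[n --> \oo] --> (l1 - l2) / 2.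
  rewrite (_ : m_ = fun n => ((1 * m_ n + 1 ^+ 2 * v_ n / 2) - (-1 * m_ n + (-1) ^+ 2 * v_ n / 2)) / 2).
    by apply: cvgMl; apply: cvgB; exact: ca.
  by apply/funext => n; field.
have cv : v_ n @[n --> \oo] --> l1 + l2.
  rewrite (_ : v_ = fun n => ((1 * m_ n + 1 ^+ 2 * v_ n / 2) + (-1 * m_ n + (-1) ^+ 2 * v_ n / 2))).
    by apply: cvgD; exact: ca.
  by apply/funext => n; field.
exists ((l1 - l2) / 2), (l1 + l2); split => //; split => //.
  by apply: (ler_cvg_to (cvg_cst 0) cv); apply: nearW => n; have [] := gY n.
move=> t; split; first exact: (lim t).1.
apply: cvg_unique (cE t) _ => //.
rewrite (_ : (fun n => _) = (fun n => expR (t * m_ n + t ^+ 2 * v_ n / 2))); last by apply/funext => n.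
have c1 : t * m_ n + t ^+ 2 * v_ n / 2 @[n --> \oo] --> t * ((l1 - l2) / 2) + t ^+ 2 * (l1 + l2) / 2.
  by apply: cvgD; [exact: cvgMr|apply: cvgMl; exact: cvgMr].
by apply: (cvg_comp _ expR c1); exact: continuous_expR.
Qed.

End GaussLimit.

(** * Gaussian spaces and the Cameron-Martin formula *)

Section GaussSpace.
Context {dT : measure_display} {T : measurableType dT} {R : realType}.
Variable P : probability T R.
Local Notation L1 := (L1 P).
Local Notation mean := (gmean P).
Local Notation cov := (gcov P).
Implicit Types X Y Z : T -> R.

Lemma gmgfE Y m v : gmgf P Y m v -> gmgf P Y (mean Y) (cov Y Y).
Proof. by move=> g; have [-> ->] := gmgf_moments g. Qed.

Lemma gmgf_addc Y m v c : gmgf P Y m v -> gmgf P (fun w => Y w + c) (m + c) v.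
Proof.
move=> [mY v0 h]; split => // [|t]; first exact: measurable_funD.
have E w : expR (t * (Y w + c)) = expR (t * c) * expR (t * Y w).
  by rewrite -expRD mulrDr addrC.
split; first by apply: eq_L1 (L1Z (expR (t * c)) (h t).1) => w; rewrite E.
under eq_EE do rewrite E; rewrite EEZ; last exact: (h t).1.
by rewrite (h t).2 -expRD; congr expR; ring.
Qed.

(** Joint Gaussianity is encoded by closure under linear combinations: every combination of members
    is again Gaussian. *)
Record gspace (V : (T -> R) -> Prop) : Prop := GSpace {
  gs_gauss : forall Y, V Y -> exists m v, gmgf P Y m v;
  gs_zero : V (fun=> 0);
  gs_comb : forall a b Y Z, V Y -> V Z -> V (fun w => a * Y w + b * Z w)
}.

Section Space.
Variable V : (T -> R) -> Prop.
Hypothesis gV : gspace V.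

Lemma gs_mgf Y : V Y -> gmgf P Y (mean Y) (cov Y Y).
Proof. by move=> /(gs_gauss gV)[m [v /gmgfE]]. Qed.

Lemma gs_meas Y : V Y -> measurable_fun setT Y.
Proof. by move=> /gs_mgf[]. Qed.

Lemma gs_L1 Y : V Y -> L1 Y.
Proof. by move=> VY; apply: L1_sqr (gs_meas VY) (gmgf_sqr (gs_mgf VY)). Qed.

Lemma gs_L1M Y Z : V Y -> V Z -> L1 (fun w => Y w * Z w).
Proof.
by move=> VY VZ; apply: L1_mul (gs_meas VY) (gs_meas VZ) (gmgf_sqr (gs_mgf VY)) (gmgf_sqr (gs_mgf VZ)).
Qed.

Lemma gs_scale a Y : V Y -> V (fun w => a * Y w).
Proof. by move=> VY; have := gs_comb gV a 0 VY VY; under eq_fun do rewrite mul0r addr0. Qed.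

Lemma gs_add Y Z : V Y -> V Z -> V (fun w => Y w + Z w).
Proof. by move=> VY VZ; have := gs_comb gV 1 1 VY VZ; under eq_fun do rewrite !mul1r. Qed.

Lemma gs_sum (J : Type) (s : seq J) (F : J -> T -> R) : (forall i, V (F i)) -> V (fun w => \sum_(i <- s) F i w).
Proof.
move=> VF; elim: s => [|i s ih]; first by under eq_fun do rewrite big_nil; exact: gs_zero gV.
by under eq_fun do rewrite big_cons; exact: gs_add.
Qed.

Lemma covC Y Z : cov Y Z = cov Z Y.
Proof. by rewrite /gcov [mean Z * _]mulrC; congr (_ - _); apply: eq_EE => w; rewrite mulrC. Qed.

Lemma mean_comb a b Y Z : V Y -> V Z -> mean (fun w => a * Y w + b * Z w) = a * mean Y + b * mean Z.
Proof.
move=> VY VZ; rewrite /gmean EED ?EEZ//; try exact: gs_L1.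
  by apply: L1Z; exact: gs_L1.
by apply: L1Z; exact: gs_L1.
Qed.

Lemma cov_comb a b X Y Z : V X -> V Y -> V Z ->
  cov (fun w => a * X w + b * Y w) Z = a * cov X Z + b * cov Y Z.
Proof.
move=> VX VY VZ; rewrite /gcov mean_comb//.
rewrite (@eq_EE _ _ _ _ _ (fun w => a * (X w * Z w) + b * (Y w * Z w))); last by move=> w; ring.
rewrite EED; [|apply: L1Z; exact: gs_L1M|apply: L1Z; exact: gs_L1M].
by rewrite !EEZ; [ring|exact: gs_L1M|exact: gs_L1M].
Qed.

Lemma cov_combr a b X Y Z : V X -> V Y -> V Z ->
  cov Z (fun w => a * X w + b * Y w) = a * cov Z X + b * cov Z Y.
Proof. by move=> VX VY VZ; rewrite covC cov_comb// ![cov _ Z]covC. Qed.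

Lemma cov_sum (J : Type) (s : seq J) (F : J -> T -> R) Z : (forall i, V (F i)) -> V Z ->
  cov (fun w => \sum_(i <- s) F i w) Z = \sum_(i <- s) cov (F i) Z.
Proof.
move=> VF VZ; elim: s => [|i s ih].
  have := cov_comb 0 0 VZ VZ VZ; rewrite !mul0r addr0 big_nil.
  rewrite (_ : (fun w => 0 * Z w + 0 * Z w) = (fun w => \sum_(i <- [::]) F i w)) //.
  by apply/funext => w; rewrite big_nil !mul0r addr0.
have := cov_comb 1 1 (VF i) (gs_sum s VF) VZ; rewrite !mul1r ih big_cons => <-.
by congr (gcov P _ _); apply/funext => w; rewrite big_cons !mul1r.
Qed.

Lemma cov_scale a Y Z : V Y -> V Z -> cov (fun w => a * Y w) Z = a * cov Y Z.
Proof.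
move=> VY VZ; have := cov_comb a 0 VY VY VZ; rewrite mul0r addr0 => <-.
by congr (gcov P _ _); apply/funext => w; rewrite mul0r addr0.
Qed.

Lemma cov_polar Y Z : V Y -> V Z ->
  cov Y Z = (cov (fun w => Y w + Z w) (fun w => Y w + Z w) - cov Y Y - cov Z Z) / 2.
Proof.
move=> VY VZ; rewrite (_ : (fun w => Y w + Z w) = fun w => 1 * Y w + 1 * Z w); last first.
  by apply/funext => w; rewrite !mul1r.
have VYZ := gs_comb gV 1 1 VY VZ.
by rewrite cov_comb// !cov_combr// [cov Z Y]covC; field.
Qed.

(** Polarisation reduces covariances to variances, whose convergence is part of [gmgf_lim]. *)
Lemma cov_lim (Y_ : nat -> T -> R) Y Z : (forall n, V (Y_ n)) -> V Y -> V Z ->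
  (forall w, Y_ n w @[n --> \oo] --> Y w) -> cov (Y_ n) Z @[n --> \oo] --> cov Y Z.
Proof.
move=> VYn VY VZ cY.
have vlim (U_ : nat -> T -> R) U : (forall n, V (U_ n)) -> (forall w, U_ n w @[n --> \oo] --> U w) ->
    cov (U_ n) (U_ n) @[n --> \oo] --> cov U U.
  move=> VU cU; have [m [v [g _ cv]]] := gmgf_lim (fun n => gs_mgf (VU n)) cU.
  by have [_ ->] := gmgf_moments g.
rewrite cov_polar// (_ : (fun n => cov (Y_ n) Z) = fun n => (cov (fun w => Y_ n w + Z w) (fun w => Y_ n w + Z w) - cov (Y_ n) (Y_ n) - cov Z Z) / 2); last first.
  by apply/funext => n; rewrite cov_polar.
apply: cvgMl; apply: cvgB; last exact: cvg_cst.
apply: cvgB; last exact: vlim.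
apply: vlim => [n|w]; first exact: gs_add.
by apply: cvgD; [exact: cY|exact: cvg_cst].
Qed.

Lemma mean_lim (Y_ : nat -> T -> R) Y : (forall n, V (Y_ n)) ->
  (forall w, Y_ n w @[n --> \oo] --> Y w) -> mean (Y_ n) @[n --> \oo] --> mean Y.
Proof.
move=> VU cU; have [m [v [g cm _]]] := gmgf_lim (fun n => gs_mgf (VU n)) cU.
by have [-> _] := gmgf_moments g.
Qed.

(** A single step of sequential closure; derivatives of order [n] of a field are reached by
    iterating it [n] times. *)
Definition gclos Y := exists2 Y_ : nat -> T -> R, (forall n, V (Y_ n)) & forall w, Y_ n w @[n --> \oo] --> Y w.

Lemma gclos_sub Y : V Y -> gclos Y.
Proof. by move=> VY; exists (fun=> Y) => // w; exact: cvg_cst. Qed.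

Lemma gspace_gclos : gspace gclos.
Proof.
split => [Y [Y_ VY cY]||a b Y Z [Y_ VY cY] [Z_ VZ cZ]].
- by have [m [v []]] := gmgf_lim (fun n => gs_mgf (VY n)) cY; exists m, v.
- by apply: gclos_sub; exact: gs_zero gV.
- exists (fun n w => a * Y_ n w + b * Z_ n w) => [n|w]; first exact: gs_comb.
  by apply: cvgD; apply: cvgMr; [exact: cY|exact: cZ].
Qed.

Lemma gspace_centered : gspace (fun Y => exists2 Z, V Z & Y = fun w => Z w - mean Z).
Proof.
split => [_ [Z VZ ->]||a b _ _ [Y VY ->] [Z VZ ->]].
- by exists (mean Z - mean Z), (cov Z Z); apply: gmgf_addc; exact: gs_mgf.
- exists (fun=> 0); first exact: gs_zero gV.
  by apply/funext => w; rewrite /gmean EE_cst subr0.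
- exists (fun w => a * Y w + b * Z w); first exact: gs_comb.
  by apply/funext => w; rewrite mean_comb//; ring.
Qed.

Lemma lin_gs (I : Type) (X : I -> T -> R) s : (forall i, V (X i)) -> V (fun w => lin s (X^~ w)).
Proof. by move=> VX; apply: (gs_sum s (F := fun c w => c.1 * X c.2 w)) => c; exact: gs_scale. Qed.

Section CameronMartin.
Context {I : Type} (X : I -> T -> R) (ze : T -> R).
Hypotheses (VX : forall i, V (X i)) (Vz : V ze).

(** The density that compensates the translation of [X i] by its covariance with [ze]. *)
Definition cmw w := expR (- (ze w - mean ze) - cov ze ze / 2).

(** On exponentials of a linear form [L] both sides are explicit, the right one through the variance
    of [L - ze]; [tm_agree] extends the identity to [tm], in particular to indicators of events
    about countably many coordinates. *)
Lemma cameron_martin f : tm f -> [/\ L1 (fun w => f (X^~ w)), L1 (fun w => cmw w * f (fun i => X i w + cov (X i) ze)) &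
  \int[P]_w f (X^~ w) = \int[P]_w (cmw w * f (fun i => X i w + cov (X i) ze))].
Proof.
move=> tf.
suff : agree P P (fun=> 1) cmw X (fun i w => X i w + cov (X i) ze) f.
  move=> [[_ l1] [_ l2] E]; split => //; first by apply: eq_L1 l1 => w; rewrite mul1r.
  by rewrite -E; apply: eq_EE => w; rewrite mul1r.
apply: tm_agree tf => // [w|s]; first exact: expR_ge0.
have VL := lin_gs s VX; pose L w := lin s (X^~ w); pose c := lin s (fun i => cov (X i) ze).
have covL : cov L ze = c.
  rewrite /L /lin (cov_sum s (F := fun e w => e.1 * X e.2 w))//; last by move=> e; exact: gs_scale.
  by apply: eq_bigr => e _; rewrite cov_scale.
have linE w : lin s (fun i => X i w + cov (X i) ze) = L w + c.
  by rewrite /L /c /lin -big_split; apply: eq_bigr => e _; rewrite mulrDr.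
have VLz : V (fun w => 1 * L w + (-1) * ze w) by exact: gs_comb.
have [mL _ hL] := gs_mgf VL; have [_ _ hLz] := gs_mgf VLz.
have vLz : cov (fun w => 1 * L w + (-1) * ze w) (fun w => 1 * L w + (-1) * ze w) = cov L L - 2 * c + cov ze ze.
  by rewrite cov_comb// !cov_combr// [cov ze L]covC covL; ring.
have l1 := (hL 1).1; have l2 := (hLz 1).1.
have E2 w : cmw w * expR (lin s (fun i => X i w + cov (X i) ze)) = expR (c + mean ze - cov ze ze / 2) * expR (1 * (1 * L w + (-1) * ze w)).
  by rewrite linE /cmw -!expRD; congr expR; ring.
split.
- split; first by rewrite (_ : (fun w => _) = fun w => expR (1 * L w)); [exact: L1_meas l1|apply/funext => w; rewrite mul1r].
  by apply: eq_L1 l1 => w; rewrite !mul1r.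
- split; last by apply: eq_L1 (L1Z (expR (c + mean ze - cov ze ze / 2)) l2) => w; rewrite E2.
  rewrite (_ : (fun w => _) = fun w => expR c * expR (1 * L w)); last by apply/funext => w; rewrite linE mul1r -expRD addrC.
  by apply: measurable_funM => //; exact: L1_meas l1.
- rewrite (@eq_EE _ _ _ _ _ (fun w => expR (1 * L w))); last by move=> w; rewrite !mul1r.
  rewrite (@eq_EE _ _ _ _ (fun w => cmw w * _) _ E2) EEZ// (hL 1).2 (hLz 1).2 -expRD vLz mean_comb//.
  by congr expR; field.
Qed.

End CameronMartin.
End Space.
End GaussSpace.

(** * Fernique's theorem *)

Section Fernique.
Context {dT : measure_display} {T : measurableType dT} {R : realType}.
Variable P : probability T R.
Local Notation PP := (P \x P)%E.
Local Notation mean := (gmean P).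
Local Notation cov := (gcov P).

Lemma prod_int (f g : T -> R) : L1 P f -> L1 P g -> (forall w, 0 <= f w) -> (forall w, 0 <= g w) ->
  L1 PP (fun z => f z.1 * g z.2) /\ \int[PP]_z (f z.1 * g z.2) = \int[P]_w f w * \int[P]_w g w.
Proof.
move=> lf lg f0 g0.
have mfg : measurable_fun setT (fun z : T * T => f z.1 * g z.2).
  by apply: measurable_funM; [exact: (measurableT_comp (L1_meas lf))|exact: (measurableT_comp (L1_meas lg))].
have E : (\int[PP]_z (f z.1 * g z.2)%:E = (\int[P]_w f w * \int[P]_w g w)%:E)%E.
  rewrite fubini_tonelli1//; last 2 first.
  - exact/measurable_EFinP.
  - by move=> z; rewrite lee_fin mulr_ge0.
  rewrite /fubini_F /=.
  transitivity (\int[P]_x ((f x)%:E * (\int[P]_w g w)%:E))%E.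
    apply: eq_integral => x _; under eq_integral do rewrite EFinM.
    rewrite ge0_integralZl ?lee_fin//.
    - by rewrite (EE_fin lg).
    - by apply/measurable_EFinP; exact: L1_meas lg.
    - by move=> y _; rewrite lee_fin.
  rewrite ge0_integralZr//.
  - by rewrite (EE_fin lf).
  - by apply/measurable_EFinP; exact: L1_meas lf.
  - by move=> y _; rewrite lee_fin.
  - by rewrite lee_fin EE_ge0.
split; last by rewrite /Rintegral E.
by apply: L1_fin_ge0 => // [z|]; [exact: mulr_ge0|rewrite E ltry].
Qed.

Variable V : (T -> R) -> Prop.
Hypothesis gV : gspace P V.
Hypothesis Vmean : forall Y, V Y -> mean Y = 0.
Variable X : nat -> T -> R.
Hypothesis VX : forall i, V (X i).
Hypothesis Xbd : forall w, exists M, forall i, `|X i w| <= M.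

Let r2 := Num.sqrt 2 : R.
Let r20 : 0 < r2. Proof. by rewrite sqrtr_gt0. Qed.
Let r2E : r2 ^+ 2 = 2. Proof. by rewrite sqr_sqrtr. Qed.
Let r2V : r2^-1 = r2 / 2. Proof. by rewrite -r2E; field; rewrite gt_eqF. Qed.

(** Two independent copies of the sequence, and below their rotation by 45 degrees; centring makes
    the law of the pair invariant under it. *)
Let Y1 (i : nat + nat) (z : T * T) := match i with inl i => X i z.1 | inr i => X i z.2 end.
Let Y2 (i : nat + nat) (z : T * T) :=
  match i with inl i => (X i z.1 - X i z.2) / r2 | inr i => (X i z.1 + X i z.2) / r2 end.

Let lin_cons (I : Type) c (i : I) s (y : I -> R) : lin ((c, i) :: s) y = c * y i + lin s y.
Proof. by rewrite /lin big_cons. Qed.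

Let split_lin (s : seq (R * (nat + nat))) : exists A B, [/\ V A, V B,
  forall z, lin s (Y1^~ z) = A z.1 + B z.2 &
  forall z, lin s (Y2^~ z) = (r2^-1 * A z.1 + r2^-1 * B z.1) + (- r2^-1 * A z.2 + r2^-1 * B z.2)].
Proof.
elim: s => [|[c i] s [A [B [VA VB h1 h2]]]].
  exists (fun=> 0), (fun=> 0); split; [exact: gs_zero gV|exact: gs_zero gV| |] => z.
    by rewrite /lin big_nil; ring.
  by rewrite /lin big_nil; ring.
case: i => i.
  exists (fun w => c * X i w + 1 * A w), B; split => // [|z|z]; first exact: (gs_comb gV).
    by rewrite lin_cons h1 /=; ring.
  by rewrite lin_cons h2 /=; ring.
exists A, (fun w => c * X i w + 1 * B w); split => // [|z|z]; first exact: (gs_comb gV).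
  by rewrite lin_cons h1 /=; ring.
by rewrite lin_cons h2 /=; ring.
Qed.

Let mgf2 A B : V A -> V B -> [/\ measurable_fun setT (fun z : T * T => expR (A z.1 + B z.2)),
  L1 PP (fun z => expR (A z.1 + B z.2)) & \int[PP]_z expR (A z.1 + B z.2) = expR ((cov A A + cov B B) / 2)].
Proof.
move=> VA VB; have [_ _ hA] := gs_mgf gV VA; have [_ _ hB] := gs_mgf gV VB.
have [l E] := prod_int (hA 1).1 (hB 1).1 (fun w => expR_ge0 _) (fun w => expR_ge0 _).
have eE z : expR (1 * A z.1) * expR (1 * B z.2) = expR (A z.1 + B z.2) by rewrite !mul1r expRD.
have l' := eq_L1 eE l; split => //; first exact: L1_meas l'.
rewrite -(@eq_EE _ _ _ _ _ _ eE) E (hA 1).2 (hB 1).2 !(Vmean VA) !(Vmean VB) -expRD; by congr expR; field.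
Qed.

Let rotation f : tm f -> [/\ L1 PP (fun z => f (Y1^~ z)), L1 PP (fun z => f (Y2^~ z)) &
  \int[PP]_z f (Y1^~ z) = \int[PP]_z f (Y2^~ z)].
Proof.
move=> tf; suff : agree PP PP (fun=> 1) (fun=> 1) Y1 Y2 f.
  move=> [[_ l1] [_ l2] E].
  split; [exact: eq_L1 (fun z => mul1r _) l1|exact: eq_L1 (fun z => mul1r _) l2|].
  by move: E; rewrite !(@eq_EE _ _ _ PP (fun z => 1 * _) _ (fun z => mul1r _)).
apply: tm_agree tf => // s; have [A [B [VA VB h1 h2]]] := split_lin s.
have VA' := gs_comb gV r2^-1 r2^-1 VA VB; have VB' := gs_comb gV (- r2^-1) r2^-1 VA VB.
have [m1 l1 e1] := mgf2 VA VB; have [m2 l2 e2] := mgf2 VA' VB'.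
rewrite /agree /goodf.
have -> : (fun x => expR (lin s (Y1^~ x))) = fun z => expR (A z.1 + B z.2) by apply/funext => z; rewrite h1.
have -> : (fun x => expR (lin s (Y2^~ x))) = fun z => expR ((r2^-1 * A z.1 + r2^-1 * B z.1) + (- r2^-1 * A z.2 + r2^-1 * B z.2)).
  by apply/funext => z; rewrite h2.
split; [split => //|split => //|].
- by apply: eq_L1 l1 => z; rewrite mul1r h1.
- by apply: eq_L1 l2 => z; rewrite mul1r h2.
- rewrite (@eq_EE _ _ _ PP (fun z => 1 * _) (fun z => expR (A z.1 + B z.2))); last by move=> z; rewrite mul1r h1.
  rewrite (@eq_EE _ _ _ PP (fun z => 1 * _) (fun z => expR ((r2^-1 * A z.1 + r2^-1 * B z.1) + (- r2^-1 * A z.2 + r2^-1 * B z.2)))); last by move=> z; rewrite mul1r h2.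
  rewrite e1 e2; congr expR; congr (_ / 2).
  rewrite !(cov_comb gV)// !(cov_combr gV)// [cov B A]covC.
  have r22 : r2^-1 * r2^-1 = 2^-1 by rewrite -invfM -expr2 r2E.
  by rewrite -[LHS]mul1r -(mulfV (_ : 2 != 0 :> R))// -r22; ring.
Qed.

Let out (t : R) : set (nat -> R) := \bigcup_i [set y | t < `|y i|].
Let cyl_out t : cyl (out t).
Proof. by apply: cyl_bigcup => i; exact: cyl_abs_gt. Qed.

Let q t := \int[P]_w (\1_(out t) (X^~ w)).

Let l_out t : L1 P (fun w => \1_(out t) (X^~ w)).
Proof. by have [] := cameron_martin gV VX (gs_zero gV) (cyl_out t). Qed.

Let q_ge0 t : 0 <= q t. Proof. by apply: EE_ge0 => w; rewrite indicE. Qed.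

Let q_le s t : s <= t -> q t <= q s.
Proof.
move=> st; apply: EE_le => // w; rewrite !indicE ler_nat.
have [h|//] := boolP (X^~ w \in out t); rewrite mem_set//.
by have [i _ hi] := set_mem h; exists i => //=; exact: le_lt_trans st hi.
Qed.

Let q_cvg0 : q n%:R @[n --> \oo] --> (0 : R).
Proof.
have [_] : L1 P (fun=> 0) /\ q n%:R @[n --> \oo] --> \int[P]_w 0.
  apply: (dct (f_ := fun n w => \1_(out n%:R) (X^~ w)) (g := fun=> 1)) => [n|w|n w|].
  - exact: l_out.
  - have [M hM] := Xbd w; apply/cvgrPdist_le => e e0; exists (Num.truncn M).+1 => // n /= Mn.
    rewrite indicE memNset ?subrr ?normr0 ?(ltW e0)// => -[i _ /=].
    apply/negP; rewrite -leNgt; apply: le_trans (hM i) _; apply: le_trans (ltW (truncnS_gt _)) _.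
    by rewrite ler_nat.
  - by rewrite indicE; case: (_ \in _); rewrite ?normr1 ?normr0.
  - exact: L1_cst.
by rewrite EE_cst.
Qed.

Let outl (t : R) : set (nat + nat -> R) := \bigcup_i [set y | t < `|y (inl i)|].
Let outr (t : R) : set (nat + nat -> R) := \bigcup_i [set y | t < `|y (inr i)|].

(** After rotation the event says that [|X - X'| <= s * r2] at all indices and [|X + X'| > t * r2]
    at one index, where both [|X|] and [|X'|] must then exceed [(t - s) / r2]. *)
Let fernique_step s t : (1 - q s) * q t <= q ((t - s) / r2) ^+ 2.
Proof.
have cE : cyl (~` outl s `&` outr t).
  by apply: cylI; [apply: cylC|]; apply: cyl_bigcup => i; exact: cyl_abs_gt.
have [l1 l2 E] := rotation cE.
have ls : L1 P (fun w => 1 - \1_(out s) (X^~ w)) by apply: L1B; [exact: L1_cst|exact: l_out].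
have ls0 w : 0 <= 1 - \1_(out s) (X^~ w) :> R by rewrite indicE subr_ge0; case: (_ \in _); rewrite ?ler01.
have lt0 t' w : 0 <= \1_(out t') (X^~ w) :> R by rewrite indicE.
have [_ e1] := prod_int ls (l_out t) ls0 (lt0 t).
have -> : (1 - q s) * q t = \int[PP]_z (\1_(~` outl s `&` outr t) (Y1^~ z)).
  rewrite (_ : 1 - q s = \int[P]_w (1 - \1_(out s) (X^~ w))); last first.
    by rewrite EEB; [rewrite EE_cst|exact: L1_cst|exact: l_out].
  rewrite -e1; apply: eq_EE => z; rewrite !indicE in_setI in_setC.
  have -> : (Y1^~ z \in outl s) = (X^~ z.1 \in out s) by [].
  have -> : (Y1^~ z \in outr t) = (X^~ z.2 \in out t) by [].
  by case: (_ \in out s); case: (_ \in out t) => /=; ring.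
rewrite E; set u := (t - s) / r2.
have [l3 e3] := prod_int (l_out u) (l_out u) (lt0 u) (lt0 u).
rewrite expr2 -e3; apply: EE_le => // z; rewrite !indicE.
have [h|_] := boolP (_ \in ~` outl s `&` outr t); last by rewrite mulr_ge0.
have [nl [i _ hi]] := set_mem h; rewrite /= in hi.
have hs : `|(X i z.1 - X i z.2) / r2| <= s.
  by rewrite leNgt; apply/negP => hh; apply: nl; exists i.
have n2 : `|r2| = r2 by rewrite gtr0_norm.
rewrite normrM normfV n2 ltr_pdivlMr// in hi; rewrite normrM normfV n2 ler_pdivrMr// in hs.
have uE : 2 * u = t * r2 - s * r2 by rewrite /u r2V; field.
have tri (a b : R) : `|a + b| <= 2 * `|a| + `|a - b|.
  have -> : a + b = 2 * a - (a - b) by ring.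
  by apply: le_trans (ler_normB _ _) _; rewrite normrM ger0_norm.
rewrite !mem_set ?mulr1//; exists i => //=.
  have := tri (X i z.2) (X i z.1); rewrite addrC (distrC (X i z.2)); lra.
have := tri (X i z.1) (X i z.2); lra.
Qed.

Theorem fernique (e : nat) : exists N : T -> R, [/\ measurable_fun setT N, forall i w, `|X i w| <= N w & L1 P (fun w => N w ^+ e)].
Proof.
pose M k w : R := iteri k (fun j m => Num.max m `|X j w|) 0.
have mM k : measurable_fun setT (M k).
  elim: k => [|k ih]; first exact: measurable_cst.
  by apply: measurable_maxr => //; apply: (measurableT_comp (@normr_measurable R setT)); exact: (gs_meas gV (VX k)).
have ndM w : nondecreasing_seq (M^~ w).
  by apply/nondecreasing_seqP => k; rewrite /M /= le_max lexx.
have M_le w t : 0 <= t -> (forall i, `|X i w| <= t) -> forall k, M k w <= t.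
  by move=> t0 ht; elim=> [//|k ih]; rewrite /M /= ge_max ih ht.
have ubM w : has_ubound (range (M^~ w)).
  have [B hB] := Xbd w; exists B => _ [k _ <-]; apply: M_le => //.
  exact: le_trans (normr_ge0 _) (hB 0%N).
pose N w := sup (range (M^~ w)).
have cM w : M k w @[k --> \oo] --> N w by exact: nondecreasing_cvgn.
have mN : measurable_fun setT N by exact: meas_lim cM.
have XN i w : `|X i w| <= N w.
  apply: (@le_trans _ _ (M i.+1 w)); first by rewrite /M /= le_max lexx orbT.
  by apply: ub_le_sup => //; exists i.+1.
have N0 w : 0 <= N w by apply: le_trans (normr_ge0 _) (XN 0%N w).
have Nout w t : 0 <= t -> t < N w -> out t (X^~ w).
  move=> t0 tN; apply: contrapT => no; move: tN; apply/negP; rewrite -leNgt.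
  apply: ge_sup; first by exists (M 0%N w), 0%N.
  move=> _ [k _ <-]; apply: M_le => // i; rewrite leNgt; apply/negP => h.
  by apply: no; exists i.
(* With this value doubling the level divides the tail by [2 ^+ e.+1], one power of 2 more than the
   growth of the [e]-th power of the level, so the dyadic sum converges. *)
pose de : R := 2^-1 ^+ e.+2; have de0 : 0 < de by rewrite exprn_gt0// invr_gt0.
have [s s0 qs] : exists2 s : R, 0 < s & q s <= de.
  have /cvgrPdist_le/(_ _ de0)[n _ hn] := q_cvg0.
  exists n.+1%:R => //; have := hn n.+1 (leqnSn n); rewrite /= sub0r normrN.
  by apply: le_trans; exact: ler_norm.
have half : q s <= 2^-1.
  apply: le_trans qs _; rewrite /de exprS ger_pMr ?invr_gt0//.
  by rewrite exprn_ile1// ?invr_ge0// invf_le1// ler1n.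
have dbl t : 2 * s <= t -> q (2 * t) <= 2 * de * q t.
  move=> st; have := fernique_step s (2 * t).
  have ut : t <= (2 * t - s) / r2.
    rewrite ler_pdivlMr//; have : r2 <= 3 / 2.
      by rewrite -(ler_pXn2r (n := 2)) ?nnegrE ?(ltW r20)// r2E; lra.
    move=> h; have : t * r2 <= t * (3 / 2) by rewrite ler_wpM2l//; lra.
    lra.
  have h1 := q_le ut; have h2 := q_ge0 ((2 * t - s) / r2); have h3 := q_ge0 (2 * t).
  have h4 : q t <= de by apply: le_trans qs; apply: q_le; lra.
  have h5 := q_ge0 t; have h7 := ltW de0 => h6.
  have h8 : q ((2 * t - s) / r2) ^+ 2 <= q t * q t by rewrite expr2 ler_pM.
  have h9 : q t * q t <= de * q t by rewrite ler_wpM2r.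
  have h10 : 2^-1 * q (2 * t) <= (1 - q s) * q (2 * t) by rewrite ler_wpM2r//; lra.
  lra.
pose t0 := 2 * s; have t00 : 0 < t0 by rewrite mulr_gt0.
have q1 t : q t <= 1.
  by rewrite -(EE_cst P 1); apply: EE_le (L1_cst P 1) _ => // w; rewrite indicE; case: (_ \in _).
have tail j : q (2 ^+ j * t0) <= (2^-1 ^+ e.+1) ^+ j.
  elim: j => [|j ih]; first by rewrite !expr0 q1.
  rewrite [2 ^+ _]exprS -mulrA; apply: le_trans (dbl _ _) _.
    by rewrite -/t0 ler_peMl ?(ltW t00)// exprn_ege1// ler1n.
  rewrite [X in _ <= X]exprS (_ : 2 * de = 2^-1 ^+ e.+1); last by rewrite /de exprS mulrA divff ?mul1r.
  by rewrite ler_wpM2l// exprn_ge0// invr_ge0.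
(* Truncation at level [2 ^+ J * t0]: passing to the next level adds at most [C / 2 ^+ J] to the
   integral. *)
pose f J w := Num.min (N w) (2 ^+ J * t0) ^+ e.
have p0 J : 0 < 2 ^+ J * t0 by rewrite mulr_gt0// exprn_gt0.
have m0 J w : 0 <= Num.min (N w) (2 ^+ J * t0) by rewrite le_min N0 ltW.
have f0 J w : 0 <= f J w by rewrite exprn_ge0.
have lf J : L1 P (f J).
  apply: L1_le (L1_cst P ((2 ^+ J * t0) ^+ e)) => [|w].
    by apply: measurable_funX; apply: measurable_minr => //; exact: measurable_cst.
  by rewrite ger0_norm// lerXn2r ?nnegrE ?(ltW (p0 _))// ge_min lexx orbT.
have fS J w : f J.+1 w <= f J w + (2 ^+ J.+1 * t0) ^+ e * \1_(out (2 ^+ J * t0)) (X^~ w).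
  have i0 : 0 <= \1_(out (2 ^+ J * t0)) (X^~ w) :> R by rewrite indicE.
  have [NJ|NJ] := leP (N w) (2 ^+ J * t0).
    apply: (@le_trans _ _ (f J w)); last by rewrite lerDl mulr_ge0// exprn_ge0// ltW.
    rewrite /f lerXn2r ?nnegrE// le_min ge_min lexx /= (le_trans _ NJ)//.
    by rewrite ge_min lexx.
  rewrite indicE mem_set ?mulr1; last by apply: Nout => //; exact: ltW.
  apply: (@le_trans _ _ ((2 ^+ J.+1 * t0) ^+ e)); last by rewrite lerDr.
  by rewrite /f lerXn2r ?nnegrE ?(ltW (p0 _))// ge_min lexx orbT.
pose C := (2 * t0) ^+ e; have C0 : 0 <= C by rewrite exprn_ge0// mulr_ge0// ltW.
have bnd J : \int[P]_w f J w <= C + C * (2 - 2 * 2^-1 ^+ J).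
  elim: J => [|J ih].
    rewrite expr0 mulr1 subrr mulr0 addr0 -(EE_cst P C); apply: EE_le (L1_cst P _) _ => // w.
    apply: lerXn2r; [exact: m0|by rewrite nnegrE mulr_ge0// ltW|].
    by rewrite ge_min expr0 mul1r; apply/orP; right; move: t00; lra.
  apply: le_trans (EE_le (lf _) (L1D (lf _) (L1Z _ (l_out _))) (fS J)) _.
  rewrite EED//; last by apply: L1Z; exact: l_out.
  rewrite EEZ; last exact: l_out.
  have : (2 ^+ J.+1 * t0) ^+ e * q (2 ^+ J * t0) <= C * 2^-1 ^+ J.
    apply: (@le_trans _ _ ((2 ^+ J.+1 * t0) ^+ e * (2^-1 ^+ e.+1) ^+ J)).
      by rewrite ler_wpM2l// exprn_ge0// ltW.
    rewrite (_ : 2 ^+ J.+1 * t0 = 2 ^+ J * (2 * t0)); last by rewrite exprS; ring.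
    have xy : 2 ^+ J * 2^-1 ^+ J = 1 :> R by rewrite -exprMn mulfV// expr1n.
    rewrite exprMn -/C (exprAC 2^-1) exprSr; move: xy; set x := 2 ^+ J; set y := 2^-1 ^+ J => xy.
    have -> : x ^+ e * C * (y ^+ e * y) = (x * y) ^+ e * (C * y) by rewrite exprMn; ring.
    by rewrite xy expr1n mul1r.
  have hJ : 2^-1 ^+ J.+1 = 2^-1 * 2^-1 ^+ J :> R by rewrite exprS.
  rewrite hJ; move: ih; rewrite /q; set x := 2^-1 ^+ J; move: (\int[P]_x0 f J x0) => I1.
  move: (_ * \int[P]_x0 _) => I2; lra.
exists N; split => //.
have [] := @L1_lim_bound _ _ _ P f (fun w => N w ^+ e) (3 * C) lf f0 => // [w|J].
  apply/cvgrPdist_le => ep ep0.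
  exists (Num.truncn (N w / t0)).+1 => // J /= hJ.
  rewrite /f min_l ?subrr ?normr0 ?(ltW ep0)//.
  rewrite -ler_pdivrMr//; apply: le_trans (ltW (truncnS_gt _)) _.
  apply: (@le_trans _ _ J%:R); first by rewrite ler_nat.
  by rewrite -natrX ler_nat ltnW// ltn_expl.
apply: le_trans (bnd J) _.
have : 0 <= C * 2^-1 ^+ J by rewrite mulr_ge0// exprn_ge0// invr_ge0.
lra.
Qed.

End Fernique.

(** * Covariance fields *)

Lemma fin_radius {R : realType} (I : finType) (r0 : R) (Q : I -> R -> Prop) : 0 < r0 ->
  (forall i (r r' : R), r' <= r -> Q i r -> Q i r') ->
  (forall i, exists2 r, 0 < r & Q i r) -> exists2 r, 0 < r <= r0 & forall i, Q i r.
Proof.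
move=> r00 mono /(_ _)/cid2 h.
exists (\big[Num.min/r0]_i s2val (h i)) => [|i].
  rewrite bigmin_le_id andbT; elim/big_ind: _ => // [x y x0 y0|i _]; first by rewrite lt_min x0.
  by case: (h i).
apply: (mono i (s2val (h i))); last by case: (h i).
exact: bigmin_le.
Qed.

Lemma eventually_small {R : realType} (u : nat -> R) :
  u n @[n --> \oo] --> (0 : R) <-> forall e, 0 < e -> exists n0, forall n, (n0 <= n)%N -> `|u n| <= e.
Proof.
split=> [/cvgrPdist_le h e /h[n0 _ hn]|h].
  by exists n0 => n /hn /=; rewrite sub0r normrN.
apply/cvgrPdist_le => e /h[n0 hn]; exists n0 => // n /= /hn.
by rewrite sub0r normrN.
Qed.

Section CovField.
Context {dT : measure_display} {T : measurableType dT} {R : realType}.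
Variable P : probability T R.
Context {K : numFieldType} (S : scalars R K).
Variable Vg : (T -> R) -> Prop.
Hypothesis gV : gspace P Vg.
Local Notation nrm := (nrm S).
Local Notation iota := (iota S).
Local Notation cov := (gcov P).
Implicit Types Y Z : T -> K.

Definition VK Y := forall b, Vg (fun w => co S b (Y w)).
(** Taken coordinate by coordinate, the covariance with a real variable is linear over [K]; this is
    what relations such as [riemann], with coefficients in [K], require. *)
Definition CovK (ze : T -> R) Y : K := \sum_b iota (cov (fun w => co S b (Y w)) ze) * uu S b.

Lemma co0 b : co S b 0 = 0.
Proof. by have := @coB _ _ S b 0 0; rewrite !subrr. Qed.

Lemma VK0 : VK (fun=> 0).
Proof. by move=> b; under eq_fun do rewrite co0; exact: gs_zero gV. Qed.

Lemma VKD Y Z : VK Y -> VK Z -> VK (fun w => Y w + Z w).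
Proof. by move=> hY hZ b; under eq_fun do rewrite co_add; exact: (gs_add gV). Qed.

Lemma co_sumr b (I : Type) (s : seq I) (F : I -> K) : co S b (\sum_(i <- s) F i) = \sum_(i <- s) co S b (F i).
Proof. exact: (big_morph (co S b) (co_add S b) (co0 b)). Qed.

Lemma co_mul b c z : co S b (c * z) = \sum_b' co S b (c * uu S b') * co S b' z.
Proof.
rewrite {1}(co_sum S z) mulr_sumr co_sumr; apply: eq_bigr => b' _.
by rewrite mulrCA co_scale mulrC.
Qed.

Lemma VKM c Y : VK Y -> VK (fun w => c * Y w).
Proof.
move=> hY b; under eq_fun do rewrite co_mul.
by apply: (gs_sum gV) => b'; exact: (gs_scale gV).
Qed.

Lemma VK_sum (I : Type) (s : seq I) (F : I -> T -> K) : (forall i, VK (F i)) -> VK (fun w => \sum_(i <- s) F i w).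
Proof.
move=> h; elim: s => [|i s ih]; first by under eq_fun do rewrite big_nil; exact: VK0.
by under eq_fun do rewrite big_cons; exact: VKD.
Qed.

Variable ze : T -> R.
Hypothesis Vz : Vg ze.
Local Notation CK := (CovK ze).

Lemma CovKD Y Z : VK Y -> VK Z -> CK (fun w => Y w + Z w) = CK Y + CK Z.
Proof.
move=> hY hZ; rewrite /CovK -big_split; apply: eq_bigr => b _ /=; rewrite -mulrDl -rmorphD; congr (iota _ * _).
have := cov_comb gV 1 1 (hY b) (hZ b) Vz; rewrite !mul1r => <-.
by congr (gcov P _ _); apply/funext => w; rewrite co_add !mul1r.
Qed.

Lemma CovKM c Y : VK Y -> CK (fun w => c * Y w) = c * CK Y.
Proof.
move=> hY; rewrite /CovK mulr_sumr.
under eq_bigr => b _.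
  rewrite (_ : (fun w => co S b (c * Y w)) = fun w => \sum_b' co S b (c * uu S b') * co S b' (Y w)); last first.
    by apply/funext => w; rewrite co_mul.
  rewrite (cov_sum gV _ (F := fun b' w => co S b (c * uu S b') * co S b' (Y w)))//; last by move=> b'; exact: (gs_scale gV).
  rewrite rmorph_sum mulr_suml.
  over.
rewrite exchange_big; apply: eq_bigr => b' _ /=.
rewrite [RHS]mulrCA [in RHS](co_sum S (c * uu S b')) mulr_sumr; apply: eq_bigr => b _.
by rewrite (cov_scale gV)// rmorphM /= mulrA [iota _ * iota _]mulrC.
Qed.

Lemma CovKB Y Z : VK Y -> VK Z -> CK (fun w => Y w - Z w) = CK Y - CK Z.
Proof.
move=> hY hZ; rewrite -[- CK Z]mulN1r -CovKM// -CovKD//; last exact: VKM.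
by congr (CovK _ _); apply/funext => w; rewrite mulN1r.
Qed.

Lemma VKB Y Z : VK Y -> VK Z -> VK (fun w => Y w - Z w).
Proof.
move=> hY hZ; have := VKD hY (VKM (-1) hZ).
by under eq_fun do rewrite mulN1r.
Qed.

Lemma CovK_sum (I : Type) (s : seq I) (F : I -> T -> K) : (forall i, VK (F i)) ->
  CK (fun w => \sum_(i <- s) F i w) = \sum_(i <- s) CK (F i).
Proof.
move=> h; elim: s => [|i s ih].
  have E := CovKM 0 VK0; rewrite [X in _ = X]mul0r in E; rewrite big_nil -[RHS]E.
  by congr (CovK _ _); apply/funext => w; rewrite big_nil mul0r.
rewrite big_cons -ih -CovKD//; last exact: VK_sum.
by congr (CovK _ _); apply/funext => w; rewrite big_cons.
Qed.

Lemma CovK_lim (Y_ : nat -> T -> K) : (forall n, VK (Y_ n)) ->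
  (forall w (tau : R), 0 < tau -> exists n0, forall n, (n0 <= n)%N -> nrm (Y_ n w) <= tau) ->
  forall tau : R, 0 < tau -> exists n0, forall n, (n0 <= n)%N -> nrm (CK (Y_ n)) <= tau.
Proof.
move=> VY h tau tau0; pose nB : R := #|BB S|%:R + 1.
have nB0 : 0 < nB by rewrite ltr_wpDl.
have hb b : exists n0, forall n, (n0 <= n)%N -> `|cov (fun w => co S b (Y_ n w)) ze| <= tau / nB.
  have : cov (fun w => co S b (Y_ n w)) ze @[n --> \oo] --> cov (fun=> 0) ze.
    apply: (cov_lim gV) => [n|||w]; [exact: VY|exact: gs_zero gV|exact: Vz|].
    apply/eventually_small => e e0; have [n0 hn] := h w e e0; exists n0 => n nn.
    exact: le_trans (co_nrm _ _ _) (hn n nn).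
  have -> : cov (fun=> 0) ze = 0.
    have E := cov_scale gV 0 Vz Vz; rewrite [X in _ = X]mul0r in E; rewrite -[RHS]E.
    by congr (gcov P _ _); apply/funext => w; rewrite mul0r.
  by move=> /eventually_small; apply; rewrite divr_gt0.
have {hb} /choice[n0 hn0] := hb.
exists (\max_b n0 b) => n nn.
apply: (@le_trans _ _ (#|BB S|%:R * (tau / nB))); last first.
  by rewrite mulrCA ler_piMr ?(ltW tau0)// ler_pdivrMr// mul1r lerDl.
apply: nrm_sum_le => b; rewrite nrmM nrm_uu mulr1 nrm_iota; apply: hn0.
by apply: leq_trans nn; exact: leq_bigmax.
Qed.

End CovField.

(** * Means and covariances of a field of jets *)

Section JetField.
Context {dT : measure_display} {T : measurableType dT} {R : realType}.
Variable P : probability T R.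
Context {K : numFieldType} (S : scalars R K) {d : nat} (k : nat).
Variable Vg : (T -> R) -> Prop.
Hypothesis gV : gspace P Vg.
Local Notation nrm := (nrm S).
Local Notation nv := (nv S).
Local Notation iota := (iota S).
Local Notation V := 'rV[K]_d.
Local Notation mi := ('I_d -> nat).
Variables (f : T -> mi -> V -> 'I_d -> K) (rho0 : R).
Hypothesis rho0_gt0 : 0 < rho0.

Record jet_field : Prop := JetField {
  jf_jets : forall w l, exists M, jets S rho0 k M (fun be x => f w be x l);
  jf_cont : forall w l be x, (msize be <= k)%N -> nv x <= rho0 -> forall eps : R, 0 < eps ->
    exists2 de : R, 0 < de & forall y, nv y <= rho0 -> nv (y - x) <= de -> nrm (f w be y l - f w be x l) <= eps;
  jf_gauss : forall be x l, (msize be <= k)%N -> nv x <= rho0 -> VK S Vg (fun w => f w be x l)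
}.
Hypothesis jf : jet_field.

Lemma jf_bound w : exists2 M : R, 0 <= M & forall be x l, (msize be <= k)%N -> nv x <= rho0 -> nrm (f w be x l) <= M.
Proof.
have /choice[M hM] := jf_jets jf w.
exists (\sum_l `|M l|) => [|be x l bk xr]; first by rewrite sumr_ge0.
apply: le_trans (jets_bound (hM l) bk xr) _; apply: le_trans (ler_norm _) _.
by rewrite (bigD1 l)//= lerDl sumr_ge0.
Qed.

(** If [Q] were unbounded there would be indices [t_ n] with [Q (t_ n) > n.+1]. Paths are bounded,
    so the variables divided by [n.+1] tend to 0 pointwise, and so do their means and covariances, a
    contradiction. Bounds follow before any moment of the supremum of the field is available. *)
Let blowup (Q : mi * V * 'I_d -> R) :
  (forall (t_ : nat -> mi * V * 'I_d), (forall n, (msize (t_ n).1.1 <= k)%N /\ nv (t_ n).1.2 <= rho0) ->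
    (forall w (tau : R), 0 < tau -> exists n0, forall n, (n0 <= n)%N ->
       nrm (iota n.+1%:R^-1 * f w (t_ n).1.1 (t_ n).1.2 (t_ n).2) <= tau) ->
     exists n, Q (t_ n) <= n.+1%:R) ->
  exists2 M : R, 0 <= M & forall be x l, (msize be <= k)%N -> nv x <= rho0 -> Q (be, x, l) <= M.
Proof.
move=> H; apply: contrapT => no.
have /choice[t_ ht] : forall n : nat, exists t : mi * V * 'I_d, [/\ (msize t.1.1 <= k)%N, nv t.1.2 <= rho0 & n.+1%:R < Q t].
  move=> n; apply: contrapT => no'; apply: no; exists n.+1%:R => // be x l bk xr.
  rewrite leNgt; apply/negP => h; apply: no'.
  by exists (be, x, l).
have [n|w tau tau0|n] := H t_.
- by have [] := ht n.
- have [M M0 hM] := jf_bound w; exists (Num.truncn (M / tau)).+1 => n nn.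
  have n0 : 0 < n.+1%:R :> R by [].
  have [h1 h2 _] := ht n; rewrite nrmM nrm_iota ger0_norm ?invr_ge0// ler_pdivrMl//.
  apply: le_trans (hM _ _ _ h1 h2) _; rewrite -ler_pdivrMr//; apply: le_trans (ltW (truncnS_gt _)) _.
  by rewrite ler_nat ltnW.
- by have [_ _ h] := ht n; rewrite leNgt h.
Qed.

Section WithZ.
Variable ze : T -> R.
Hypothesis Vz : Vg ze.
Local Notation CK := (CovK P S ze).

Lemma jf_cov_bound : exists2 M : R, 0 <= M & forall be x l, (msize be <= k)%N -> nv x <= rho0 ->
  nrm (CK (fun w => f w be x l)) <= M.
Proof.
have [|M M0 hM] := blowup (Q := fun t => nrm (CK (fun w => f w t.1.1 t.1.2 t.2))); last by exists M.
move=> t_ ht h.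
have VKt n : VK S Vg (fun w => f w (t_ n).1.1 (t_ n).1.2 (t_ n).2).
  by apply: (jf_gauss jf); have [] := ht n.
have [n0 hn] := CovK_lim gV Vz (fun n => VKM gV (iota n.+1%:R^-1) (VKt n)) h ltr01.
exists n0; have := hn n0 (leqnn _); rewrite (CovKM gV)// nrmM nrm_iota ger0_norm ?invr_ge0// ler_pdivrMl//.
by rewrite mulr1.
Qed.

Lemma jf_cov_riemann be (j : 'I_d) (a x : V) l : (msize be < k)%N -> (forall i : 'I_d, (i < j)%N -> be i = 0%N) ->
  nv a <= rho0 -> nv x <= rho0 -> (forall i, i != j -> a 0 i = x 0 i) ->
  riemann S a x j (fun y => CK (fun w => f w be y l)) (fun y => CK (fun w => f w (incr be j) y l)).
Proof.
move=> bk hb ha hx hax tau tau0.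
have VF y : nv y <= rho0 -> VK S Vg (fun w => f w be y l) by apply: (jf_gauss jf); exact: ltnW.
have VF' y : nv y <= rho0 -> VK S Vg (fun w => f w (incr be j) y l).
  by apply: (jf_gauss jf); rewrite msize_incr.
have hpt n (m : 'I_n) : nv (pt S a x (m%:R / n%:R)) <= rho0.
  apply: nv_pt => //; have n0 : 0 < n%:R :> R by rewrite ltr0n; case: n m => [[]|].
  by rewrite divr_ge0//= ler_pdivrMr// mul1r ler_nat ltnW.
pose Y n w := f w be x l - f w be a l - (x 0 j - a 0 j) * (iota n.+1%:R^-1 * \sum_(m < n.+1) f w (incr be j) (pt S a x (m%:R / n.+1%:R)) l).
have V1 := VKB gV (VF x hx) (VF a ha).
have V3 n : VK S Vg (fun w => \sum_(m < n.+1) f w (incr be j) (pt S a x (m%:R / n.+1%:R)) l).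
  by apply: (VK_sum gV) => m; exact: VF' (hpt _ m).
have V2 n := VKM gV (x 0 j - a 0 j) (VKM gV (iota n.+1%:R^-1) (V3 n)).
have VY n : VK S Vg (Y n) := VKB gV V1 (V2 n).
have [w t t0|n0 hn] := CovK_lim gV Vz VY _ tau0.
  have [M hM] := jf_jets jf w l; have [n0 hn] := jets_riemann hM bk hb ha hx hax t0.
  by exists n0 => n nn; apply: hn; rewrite ?ltnS// ltnW.
exists n0.+1 => -[//|n]; rewrite ltnS => nn _; have := hn n nn.
rewrite /Y (CovKB gV Vz V1 (V2 n)) (CovKB gV Vz (VF x hx) (VF a ha)) !(CovKM gV Vz)//; last exact: (VKM gV).
by rewrite (CovK_sum gV Vz) // => m; exact: VF' (hpt _ m).
Qed.

(** Continuity at 0 is proved by contradiction along a sequence, since covariances are continuous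
    under sequential pointwise limits. *)
Lemma jf_cov_small be l (kap : R) : 0 < kap -> (msize be <= k)%N -> exists2 r : R, 0 < r &
  forall x, nv x <= rho0 -> nv x <= r -> nrm (CK (fun w => f w be x l) - CK (fun w => f w be 0 l)) <= kap.
Proof.
move=> kap0 bk; apply: contrapT => no.
have /choice[x_ hx] : forall n : nat, exists x : V, [/\ nv x <= rho0, nv x <= n.+1%:R^-1 &
    kap < nrm (CK (fun w => f w be x l) - CK (fun w => f w be 0 l))].
  move=> n; apply: contrapT => no'; apply: no; exists n.+1%:R^-1 => [|x xr xn]; first by rewrite invr_gt0.
  by rewrite leNgt; apply/negP => h; apply: no'; exists x.
have n0r : nv (0 : V) <= rho0 by rewrite nv0 ltW.
have VF y : nv y <= rho0 -> VK S Vg (fun w => f w be y l) by exact: (jf_gauss jf).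
have VFx n : VK S Vg (fun w => f w be (x_ n) l) by apply: VF; have [] := hx n.
have [w t t0|n0 hn] := CovK_lim gV Vz (fun n => VKB gV (VFx n) (VF 0 n0r)) _ kap0.
  have [de de0 hde] := jf_cont jf w l bk n0r t0.
  exists (Num.truncn de^-1).+1 => n nn; have [h1 h2 _] := hx n; apply: hde => //.
  rewrite subr0; apply: le_trans h2 _; rewrite -[de]invrK lef_pV2 ?posrE ?invr_gt0//.
  by apply: le_trans (ltW (truncnS_gt _)) _; rewrite ler_nat ltnW.
have [_ _ h] := hx n0; have := hn n0 (leqnn _); rewrite (CovKB gV Vz (VFx n0) (VF 0 n0r)).
by move=> /(lt_le_trans h); rewrite ltxx.
Qed.

End WithZ.

Lemma jf_mean_bound b : exists2 M : R, 0 <= M & forall be x l, (msize be <= k)%N -> nv x <= rho0 ->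
  `|gmean P (fun w => co S b (f w be x l))| <= M.
Proof.
have [|M M0 hM] := blowup (Q := fun t => `|gmean P (fun w => co S b (f w t.1.1 t.1.2 t.2))|); last by exists M.
move=> t_ ht h.
have VKt n : VK S Vg (fun w => f w (t_ n).1.1 (t_ n).1.2 (t_ n).2).
  by apply: (jf_gauss jf); have [] := ht n.
have VY n := VKM gV (iota n.+1%:R^-1) (VKt n) b.
have : gmean P (fun w => co S b (iota n.+1%:R^-1 * f w (t_ n).1.1 (t_ n).1.2 (t_ n).2)) @[n --> \oo] --> gmean P (fun=> 0).
  apply: (mean_lim gV VY) => w; apply/eventually_small => e e0; have [n0 hn] := h w e e0.
  by exists n0 => n nn; exact: le_trans (co_nrm _ _ _) (hn n nn).
rewrite {2}/gmean EE_cst => /eventually_small/(_ _ ltr01)[n0 hn].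
exists n0; have := hn n0 (leqnn _); rewrite /gmean; under eq_EE do rewrite co_scale.
rewrite EEZ; last by exact: (gs_L1 gV (VKt n0 b)).
by rewrite normrM ger0_norm ?invr_ge0// ler_pdivrMl// mulr1.
Qed.

End JetField.

Section CylCountable.
Context {R : realType} {I : Type}.

Lemma cyl0 : cyl (set0 : set (I -> R)).
Proof. by rewrite -setCT; apply/cylC/cylT. Qed.

Lemma cyl_ex (C : countType) (A : C -> set (I -> R)) : (forall c, cyl (A c)) -> cyl [set y | exists c, A c y].
Proof.
move=> h; rewrite (_ : [set y | _] = \bigcup_n (if @choice.unpickle C n is Some c then A c else set0)).
  by apply: cyl_bigcup => n; case: (@choice.unpickle C n) => [c|]; [exact: h|exact: cyl0].
apply/seteqP; split => y /= [c]; first by move=> hc; exists (choice.pickle c) => //; rewrite choice.pickleK.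
by move=> _; case: (@choice.unpickle C c) => // c' hc'; exists c'.
Qed.

Lemma cyl_all (C : countType) (A : C -> set (I -> R)) : (forall c, cyl (A c)) -> cyl [set y | forall c, A c y].
Proof.
move=> h; rewrite (_ : [set y | _] = ~` [set y | exists c, (~` A c) y]).
  by apply/cylC/cyl_ex => c; exact: cylC.
by apply/seteqP; split => y /=; [move=> hc [c]; apply; exact: hc|move=> /forallNP hc c; exact: contrapT (hc c)].
Qed.

Lemma cyl_and (Q : Prop) (A : set (I -> R)) : cyl A -> cyl [set y | Q /\ A y].
Proof.
move=> cA; have [hQ|hQ] := pselect Q.
  by rewrite (_ : [set y | _] = A)//; apply/seteqP; split => y //= [].
by rewrite (_ : [set y | _] = set0); [exact: cyl0|apply/seteqP; split => y //= []].
Qed.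
End CylCountable.

(** * The bound in a small box *)

Section LocalBound.
Context {dT : measure_display} {T : measurableType dT} {R : realType}.
Variable P : probability T R.
Context {K : numFieldType} (S : scalars R K) {d q : nat}.
Variable Vg : (T -> R) -> Prop.
Hypothesis gV : gspace P Vg.
Local Notation nrm := (nrm S).
Local Notation nv := (nv S).
Local Notation iota := (iota S).
Local Notation V := 'rV[K]_d.
Local Notation mi := ('I_d -> nat).
Local Notation tpar := (tpar S (d := d) (q := q)).
Local Notation grid := (grid S (d := d) (q := q)).
Variables (f : T -> mi -> V -> 'I_d -> K) (rho0 : R).
Hypothesis rho0_gt0 : 0 < rho0.
Hypothesis rho0_le1 : rho0 <= 1.
Hypothesis jf : jet_field S q.+1 Vg f rho0.
Variable ze : tpar -> T -> R.
Hypothesis Vze : forall a, Vg (ze a).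
Hypothesis dual : forall be l b (a : tpar), (msize be <= q)%N ->
  gcov P (fun om => co S b (f om be 0 l)) (ze a) = ([forall i, wcont a.1.1 i == be i] && (a.1.2 == l) && (b == a.2))%:R.

(** These factorials turn variables dual to the jet at 0 into directions whose jet at 0 is that of a
    monomial with coefficient 1. *)
Let wf (a : tpar) : R := \prod_i ((wcont a.1.1 i)`!)%:R.
Let z' a w := wf a * ze a w.
Let Vz' a : Vg (z' a). Proof. exact: (gs_scale gV). Qed.
Let A (a : tpar) be x l := CovK P S (z' a) (fun w => f w be x l).
Let monA (a : tpar) be (x : V) l : K := if a.1.2 == l then uu S a.2 * mon (wcont a.1.1) be x else 0.
Let n0rho : nv (0 : V) <= rho0. Proof. by rewrite nv0 ltW. Qed.

Let wf_ge0 a : 0 <= wf a. Proof. by apply: prodr_ge0. Qed.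

Let A0 a be l : (msize be <= q)%N -> A a be 0 l = monA a be 0 l.
Proof.
move=> bq; rewrite /A /monA /CovK mon0.
have E b : gcov P (fun om => co S b (f om be 0 l)) (z' a) = wf a * ([forall i, wcont a.1.1 i == be i] && (a.1.2 == l) && (b == a.2))%:R.
  by rewrite /z' covC (cov_scale gV)//; [rewrite covC dual|apply: (jf_gauss jf) => //; exact: leqW].
transitivity (\sum_b iota (wf a * ([forall i, wcont a.1.1 i == be i] && (a.1.2 == l) && (b == a.2))%:R) * uu S b).
  by apply: eq_bigr => b _; rewrite -E.
case: (a.1.2 == l); last by rewrite big1// => b _; rewrite andbF /= mulr0 rmorph0 mul0r.
case: [forall i, wcont a.1.1 i == be i]; last by rewrite [RHS]mulr0 big1// => b _; rewrite /= mulr0 rmorph0 mul0r.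
rewrite (bigD1 a.2)//= eqxx mulr1 big1 ?addr0; last first.
  by move=> b /negbTE ->; rewrite mulr0 rmorph0 mul0r.
rewrite mulrC; congr (_ * _); rewrite /wf rmorph_prod; apply: eq_bigr => i _; by rewrite rmorph_nat.
Qed.

Let mon_small al be (x : V) : nv x <= 1 -> nrm (mon al be x - mon al be 0) <= (\prod_i ((al i)`!)%:R) * nv x.
Proof.
move=> x1; have p0 : 0 <= \prod_i ((al i)`!)%:R * nv x by rewrite mulr_ge0 ?nv_ge0// prodr_ge0.
rewrite mon0; case: forallP => [h|/forallP].
  rewrite (_ : mon al be x = \prod_i ((al i)`!)%:R) ?subrr ?nrm0//.
  by apply: eq_bigr => i _; have /eqP <- := h i; rewrite subnn expr0 mulr1 ffactnn.
rewrite negb_forall subr0 => /existsP[i hi].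
have [ab|ab] := ltnP (al i) (be i).
  by rewrite /mon (bigD1 i)//= ffact_small// !mul0r nrm0.
have {hi}ab : (be i < al i)%N by rewrite ltn_neqAle eq_sym hi.
rewrite /mon (bigD1 i)//= nrmM [X in _ <= X * _](bigD1 i)//= [leRHS]mulrAC.
apply: ler_pM; rewrite ?nrm_ge0//.
  rewrite nrmM nrm_nat nrmX; apply: ler_pM; rewrite ?exprn_ge0 ?nrm_ge0//.
    by rewrite ler_nat -(ffact_fact (ltnW ab)) leq_pmulr// fact_gt0.
  have -> : (al i - be i = (al i - be i).-1.+1)%N by rewrite prednK// subn_gt0.
  rewrite exprS; apply: (@le_trans _ _ (nrm (x 0 i) * 1)); last by rewrite mulr1 le_nv.
  by rewrite ler_wpM2l ?nrm_ge0// exprn_ile1 ?nrm_ge0// (le_trans (le_nv _ _ _) x1).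
rewrite (big_morph nrm (nrmM S) (nrm1 S)); apply: ler_prod => j ij; rewrite nrm_ge0 /= nrmM nrm_nat nrmX.
rewrite -[leRHS]mulr1; apply: ler_pM; rewrite ?exprn_ge0 ?nrm_ge0//.
  rewrite ler_nat; have [h|h] := leqP (be j) (al j); last by rewrite ffact_small.
  by rewrite -(ffact_fact h) leq_pmulr// fact_gt0.
by rewrite exprn_ile1 ?nrm_ge0// (le_trans (le_nv _ _ _) x1).
Qed.

(** At 0 the jets of order at most [q] coincide by [A0], and both sides are continuous there;
    [fin_radius] gives one box for the finitely many indices. *)
Let small_jets (kap : R) : 0 < kap -> exists2 rho, 0 < rho <= rho0 & forall a l,
  jets S rho q kap (fun be x => A a be x l - monA a be x l).
Proof.
move=> kap0; have k2 : 0 < kap / 2 by rewrite divr_gt0.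
pose Q (t : {ffun 'I_d -> 'I_q.+1} * tpar * 'I_d) (r : R) := forall x, nv x <= rho0 -> nv x <= r ->
   let be := fun i => (t.1.1 i : nat) in (msize be <= q)%N ->
   nrm (A t.1.2 be x t.2 - A t.1.2 be 0 t.2) <= kap / 2 /\ nrm (monA t.1.2 be x t.2 - monA t.1.2 be 0 t.2) <= kap / 2.
have [|t|rho rr hQ] := @fin_radius R _ rho0 Q rho0_gt0.
- by move=> t r r' rr h x h1 h2; apply: h => //; exact: le_trans rr.
- set be := fun i => (t.1.1 i : nat); have [bq|bq] := boolP (msize be <= q)%N; last first.
    by exists 1 => // x _ _ /= h; rewrite h in bq.
  have [r r0 hr] := jf_cov_small gV rho0_gt0 jf (Vz' t.1.2) t.2 k2 (leqW bq).
  pose c := wf t.1.2 + 1; have c0 : 0 < c by rewrite ltr_wpDl.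
  exists (Num.min r (kap / 2 / c)) => [|x h1 h23 be' _]; first by rewrite lt_min r0 divr_gt0.
  move: h23; rewrite le_min => /andP[h2 h3]; split; first exact: hr.
  rewrite /monA; case: ifP => _; last by rewrite subrr nrm0 ltW.
  rewrite -mulrBr nrmM nrm_uu mul1r; apply: le_trans (mon_small _ _ (le_trans h1 rho0_le1)) _.
  rewrite -/(wf t.1.2); apply: (@le_trans _ _ (c * (kap / 2 / c))); last by rewrite mulrCA mulfV ?mulr1// gt_eqF.
  by rewrite ler_pM ?nv_ge0// lerDl.
have /andP[r0 rr0] := rr; exists rho => // a l.
have riem be (j : 'I_d) (a' x : V) : (msize be < q)%N -> (forall i : 'I_d, (i < j)%N -> be i = 0%N) ->
    nv a' <= rho -> nv x <= rho -> (forall i, i != j -> a' 0 i = x 0 i) ->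
    riemann S a' x j (fun y => A a be y l + (-1) * monA a be y l) (fun y => A a (incr be j) y l + (-1) * monA a (incr be j) y l).
  move=> bq hb h1 h2 h3; apply: riemannD.
    by apply: (jf_cov_riemann gV jf (Vz' a)) => //; [exact: leqW|exact: le_trans rr0|exact: le_trans rr0].
  apply: riemannZ; rewrite /monA; case: (a.1.2 == l); last first.
    by move=> tau t0; exists 0%N => n _ _; rewrite big1 ?mulr0 ?subrr ?nrm0 ?ltW.
  have r1 := le_trans rr0 rho0_le1.
  by apply/riemannZ/mon_riemann => //; [exact: le_trans r1|exact: le_trans r1].
split => [be x bq xr|be j a' x bq hb h1 h2 h3]; last first.
  move=> tau t0; have [n0 hn] := riem be j a' x bq hb h1 h2 h3 tau t0; exists n0 => n nn n1.
  have := hn n nn n1; rewrite !mulN1r; congr (nrm (_ - _ * (_ * _)) <= _).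
  by apply: eq_bigr => i _; rewrite mulN1r.
have bE i : (be i < q.+1)%N.
  by rewrite ltnS; apply: leq_trans bq; rewrite /msize (bigD1 i)//= leq_addr.
have := hQ ([ffun i => Ordinal (bE i)], a, l) x (le_trans xr rr0) xr.
rewrite /= (_ : (fun i => _) = be); last by apply/funext => i; rewrite ffunE.
move=> /(_ bq)[h1 h2].
rewrite (_ : _ - _ = (A a be x l - A a be 0 l) - (monA a be x l - monA a be 0 l)); last by rewrite (A0 a l bq); ring.
by rewrite (splitr kap); exact: nrmBl.
Qed.

(** Fernique's theorem is applied to the centred derivatives at rational points of the box, a
    countable family. The means are bounded by [jf_mean_bound], and continuity of paths reaches the
    other points. *)
Let sup_moment (e : nat) : exists N : T -> R, [/\ measurable_fun setT N, forall w, 0 <= N w,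
  (forall w be x l, (msize be <= q.+1)%N -> nv x <= rho0 -> nrm (f w be x l) <= #|BB S|%:R * N w) & L1 P (fun w => N w ^+ e)].
Proof.
have /choice[Mb hMb] : forall b, exists M : R, 0 <= M /\ forall be x l, (msize be <= q.+1)%N -> nv x <= rho0 ->
    `|gmean P (fun w => co S b (f w be x l))| <= M.
  by move=> b; have [M M0 hM] := jf_mean_bound gV jf b; exists M.
pose Mm := \sum_b Mb b; have Mm0 : 0 <= Mm by apply: sumr_ge0 => b _; have [] := hMb b.
have MmE b : Mb b <= Mm by rewrite /Mm (bigD1 b)//= lerDl; apply: sumr_ge0 => b' _; have [] := hMb b'.
pose CI : countType := ({ffun 'I_d -> 'I_q.+2} * {ffun 'I_d * BB S -> rat} * 'I_d * BB S)%type.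
pose ok (c : CI) := (msize (fun i => (c.1.1.1 i : nat)) <= q.+1)%N && (nv (dpt c.1.1.2) <= rho0).
pose Y (c : CI) w := co S c.2 (f w (fun i => (c.1.1.1 i : nat)) (dpt c.1.1.2) c.1.2).
pose X (n : nat) : T -> R := if @choice.unpickle CI n is Some c then (if ok c then fun w => Y c w - gmean P (Y c) else fun=> 0) else fun=> 0.
have gV0 := gspace_centered gV.
have VY c : ok c -> Vg (Y c) by move=> /andP[h1 h2]; exact: (jf_gauss jf).
have V0X n : exists2 Z, Vg Z & X n = fun w => Z w - gmean P Z.
  rewrite /X; case: (@choice.unpickle CI n) => [c|]; last exact: gs_zero gV0.
  by case: ifP => [h|_]; [exists (Y c) => //; exact: VY|exact: gs_zero gV0].
have mean0 (Z : T -> R) : (exists2 Z', Vg Z' & Z = fun w => Z' w - gmean P Z') -> gmean P Z = 0.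
  move=> [Z' VZ' ->]; rewrite /gmean EEB; [|exact: (gs_L1 gV)|exact: L1_cst].
  by rewrite EE_cst subrr.
have Xbd w : exists M, forall i, `|X i w| <= M.
  have [M M0 hM] := jf_bound jf w; exists (M + Mm) => n; rewrite /X.
  case: (@choice.unpickle CI n) => [c|]; last by rewrite normr0 addr_ge0.
  case: ifP => [/andP[h1 h2]|_]; last by rewrite normr0 addr_ge0.
  apply: le_trans (ler_normB _ _) (lerD _ _); first exact: le_trans (co_nrm _ _ _) (hM _ _ _ h1 h2).
  by apply: le_trans (MmE c.2); have [_] := hMb c.2; exact.
have [N [mN hN lN]] := fernique gV0 mean0 V0X Xbd e.
have N0 w : 0 <= N w by apply: le_trans (normr_ge0 _) (hN 0%N w).
exists (fun w => N w + Mm); split => // [|w|w be x l bq xr|].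
- by apply: measurable_funD.
- exact: addr_ge0.
- apply: nrm_co_le => b; apply/ler_addgt0Pr => eps eps0.
  have [de de0 hde] := jf_cont jf w l bq xr eps0.
  have [r [h1 h2]] := dpt_dense_box rho0_gt0 xr de0.
  have bE i : (be i < q.+2)%N.
    by rewrite ltnS; apply: leq_trans bq; rewrite /msize (bigD1 i)//= leq_addr.
  pose c : CI := ([ffun i => Ordinal (bE i)], r, l, b).
  have beE : (fun i => (c.1.1.1 i : nat)) = be by apply/funext => i; rewrite ffunE.
  have okc : ok c by rewrite /ok beE bq.
  have hc : `|co S b (f w be (dpt r) l)| <= N w + Mm.
    have := hN (choice.pickle c) w; rewrite /X choice.pickleK okc.
    rewrite /Y beE /= => h; rewrite -(subrK (gmean P (fun w => co S b (f w be (dpt r) l))) (co S b _)).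
    apply: le_trans (ler_normD _ _) (lerD h _); apply: le_trans (MmE b).
    by have [_] := hMb b; exact.
  rewrite -(subrK (co S b (f w be (dpt r) l)) (co S b (f w be x l))) addrC.
  apply: le_trans (ler_normD _ _) (lerD hc _); rewrite -coB; apply: le_trans (co_nrm _ _ _) _.
  by rewrite nrmB; exact: hde.
- apply: L1_le (L1Z (2 ^+ e) (L1D lN (L1_cst P (Mm ^+ e)))).
    by apply: measurable_funX; apply: measurable_funD.
  move=> w; rewrite ger0_norm ?exprn_ge0 ?addr_ge0//.
  have [h|h] := leP (N w) Mm.
    apply: (@le_trans _ _ ((2 * Mm) ^+ e)); first by rewrite lerXn2r ?nnegrE ?addr_ge0 ?mulr_ge0//; lra.
    by rewrite exprMn ler_wpM2l ?exprn_ge0// lerDr exprn_ge0.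
  apply: (@le_trans _ _ ((2 * N w) ^+ e)); first by rewrite lerXn2r ?nnegrE ?addr_ge0 ?mulr_ge0//; have := N0 w; lra.
  by rewrite exprMn ler_wpM2l ?exprn_ge0// lerDl exprn_ge0.
Qed.

Let IX : Type := (V * 'I_d * BB S)%type.
Let X (i : IX) : T -> R := if nv i.1.1 <= rho0 then fun w => co S i.2 (f w (fun=> 0%N) i.1.1 i.1.2) else fun=> 0.

Let s0 : msize (fun _ : 'I_d => 0%N) = 0%N. Proof. by rewrite /msize big1. Qed.

Let VX i : Vg (X i).
Proof.
rewrite /X; case: ifP => [h|_]; last exact: gs_zero gV.
by apply: (jf_gauss jf) => //; rewrite s0.
Qed.

(** Stands in for the existence of [m] zeros: [m] separated almost zeros at rational points form a
    countable union of events about finitely many coordinates, hence an event in [cyl]. *)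
Let Zev (rho : R) (m : nat) (r tau : R) : set (IX -> R) :=
  [set y | exists z : m.-tuple {ffun 'I_d * BB S -> rat},
     ((forall i, nv (dpt (tnth z i)) <= rho) /\ (forall i j, i != j -> r <= nv (dpt (tnth z i) - dpt (tnth z j)))) /\
     forall t : 'I_m * 'I_d * BB S, `|y (dpt (tnth z t.1.1), t.1.2, t.2)| <= tau].

Let cyl_Zev rho m r tau : cyl (Zev rho m r tau).
Proof.
apply: (@cyl_ex _ _ (m.-tuple {ffun 'I_d * BB S -> rat})) => z; apply: cyl_and.
apply: (@cyl_all _ _ ('I_m * 'I_d * BB S)%type (fun t => [set y : IX -> R | `|y (dpt (tnth z t.1.1), t.1.2, t.2)| <= tau])) => t.
rewrite (_ : [set y | _] = ~` [set y : IX -> R | tau < `|y (dpt (tnth z t.1.1), t.1.2, t.2)|]); first exact/cylC/cyl_abs_gt.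
by apply/seteqP; split => y /=; rewrite leNgt => /negP.
Qed.

Let cm m : R := ((m.+1) ^_ q.+1)%:R - (m ^_ q.+1)%:R.
Let cm_ge0 m : 0 <= cm m.
Proof. by rewrite subr_ge0 ler_nat; rewrite ffactSS ffactnSr mulnC leq_mul// (leq_trans (leq_subr _ _)). Qed.

(** Summation by parts of the falling factorial of the number of separated almost zeros, truncated
    at [L]. Written with indicators it belongs to [tm], so [cameron_martin] applies to it. *)
Let phi rho L r tau (y : IX -> R) : R := \sum_(m < L) cm m * \1_(Zev rho m.+1 r tau) y.

Let tm_phi rho L r tau : tm (phi rho L r tau).
Proof.
rewrite /phi; elim: L => [|L ih]; first by apply: eq_tm (tm_cst 0) => y; rewrite big_ord0.
by apply: eq_tm (tm_add ih (tm_scale (cm L) (cyl_Zev rho L.+1 r tau))) => y; rewrite big_ord_recr.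
Qed.

Let sum_cm n : \sum_(m < n) cm m = (n ^_ q.+1)%:R.
Proof.
rewrite -(big_mkord xpredT cm) telescope_sumr// ffact0n /= subr0 //.
Qed.

Let phi_le rho L r tau y : exists m, (m = 0%N \/ Zev rho m r tau y) /\ phi rho L r tau y <= (m ^_ q.+1)%:R.
Proof.
elim: L => [|L [m [hm h]]]; first by exists 0%N; split; [left|rewrite /phi big_ord0].
rewrite /phi big_ord_recr /= indicE; have [hZ|hZ] := pselect (Zev rho L.+1 r tau y).
  exists L.+1; split; first by right.
  rewrite mem_set// mulr1 -sum_cm big_ord_recr lerD2r; apply: ler_sum => i _.
  by rewrite indicE ler_piMr//; case: (_ \in _).
by exists m; rewrite memNset// mulr0 addr0.
Qed.

Let phi_ge rho L r tau y n : (n <= L)%N -> (forall m, (m <= n)%N -> Zev rho m r tau y) ->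
  (n ^_ q.+1)%:R <= phi rho L r tau y.
Proof.
move=> nL h; rewrite -sum_cm /phi -(subnKC nL) big_split_ord /= -[leLHS]addr0 lerD//.
  by apply: ler_sum => i _; rewrite indicE mem_set ?mulr1//; exact: h.
by apply: sumr_ge0 => i _; rewrite mulr_ge0// indicE.
Qed.

Let phi_ge0 rho L r tau y : 0 <= phi rho L r tau y.
Proof. by apply: sumr_ge0 => i _; rewrite mulr_ge0// indicE. Qed.

Let zeg N (g : grid N) w := \sum_a gv (g (lowi a)) * z' a w.

Let Vzeg N (g : grid N) : Vg (zeg g).
Proof. by apply: (gs_sum gV) => a; exact: (gs_scale gV). Qed.

Let G w (x : V) : V := \row_l f w (fun=> 0%N) x l.
Let Af (a : tpar) (x : V) : V := \row_l A a (fun=> 0%N) x l.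

(** Identifies the Cameron-Martin translation along [zeg g] with the perturbed field of
    [core_bound]. *)
Let shiftE N (g : grid N) w x l b : nv x <= rho0 ->
  X (x, l, b) w + gcov P (X (x, l, b)) (zeg g) = co S b (pfield (G w) Af g x 0 l).
Proof.
move=> xr; rewrite /X /= xr.
rewrite /pfield mxE co_add mxE; congr (_ + _).
have VF : Vg (fun w => co S b (f w (fun=> 0%N) x l)) by apply: (jf_gauss jf) => //; rewrite s0.
rewrite covC (cov_sum gV _ (F := fun a w => gv (g (lowi a)) * z' a w))//; last by move=> a; exact: (gs_scale gV).
rewrite summxE co_sumr; apply: eq_bigr => a _; rewrite (cov_scale gV)// !mxE co_scale; congr (_ * _).
by rewrite /A /CovK co_comb covC.
Qed.

Let gvb N (g : grid N) a : (0 < N)%N -> `|(gv (g (lowi a)) : R)| <= 1.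
Proof. exact: gv_bound. Qed.

Let W w := expR (\sum_a `|z' a w - gmean P (z' a)|).

(** The variance term has a favourable sign and the grid values are at most 1 in absolute value, so
    the densities have a majorant common to all parameters. *)
Let cmw_le N (g : grid N) w : (0 < N)%N -> cmw P (zeg g) w <= W w.
Proof.
move=> N0; rewrite /cmw ler_expR.
have v0 : 0 <= gcov P (zeg g) (zeg g) by have [_ v0 _] := gs_mgf gV (Vzeg g).
have mE : gmean P (zeg g) = \sum_a gv (g (lowi a)) * gmean P (z' a).
  rewrite /zeg; elim: (index_enum _) => [|a s ih].
    by rewrite big_nil /gmean (@eq_EE _ _ _ _ _ (fun=> 0)) ?EE_cst// => om; rewrite big_nil.
  rewrite big_cons -ih -[gmean P (fun=> \sum_(a <- s) _)]mul1r -(mean_comb gV)//; last first.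
    by apply: (gs_sum gV) => a'; exact: (gs_scale gV).
  by congr (gmean P _); apply/funext => om; rewrite big_cons mul1r.
apply: (@le_trans _ _ (- (zeg g w - gmean P (zeg g)))); first by rewrite gerBl divr_ge0.
rewrite mE /zeg -sumrB -sumrN; apply: ler_sum => a _.
apply: le_trans (ler_norm _) _; rewrite normrN -mulrBr normrM ler_piMl//; exact: gvb.
Qed.

Let L1W2 : L1 P (fun w => W w ^+ 2).
Proof.
pose n := #|tpar|.
have mW : measurable_fun setT (fun w => W w ^+ 2).
  apply: measurable_funX; apply: (measurableT_comp (@measurable_expR R)).
  apply: measurable_sum => a; apply: (measurableT_comp (@normr_measurable R setT)).
  by apply: measurable_funB => //; exact: (gs_meas gV).
pose cc := 2 * n%:R : R.
have hz a : L1 P (fun w => expR (cc * (z' a w - gmean P (z' a))) + expR (- (cc * (z' a w - gmean P (z' a))))).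
  by apply: gmgf_cosh; apply: gmgf_addc; exact: (gs_mgf gV).
have lS : L1 P (fun w => 1 + \sum_a (expR (cc * (z' a w - gmean P (z' a))) + expR (- (cc * (z' a w - gmean P (z' a)))))).
  by apply: L1D; [exact: L1_cst|apply: L1_sum => //; exact: L1_cst].
apply: L1_le mW _ lS => w; rewrite ger0_norm ?sqr_ge0// /W -expRM_natl.
set u := fun a => `|z' a w - gmean P (z' a)|.
have [t0|t0] := boolP (0 < n)%N; last first.
  rewrite big1; last by move=> a; move: t0; rewrite /n -eqn0Ngt => /eqP/card0_eq/(_ a); rewrite inE.
  by rewrite mulr0 expR0 lerDl sumr_ge0// => a _; rewrite addr_ge0// expR_ge0.
have /card_gt0P[a0 _] := t0.
have [am _ ham] := @arg_maxP _ R tpar a0 xpredT u isT.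
apply: (@le_trans _ _ (expR (cc * u am))).
  rewrite ler_expR /cc -mulrA ler_wpM2l// /n -[X in X%:R * _]/#|tpar| mulr_natl -sumr_const.
  by apply: ler_sum => a _; exact: ham.
apply: (@le_trans _ _ (expR (cc * (z' am w - gmean P (z' am))) + expR (- (cc * (z' am w - gmean P (z' am)))))).
  by apply: le_trans _ (expR_cosh _); rewrite normrM (ger0_norm (_ : 0 <= cc))// mulr_ge0.
rewrite [X in _ <= _ + X](bigD1 am)//= addrCA lerDl addr_ge0// sumr_ge0//.
Qed.

(** The constant [Cst] does not depend on the separation, so the lower limit of the counts with
    [r = 1 / k.+1] has finite integral by Fatou's lemma, and it dominates the falling factorial for
    every finite set of zeros. The measurable majorant [Psi] replaces the number of zeros itself. *)
Theorem local_bound : exists2 rho : R, 0 < rho <= rho0 & exists Psi : T -> \bar R,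
  [/\ measurable_fun setT Psi, (forall w, 0 <= Psi w)%E, (\int[P]_w Psi w < +oo)%E &
   forall w (Z : seq V), uniq Z -> (forall x, x \in Z -> nv x <= rho /\ forall l, f w (fun=> 0%N) x l = 0) ->
     (((size Z) ^_ q.+1)%:R%:E <= Psi w)%E].
Proof.
have T0 : 0 < 2 * (#|tpar|%:R + 1) :> R by rewrite mulr_gt0// ltr_wpDl.
pose kap0 : R := (2 * (#|tpar|%:R + 1))^-1; have kap00 : 0 < kap0 by rewrite invr_gt0.
have kapT : 2 * #|tpar|%:R * kap0 <= 1 by rewrite ler_pdivrMr// mul1r ler_wpM2l// lerDl.
have [Cc [e [Cc0 core]]] := @core_bound R K S d q kap0 (ltW kap00) kapT.
have [Cq Cq1 hCq] := @jets_Int R K S d q; have [Cp Cp1 hCp] := @jets_Int R K S d q.+1.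
have Cq0 : 0 < Cq by apply: lt_le_trans Cq1.
have [rho rr hsm] := small_jets (divr_gt0 kap00 Cq0); have /andP[rho_gt0 rho_le] := rr.
have rho1 : rho <= 1 by exact: le_trans rho0_le1.
have /choice[MA hMA] : forall a, exists M : R, 0 <= M /\ forall be x l, (msize be <= q.+1)%N -> nv x <= rho0 -> nrm (A a be x l) <= M.
  by move=> a; have [M M0 hM] := jf_cov_bound gV jf (Vz' a); exists M.
pose MS := \sum_a MA a; have MS0 : 0 <= MS by apply: sumr_ge0 => a _; have [] := hMA a.
have MSE a : MA a <= MS by rewrite /MS (bigD1 a)//= lerDl; apply: sumr_ge0 => a' _; have [] := hMA a'.
(* The order [2 * e] comes from separating the density from the path size by
   [x * y <= x ^+ 2 + y ^+ 2], with [x = W w] and [y = M w ^+ e]. *)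
have [N [mN N0 hN lN]] := sup_moment (2 * e)%N.
have Cp0 : 0 <= Cp by apply: le_trans Cp1.
pose c1 := Cp * #|BB S|%:R; pose c2 := Cp * (#|tpar|%:R * MS) + 1.
have c10 : 0 <= c1 by rewrite mulr_ge0. have c20 : 0 <= c2 by rewrite addr_ge0// !mulr_ge0.
pose M w := c1 * N w + c2.
have M1 w : 1 <= M w by rewrite /M /c2 addrA lerDr addr_ge0// !mulr_ge0.
have M0 w : 0 <= M w by exact: le_trans (M1 w).
have boxE : unitbox S [set x : V | nv x <= rho] by move=> x /= xr; exact: le_trans rho1.
have IntF Nn (g : grid Nn) w l : (0 < Nn)%N -> Int S [set x | nv x <= rho] q.+1 (M w) (fun x => pfield (G w) Af g x 0 l).
  move=> Nn0.
  pose h be x := f w be x l + \sum_a iota (gv (g (lowi a))) * A a be x l.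
  have jh : jets S rho q.+1 (#|BB S|%:R * N w + #|tpar|%:R * MS) h.
    split => [be x bq xr|be j a x bq hb h1 h2 h3].
      have xr0 := le_trans xr rho_le; apply: nrmDl; first exact: hN.
      apply: nrm_sum_le => a; rewrite nrmM nrm_iota -[leRHS]mul1r ler_pM ?nrm_ge0//; first exact: gvb.
      by apply: le_trans (MSE a); have [_] := hMA a; exact.
    apply: riemannD.
      by have [Mw hMw] := jf_jets jf w l; apply: (jets_riemann hMw) => //; exact: le_trans rho_le.
    rewrite /=; elim: (index_enum _) => [|a' s ih].
      by move=> tau t0; exists 0%N => n _ _; rewrite !big_nil big1 ?mulr0 ?subrr ?nrm0 ?ltW// => i _; rewrite big_nil.
    have ra : riemann S a x j (fun y => iota (gv (g (lowi a'))) * A a' be y l) (fun y => iota (gv (g (lowi a'))) * A a' (incr be j) y l).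
      by apply: riemannZ; apply: (jf_cov_riemann gV jf (Vz' a')) => //; exact: le_trans rho_le.
    have := riemannD ra ih.
    by congr riemann; apply/funext => y; rewrite big_cons.
  have := hCp rho _ _ rho1 jh.
  move=> /(Int_le (_ : _ <= M w)) hI; apply: Int_ext (hI _).
    by move=> x; rewrite /h /pfield !mxE summxE; congr (_ + _); apply: eq_bigr => a _; rewrite !mxE.
  by rewrite /M /c1 /c2 mulrDr mulrA addrA lerDl.
have IntA a l : Int S [set x | nv x <= rho] q kap0 (fun y => Af a y 0 l - (if a.1.2 == l then uu S a.2 * wmon a.1.1 y else 0)).
  have := hCq rho _ _ rho1 (hsm a l); have CqN : Cq != 0 by rewrite gt_eqF.
  rewrite mulrCA mulfV// mulr1 => hI; apply: Int_ext hI => x.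
  rewrite /monA mxE; case: ifP => _ //; congr (_ - _ * _); rewrite wmonE /mon.
  by apply: eq_bigr => i _; rewrite ffactn0 subn0 mul1r.
have nB0 : 0 < #|BB S|%:R + 1 :> R by rewrite ltr_wpDl.
have lWM : L1 P (fun w => Cc * (W w ^+ 2 + M w ^+ (2 * e))).
  apply: L1Z; apply: L1D => //.
  apply: L1_le (L1Z (2 ^+ (2 * e)) (L1D (L1Z (c1 ^+ (2 * e)) lN) (L1_cst P (c2 ^+ (2 * e))))).
    by apply: measurable_funX; apply: measurable_funD => //; exact: measurable_funM.
  move=> w; rewrite ger0_norm ?exprn_ge0// /M -exprMn.
  have u0 : 0 <= c1 * N w by rewrite mulr_ge0.
  set u := c1 * N w in u0 *; set E := (2 * e)%N.
  have [h|h] := leP u c2.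
    apply: (@le_trans _ _ ((2 * c2) ^+ E)); first by rewrite lerXn2r ?nnegrE ?addr_ge0 ?mulr_ge0//; lra.
    by rewrite exprMn ler_wpM2l ?exprn_ge0// lerDr exprn_ge0.
  apply: (@le_trans _ _ ((2 * u) ^+ E)); first by rewrite lerXn2r ?nnegrE ?addr_ge0 ?mulr_ge0//; lra.
  by rewrite exprMn ler_wpM2l ?exprn_ge0// lerDl exprn_ge0.
pose Cst := \int[P]_w (Cc * (W w ^+ 2 + M w ^+ (2 * e))).
(* Averaging: [#|grid Nn|] times the expectation equals the expectation of the sum over [g] of the
   density times the count for the translated path, and [core] bounds the sum of the counts path by
   path. *)
have main (r : R) : 0 < r -> exists2 tau, 0 < tau & forall L, L1 P (fun w => phi rho L r tau (X^~ w)) /\ \int[P]_w phi rho L r tau (X^~ w) <= Cst.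
  move=> r0; have [Nn [tau [Nn0 tau0 hcore]]] := core r r0.
  pose tau' := tau / (#|BB S|%:R + 1); exists tau' => [|L]; first by rewrite divr_gt0.
  have tp := tm_phi rho L r tau'.
  have CM (g : grid Nn) := cameron_martin gV VX (Vzeg g) tp.
  pose ph (g : grid Nn) w := phi rho L r tau' (fun i => X i w + gcov P (X i) (zeg g)).
  have card0 : 0 < #|grid Nn|%:R :> R by rewrite card_ffun card_ord ltr0n expn_gt0.
  have det w : \sum_g ph g w <= Cc * M w ^+ e * #|grid Nn|%:R.
    have wit (g : grid Nn) : exists Z : seq V, [/\ uniq Z, forall x, x \in Z -> nv x <= rho /\ (forall l, nrm (pfield (G w) Af g x 0 l) <= tau),
        (forall x y, x \in Z -> y \in Z -> x != y -> r <= nv (x - y)) & ph g w <= ((size Z) ^_ q.+1)%:R].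
      have [m [[->|[z [[hz1 hz2] hz3]]] hm]] := phi_le rho L r tau' (fun i => X i w + gcov P (X i) (zeg g)).
        by exists [::].
      exists [seq dpt (tnth z i) | i <- enum 'I_m]; split.
      - rewrite map_inj_uniq ?enum_uniq// => i j ij; apply/eqP/negPn/negP => nij.
        by have := hz2 i j nij; rewrite ij subrr nv0 leNgt r0.
      - move=> _ /mapP[i _ ->]; split => // l.
        have xr := le_trans (hz1 i) rho_le.
        apply: (@le_trans _ _ (#|BB S|%:R * tau')); last first.
          by rewrite /tau' mulrCA ler_piMr ?(ltW tau0)// ler_pdivrMr// mul1r lerDl.
        apply: nrm_co_le => b; rewrite -(shiftE g w l b xr); exact: hz3 (i, l, b).
      - move=> _ _ /mapP[i _ ->] /mapP[j _ ->] ij; apply: hz2; apply: contra_neq ij => ->; by [].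
      - by rewrite size_map size_enum_ord.
    have {wit} /choice[Z hZ] := wit.
    have := hcore [set x | nv x <= rho] (M w) (G w) Af Z boxE (M1 w) (fun g l => IntF _ g w l Nn0) IntA.
    move=> /(_ _ _ _) hc; apply: le_trans (hc _ _ _); first last.
    - by move=> g x y; have [_ _] := hZ g; auto.
    - by move=> g x xZ; have [_ h _ _] := hZ g; exact: h.
    - by move=> g; have [] := hZ g.
    by rewrite natr_sum; apply: ler_sum => g _; have [] := hZ g.
  have lX : L1 P (fun w => phi rho L r tau' (X^~ w)) by have [] := CM [ffun=> ord0].
  split => //.
  have lg g : L1 P (fun w => cmw P (zeg g) w * ph g w) by have [] := CM g.
  have E1 : #|grid Nn|%:R * \int[P]_w phi rho L r tau' (X^~ w) = \int[P]_w \sum_g (cmw P (zeg g) w * ph g w).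
    have gen (s : seq (grid Nn)) : (size s)%:R * \int[P]_w phi rho L r tau' (X^~ w) = \int[P]_w \sum_(g <- s) (cmw P (zeg g) w * ph g w).
      elim: s => [|g s ih].
        by rewrite mul0r (@eq_EE _ _ _ _ _ (fun=> 0)) ?EE_cst// => w; rewrite big_nil.
      rewrite [RHS](@eq_EE _ _ _ _ _ (fun w => cmw P (zeg g) w * ph g w + \sum_(g <- s) (cmw P (zeg g) w * ph g w))); last by move=> w; rewrite big_cons.
      rewrite EED//; last by apply: L1_sum => //; exact: L1_cst.
      by rewrite -ih /= -natr1 mulrDl mul1r addrC; have [_ _ <-] := CM g.
    have := gen (index_enum (grid Nn)); rewrite (_ : size _ = #|grid Nn|)// .
    by rewrite cardT enumT.
  have WE w : \sum_g (cmw P (zeg g) w * ph g w) <= #|grid Nn|%:R * (Cc * (W w ^+ 2 + M w ^+ (2 * e))).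
    have W0 : 0 <= W w := expR_ge0 _.
    apply: (@le_trans _ _ (W w * \sum_g ph g w)).
      rewrite mulr_sumr; apply: ler_sum => g _; rewrite ler_wpM2r ?phi_ge0//; exact: cmw_le.
    apply: (@le_trans _ _ (W w * (Cc * M w ^+ e * #|grid Nn|%:R))); first by rewrite ler_wpM2l.
    rewrite mulnC exprM; have : 0 <= M w ^+ e by rewrite exprn_ge0.
    move: (M w ^+ e) (W w) W0 => y x x0 y0.
    have -> : x * (Cc * y * #|grid Nn|%:R) = #|grid Nn|%:R * (Cc * (x * y)) by ring.
    by rewrite ler_wpM2l// ler_wpM2l//; nra.
  have := EE_le (L1_sum (index_enum (grid Nn)) (L1_cst P 0) lg) (L1Z #|grid Nn|%:R lWM) WE.
  by rewrite -E1 EEZ// ler_pM2l.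
have /choice[tau htau] : forall k : nat, exists tau : R, 0 < tau /\ forall L, L1 P (fun w => phi rho L k.+1%:R^-1 tau (X^~ w)) /\ \int[P]_w phi rho L k.+1%:R^-1 tau (X^~ w) <= Cst.
  by move=> k; have [|t t0 ht] := main k.+1%:R^-1; [rewrite invr_gt0|exists t].
pose F k w := phi rho k k.+1%:R^-1 (tau k) (X^~ w).
have lF k : L1 P (F k) by have [_ /(_ k)[]] := htau k.
pose Psi w := limn_einf (fun k => (F k w)%:E).
have mEF k : measurable_fun setT (fun w => (F k w)%:E) by apply/measurable_EFinP; exact: L1_meas (lF k).
have EF0 k w : setT w -> (0 <= (F k w)%:E)%E by rewrite lee_fin phi_ge0.
have Psi_ge (c : R) w : (\forall k \near \oo, c <= F k w) -> (c%:E <= Psi w)%E.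
  move=> [k0 _ hk]; rewrite /Psi limn_einf_lim; apply: lime_ge; first exact: is_cvg_einfs.
  exists k0 => // k /= k0k; apply: le_ereal_inf_tmp => _ [m /= km <-]; rewrite lee_fin; apply: hk.
  exact: leq_trans km.
exists rho => //; exists Psi; split.
- rewrite /Psi (_ : (fun w => _) = (fun w => - limn_esup (fun k => - (F k w)%:E))%E); last by [].
  apply: measurableT_comp => //; apply: measurable_fun_limn_esup => k.
  by apply: measurableT_comp => //; exact: mEF.
- by move=> w; apply: Psi_ge; apply: nearW => k; exact: phi_ge0.
- apply: le_lt_trans (fatou P measurableT mEF EF0) _.
  apply: (@le_lt_trans _ _ Cst%:E); last exact: ltry.
  rewrite limn_einf_lim; apply: lime_le; first exact: is_cvg_einfs.
  apply: nearW => k; apply: (@le_trans _ _ (\int[P]_w (F k w)%:E)%E).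
    by apply: ereal_inf_lbound; exists k => /=.
  by rewrite (EE_fin (lF k)) lee_fin; have [_ /(_ k)[]] := htau k.
move=> w Z uZ hZ; apply: Psi_ge.
(* The factor 3 ensures that rational points within [r] of distinct zeros are still at distance
   [r]. *)
have [r r0 hr] : exists2 r : R, 0 < r & forall x y, x \in Z -> y \in Z -> x != y -> 3 * r <= nv (x - y).
  pose Q (t : seq_sub Z * seq_sub Z) (r : R) := ssval t.1 != ssval t.2 -> 3 * r <= nv (ssval t.1 - ssval t.2).
  have [|t|r /andP[r0 _] hQ] := @fin_radius R _ 1 Q ltr01.
  - by move=> t r r' rr' h /h; apply: le_trans; rewrite ler_wpM2l.
  - have [e'|ne] := eqVneq (ssval t.1) (ssval t.2); first by exists 1 => //; rewrite /Q e' eqxx.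
    have p0 : 0 < nv (ssval t.1 - ssval t.2).
      rewrite lt_neqAle nv_ge0 andbT eq_sym; apply/negP => /eqP/nv_eq0/eqP; rewrite subr_eq0.
      exact/negP.
    by exists (nv (ssval t.1 - ssval t.2) / 3) => [|_]; [rewrite divr_gt0|rewrite mulrCA mulfV ?mulr1].
  by exists r => // x y xZ yZ; exact: hQ (SeqSub xZ, SeqSub yZ).
exists (maxn (size Z) (Num.truncn r^-1).+1) => // k /=; rewrite geq_max => /andP[kZ kr].
apply: phi_ge => // m mZ.
have tk0 : 0 < tau k by have [] := htau k.
have kr' : k.+1%:R^-1 <= r.
  rewrite -[r]invrK lef_pV2 ?posrE ?invr_gt0//; apply: le_trans (ltW (truncnS_gt _)) _.
  by rewrite ler_nat ltnW.
pose zz (i : 'I_m) := nth 0 Z i.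
have iZ (i : 'I_m) : (i < size Z)%N by exact: leq_trans mZ.
have zin i : zz i \in Z by exact: mem_nth.
have app (i : 'I_m) : exists p : {ffun 'I_d * BB S -> rat}, [/\ nv (dpt p) <= rho, nv (dpt p - zz i) <= r & forall l, nrm (f w (fun=> 0%N) (dpt p) l) <= tau k].
  have [h1 h2] := hZ _ (zin i); have h1' := le_trans h1 rho_le.
  pose Q (l : 'I_d) (de : R) := forall y, nv y <= rho0 -> nv (y - zz i) <= de -> nrm (f w (fun=> 0%N) y l) <= tau k.
  have [|l|de /andP[de0 der] hQ] := @fin_radius R _ r Q r0.
  - by move=> l de de' dd h y h3 h4; apply: h => //; exact: le_trans dd.
  - have s0' : (msize (fun _ : 'I_d => 0%N) <= q.+1)%N by rewrite s0.
    have [de de0 hde] := jf_cont jf w l s0' h1' tk0.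
    by exists de => // y h3 h4; have := hde y h3 h4; rewrite h2 subr0.
  have [p [h3 h4]] := dpt_dense_box rho_gt0 h1 de0.
  exists p; split => // [|l]; first exact: le_trans der.
  by apply: hQ => //; exact: le_trans rho_le.
have {app} /choice[pp hpp] := app.
exists [tuple pp i | i < m]; split; first split => [i|i j ij].
- by rewrite tnth_mktuple; have [] := hpp i.
- rewrite !tnth_mktuple; have [_ h1 _] := hpp i; have [_ h2 _] := hpp j.
  have zij : zz i != zz j by rewrite /zz nth_uniq.
  have h3 := hr _ _ (zin i) (zin j) zij.
  have := nv_tri S (dpt (pp i)) (zz i) (zz j); have := nv_tri S (dpt (pp j)) (dpt (pp i)) (zz j).
  rewrite [nv (zz i - dpt _)]nvB => t1 t2; apply: le_trans kr' _; move: h1 h2 h3 t1 t2; lra.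
- move=> [[i l] b] /=; rewrite tnth_mktuple; have [h1 _ h2] := hpp i.
  rewrite /X /= (le_trans h1 rho_le).
  exact: le_trans (co_nrm _ _ _) (h2 l).
Qed.

End LocalBound.

(** * From smooth paths to jets *)

Section Smooth.
Context {R : realType} {K : numFieldType} (S : scalars R K) {d : nat}.
Local Notation nrm := (nrm S).
Local Notation nv := (nv S).
Local Notation iota := (iota S).
Local Notation V := 'rV[K]_d.
Local Notation mi := ('I_d -> nat).

Definition contv (F : V -> K) (y : V) := forall eps : R, 0 < eps -> exists2 de : R, 0 < de &
  forall y', nv (y' - y) <= de -> nrm (F y' - F y) <= eps.

Definition pd (F : V -> K) (j : 'I_d) (y : V) (v : K) := forall eps : R, 0 < eps -> exists2 de : R, 0 < de &
  forall h : K, nrm h <= de -> nrm (F (y + h *: delta_mx 0 j) - F y - h * v) <= eps * nrm h.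

(** Compactness of a cube of real coordinates, as a uniformity principle. In the complex case the
    cube is larger than the box; its points outside the box have neighbourhoods where the property
    is vacuous. *)
Lemma box_unif (rho : R) (Q : R -> V -> Prop) :
  (forall y, nv y <= rho -> exists2 de : R, 0 < de & forall y', nv (y' - y) <= de -> nv y' <= rho ->
     forall eta : R, 0 < eta -> eta <= de -> Q eta y') ->
  exists2 eta : R, 0 < eta & forall y, nv y <= rho -> Q eta y.
Proof.
move=> h; pose n := #|{: 'I_d * BB S}|.
pose ph (c : 'rV[R]_n) : V := \row_i \sum_b iota (c 0 (enum_rank (i, b))) * uu S b.
pose A : set 'rV[R]_n := [set c | forall i, `[- rho, rho]%classic (c 0 i)].
have cA : compact A by exact: (@rV_compact R n (fun=> `[- rho, rho]%classic) (fun i => @segment_compact R _ _)).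
have phlip (c c' : 'rV[R]_n) (e : R) : 0 <= e -> (forall i, `|c 0 i - c' 0 i| <= e) -> nv (ph c' - ph c) <= #|BB S|%:R * e.
  move=> e0 he; apply: nv_le => [|i]; first by rewrite mulr_ge0.
  rewrite !mxE -sumrB; apply: nrm_sum_le => b; rewrite -mulrBl -rmorphB nrmM nrm_uu mulr1 nrm_iota.
  by rewrite distrC.
have nB0 : 0 < #|BB S|%:R + 1 :> R by rewrite ltr_wpDl.
have ballP (c c' : 'rV[R]_n) (e : R) : ball c e c' -> forall i, `|c 0 i - c' 0 i| <= e.
  by move=> [_ H] i; apply: ltW; exact: (H 0 i).
have near_c c : A c -> \forall c' \near c & eta \near 0^'+, nv (ph c') <= rho -> Q eta (ph c').
  move=> Ac; have [yr|yr] := leP (nv (ph c)) rho.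
    have [de de0 hde] := h _ yr.
    have e0 : 0 < de / (#|BB S|%:R + 1) by rewrite divr_gt0.
    exists (ball c (de / (#|BB S|%:R + 1)), [set eta | 0 < eta <= de]); first split.
    - exact: nbhsx_ballx.
    - exists de => //= eta /=; rewrite sub0r normrN => h1 h2; rewrite h2 /=.
      by apply: le_trans (ler_norm _) (ltW h1).
    move=> [c' eta] /= [h1 /andP[h2 h3]] h4; apply: hde => //.
    apply: le_trans (phlip _ _ _ (ltW e0) (ballP _ _ _ h1)) _.
    by rewrite mulrCA ler_piMr ?(ltW de0)// ler_pdivrMr// mul1r lerDl.
  pose e := (nv (ph c) - rho) / (#|BB S|%:R + 1).
  have e0 : 0 < e by rewrite divr_gt0// subr_gt0.
  exists (ball c e, setT); first by split; [exact: nbhsx_ballx|exact: filterT].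
  move=> [c' eta] /= [h1 _] h4; exfalso.
  have h2 := phlip _ _ _ (ltW e0) (ballP _ _ _ h1).
  have h3 := nv_tri S (ph c') (ph c) 0; rewrite !subr0 [nv (ph c - _)]nvB in h3.
  have h5 : (#|BB S|%:R + 1) * e = nv (ph c) - rho by rewrite mulrC divfK// gt_eqF.
  by rewrite mulrDl mul1r in h5; move: h2 h3 h5 e0 h4; lra.
have H : \forall eta \near 0^'+, A `<=` (fun c => nv (ph c) <= rho -> Q eta (ph c)).
  by have /compact_near_coveringP := cA; apply.
have [e0 /= e00 he] := H.
exists (e0 / 2) => [|y yr]; first by rewrite divr_gt0.
pose c : 'rV[R]_n := \row_k co S (enum_val k).2 (y 0 (enum_val k).1).
have phc : ph c = y.
  apply/rowP => i; rewrite mxE [RHS](co_sum S); apply: eq_bigr => b _.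
  by rewrite mxE enum_rankK.
rewrite -phc; apply: he; rewrite ?phc//=; last 2 first.
- by rewrite divr_gt0.
- move=> k /=; rewrite mxE in_itv /= -ler_norml.
  exact: le_trans (co_nrm _ _ _) (le_trans (le_nv _ _ _) yr).
by rewrite sub0r normrN gtr0_norm ?divr_gt0// ltr_pdivrMr// ltr_pMr// ltr1n.
Qed.

Lemma is_derive_eps (g : R -> R) (u v : R) : (forall eps : R, 0 < eps -> exists2 de : R, 0 < de &
  forall h, `|h| <= de -> `|g (u + h) - g u - h * v| <= eps * `|h|) -> is_derive u (1 : R) g v.
Proof.
move=> H; have c : h^-1 *: ((g \o shift u) (h *: (1 : R)) - g u) @[h --> 0^'] --> v.
  apply/cvgrPdist_le => eps eps0; have [de de0 hde] := H _ eps0.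
  exists de => //= h /=; rewrite sub0r normrN => h1 h0.
  have := hde h (ltW h1); have h0' : 0 < `|h| by rewrite normr_gt0.
  rewrite -ler_pdivrMr// -normfV -normrM distrC; congr (`|_| <= _).
  by rewrite /= /shift /= [h *: 1]mulr1 [h + u]addrC mulrC /GRing.scale /= mulrBr mulrA mulVf ?mul1r.
by apply: DeriveDef; [apply/cvg_ex; exists v|exact: cvg_lim].
Qed.

Lemma contv_bound rho F : (forall y, nv y <= rho -> contv F y) -> exists2 M : R, 0 <= M & forall y, nv y <= rho -> nrm (F y) <= M.
Proof.
move=> h; have [y yr|eta eta0 he] := @box_unif rho (fun eta y => nrm (F y) <= eta^-1); last first.
  by exists eta^-1; rewrite ?invr_ge0 ?ltW.
have [de de0 hde] := h y yr 1 ltr01.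
have m0 : 0 < nrm (F y) + 1 by rewrite ltr_wpDl ?nrm_ge0.
exists (Num.min de (nrm (F y) + 1)^-1) => [|y' hy' _ eta eta0]; first by rewrite lt_min de0 invr_gt0.
rewrite le_min => /andP[_ h2]; move: hy'; rewrite le_min => /andP[h1 _].
apply: (@le_trans _ _ (nrm (F y) + 1)); last by rewrite -[leLHS]invrK lef_pV2 ?posrE ?invr_gt0.
by rewrite -(subrK (F y) (F y')) addrC; apply: nrmDl => //; exact: hde.
Qed.

Lemma contv_unif rho F (eps : R) : (forall y, nv y <= rho -> contv F y) -> 0 < eps ->
  exists2 eta : R, 0 < eta & forall y z, nv y <= rho -> nv z <= rho -> nv (z - y) <= eta -> nrm (F z - F y) <= eps.
Proof.
move=> h eps0; have [y yr|eta eta0 he] := @box_unif rho (fun eta y => forall z, nv z <= rho -> nv (z - y) <= eta -> nrm (F z - F y) <= eps); last first.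
  by exists eta => // y z yr; exact: he.
have e2 : 0 < eps / 2 by rewrite divr_gt0.
have [de de0 hde] := h y yr _ e2.
exists (de / 2) => [|y' hy' _ eta eta0 etad z zr zy]; first by rewrite divr_gt0.
have -> : F z - F y' = (F z - F y) - (F y' - F y) by ring.
rewrite (splitr eps); apply: nrmBl; apply: hde.
  by apply: le_trans (nv_tri _ y' _ _) _; rewrite [leRHS]splitr lerD// (le_trans zy).
by apply: le_trans hy' _; rewrite ler_pdivrMr// ler_peMr ?(ltW de0)//; lra.
Qed.

(** The mean value theorem is applied to each real coordinate along the segment, and the uniform
    continuity of [f] makes the error uniform, as [riemann_unif] requires. *)
Lemma pd_riemann rho (F f : V -> K) j (a x : V) : (forall y, nv y <= rho -> contv F y) -> (forall y, nv y <= rho -> contv f y) ->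
  (forall y, nv y <= rho -> pd F j y (f y)) -> nv a <= rho -> nv x <= rho -> (forall i, i != j -> a 0 i = x 0 i) ->
  riemann S a x j F f.
Proof.
move=> cF cf dF ar xr ax; apply: riemann_unif => eps eps0.
pose v := x 0 j - a 0 j; pose D := (#|BB S|%:R + 1) * (nrm v + 1).
have D0 : 0 < D by rewrite mulr_gt0// ltr_wpDl ?nrm_ge0.
have [eta eta0 heta] := contv_unif cf (divr_gt0 eps0 D0).
have ptD s t : pt S a x t = pt S a x s + (iota (t - s) * v) *: delta_mx 0 j.
  apply/rowP => i; rewrite !mxE eqxx /=; have [->|ij] := eqVneq i j.
    by rewrite ?eqxx /= mulr1 rmorphB /v; ring.
  by rewrite ?(negbTE ij) (ax _ ij) subrr /= !mulr0 !addr0.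
have nvd (h : K) : nv (h *: (delta_mx 0 j : V)) <= nrm h.
  rewrite nvZ ler_piMr ?nrm_ge0//; apply: nv_le => // i; rewrite mxE eqxx /=.
  by case: (i == j); rewrite ?nrm1 ?nrm0.
have vv0 : 0 < nrm v + 1 by rewrite ltr_wpDl ?nrm_ge0.
exists (eta / (nrm v + 1)) => [|s t s01 t01 st]; first by rewrite divr_gt0.
have inb u : 0 <= u <= 1 -> nv (pt S a x u) <= rho by exact: nv_pt.
pose g b u := co S b (F (pt S a x u)); pose dg b u := co S b (v * f (pt S a x u)).
have isd b (u : R) : 0 <= u <= 1 -> is_derive u (1 : R) (g b) (dg b u).
  move=> u01; apply: is_derive_eps => ep ep0.
  have [de de0 hde] := dF _ (inb u u01) _ (divr_gt0 ep0 vv0).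
  exists (de / (nrm v + 1)) => [|h hh]; first by rewrite divr_gt0.
  have nh : nrm (iota h * v) = `|h| * nrm v by rewrite nrmM nrm_iota.
  have hv : `|h| * nrm v <= `|h| * (nrm v + 1) by rewrite ler_wpM2l// lerDl.
  have := hde (iota h * v); rewrite nh => H.
  have {}H : nrm (F (pt S a x u + (iota h * v) *: delta_mx 0 j) - F (pt S a x u) - iota h * v * f (pt S a x u)) <= ep / (nrm v + 1) * (`|h| * nrm v).
    apply: H; apply: le_trans hv _; by rewrite -ler_pdivlMr.
  rewrite /g /dg (ptD u (u + h)) [u + h - u]addrC addKr -(co_scale S) -!coB mulrA.
  apply: le_trans (co_nrm _ _ _) (le_trans H _).
  apply: (@le_trans _ _ (ep / (nrm v + 1) * (`|h| * (nrm v + 1)))).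
    by rewrite ler_wpM2l// divr_ge0 ?ltW.
  by rewrite (_ : ep / (nrm v + 1) * (`|h| * (nrm v + 1)) = ep * `|h|)//; field; rewrite gt_eqF.
have mvt b (s1 t1 : R) : 0 <= s1 <= 1 -> 0 <= t1 <= 1 -> s1 <= t1 -> exists2 c, s1 <= c <= t1 & g b t1 - g b s1 = dg b c * (t1 - s1).
  move=> h1 h2 h3; have [||c] := @MVT_segment R (g b) (dg b) s1 t1 h3.
  - move=> y; rewrite in_itv /= => /andP[y1 y2]; apply: isd; lra.
  - apply: continuous_in_subspaceT => y /set_mem /=; rewrite in_itv /= => /andP[y1 y2].
    have y01 : 0 <= y <= 1 by move: h1 h2 => /andP[? ?] /andP[? ?]; apply/andP; split; lra.
    have [dy _] := isd b y y01; apply: differentiable_continuous; exact/derivable1_diffP.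
  - by rewrite in_itv /=; exists c.
have key b : `|co S b (F (pt S a x t) - F (pt S a x s) - iota (t - s) * (v * f (pt S a x s)))| <= eps / (#|BB S|%:R + 1) * `|t - s|.
  rewrite !coB co_scale -/(g b t) -/(g b s) -/(dg b s).
  have [c [c01 cs cE]] : exists c, [/\ 0 <= c <= 1, `|c - s| <= `|t - s| & g b t - g b s = dg b c * (t - s)].
    have [le_st|/ltW le_ts] := leP s t.
      have [c cst E] := mvt b s t s01 t01 le_st; exists c; split => //; first by lra.
      by rewrite !ger0_norm; lra.
    have [c cst E] := mvt b t s t01 s01 le_ts; exists c; split; first by lra.
      by rewrite !ler0_norm; lra.
    by rewrite -opprB E; ring.
  rewrite cE [(t - s) * _]mulrC -mulrBl normrM ler_wpM2r// -coB -mulrBr.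
  apply: le_trans (co_nrm _ _ _) _; rewrite nrmM.
  apply: (@le_trans _ _ ((nrm v + 1) * (eps / D))); last first.
    by rewrite /D le_eqVlt; apply/orP; left; apply/eqP; field; rewrite !gt_eqF// ltr_wpDl.
  apply: ler_pM; rewrite ?nrm_ge0 ?lerDl//; apply: heta; [exact: inb|exact: inb|].
  rewrite (ptD s c) [pt S a x s + _]addrC addrK; apply: le_trans (nvd _) _; rewrite nrmM nrm_iota.
  apply: (@le_trans _ _ (eta / (nrm v + 1) * (nrm v + 1))); last by rewrite divfK ?gt_eqF.
  by apply: ler_pM; rewrite ?nrm_ge0 ?lerDl//; exact: le_trans st.
apply: le_trans (nrm_co_le key) _; rewrite mulrA ler_wpM2r// mulrCA ler_piMr ?(ltW eps0)//.
by rewrite ler_pdivrMr ?mul1r ?lerDl// ltr_wpDl.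
Qed.

End Smooth.

Section SmoothField.
Context {dT : measure_display} {T : measurableType dT} {R : realType}.
Variable P : probability T R.
Context {K : numFieldType} (S : scalars R K) {d : nat} (k : nat).
Local Notation nrm := (nrm S).
Local Notation nv := (nv S).
Local Notation iota := (iota S).
Local Notation V := 'rV[K]_d.
Local Notation mi := ('I_d -> nat).
Variables (V0 : (T -> R) -> Prop) (U : set V) (D : T -> mi -> V -> 'I_d -> K).
Hypothesis gV0 : gspace P V0.
Hypothesis Uop : forall x, U x -> exists2 de : R, 0 < de & forall y, nv (y - x) <= de -> U y.
Hypothesis Dc : forall w be l x, (msize be <= k)%N -> U x -> contv S (fun y => D w be y l) x.
Hypothesis Dd : forall w be (j : 'I_d) l x, (msize be < k)%N -> (forall i : 'I_d, (i < j)%N -> be i = 0%N) -> U x ->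
  pd S (fun y => D w be y l) j x (D w (incr be j) x l).
Hypothesis DG : forall x l, U x -> VK S V0 (fun w => D w (fun=> 0%N) x l).

Definition gcl n := iter n (@gclos _ T R) V0.

Lemma gspace_gcl n : gspace P (gcl n).
Proof. by elim: n => [//|n ih]; exact: gspace_gclos. Qed.

Lemma gcl_le m n Y : (m <= n)%N -> gcl m Y -> gcl n Y.
Proof.
move=> /subnK <-; elim: (n - m)%N => [//|i ih] h.
by apply: gclos_sub; exact: ih.
Qed.

(** A derivative is the pointwise limit of difference quotients of a derivative of one order less,
    so each order costs one closure. The variable removed is the smallest one present, which is the
    last in which the derivative was taken. *)
Lemma D_gcl be l x : (msize be <= k)%N -> U x -> VK S (gcl (msize be)) (fun w => D w be x l).
Proof.
move: x; move sE : (msize be) => s; elim: s be sE => [|s ih] be sE x sk Ux.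
  have -> : be = fun=> 0%N; last exact: DG.
  apply/funext => i; apply/eqP; rewrite -leqn0 -sE /msize (bigD1 i)//= leq_addr //.
have [j [be' [beE hj]]] : exists j be', be = incr be' j /\ forall i : 'I_d, (i < j)%N -> be' i = 0%N.
  have exj : exists j, (0 < be j)%N.
    apply: contrapT => no; move: sE; rewrite /msize big1// => i _.
    by apply/eqP; rewrite -leqn0 leqNgt; apply/negP => h; apply: no; exists i.
  have [j bj jm] := @arg_minnP _ (sval (cid exj)) (fun j => 0 < be j)%N (fun j => j : nat) (svalP (cid exj)).
  exists j, (fun i => be i - (i == j))%N; split => [|i ij].
    apply/funext => i; rewrite /incr; have [->|] := eqVneq i j; last by rewrite subn0 addn0.
    by rewrite subnK.
  rewrite (_ : i == j = false) ?subn0; last by apply/negbTE; rewrite neq_ltn ij.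
  by apply/eqP; rewrite -leqn0 leqNgt; apply/negP => /jm; rewrite leqNgt ij.
have s'E : msize be' = s by have := msize_incr be' j; rewrite -beE sE => -[].
have [de de0 hde] := Uop Ux.
pose h n : K := iota (de / n.+1%:R).
have hn0 n : 0 < de / n.+1%:R by rewrite divr_gt0.
have Uh n : U (x + h n *: delta_mx 0 j).
  apply: hde; rewrite addrC addKr nvZ nrm_iota ger0_norm ?(ltW (hn0 n))//.
  apply: (@le_trans _ _ (de / n.+1%:R * 1)).
    rewrite ler_wpM2l ?(ltW (hn0 n))//; apply: nv_le => // i; rewrite mxE eqxx /=.
    by case: (i == j); rewrite ?nrm1 ?nrm0.
  by rewrite mulr1 ler_pdivrMr// ler_peMr ?(ltW de0)// ler1n.
have VD y : U y -> VK S (gcl s) (fun w => D w be' y l) by move=> Uy; apply: ih => //; exact: ltnW.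
move=> b; exists (fun n w => co S b ((h n)^-1 * (D w be' (x + h n *: delta_mx 0 j) l - D w be' x l))) => [n|w].
  by apply: (VKM (gspace_gcl s)); apply: (VKB (gspace_gcl s)); exact: VD.
apply/cvgrPdist_le => eps eps0.
have bk' : (msize be' < k)%N by rewrite s'E.
have [de' de'0 hde'] := @Dd w be' j l x bk' hj Ux eps eps0.
exists (Num.truncn (de / de')).+1 => // n /= nn.
rewrite -coB; apply: le_trans (co_nrm _ _ _) _; rewrite nrmB.
have nh : nrm (h n) = de / n.+1%:R by rewrite nrm_iota ger0_norm ?(ltW (hn0 n)).
have hN : h n != 0 by apply/eqP => e; have := hn0 n; rewrite -nh e nrm0 ltxx.
have := hde' (h n); rewrite nh ler_pdivrMr// -ler_pdivrMl// mulrC.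
have -> : de / de' <= n.+1%:R by apply: le_trans (ltW (truncnS_gt _)) _; rewrite ler_nat ltnW.
move=> /(_ isT) H.
rewrite beE (_ : _ - _ = (h n)^-1 * (D w be' (x + h n *: delta_mx 0 j) l - D w be' x l - h n * D w (incr be' j) x l)); last first.
  by rewrite [in RHS]mulrBr mulrA mulVf// mul1r.
by rewrite nrmM nrmV nh mulrC ler_pdivrMr.
Qed.

Lemma smooth_jet_field x0 rho : (forall y, nv y <= rho -> U (x0 + y)) ->
  jet_field S k (gcl k) (fun w be y l => D w be (x0 + y) l) rho.
Proof.
move=> hU.
have cT w be l y : (msize be <= k)%N -> nv y <= rho -> contv S (fun y => D w be (x0 + y) l) y.
  move=> bk yr eps eps0; have [de de0 h] := Dc w l bk (hU y yr) eps0; exists de => // y' hy'.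
  by apply: h; rewrite opprD addrACA subrr add0r.
split => [w l|w l be x bk xr eps eps0|be x l bk xr].
- have [M M0 hM] : exists2 M : R, 0 <= M & forall be y, (msize be <= k)%N -> nv y <= rho -> nrm (D w be (x0 + y) l) <= M.
    pose be_ (t : {ffun 'I_d -> 'I_k.+1}) i : nat := t i.
    have /choice[M hM] : forall t : {ffun 'I_d -> 'I_k.+1}, exists M : R, 0 <= M /\ ((msize (be_ t) <= k)%N -> forall y, nv y <= rho -> nrm (D w (be_ t) (x0 + y) l) <= M).
      move=> t; have [bk|_] := boolP (msize (be_ t) <= k)%N; last by exists 0.
      by have [M M0 hM] := contv_bound (fun y yr => cT w _ l y bk yr); exists M.
    exists (\sum_t M t) => [|be y bk yr]; first by apply: sumr_ge0 => t _; have [] := hM t.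
    have bE i : (be i < k.+1)%N by rewrite ltnS; apply: leq_trans bk; rewrite /msize (bigD1 i)//= leq_addr.
    pose t : {ffun 'I_d -> 'I_k.+1} := [ffun i => Ordinal (bE i)].
    have tE : be_ t = be by apply/funext => i; rewrite /be_ ffunE.
    have [_] := hM t; rewrite tE => /(_ bk y yr) h; apply: le_trans h _.
    by rewrite (bigD1 t)//= lerDl; apply: sumr_ge0 => t' _; have [] := hM t'.
  exists M; split => // be j a x bk hb h1 h2 h3.
  apply: (@pd_riemann _ _ S d rho) => // [y yr|y yr|y yr].
  + by apply: cT => //; exact: ltnW.
  + by apply: cT => //; rewrite msize_incr.
  + move=> eps eps0; have [de de0 h] := @Dd w be j l (x0 + y) bk hb (hU y yr) eps eps0; exists de => // u hu.
    by rewrite addrA; exact: h.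
- by have [de de0 h] := cT w be l x bk xr eps eps0; exists de => // y _; exact: h.
- by move=> b; apply: (gcl_le bk); exact: (@D_gcl be l (x0 + x) bk (hU x xr) b).
Qed.

End SmoothField.

(** * Local to global *)

Section NonMeasurable.
Context {dT : measure_display} {T : measurableType dT} {R : realType}.
Variable mu : {measure set T -> \bar R}.
Import HBNNSimple.
Local Open Scope ereal_scope.

(** The integral is a supremum over simple functions below [f]; this allows a number of zeros of
    unknown measurability to be compared with a measurable majorant. *)
Lemma le_integral_ae (f g : T -> \bar R) (N : set T) : (forall w, 0 <= f w) -> (forall w, 0 <= g w) ->
  measurable_fun setT g -> measurable N -> mu N = 0 -> (forall w, ~ N w -> f w <= g w) ->
  \int[mu]_w f w <= \int[mu]_w g w.
Proof.
move=> f0 g0 mg mN N0 fg; rewrite ge0_integralTE//; apply: ge_ereal_sup => _ [h /= hf <-].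
rewrite -integralT_nnsfun; apply: ae_ge0_le_integral => //.
- by move=> x _; rewrite lee_fin.
- by apply/measurable_EFinP; exact: measurable_funP.
- exists N; split => // w /= hw; apply: contrapT => Nw; apply: hw => _.
  exact: le_trans (hf w) (fg w Nw).
Qed.

Lemma ge_integral_all (f g : T -> \bar R) : (forall w, 0 <= f w) -> (forall w, 0 <= g w) ->
  (forall w, g w <= f w) -> \int[mu]_w g w <= \int[mu]_w f w.
Proof.
move=> f0 g0 gf; rewrite !ge0_integralTE//; apply: ge_ereal_sup => _ [h /= hg <-].
by apply: ereal_sup_ubound; exists h => //= w; exact: le_trans (hg w) (gf w).
Qed.

Lemma eq_integral_ae (f g : T -> R) (N : set T) : measurable_fun setT g -> measurable N -> mu N = 0 ->
  (forall w, ~ N w -> f w = g w) -> \int[mu]_w (f w)%:E = \int[mu]_w (g w)%:E.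
Proof.
move=> mg mN N0 fg.
have ge0 (u v : T -> \bar R) : (forall w, 0 <= u w) -> (forall w, 0 <= v w) -> measurable_fun setT v ->
    (forall w, ~ N w -> u w = v w) -> \int[mu]_w u w = \int[mu]_w v w.
  move=> u0 v0 mv uv; apply/eqP; rewrite eq_le; apply/andP; split.
    by apply: (le_integral_ae (N := N)) => // w Nw; rewrite uv.
  pose v' w := v w * (\1_(~` N) w)%:E.
  have v'0 w : 0 <= v' w by rewrite mule_ge0// lee_fin indicE.
  apply: (@le_trans _ _ (\int[mu]_w v' w)).
    apply: (le_integral_ae (N := N)) => //.
      by apply: emeasurable_funM => //; apply/measurable_EFinP; exact: (measurable_indic (measurableC mN)).
    by move=> w Nw; rewrite /v' indicE mem_set ?mule1.
  apply: ge_integral_all => // w; rewrite /v' indicE.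
  by have [Nw|Nw] := pselect (N w); [rewrite memNset ?mule0//|rewrite mem_set// mule1 uv].
rewrite integralE [RHS]integralE; congr (_ - _); apply: ge0 => //.
- by apply: measurable_funepos; exact/measurable_EFinP.
- by move=> w Nw; rewrite !funeposE fg.
- by apply: measurable_funeneg; exact/measurable_EFinP.
- by move=> w Nw; rewrite !funenegE fg.
Qed.
End NonMeasurable.

Section Dual.
Context {dT : measure_display} {T : measurableType dT} {R : realType}.
Variable P : probability T R.
Variable Vg : (T -> R) -> Prop.
Hypothesis gV : gspace P Vg.

(** The coefficients are those of the inverse covariance matrix: a vector in its kernel would
    contradict positivity of the quadratic form. *)
Lemma dual_family (I : finType) (xi : I -> T -> R) : (forall i, Vg (xi i)) ->
  (forall c : I -> R, (exists i, c i != 0) -> 0 < \sum_i \sum_j c i * c j * gcov P (xi i) (xi j)) ->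
  exists2 ze : I -> T -> R, (forall i, Vg (ze i)) & forall i j, gcov P (xi j) (ze i) = (i == j)%:R.
Proof.
move=> Vxi pos; pose n := #|I|.
pose M : 'M[R]_n := \matrix_(i, j) gcov P (xi (enum_val i)) (xi (enum_val j)).
have uM : M \in unitmx.
  rewrite -row_free_unit -kermx_eq0; apply/rowV0P => v /sub_kermxP vM; apply: contrapT => v0.
  pose c i := v 0 (enum_rank i).
  have [i ci] : exists i, c i != 0.
    apply: contrapT => no; apply: v0; apply/rowP => k; rewrite mxE; apply: contrapT => vk.
    by apply: no; exists (enum_val k); rewrite /c enum_valK; exact/eqP.
  have := pos c (ex_intro _ i ci).
  have -> : \sum_i \sum_j c i * c j * gcov P (xi i) (xi j) = (v *m M *m v^T) 0 0.
    rewrite mxE exchange_big /= (reindex (@enum_val _ (mem I)))/=; last by apply: onW_bij; exact: enum_val_bij.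
    apply: eq_bigr => j _; rewrite !mxE mulr_suml (reindex (@enum_val _ (mem I)))/=; last by apply: onW_bij; exact: enum_val_bij.
    by apply: eq_bigr => k _; rewrite /c !enum_valK !mxE; ring.
  by rewrite vM mul0mx mxE ltxx.
pose ze i w := \sum_(j <- index_enum I) invmx M (enum_rank i) (enum_rank j) * xi j w.
exists ze => [i|i k]; first by apply: (gs_sum gV) => j; exact: (gs_scale gV).
rewrite covC (cov_sum gV _ (F := fun j w => invmx M (enum_rank i) (enum_rank j) * xi j w))//; last by move=> j; exact: (gs_scale gV).
have := congr1 (fun A : 'M[R]_n => A (enum_rank i) (enum_rank k)) (mulVmx uM).
rewrite !mxE (inj_eq enum_rank_inj) => <-.
rewrite (reindex (@enum_rank I))/=; last by apply: onW_bij; exact: enum_rank_bij.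
by apply: eq_bigr => j _; rewrite (cov_scale gV)// !mxE !enum_rankK.
Qed.
End Dual.

Section Topology.
Context {R : realType} {K : numFieldType} (S : scalars R K) {d : nat}.
Local Notation nrm := (nrm S).
Local Notation nv := (nv S).
Local Notation V := 'rV[K]_d.

Lemma iota_gt0 (e : R) : 0 < e -> 0 < iota S e.
Proof. by move=> e0; rewrite lt_neqAle -(rmorph0 (iota S)) iota_le ltW// andbT (inj_eq (@iota_inj _ _ S)) lt_eqF. Qed.

Lemma ball_nv (x y : V) (e : R) : 0 < e -> nv (y - x) < e -> ball x (iota S e) y.
Proof.
move=> e0 h; split=> [|i j]; first exact: iota_gt0.
rewrite (ord1 i) -ball_normE /= (normE S).
rewrite lt_neqAle iota_le (inj_eq (@iota_inj _ _ S)) -lt_neqAle.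
apply: le_lt_trans h; rewrite nrmB; apply: le_trans (le_nv _ _ j); by rewrite !mxE.
Qed.

Lemma nv_ball (x y : V) (e : R) : 0 < e -> ball x (iota S e) y -> nv (y - x) <= e.
Proof.
move=> e0 h; apply: nv_le => [|i]; first exact: ltW.
have := h.2 0 i; rewrite -ball_normE /= (normE S) => /ltW; rewrite iota_le => h'.
by rewrite !mxE nrmB.
Qed.

Lemma nbhs_nv (x : V) (A : set V) : nbhs x A <-> exists2 de : R, 0 < de & forall y, nv (y - x) <= de -> A y.
Proof.
split=> [/nbhs_ballP[e /= e0 he]|[de de0 h]].
  have ne : iota S (nrm e) = e by rewrite -normE gtr0_norm.
  have n0 : 0 < nrm e.
    rewrite lt_neqAle nrm_ge0 andbT eq_sym; apply/negP => /eqP/nrm_eq0 h.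
    by move: e0; rewrite h ltxx.
  exists (nrm e / 2) => [|y hy]; first by rewrite divr_gt0.
  apply: he; rewrite -ne; apply: ball_nv => //; apply: le_lt_trans hy _.
  by rewrite ltr_pdivrMr// ltr_pMr// ltr1n.
apply/nbhs_ballP; exists (iota S de) => /=; first exact: iota_gt0.
by move=> y /(nv_ball de0); exact: h.
Qed.
End Topology.

(** * From boxes to compact sets *)

Section Global.
Context {dT : measure_display} {T : measurableType dT} {R : realType}.
Variable P : probability T R.
Context {K : numFieldType} (S : scalars R K) {d q : nat}.
Local Notation nrm := (nrm S).
Local Notation nv := (nv S).
Local Notation V := 'rV[K]_d.
Local Notation mi := ('I_d -> nat).
Variables (U : set V) (F : T -> V -> V) (D : T -> mi -> V -> 'I_d -> K) (N : set T).
Hypothesis Uo : open U.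
Hypotheses (mN : measurable N) (PN : P N = 0%E).
Hypothesis gauss : forall n (x : 'I_n -> V) (j : 'I_n -> 'I_d) (b : 'I_n -> BB S) (c : 'I_n -> R),
  (forall k, U (x k)) -> gaussian_rv P (fun w => \sum_(k < n) c k * co S (b k) (F w (x k) 0 (j k))).
Hypothesis DF : forall w x l, U x -> D w (fun=> 0%N) x l = if w \in N then 0 else F w x 0 l.
Hypothesis Dc : forall w be l x, (msize be <= q.+1)%N -> U x -> contv S (fun y => D w be y l) x.
Hypothesis Dd : forall w be (j : 'I_d) l x, (msize be < q.+1)%N -> (forall i : 'I_d, (i < j)%N -> be i = 0%N) -> U x ->
  pd S (fun y => D w be y l) j x (D w (incr be j) x l).
Variable xi : V -> multi_index d q.+1 * 'I_d * BB S -> T -> R.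
Hypothesis xiD : forall x i w, U x -> ~ N w -> xi x i w = co S i.2 (D w (mi_fun i.1.1) x i.1.2).
Hypothesis nondeg : forall x, U x -> nondegenerate_vec P (xi x).

(** Finite combinations of values of the field set to 0 on the null set [N], so that limits can be
    taken at every sample point. *)
Let V0 (Y : T -> R) := exists2 s : seq (R * (V * 'I_d * BB S)), (forall c, c \in s -> U c.2.1.1) &
  Y = fun w => \sum_(c <- s) c.1 * co S c.2.2 (D w (fun=> 0%N) c.2.1.1 c.2.1.2).

Let gV0 : gspace P V0.
Proof.
split => [_ [s hs ->]||a b _ _ [s hs ->] [t ht ->]].
- pose Y w := \sum_(c <- s) c.1 * co S c.2.2 (F w c.2.1.1 0 c.2.1.2).
  have gY : gaussian_rv P Y.
    pose tt := in_tuple s.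
    have := @gauss (size s) (fun k => (tnth tt k).2.1.1) (fun k => (tnth tt k).2.1.2) (fun k => (tnth tt k).2.2) (fun k => (tnth tt k).1).
    rewrite (_ : (fun w => _) = Y); first by apply=> k; apply: hs; exact: mem_tnth.
    by apply/funext => w; rewrite /Y [in RHS]big_tnth.
  have [m [v [mY v0 hY]]] := gaussian_rv_gmgf gY; exists m, v.
  set Z := fun w => _.
  have ZE w : Z w = Y w * \1_(~` N) w.
    rewrite /Z /Y indicE in_setC; have [wN|wN] := boolP (w \in N) => /=.
      by rewrite mulr0 big_seq big1// => c cs; rewrite DF ?wN ?co0 ?mulr0//; exact: hs.
    by rewrite mulr1 !big_seq; apply: eq_bigr => c cs; rewrite DF ?(negbTE wN)//; exact: hs.
  have mZ : measurable_fun setT Z.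
    rewrite (funext ZE); apply: measurable_funM => //; apply: measurable_indic; exact: measurableC.
  split => // t; have [l E] := hY t.
  have me := measurable_expZ t mZ.
  have ee : (\int[P]_w (expR (t * Z w))%:E = \int[P]_w (expR (t * Y w))%:E)%E.
    apply: (@eq_integral_ae _ T R P _ _ N) => //; first exact: L1_meas l.
    by move=> w Nw; rewrite ZE indicE mem_set ?mulr1.
  split; last by rewrite -E /Rintegral ee.
  by apply: L1_fin_ge0 => //; rewrite ee (EE_fin l) ltry.
- by exists [::] => //; apply/funext => w; rewrite big_nil.
- exists ([seq (a * c.1, c.2) | c <- s] ++ [seq (b * c.1, c.2) | c <- t]).
    by move=> c; rewrite mem_cat => /orP[] /mapP[c' hc' ->] /=; [exact: hs|exact: ht].
  apply/funext => w; rewrite big_cat !big_map /= !mulr_sumr.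
  by congr (_ + _); apply: eq_bigr => c _; rewrite mulrA.
Qed.

Let Uop x : U x -> exists2 de : R, 0 < de & forall y, nv (y - x) <= de -> U y.
Proof. by move=> Ux; apply/nbhs_nv; exact: (open_nbhs_nbhs (conj Uo Ux)). Qed.

Let DG x l : U x -> VK S V0 (fun w => D w (fun=> 0%N) x l).
Proof.
move=> Ux b; exists [:: (1, (x, l, b))] => [c|]; first by rewrite inE => /eqP ->.
by apply/funext => w; rewrite big_seq1 mul1r.
Qed.

Let gV := gspace_gcl gV0 q.+1.
Let Vg := gcl V0 q.+1.

Lemma local_psi x0 : U x0 -> exists2 rho : R, 0 < rho & exists Psi : T -> \bar R,
  [/\ measurable_fun setT Psi, (forall w, 0 <= Psi w)%E, (\int[P]_w Psi w < +oo)%E &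
   forall w (Z : seq V), ~ N w -> uniq Z -> (forall x, x \in Z -> nv (x - x0) <= rho /\ F w x = 0) ->
     (((size Z) ^_ q.+1)%:R%:E <= Psi w)%E].
Proof.
move=> Ux0; have [de de0 hde] := Uop Ux0.
pose rho0 := Num.min 1 de; have rho00 : 0 < rho0 by rewrite lt_min ltr01.
have rho01 : rho0 <= 1 by rewrite ge_min lexx.
have inU y : nv y <= rho0 -> U (x0 + y).
  by move=> h; apply: hde; rewrite addrC addKr (le_trans h)// ge_min lexx orbT.
have jf := smooth_jet_field gV0 Uop Dc Dd DG inU.
pose I : finType := (multi_index d q.+1 * 'I_d * BB S)%type.
pose xt (i : I) w := co S i.2 (D w (mi_fun i.1.1) (x0 + 0) i.1.2).
have miq (a : multi_index d q.+1) : (msize (mi_fun a) <= q)%N by rewrite -ltnS; exact: (svalP a).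
have n0 : nv (0 : V) <= rho0 by rewrite nv0 ltW.
have Vxt i : Vg (xt i) by apply: (jf_gauss jf) => //; exact: leqW (miq _).
(* Non-degeneracy concerns the original field, the Gaussian space the modified one; the two differ
   on a null set, and the possibly non measurable side is handled by [eq_integral_ae]. *)
have covE i j : fine (covariance P (xi x0 i) (xi x0 j)) = gcov P (xt i) (xt j).
  have xE k w : ~ N w -> xi x0 k w = xt k w by move=> Nw; rewrite /xt addr0 xiD.
  have mE k : fine ('E_P[xi x0 k])%E = gmean P (xt k).
    by rewrite unlock; congr fine; apply: (@eq_integral_ae _ T R P _ _ N) => //; [exact: (gs_meas gV (Vxt k))|exact: xE].
  have Li := gs_L1 gV (Vxt i); have Lj := gs_L1 gV (Vxt j); have Lij := gs_L1M gV (Vxt i) (Vxt j).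
  rewrite unlock !mE unlock.
  transitivity (\int[P]_w ((xt i w - gmean P (xt i)) * (xt j w - gmean P (xt j)))).
    congr fine; apply: (@eq_integral_ae _ T R P _ _ N) => //.
      by apply: measurable_funM; apply: measurable_funB => //; exact: (gs_meas gV (Vxt _)).
    by move=> w Nw; rewrite -(xE i)// -(xE j).
  rewrite (@eq_EE _ _ _ _ _ (fun w => xt i w * xt j w + (- gmean P (xt j) * xt i w + (- gmean P (xt i) * xt j w + gmean P (xt i) * gmean P (xt j))))); last by move=> w; ring.
  have l1 : L1 P (fun w => - gmean P (xt i) * xt j w + gmean P (xt i) * gmean P (xt j)) by apply: L1D; [exact: L1Z|exact: L1_cst].
  have l2 : L1 P (fun w => - gmean P (xt j) * xt i w + (- gmean P (xt i) * xt j w + gmean P (xt i) * gmean P (xt j))) by apply: L1D; [exact: L1Z|].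
  rewrite EED// EED//; last exact: L1Z.
  rewrite EED; [|exact: L1Z|exact: L1_cst].
  by rewrite (EEZ _ Li) (EEZ _ Lj) EE_cst /gcov -!/(gmean P _); ring.
have [|ze Vze hze] := dual_family gV Vxt.
  by move=> c hc; have := nondeg Ux0 hc; under eq_bigr do under eq_bigr do rewrite covE.
have wc (w : J d q) i : (wcont w i < q.+1)%N.
  by rewrite ltnS; apply: leq_trans (msize_wcont w); rewrite /msize (bigD1 i)//= leq_addr.
have wc2 (w : J d q) : (\sum_(i < d) ([ffun i => Ordinal (wc w i)] i : nat) < q.+1)%N.
  by rewrite ltnS; apply: leq_trans (msize_wcont w); apply: eq_leq; apply: eq_bigr => i _; rewrite ffunE.
pose al (w : J d q) : multi_index d q.+1 := exist _ [ffun i => Ordinal (wc w i)] (wc2 w).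
have alE w : mi_fun (al w) = wcont w by apply/funext => i; rewrite /mi_fun /= ffunE.
pose ze' (a : tpar S (d := d) (q := q)) := ze (al a.1.1, a.1.2, a.2).
have [|rho rr [Psi [h1 h2 h3 h4]]] := @local_bound _ T R P K S d q Vg gV _ rho0 rho00 rho01 jf ze' (fun a => Vze _) _.
  move=> be l b a bq.
  have bE i : (be i < q.+1)%N by rewrite ltnS; apply: leq_trans bq; rewrite /msize (bigD1 i)//= leq_addr.
  have bE2 : (\sum_(i < d) ([ffun i => Ordinal (bE i)] i : nat) < q.+1)%N.
    by rewrite ltnS; apply: leq_trans bq; apply: eq_leq; apply: eq_bigr => i _; rewrite ffunE.
  pose bb : multi_index d q.+1 := exist _ [ffun i => Ordinal (bE i)] bE2.
  have bbE : mi_fun bb = be by apply/funext => i; rewrite /mi_fun /= ffunE.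
  have := hze (al a.1.1, a.1.2, a.2) (bb, l, b); rewrite /xt /= bbE => ->; congr (nat_of_bool _)%:R.
  rewrite -[LHS]/((al a.1.1 == bb) && (a.1.2 == l) && (a.2 == b)) [b == _]eq_sym; congr (_ && _ && _).
  apply/eqP/forallP => [e i|h]; first by rewrite -alE -bbE e.
  apply/val_inj/ffunP => i; apply/val_inj; rewrite /= !ffunE /=; exact/eqP.
have /andP[rho_gt0 rho_le] := rr; exists rho => //; exists Psi; split => // w Z Nw uZ hZ.
have := h4 w [seq z - x0 | z <- Z]; rewrite size_map; apply.
  by rewrite map_inj_uniq// => x y /(congr1 (+%R^~ x0)); rewrite !subrK.
move=> _ /mapP[z zZ ->]; have [z1 z2] := hZ z zZ; split => // l.
rewrite addrC subrK DF; last by rewrite -(subrK x0 z) addrC; apply: inU; exact: le_trans rho_le.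
by rewrite memNset// z2 mxE.
Qed.

(** The majorants of finitely many boxes covering [C] are combined by a crude power mean inequality,
    after powers have been bounded by falling factorials. If a path has infinitely many zeros in
    [C], so it does in some box, and the majorant there is infinite. *)
Lemma global_bound (C : set V) : compact C -> C `<=` U ->
  (\int[P]_w (nzeros (R := R) (F w) C ^+ q.+1) < +oo)%E.
Proof.
move=> cC CU.
have /choice[rP hrP] : forall x, exists rP : R * (T -> \bar R), [/\ measurable_fun setT rP.2, (forall w, 0 <= rP.2 w)%E, (\int[P]_w rP.2 w < +oo)%E &
   U x -> 0 < rP.1 /\ forall w (Z : seq V), ~ N w -> uniq Z -> (forall y, y \in Z -> nv (y - x) <= rP.1 /\ F w y = 0) -> (((size Z) ^_ q.+1)%:R%:E <= rP.2 w)%E].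
  move=> x; have [Ux|nU] := pselect (U x); last first.
    by exists (0, fun=> 0%E); split => //=; rewrite integral0 ltry.
  by have [rho rho0 [Psi [? ? ? ?]]] := local_psi Ux; exists (rho, Psi).
pose B x := [set y | nv (y - x) <= (rP x).1].
have cC' := cC; rewrite compact_cover in cC'.
have [Ds sD cov] : exists2 Ds : {fset V}, {subset Ds <= C} & C `<=` \bigcup_(i in [set` Ds]) (B i)^°.
  apply: cC' => [x _|x Cx]; first exact: open_interior.
  exists x => //; rewrite /interior; apply/(nbhs_nv S); exists (rP x).1 => //.
  by have [_ _ _ /(_ (CU x Cx))[]] := hrP x.
pose L := enum_fset Ds.
have UL x : x \in L -> U x by move=> /sD /set_mem /CU.
pose m := size L.
pose a1 : R := ((2 * q.+1) ^ q.+1)%:R; pose a2 : R := (2 ^ q.+1)%:R; pose a3 : R := (m ^ q.+1)%:R.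
pose H x w : \bar R := (a1%:E + a2%:E * (rP x).2 w)%E.
pose G w : \bar R := (a3%:E * \sum_(x <- L) H x w)%E.
have mH x : measurable_fun setT (H x).
  have [mP _ _ _] := hrP x; apply: emeasurable_funD; first exact: measurable_cst.
  by apply: emeasurable_funM => //; exact: measurable_cst.
have H0 x w : (0 <= H x w)%E.
  by have [_ h _ _] := hrP x; rewrite adde_ge0 ?lee_fin// mule_ge0 ?lee_fin.
have mS : measurable_fun setT (fun w => \sum_(x <- L) H x w)%E by apply: emeasurable_sum.
have mG : measurable_fun setT G by apply: emeasurable_funM => //; exact: measurable_cst.
have G0 w : (0 <= G w)%E by apply: mule_ge0; [rewrite lee_fin|apply: sume_ge0].
apply: (@le_lt_trans _ _ (\int[P]_w G w)%E); last first.
  rewrite ge0_integralZl//; [|by move=> w _; apply: sume_ge0|by rewrite lee_fin].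
  apply: lte_mul_pinfty; [by rewrite lee_fin|by []|]; rewrite ge0_integral_sum//.
  apply: lte_sum_pinfty => x _; have [mP P0 Pi _] := hrP x.
  rewrite ge0_integralD//; first last.
  - by apply: emeasurable_funM => //; exact: measurable_cst.
  - by move=> w _; rewrite mule_ge0// lee_fin.
  - by move=> w _; rewrite lee_fin.
  apply: lte_add_pinfty; first by rewrite integral_cst//; apply: lte_mul_pinfty; rewrite ?lee_fin//; apply: le_lt_trans (probability_le1 P _) _ => //; exact: ltry.
  by rewrite ge0_integralZl ?lee_fin//; apply: lte_mul_pinfty => //; rewrite lee_fin.
apply: (@le_integral_ae _ T R P _ _ N) => //.
  by move=> w; apply: expe_ge0; rewrite /nzeros; case: pselect => // _; rewrite lee_fin.
move=> w Nw; rewrite /nzeros.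
(* When [n] exceeds [2 * q.+1], every factor of the falling factorial is at least [n / 2]; smaller
   [n] go into the constant. *)
have ffp (n : nat) : (n ^ q.+1 <= (2 * q.+1) ^ q.+1 + 2 ^ q.+1 * (n ^_ q.+1))%N.
  have [n2|n2] := leqP n (2 * q.+1).
    by apply: leq_trans (leq_addr _ _); rewrite leq_exp2r.
  apply: leq_trans (leq_addl _ _).
  suff hk k : (k <= q.+1)%N -> (n ^ k <= 2 ^ k * n ^_ k)%N by exact: hk.
  elim: k => [//|k ih] kq; rewrite !expnSr ffactnSr mulnACA leq_mul ?ih ?(ltnW kq)//.
  by rewrite mulnBr; lia.
have Pge x (Z : seq V) : x \in L -> uniq Z -> (forall y, y \in Z -> B x y /\ F w y = 0) ->
    (((size Z) ^_ q.+1)%:R%:E <= (rP x).2 w)%E.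
  by move=> xL uZ hZ; have [_ _ _ /(_ (UL x xL))[_ h]] := hrP x; apply: h.
pose ZZ := [set x | C x /\ F w x = 0].
have Zcov y : ZZ y -> exists2 x, x \in L & B x y.
  by move=> [Cy _]; have [x xD] := cov y Cy; exists x => //; exact: interior_subset.
case: pselect => [fin|inf].
  pose fs := fset_set ZZ; have fsE y : (y \in fs) = (y \in ZZ) by rewrite in_fset_set.
  pose a x := size [seq y <- enum_fset fs | nv (y - x) <= (rP x).1].
  have aP x : x \in L -> (((a x) ^_ q.+1)%:R%:E <= (rP x).2 w)%E.
    move=> xL; apply: Pge => //; first by rewrite filter_uniq// fset_uniq.
    move=> y; rewrite mem_filter => /andP[h1 h2]; split => //.
    by have : y \in fs := h2; rewrite fsE => /set_mem[].
  have card_le : (#|` fs| <= \sum_(x <- L) a x)%N.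
    rewrite /a; under eq_bigr do rewrite size_filter -sum1_count.
    rewrite (exchange_big_dep xpredT)//=; have -> : (#|` fs| = \sum_(y <- enum_fset fs) 1)%N by rewrite sum1_size.
    rewrite [leqLHS]big_seq [leqRHS]big_seq; apply: leq_sum => y yfs.
    have [x xL Bx] : exists2 x, x \in L & B x y by apply: Zcov; have : y \in fs := yfs; rewrite fsE => /set_mem.
    by rewrite sum1_count -has_count; apply/hasP; exists x.
  have pow_sum (s : seq V) : ((\sum_(x <- s) a x) ^ q.+1 <= (size s) ^ q.+1 * \sum_(x <- s) a x ^ q.+1)%N.
    pose Mx := (\max_(x <- s) a x)%N.
    have h1 : (\sum_(x <- s) a x <= size s * Mx)%N.
      rewrite /Mx; clear Mx; elim: s => [|x s ih]; first by rewrite !big_nil.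
      rewrite !big_cons mulSn leq_add ?leq_maxl//; apply: leq_trans ih _; by rewrite leq_mul2l leq_maxr orbT.
    have h2 : (Mx ^ q.+1 <= \sum_(x <- s) a x ^ q.+1)%N.
      rewrite /Mx; clear h1 Mx; elim: s => [|x s ih]; first by rewrite !big_nil exp0n.
      rewrite !big_cons; have [e|e] := leqP (a x) (\max_(j <- s) a j); first exact: leq_trans ih (leq_addl _ _).
      exact: leq_addr.
    apply: (@leq_trans ((size s * Mx) ^ q.+1)); first by rewrite leq_exp2r.
    by rewrite expnMn leq_mul2l h2 orbT.
  have -> : ((#|` fs|%:R)%:E ^+ q.+1 = ((#|` fs| ^ q.+1)%N%:R : R)%:E)%E by rewrite -EFin_expe natrX.
  apply: (@le_trans _ _ (((m ^ q.+1 * \sum_(x <- L) a x ^ q.+1)%N)%:R)%:E).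
    rewrite lee_fin ler_nat; apply: leq_trans (pow_sum L); by rewrite leq_exp2r.
  rewrite natrM EFinM; apply: lee_wpmul2l; first by rewrite lee_fin.
  rewrite natr_sum -sumEFin big_seq [X in (_ <= X)%E]big_seq; apply: lee_sum => x xL.
  apply: (@le_trans _ _ (a1 + a2 * ((a x) ^_ q.+1)%:R)%:E).
    by rewrite lee_fin /a1 /a2 -natrM -natrD ler_nat.
  by rewrite EFinD EFinM; apply: leeD => //; apply: lee_wpmul2l; [rewrite lee_fin|exact: aP].
have [x xL xinf] : exists2 x, x \in L & infinite_set (ZZ `&` B x).
  apply: contrapT => no; apply: inf.
  have -> : [set x | C x /\ F w x = 0] = \bigcup_(x in [set` Ds]) (ZZ `&` B x).
    apply/seteqP; split => [y Zy|y [x _ []]//]; have [x xL Bx] := Zcov y Zy.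
    by exists x.
  apply: bigcup_finite => // x xL; apply: contrapT => h; apply: no.
  by exists x.
(* Arbitrarily large finite subsets of the zeros force the majorant above every real number. *)
have Pinf : ((rP x).2 w = +oo)%E.
  apply: eq_infty => t.
  have [D0 D1 D2] := @infinite_set_fset _ (ZZ `&` B x) (Num.truncn `|t| + q.+1).+1 xinf.
  have := Pge x (enum_fset D0) xL (fset_uniq _) (fun y yD => conj (D1 y yD).2 (D1 y yD).1.2).
  apply: le_trans; rewrite lee_fin; apply: le_trans (ler_norm _) _.
  apply: le_trans (ltW (truncnS_gt _)) _; rewrite ler_nat.
  set s := size _; have sE : (Num.truncn `|t| + q.+1 < s)%N by exact: D2.
  move: sE; case: s => // s; rewrite ltnS => sE; rewrite ffactSS.
  apply: (@leq_trans (s.+1 * 1)); first by rewrite muln1 ltnS; apply: leq_trans sE; exact: leq_addr.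
  by rewrite leq_mul2l ffact_gt0; apply/orP; right; apply: leq_trans sE; rewrite addnS leqW// leq_addl.
suff -> : (G w = +oo)%E by rewrite leey.
have m0 : (0 < m)%N by rewrite /m; case: (L) xL.
rewrite /G (_ : (\sum_(x <- L) H x w)%E = +oo%E); last first.
  apply/eqP; rewrite -leye_eq (big_rem x)//= /H Pinf gt0_muley ?lte_fin ?ltr0n ?expn_gt0//.
  by rewrite addey// addye ?leey//; rewrite gt_eqF//; apply: (@lt_le_trans _ _ 0%E) => //; apply: sume_ge0 => y _; exact: H0.
by rewrite gt0_muley// lte_fin ltr0n expn_gt0 m0.
Qed.

End Global.

(** * Derivatives *)

Section Deriv.
Context {R : realType} {K : numFieldType} (S : scalars R K) {d : nat}.
Local Notation nrm := (nrm S).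
Local Notation nv := (nv S).
Local Notation V := 'rV[K]_d.

Lemma continuous_contv (f : V -> V) x l : {for x, continuous f} -> contv S (fun y => f y 0 l) x.
Proof.
move=> cf eps eps0; have n1 : nbhs (f x) (ball (f x) (iota S eps)) by apply: nbhsx_ballx; exact: iota_gt0.
have /(nbhs_nv S)[de de0 h] := cf _ n1; exists de => // y /h /(nv_ball eps0) h'.
by apply: le_trans h'; apply: le_trans (le_nv _ _ l); rewrite !mxE.
Qed.

Lemma derivable_pd (f : V -> V) j x l : derivable f x (unit_dir j) -> pd S (fun y => f y 0 l) j x (pderiv j f x 0 l).
Proof.
move=> df eps eps0.
have n1 : nbhs (pderiv j f x) (ball (pderiv j f x) (iota S eps)) by apply: nbhsx_ballx; exact: iota_gt0.
have := df _ n1; move=> [e /= e0 he].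
have ne : iota S (nrm e) = e by rewrite -normE gtr0_norm.
have n0 : 0 < nrm e.
  rewrite lt_neqAle nrm_ge0 andbT eq_sym; apply/negP => /eqP/nrm_eq0 h.
  by move: e0; rewrite h ltxx.
exists (nrm e / 2) => [|h hh]; first by rewrite divr_gt0.
have [->|h0] := eqVneq h 0; first by rewrite scale0r addr0 subrr mul0r subrr nrm0 mulr0.
have h0' : 0 < nrm h.
  rewrite lt_neqAle nrm_ge0 andbT eq_sym; apply/negP => /eqP/nrm_eq0 h1; by rewrite h1 eqxx in h0.
have hb : ball 0 e h.
  rewrite -ball_normE /= sub0r normrN (normE S) -ne.
  rewrite lt_neqAle iota_le (inj_eq (@iota_inj _ _ S)) -lt_neqAle.
  by apply: le_lt_trans hh _; rewrite ltr_pdivrMr// ltr_pMr// ltr1n.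
have := nv_ball eps0 (he h hb h0); move=> /(le_trans (le_nv _ _ l)); rewrite !mxE /= => H.
rewrite (_ : _ - _ = h * (h^-1 * (f (shift x (h *: unit_dir j)) 0 l - f x 0 l) - pderiv j f x 0 l)); last first.
  by rewrite mulrBr mulrA mulfV// mul1r /shift /= [h *: _ + x]addrC.
by rewrite nrmM mulrC ler_wpM2r ?nrm_ge0.
Qed.

Lemma multi_deriv0 (f : V -> V) : multi_deriv (fun=> 0%N) f = f.
Proof. by rewrite /multi_deriv; elim: (enum _) => //= i s ->. Qed.

(** [foldr] differentiates in the last variable first, so a derivative in a variable not above those
    already used is the outermost operator. This is the order of derivatives followed in [jets]. *)
Lemma multi_deriv_incr (be : 'I_d -> nat) (j : 'I_d) (f : V -> V) : (forall i : 'I_d, (i < j)%N -> be i = 0%N) ->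
  multi_deriv (incr be j) f = pderiv j (multi_deriv be f).
Proof.
move=> hb; rewrite /multi_deriv.
have eE : enum 'I_d = take j (enum 'I_d) ++ j :: drop j.+1 (enum 'I_d).
  rewrite -[LHS](cat_take_drop j); congr (_ ++ _).
  by rewrite (drop_nth j) ?size_enum_ord// nth_ord_enum.
have s1 i : i \in take j (enum 'I_d) -> (i < j)%N.
  by rewrite in_take ?mem_enum// index_enum_ord.
have s2 : j \notin drop j.+1 (enum 'I_d).
  have u := enum_uniq 'I_d; rewrite eE in u.
  by move: u; rewrite cat_uniq /= => /and3P[_ _ /andP[]].
rewrite eE !foldr_cat /=.
have id1 (a : 'I_d -> nat) (g : V -> V) s : (forall i, i \in s -> a i = 0%N) -> foldr (fun i g => iter (a i) (pderiv i) g) g s = g.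
  elim: s => [//|i s ih] h /=; rewrite ih => [|i' hi']; last by apply: h; rewrite inE hi' orbT.
  by rewrite h ?mem_head.
have z1 i : i \in take j (enum 'I_d) -> be i = 0%N by move=> /s1; exact: hb.
have z2 i : i \in take j (enum 'I_d) -> incr be j i = 0%N.
  by move=> ii; rewrite /incr z1// (_ : (i == j) = false)//; apply/negbTE; rewrite neq_ltn s1.
rewrite (id1 _ _ _ z1) (id1 _ _ _ z2).
rewrite /incr eqxx addn1 iterS; congr (pderiv j (iter _ _ _)).
elim: (drop _ _) s2 => [//|i s ih]; rewrite inE negb_or => /andP[ij /ih /= ->].
by rewrite eq_sym (negbTE ij) addn0.
Qed.
End Deriv.

(** * The real case *)

Section RealCase.
Context {R : realType}.

Lemma real_scalars_subproof (x : R) : x = \sum_(b : unit) idfun x * 1.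
Proof. by rewrite (big_pred1 tt) ?mulr1//; case. Qed.

Definition realS : scalars R R := @Scalars R R idfun (fun z => `|z|) unit (fun=> 1) (fun=> id)
  (fun z => erefl) (fun x y => erefl) (fun b x y => erefl) (fun b r x => erefl) (fun b x => lexx _)
  (fun b b' => match b, b' with tt, tt => esym (mulr1n 1) end) (fun b => normr1 _) real_scalars_subproof.

Context {d : nat}.
Implicit Types (U : set 'rV[R]_d) (f : 'rV[R]_d -> 'rV[R]_d).

Lemma is_Ck0 k U : is_Ck k U (fun=> 0).
Proof.
have p0 i : pderiv i (fun=> 0) = (fun=> 0) :> ('rV[R]_d -> 'rV[R]_d).
  by apply/funext => x; rewrite /pderiv (derive_cst 0).
have c0 : cont_on U (fun=> 0) by move=> x _; exact: cst_continuous.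
elim: k => [|k ih]; first by split.
by split => // i; split; [move=> x _; exact: derivable_cst|rewrite p0].
Qed.

Lemma is_Ck_cont k U f : is_Ck k U f -> cont_on U f.
Proof. by case: k => [|k] []. Qed.

Lemma is_Ck_multi k U f be : is_Ck (k + msize be) U f -> is_Ck k U (multi_deriv be f).
Proof.
have it n i k' g : is_Ck (k' + n) U g -> is_Ck k' U (iter n (pderiv i) g).
  elim: n k' => [|n ih] k'; first by rewrite addn0.
  by rewrite addnS -addSn => /ih [_ /(_ i)[]].
rewrite /multi_deriv /msize -(big_enum _ _ _ be) /=.
elim: (enum _) k => [|i s ih] k; first by rewrite big_nil addn0.
by rewrite big_cons addnA => h; apply: it; exact: ih h.
Qed.
End RealCase.

Theorem real_case (R : realType) (dT : measure_display) (T : measurableType dT)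
    (P : probability T R) (q d : nat) (U : set 'rV[R]_d) (F : T -> 'rV[R]_d -> 'rV[R]_d) :
  open U -> gaussian_field_R P U F -> {ae P, forall w, is_Ck q.+1 U (F w)} ->
  (forall x, U x -> nondegenerate_vec P (fun aj : multi_index d q.+1 * 'I_d =>
             fun w => multi_deriv (mi_fun aj.1) (F w) x 0 aj.2)) ->
  forall K : set 'rV[R]_d, compact K -> K `<=` U -> (\int[P]_w (nzeros (R := R) (F w) K ^+ q.+1) < +oo)%E.
Proof.
move=> Uo gF [N [mN PN hN]] nd K cK KU.
(* Exceptional paths are replaced by 0, so that smoothness holds for every sample point. *)
pose Ft w : 'rV[R]_d -> 'rV[R]_d := if w \in N then fun=> 0 else F w.
have Ck w : is_Ck q.+1 U (Ft w).
  rewrite /Ft; case: (boolP (w \in N)) => [_|wN]; first exact: is_Ck0.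
  by apply: contrapT => h; move: wN; rewrite notin_setE; apply; exact: hN.
have Ckb w be : (msize be <= q.+1)%N -> is_Ck (q.+1 - msize be) U (multi_deriv be (Ft w)).
  by move=> bq; apply: is_Ck_multi; rewrite subnK.
apply: (@global_bound _ T R P R realS d q U F (fun w be x l => multi_deriv be (Ft w) x 0 l) N Uo mN PN _ _ _ _
  (fun x i w => multi_deriv (mi_fun i.1.1) (F w) x 0 i.1.2)) => //.
- by move=> n x j b c hx; exact: gF.
- by move=> w x l Ux; rewrite multi_deriv0 /Ft; case: ifP => // _; rewrite mxE.
- by move=> w be l x bq Ux; apply: continuous_contv; exact: (is_Ck_cont (Ckb w be bq)).
- move=> w be j l x bq hb Ux; rewrite (multi_deriv_incr _ hb); apply: derivable_pd.
  have := Ckb w be (ltnW bq); rewrite subSn; last by rewrite -ltnS.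
  by move=> [_ /(_ j)[h _]]; exact: h.
- by move=> x i w Ux Nw; rewrite /Ft memNset.
- move=> x Ux c [[i []] ci]; have := nd x Ux (fun i => c (i, tt)) (ex_intro _ i ci).
  have bj : bijective (fun i : multi_index d q.+1 * 'I_d => (i, tt)).
    by exists fst => // -[i' []].
  congr (_ < _); rewrite [RHS](reindex (fun i => (i, tt))) /=; last exact: onW_bij.
  by apply: eq_bigr => i' _; rewrite [RHS](reindex (fun i => (i, tt))) /=; last exact: onW_bij.
Qed.

(** * Goursat's theorem and Cauchy's estimate *)

Section ComplexScalars.
Context {R : realType}.

Definition cnrm (z : Cnum R) : R := Num.sqrt (complex.Re z ^+ 2 + complex.Im z ^+ 2).
Definition ciota : {rmorphism R -> Cnum R} := real_complex R.
Definition cuu (b : bool) : Cnum R := if b then 1 else 'i%C.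

Lemma cnormE (z : Cnum R) : `|z| = ciota (cnrm z).
Proof. exact: normc_def. Qed.

Lemma ciota_le (x y : R) : (ciota x <= ciota y) = (x <= y).
Proof. by rewrite lecE /= eqxx. Qed.

Lemma cco_add b (x y : Cnum R) : re_im b (x + y) = re_im b x + re_im b y.
Proof. by case: b; rewrite /re_im; case: x y => [a c] [a' c']. Qed.

Lemma cco_scale b r (x : Cnum R) : re_im b (ciota r * x) = r * re_im b x.
Proof. by case: b; case: x => [a c]; rewrite /re_im /= !mul0r ?subr0 ?addr0. Qed.

Lemma cco_nrm b (x : Cnum R) : `|re_im b x| <= cnrm x.
Proof.
rewrite -(sqrtr_sqr (re_im b x)) /cnrm; apply: ler_wsqrtr.
by case: b => /=; rewrite ?lerDl ?lerDr sqr_ge0.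
Qed.

Lemma cco_uu b b' : re_im b (cuu b') = (b == b')%:R.
Proof. by case: b b' => [] []. Qed.

Lemma cnrm_uu b : cnrm (cuu b) = 1.
Proof. by case: b; rewrite /cnrm /= expr0n /= expr1n ?addr0 ?add0r sqrtr1. Qed.

Lemma cco_sum (x : Cnum R) : x = \sum_b ciota (re_im b x) * cuu b.
Proof. by rewrite big_bool /= mulr1 mulrC; exact: complexE. Qed.

Definition complexS : scalars R (Cnum R) :=
  @Scalars R (Cnum R) ciota cnrm bool cuu re_im cnormE ciota_le cco_add cco_scale cco_nrm cco_uu cnrm_uu cco_sum.
End ComplexScalars.

Section RealPrim.
Context {R : realType}.
Notation mu := (@lebesgue_measure R).

(** Clamping the argument extends the function continuously beyond [[a, b]], so that the fundamental
    theorem applies at the end points too. *)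
Lemma primitive_exists (h : R -> R) (a b : R) : a <= b ->
  (forall x, a <= x <= b -> forall eps : R, 0 < eps -> exists2 de : R, 0 < de & forall y, `|y - x| <= de -> `|h y - h x| <= eps) ->
  exists P : R -> R, forall x, a <= x <= b -> is_derive x (1 : R) P (h x).
Proof.
move=> ab ch.
pose cl (x : R) := Num.max a (Num.min x b).
have clab x : a <= cl x <= b by rewrite /cl le_max lexx ge_max ab /= ge_min lexx orbT.
have clid x : a <= x <= b -> cl x = x by move=> /andP[h1 h2]; rewrite /cl (min_idPl h2) (max_idPr h1).
have cl1 x y : `|cl y - cl x| <= `|y - x|.
  have clE z : [\/ z <= a /\ cl z = a, a <= z <= b /\ cl z = z | b <= z /\ cl z = b].
    have [za|az] := leP z a; first by apply: Or31; split => //; rewrite /cl (min_idPl (le_trans za ab)) (max_idPl za).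
    have [zb|bz] := leP z b; last by apply: Or33; split; [exact: ltW|rewrite /cl (min_idPr (ltW bz)) (max_idPr ab)].
    by apply: Or32; rewrite clid ltW.
  rewrite ler_norml; have := ler_norm (y - x); have := ler_norm (x - y); rewrite (distrC x y).
  by have [[? ->]|[? ->]|[? ->]] := clE x; have [[? ->]|[? ->]|[? ->]] := clE y; lra.
pose k x := h (cl x).
have ck x : {for x, continuous k}.
  apply/cvgrPdist_le => eps eps0; have [de de0 hde] := ch _ (clab x) _ eps0.
  exists de => //= y /= yx; rewrite distrC; apply: hde; apply: le_trans (cl1 _ _) _; by rewrite distrC ltW.
have ik : mu.-integrable `[a - 1, b + 1] (EFin \o k).
  apply: continuous_compact_integrable; first exact: segment_compact.
  by apply: continuous_subspaceT => x; exact: ck.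
exists (fun x => (\int[mu]_(t in [set` `[a - 1, x]]) (k t))%R) => x /[dup] xab /andP[ax xb].
have [||d1 d2] := @continuous_FTC1_closed R k (a - 1) x (b + 1) _ ik _ (ck x); [lra|lra|].
have e : h x = k x by rewrite /k clid.
by rewrite e; apply: DeriveDef; [exact: d1|rewrite -derive1E; exact: d2].
Qed.

Lemma nested (u : nat -> R) (l : R) : (forall n, u n <= u n.+1) -> (forall n, u n.+1 + l / 2 ^+ n.+1 <= u n + l / 2 ^+ n) -> 0 <= l ->
  exists x, forall n, u n <= x <= u n + l / 2 ^+ n.
Proof.
move=> h1 h2 l0; have p n : (0 : R) < 2 ^+ n by rewrite exprn_gt0.
have lp n : 0 <= l / 2 ^+ n by rewrite divr_ge0// ltW.
have m1 m n : u m <= u (m + n)%N by elim: n => [|n ih]; rewrite ?addn0// addnS; exact: le_trans ih (h1 _).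
have m2 m n : u (m + n)%N + l / 2 ^+ (m + n) <= u m + l / 2 ^+ m.
  by elim: n => [|n ih]; rewrite ?addn0// addnS; exact: le_trans (h2 _) ih.
have um m n : u m <= u n + l / 2 ^+ n.
  have [mn|nm] := leqP m n.
    by have := m1 m (n - m)%N; rewrite subnKC// => h; apply: le_trans h _; rewrite lerDl.
  by have := m2 n (m - n)%N; rewrite subnKC ?(ltnW nm)// => h; apply: le_trans h; rewrite lerDl.
exists (sup (range u)) => n; apply/andP; split.
  by apply: ub_le_sup; [exists (u 0 + l / 2 ^+ 0) => _ [m _ <-]; exact: um|exists n].
by apply: ge_sup; [exists (u 0); exists 0%N|move=> _ [m _ <-]; exact: um].
Qed.
End RealPrim.

Section Goursat.
Context {R : realType}.
Local Notation C := (Cnum R).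
Local Notation S := (@complexS R).
Local Notation nrm := (nrm S).
Local Notation iota := (iota S).
Local Notation co := (co S).

Definition ii : C := 'i%C.
Definition zpt (s t : R) : C := iota s + ii * iota t.

Lemma iiE : ii * ii = -1.
Proof. by rewrite -expr2; exact: sqr_i. Qed.

Lemma nrm_ii : nrm ii = 1.
Proof. exact: (nrm_uu S false). Qed.

Lemma ptE s t : zpt s t = (s +i* t)%C.
Proof. by rewrite /zpt; apply/eqP; rewrite eq_complex /=; apply/andP; split; apply/eqP; ring. Qed.

Lemma co_pt b s t : co b (zpt s t) = if b then s else t.
Proof. by rewrite ptE; case: b. Qed.

Lemma nrm_pt s t : nrm (zpt s t) <= `|s| + `|t|.
Proof. by apply: le_trans (nrmD _ _ _) _; rewrite nrmM nrm_ii mul1r !nrm_iota. Qed.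

Lemma ptB s t s' t' : zpt s t - zpt s' t' = zpt (s - s') (t - t').
Proof. by rewrite /zpt !rmorphB /=; ring. Qed.

Lemma ptV s t : s ^+ 2 + t ^+ 2 != 0 -> (zpt s t)^-1 = zpt (s / (s ^+ 2 + t ^+ 2)) (- t / (s ^+ 2 + t ^+ 2)).
Proof.
move=> n0; rewrite ptE; set D := _ + _ in n0 *.
have e : zpt s t * zpt (s / D) (- t / D) = 1.
  rewrite (_ : 1 = iota (s * (s / D) - t * (- t / D))); last by rewrite -(rmorph1 iota); congr (iota _); rewrite /D; field.
  rewrite (_ : zpt _ _ * _ = iota (s * (s / D) - t * (- t / D)) + ii * iota (s * (- t / D) + t * (s / D))).
    by rewrite (_ : s * (- t / D) + t * (s / D) = 0) ?rmorph0 ?mulr0 ?addr0//; ring.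
  rewrite /zpt rmorphB rmorphD !rmorphM /=; set x := iota s; set y := iota t; set p := iota (s / D); set q := iota (- t / D).
  rewrite (_ : _ * _ = x * p + ii * (x * q + y * p) + ii * ii * (y * q)); last by ring.
  by rewrite iiE; ring.
have u0 : zpt s t != 0 by apply: contra_eq_neq e => ->; rewrite mul0r eq_sym oner_eq0.
by rewrite -ptE -[LHS]mulr1 -e mulKf.
Qed.

(** [v] plays the part of the integral of [h] from [a] to [b], through a primitive taken coordinate
    by coordinate. *)
Definition isinc (h : R -> C) (a b : R) (v : C) := exists2 P : R -> C,
  (forall c (x : R), a <= x <= b -> is_derive x (1 : R) (fun y => co c (P y)) (co c (h x))) & v = P b - P a.

Lemma isinc_mvt h a b v c : isinc h a b v -> a <= b -> exists2 x, a <= x <= b & co c v = co c (h x) * (b - a).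
Proof.
move=> [P dP ->] ab.
have [x xab||x xab e] := @MVT_segment R (fun y => co c (P y)) (fun y => co c (h y)) a b ab.
- by apply: dP; have /andP[h1 h2] := xab; rewrite !ltW.
- apply: derivable_within_continuous => x xab.
  by have [] := dP c x xab.
- by exists x => //; rewrite coB e.
Qed.

Lemma isincB h k a b u v : isinc h a b u -> isinc k a b v -> isinc (fun x => h x - k x) a b (u - v).
Proof.
move=> [P dP ->] [Q dQ ->]; exists (fun x => P x - Q x) => [c x xab|]; last by ring.
rewrite coB (_ : (fun y => _) = (fun y => co c (P y)) - (fun y => co c (Q y))); last by apply/funext => y; rewrite coB.
by apply: is_deriveB; [exact: dP|exact: dQ].
Qed.

(** The factor 2 is the number of real coordinates, each with its own mean value point. *)
Lemma isinc_close h k a b u v (E : R) : isinc h a b u -> isinc k a b v -> a <= b ->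
  (forall x, a <= x <= b -> nrm (h x - k x) <= E) -> nrm (u - v) <= 2 * (E * (b - a)).
Proof.
move=> hu kv ab hE; have H := isincB hu kv.
apply: le_trans (nrm_co_le (M := E * (b - a)) _) _; last by rewrite card_bool.
move=> c; have [x xab ->] := isinc_mvt c H ab; rewrite normrM (@ger0_norm _ (b - a)) ?subr_ge0//.
by apply: ler_wpM2r; [rewrite subr_ge0|exact: le_trans (co_nrm _ _ _) (hE _ xab)].
Qed.

Lemma isinc_uniq h a b u v : isinc h a b u -> isinc h a b v -> a <= b -> u = v.
Proof.
move=> hu hv ab; apply/eqP; rewrite -subr_eq0; apply/eqP; apply: (@nrm_eq0 _ _ S).
apply/eqP; rewrite eq_le nrm_ge0 andbT.
have := isinc_close (E := 0) hu hv ab; rewrite mul0r mulr0; apply=> x _; by rewrite subrr nrm0.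
Qed.

Lemma isinc_affine (c e : C) (a b : R) : isinc (fun x => c + iota x * e) a b (c * iota (b - a) + e * iota ((b ^+ 2 - a ^+ 2) / 2)).
Proof.
exists (fun x => iota x * c + iota (x ^+ 2 / 2) * e) => [b0 x _|]; last first.
  by rewrite mulrBl !rmorphB /=; ring.
apply: is_derive_eps => eps eps0; set e' := co b0 e.
exists (eps / (`|e'| + 1)) => [|h hh]; first by rewrite divr_gt0// ltr_wpDl.
rewrite !co_add !co_scale -/e'.
rewrite (_ : _ - _ - _ = (e' * h / 2) * h); last by field.
rewrite normrM ler_wpM2r// !normrM.
have n0 : 0 < `|e'| + 1 by rewrite ltr_wpDl.
move: hh; rewrite ler_pdivlMr// => hh; rewrite (@ger0_norm _ (2^-1 : R)) ?invr_ge0//.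
have h0 := normr_ge0 h; have e0 := normr_ge0 e'; nra.
Qed.

Definition hcont (h : R -> C) (x : R) := forall eps : R, 0 < eps -> exists2 de : R, 0 < de & forall y, `|y - x| <= de -> nrm (h y - h x) <= eps.

(** The default value 0 is taken when [h] has no primitive; on edges where [h] is continuous [incP]
    excludes this case. *)
Definition inc (h : R -> C) (a b : R) : C := xget 0 [set v | isinc h a b v].

Lemma isinc_inc h a b v : a <= b -> isinc h a b v -> inc h a b = v.
Proof. by move=> ab hv; rewrite /inc; case: xgetP => [y _ hy|/(_ v)//]; exact: isinc_uniq hy hv ab. Qed.

Lemma hcont_prim (h : R -> C) (a b : R) : a <= b -> (forall x, a <= x <= b -> hcont h x) ->
  exists P : R -> C, forall c (x : R), a <= x <= b -> is_derive x (1 : R) (fun y => co c (P y)) (co c (h x)).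
Proof.
move=> ab ch.
have /choice[p hp] : forall c, exists P : R -> R, forall x, a <= x <= b -> is_derive x (1 : R) P (co c (h x)).
  move=> c; apply: (primitive_exists (h := fun x => co c (h x))) => // x xab eps eps0.
  have [de de0 hde] := ch x xab eps eps0; exists de => // y yx.
  by rewrite -coB; apply: le_trans (co_nrm _ _ _) (hde y yx).
exists (fun y => \sum_b iota (p b y) * uu S b) => c x xab.
by rewrite (_ : (fun y => _) = p c); [exact: hp|apply/funext => y; rewrite co_comb].
Qed.

Lemma incP h a b : a <= b -> (forall x, a <= x <= b -> hcont h x) -> isinc h a b (inc h a b).
Proof.
move=> ab /(hcont_prim ab)[P dP]; have H : isinc h a b (P b - P a) by exists P.
by rewrite (isinc_inc ab H).
Qed.

Lemma inc_split h a m b : a <= m <= b -> (forall x, a <= x <= b -> hcont h x) -> inc h a b = inc h a m + inc h m b.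
Proof.
move=> /andP[am mb] ch; have ab := le_trans am mb; have [P dP] := hcont_prim ab ch.
rewrite (@isinc_inc h a b (P b - P a)) ?(@isinc_inc h a m (P m - P a)) ?(@isinc_inc h m b (P b - P m))//; first by ring.
- by exists P => // c x /andP[h1 h2]; apply: dP; rewrite h2 (le_trans am h1).
- by exists P => // c x /andP[h1 h2]; apply: dP; rewrite h1 (le_trans h2 mb).
- by exists P.
Qed.

Definition cd (g : C -> C) (z v : C) := forall eps : R, 0 < eps -> exists2 de : R, 0 < de &
  forall h, nrm h <= de -> nrm (g (z + h) - g z - h * v) <= eps * nrm h.

Lemma cd_cont g z v : cd g z v -> forall eps : R, 0 < eps -> exists2 de : R, 0 < de & forall h, nrm h <= de -> nrm (g (z + h) - g z) <= eps.
Proof.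
move=> /(_ 1 ltr01)[de de0 h] eps eps0.
have m0 : 0 < 1 + nrm v by rewrite ltr_pwDl ?nrm_ge0.
exists (Num.min de (eps / (1 + nrm v))) => [|k]; first by rewrite lt_min de0 divr_gt0.
rewrite le_min => /andP[k1 k2]; rewrite -[_ - _](subrK (k * v)).
apply: (le_trans (nrmDl (h k k1) (lexx _))); rewrite nrmM.
by move: k2; rewrite ler_pdivlMr//; lra.
Qed.

Definition cdrect g (s1 s2 t1 t2 : R) := forall s t : R, s1 <= s <= s2 -> t1 <= t <= t2 -> exists v, cd g (zpt s t) v.

Lemma cdrect_s g s1 s2 t1 t2 t : cdrect g s1 s2 t1 t2 -> t1 <= t <= t2 -> forall s, s1 <= s <= s2 -> hcont (fun s => g (zpt s t)) s.
Proof.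
move=> H ht s hs eps eps0; have [v dv] := H s t hs ht; have [de de0 h] := cd_cont dv eps0.
exists de => // s' s's; have := h (zpt s' t - zpt s t); rewrite [zpt s t + _]addrC subrK; apply.
by rewrite ptB subrr; apply: le_trans (nrm_pt _ _) _; rewrite normr0 addr0.
Qed.

Lemma cdrect_t g s1 s2 t1 t2 s : cdrect g s1 s2 t1 t2 -> s1 <= s <= s2 -> forall t, t1 <= t <= t2 -> hcont (fun t => g (zpt s t)) t.
Proof.
move=> H hs t ht eps eps0; have [v dv] := H s t hs ht; have [de de0 h] := cd_cont dv eps0.
exists de => // t' t't; have := h (zpt s t' - zpt s t); rewrite [zpt s t + _]addrC subrK; apply.
by rewrite ptB subrr; apply: le_trans (nrm_pt _ _) _; rewrite normr0 add0r.
Qed.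

(* The integral of [g] along the boundary of a rectangle, taken counterclockwise *)
Definition bint (g : C -> C) (s1 s2 t1 t2 : R) : C :=
  ii * (inc (fun t => g (zpt s2 t)) t1 t2 - inc (fun t => g (zpt s1 t)) t1 t2)
  + (inc (fun s => g (zpt s t1)) s1 s2 - inc (fun s => g (zpt s t2)) s1 s2).

Lemma bint_split_s g s1 m s2 t1 t2 : s1 <= m <= s2 ->
  (forall s, s1 <= s <= s2 -> hcont (fun s => g (zpt s t1)) s) -> (forall s, s1 <= s <= s2 -> hcont (fun s => g (zpt s t2)) s) ->
  bint g s1 s2 t1 t2 = bint g s1 m t1 t2 + bint g m s2 t1 t2.
Proof. by move=> hm h1 h2; rewrite /bint (inc_split hm h1) (inc_split hm h2); ring. Qed.

Lemma bint_split_t g s1 s2 t1 m t2 : t1 <= m <= t2 ->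
  (forall t, t1 <= t <= t2 -> hcont (fun t => g (zpt s1 t)) t) -> (forall t, t1 <= t <= t2 -> hcont (fun t => g (zpt s2 t)) t) ->
  bint g s1 s2 t1 t2 = bint g s1 s2 t1 m + bint g s1 s2 m t2.
Proof. by move=> hm h1 h2; rewrite /bint (inc_split hm h1) (inc_split hm h2); ring. Qed.

Definition edges (g : C -> C) (s1 s2 t1 t2 : R) :=
  [/\ forall t, t1 <= t <= t2 -> hcont (fun t => g (zpt s1 t)) t, forall t, t1 <= t <= t2 -> hcont (fun t => g (zpt s2 t)) t,
      forall s, s1 <= s <= s2 -> hcont (fun s => g (zpt s t1)) s & forall s, s1 <= s <= s2 -> hcont (fun s => g (zpt s t2)) s].

(** Affine functions have boundary integral 0, so only the deviation [E] contributes: two edges in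
    each direction, each with the factor 2 of [isinc_close]. *)
Lemma bint_affine g s1 s2 t1 t2 (c v z0 : C) (E : R) : s1 <= s2 -> t1 <= t2 -> edges g s1 s2 t1 t2 ->
  (forall s t, s1 <= s <= s2 -> t1 <= t <= t2 -> [|| s == s1, s == s2, t == t1 | t == t2] ->
     nrm (g (zpt s t) - (c + (zpt s t - z0) * v)) <= E) ->
  nrm (bint g s1 s2 t1 t2) <= 4 * (E * ((s2 - s1) + (t2 - t1))).
Proof.
move=> hs ht [e1 e2 e3 e4] hE.
have T s : s1 <= s <= s2 -> (s == s1) || (s == s2) -> (forall t, t1 <= t <= t2 -> hcont (fun t => g (zpt s t)) t) ->
  nrm (inc (fun t => g (zpt s t)) t1 t2 - ((c + (iota s - z0) * v) * iota (t2 - t1) + (ii * v) * iota ((t2 ^+ 2 - t1 ^+ 2) / 2))) <= 2 * (E * (t2 - t1)).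
  move=> ss se hc; apply: isinc_close (incP ht hc) (isinc_affine _ _ _ _) ht _ => t tt.
  have -> : c + (iota s - z0) * v + iota t * (ii * v) = c + (zpt s t - z0) * v by rewrite /zpt; ring.
  by apply: hE => //; rewrite orbA se.
have Sx t : t1 <= t <= t2 -> (t == t1) || (t == t2) -> (forall s, s1 <= s <= s2 -> hcont (fun s => g (zpt s t)) s) ->
  nrm (inc (fun s => g (zpt s t)) s1 s2 - ((c + (ii * iota t - z0) * v) * iota (s2 - s1) + v * iota ((s2 ^+ 2 - s1 ^+ 2) / 2))) <= 2 * (E * (s2 - s1)).
  move=> tt te hc; apply: isinc_close (incP hs hc) (isinc_affine _ _ _ _) hs _ => s ss.
  have -> : c + (ii * iota t - z0) * v + iota s * v = c + (zpt s t - z0) * v by rewrite /zpt; ring.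
  by apply: hE => //; rewrite te !orbT.
have a1 := T s1 (introT andP (conj (lexx _) hs)) ltac:(by rewrite eqxx) e1.
have a2 := T s2 (introT andP (conj hs (lexx _))) ltac:(by rewrite eqxx orbT) e2.
have a3 := Sx t1 (introT andP (conj (lexx _) ht)) ltac:(by rewrite eqxx) e3.
have a4 := Sx t2 (introT andP (conj ht (lexx _))) ltac:(by rewrite eqxx orbT) e4.
rewrite /bint; move: a1 a2 a3 a4.
set A1 := inc _ t1 t2; set A2 := inc _ t1 t2; set A3 := inc _ s1 s2; set A4 := inc _ s1 s2.
set B1 := (X in A1 - X); set B2 := (X in A2 - X); set B3 := (X in A3 - X); set B4 := (X in A4 - X).
move=> a1 a2 a3 a4.
have z : ii * (B2 - B1) + (B3 - B4) = 0 by rewrite /B1 /B2 /B3 /B4 !rmorphB /=; ring.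
rewrite (_ : _ + _ = ii * ((A2 - B2) - (A1 - B1)) + ((A3 - B3) - (A4 - B4))); last first.
  by rewrite -[LHS]subr0 -z; ring.
apply: le_trans (nrmD _ _ _) _; rewrite nrmM nrm_ii mul1r.
apply: le_trans (lerD (nrmBl a2 a1) (nrmBl a3 a4)) _; rewrite le_eqVlt; apply/orP; left; apply/eqP; ring.
Qed.

Lemma exp2_large (x : R) : exists n : nat, x <= 2 ^+ n.
Proof.
exists (Num.bound x); apply: le_trans (ler_norm x) _; apply: le_trans (ltW (archi_boundP (normr_ge0 x))) _.
rewrite /Num.bound normr_id -natrX ler_nat; exact/ltnW/ltn_expl.
Qed.

(** One of the four quarters keeps at least a fourth of the boundary integral. At the common point
    of the nested rectangles, differentiability bounds the [n]-th integral by a small multiple of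
    [4 ^- n], as both the sides and the affine deviation shrink like [2 ^- n]. *)
Lemma goursat g s1 s2 t1 t2 : s1 <= s2 -> t1 <= t2 -> cdrect g s1 s2 t1 t2 -> bint g s1 s2 t1 t2 = 0.
Proof.
move=> hs ht H; pose a := s2 - s1; pose b := t2 - t1.
have a0 : 0 <= a by rewrite subr_ge0.
have b0 : 0 <= b by rewrite subr_ge0.
have p n : (0 : R) < 2 ^+ n by rewrite exprn_gt0.
have an n : 0 <= a / 2 ^+ n by rewrite divr_ge0// ltW.
have bn n : 0 <= b / 2 ^+ n by rewrite divr_ge0// ltW.
have half x n : x / 2 ^+ n = x / 2 ^+ n.+1 + x / 2 ^+ n.+1 :> R by rewrite exprS; field; rewrite gt_eqF.
pose Q n (c : R * R) := bint g c.1 (c.1 + a / 2 ^+ n) c.2 (c.2 + b / 2 ^+ n).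
pose inR n (c : R * R) := [/\ s1 <= c.1, c.1 + a / 2 ^+ n <= s2, t1 <= c.2 & c.2 + b / 2 ^+ n <= t2].
have step (nc : nat * (R * R)) : exists c' : R * R, inR nc.1 nc.2 -> [/\ inR nc.1.+1 c',
    nc.2.1 <= c'.1 /\ c'.1 + a / 2 ^+ nc.1.+1 <= nc.2.1 + a / 2 ^+ nc.1,
    nc.2.2 <= c'.2 /\ c'.2 + b / 2 ^+ nc.1.+1 <= nc.2.2 + b / 2 ^+ nc.1 &
    nrm (Q nc.1 nc.2) <= 4 * nrm (Q nc.1.+1 c')].
  case: nc => n [s t] /=; have [hin|] := pselect (inR n (s, t)); last by exists (s, t).
  have [/= i1 i2 i3 i4] := hin.
  have ea := half a n; have eb := half b n; have a1 := an n.+1; have b1 := bn n.+1.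
  have hQ : Q n (s, t) = (Q n.+1 (s, t) + Q n.+1 (s + a / 2 ^+ n.+1, t)) + (Q n.+1 (s, t + b / 2 ^+ n.+1) + Q n.+1 (s + a / 2 ^+ n.+1, t + b / 2 ^+ n.+1)).
    rewrite /Q /= ea eb; move: (a / 2 ^+ n.+1) (b / 2 ^+ n.+1) a1 b1 ea eb => x y x0 y0 ea eb.
    move: i2 i4; rewrite ea eb => i2 i4; rewrite (addrA s) (addrA t); rewrite !addrA in i2 i4.
    rewrite (@bint_split_t g _ _ t (t + y)); [|lra| |]; last 2 first.
    - by move=> t' ht'; apply: (cdrect_t H); lra.
    - by move=> t' ht'; apply: (cdrect_t H); lra.
    congr (_ + _); (rewrite (@bint_split_s g s (s + x)); [by []|lra| |]); by move=> s' hs'; apply: (cdrect_s H); lra.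
  have [q1|q1] := leP (nrm (Q n (s, t))) (4 * nrm (Q n.+1 (s, t))).
    by exists (s, t) => _; rewrite /inR /=; split => //; [split => //; lra|lra|lra].
  have [q2|q2] := leP (nrm (Q n (s, t))) (4 * nrm (Q n.+1 (s + a / 2 ^+ n.+1, t))).
    by exists (s + a / 2 ^+ n.+1, t) => _; rewrite /inR /=; split => //; [split => //; lra|lra|lra].
  have [q3|q3] := leP (nrm (Q n (s, t))) (4 * nrm (Q n.+1 (s, t + b / 2 ^+ n.+1))).
    by exists (s, t + b / 2 ^+ n.+1) => _; rewrite /inR /=; split => //; [split => //; lra|lra|lra].
  exists (s + a / 2 ^+ n.+1, t + b / 2 ^+ n.+1) => _; rewrite /inR /=; split; [split => //; lra|lra|lra|].
  change (nrm (Q n (s, t)) <= 4 * nrm (Q n.+1 (s + a / 2 ^+ n.+1, t + b / 2 ^+ n.+1))).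
  have := nrmDl (nrmD S (Q n.+1 (s, t)) (Q n.+1 (s + a / 2 ^+ n.+1, t))) (nrmD S (Q n.+1 (s, t + b / 2 ^+ n.+1)) (Q n.+1 (s + a / 2 ^+ n.+1, t + b / 2 ^+ n.+1))).
  rewrite -hQ; move: q1 q2 q3; set N0 := nrm (Q n _); set N1 := nrm (Q n.+1 (s, t)).
  set N2 := nrm (Q n.+1 (_, t)); set N3 := nrm (Q n.+1 (s, _)); set N4 := nrm _.
  by move: N0 N1 N2 N3 N4 => N0 N1 N2 N3 N4; lra.
have [nx hnx] := choice step.
pose cs := fix cs n : R * R := if n is m.+1 then nx (m, cs m) else (s1, t1).
have csin n : inR n (cs n).
  elim: n => [|n ih]; first by rewrite /inR /= expr0 !divr1 /a /b; split => //; lra.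
  by have [] := hnx (n, cs n) ih.
have csS n := hnx (n, cs n) (csin n).
have [s0 hs0] : exists x, forall n, (cs n).1 <= x <= (cs n).1 + a / 2 ^+ n.
  by apply: nested => // n; have [_ [h1 h2] _ _] := csS n.
have [t0 ht0] : exists x, forall n, (cs n).2 <= x <= (cs n).2 + b / 2 ^+ n.
  by apply: nested => // n; have [_ _ [h1 h2] _] := csS n.
have Qn n : nrm (bint g s1 s2 t1 t2) <= 4 ^+ n * nrm (Q n (cs n)).
  elim: n => [|n ih].
    by rewrite expr0 mul1r /Q /= !expr0 !divr1 /a /b ![_ + (_ - _)]addrC !subrK.
  apply: le_trans ih _; rewrite exprSr -mulrA ler_wpM2l ?exprn_ge0//; by have [_ _ _] := csS n.
have [v dv] : exists v, cd g (zpt s0 t0) v.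
  have [/= i1 i2 i3 i4] := csin 0; have := hs0 0%N; have := ht0 0%N; rewrite /= expr0 !divr1 /a /b => h1 h2.
  by apply: H; lra.
apply: (@nrm_eq0 _ _ S); apply/eqP; rewrite eq_le nrm_ge0 andbT; apply/ler_addgt0Pr => e e0; rewrite add0r.
pose D := 4 * (a + b + 1) ^+ 2; have D0 : 0 < D by rewrite mulr_gt0// exprn_gt0// ltr_wpDl// addr_ge0.
have ed : 0 < e / D by rewrite divr_gt0.
have [de de0 hde] := dv _ ed.
have [n hn] := exp2_large ((a + b) / de).
have nd : (a + b) / 2 ^+ n <= de by rewrite ler_pdivrMr// -ler_pdivrMl// mulrC.
apply: le_trans (Qn n) _.
pose w := (a + b) / 2 ^+ n; have wE : w = a / 2 ^+ n + b / 2 ^+ n by rewrite /w mulrDl.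
have w0 : 0 <= w by rewrite wE addr_ge0.
have [/= i1 i2 i3 i4] := csin n; have js := hs0 n; have jt := ht0 n.
have est : nrm (Q n (cs n)) <= 4 * ((e / D * w) * w).
  have an' := an n; have bn' := bn n.
  apply: (le_trans (@bint_affine g _ _ _ _ (g (zpt s0 t0)) v (zpt s0 t0) (e / D * w) _ _ _ _)); first by rewrite lerDl.
  - by rewrite lerDl.
  - by split=> x xx; [apply: (cdrect_t H)|apply: (cdrect_t H)|apply: (cdrect_s H)|apply: (cdrect_s H)]; lra.
  - move=> s t ss tt _; have := hde (zpt s t - zpt s0 t0); rewrite [zpt s0 t0 + _]addrC subrK => h.
    have -> : g (zpt s t) - (g (zpt s0 t0) + (zpt s t - zpt s0 t0) * v) = g (zpt s t) - g (zpt s0 t0) - (zpt s t - zpt s0 t0) * v by rewrite opprD addrA.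
    have le : nrm (zpt s t - zpt s0 t0) <= w.
      rewrite ptB; apply: le_trans (nrm_pt _ _) _; rewrite wE; apply: lerD; rewrite ler_norml; lra.
    by apply: le_trans (h (le_trans le nd)) _; rewrite ler_pM2l.
  rewrite wE le_eqVlt; apply/orP; left; apply/eqP; ring.
apply: le_trans (ler_wpM2l _ est) _; first by rewrite exprn_ge0.
apply: (@le_trans _ _ (e * (4 * (a + b) ^+ 2 / D))).
  have -> : (4 : R) ^+ n = 2 ^+ n * 2 ^+ n by rewrite -exprMn; congr (_ ^+ _); ring.
  by rewrite le_eqVlt; apply/orP; left; apply/eqP; rewrite /w; field; rewrite !gt_eqF.
rewrite -[leRHS]mulr1; apply: ler_wpM2l; first exact: ltW.
by rewrite ler_pdivrMr// mul1r /D ler_pM2l//; apply: lerXn2r; rewrite ?nnegrE ?lerDl//; lra.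
Qed.
End Goursat.

Section Cauchy.
Context {R : realType}.
Local Notation C := (Cnum R).
Local Notation S := (@complexS R).
Local Notation nrm := (nrm S).
Local Notation iota := (iota S).
Local Notation co := (co S).

Lemma nrm_gt0 (z : C) : z != 0 -> 0 < nrm z.
Proof. by move=> z0; rewrite lt_neqAle nrm_ge0 andbT eq_sym; apply: contra_neq z0; exact: nrm_eq0. Qed.

Lemma cd_ext (f g : C -> C) z v : (forall x, f x = g x) -> cd f z v -> cd g z v.
Proof. by move=> /funext ->. Qed.

Lemma cdM (f g : C -> C) z u v : cd f z u -> cd g z v -> cd (fun x => f x * g x) z (u * g z + f z * v).
Proof.
move=> df dg eps eps0.
pose m := nrm u + nrm (f z) + nrm (g z) + 1.
have m0 : 0 < m by rewrite /m ltr_wpDl// !addr_ge0// nrm_ge0.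
pose e := Num.min 1 (eps / (4 * m)).
have e0 : 0 < e by rewrite lt_min ltr01 divr_gt0// mulr_gt0.
have e1 : e <= 1 by rewrite ge_min lexx.
have em : e * (4 * m) <= eps by rewrite -ler_pdivlMr ?mulr_gt0// ge_min lexx orbT.
have [d1 d10 h1] := df _ e0; have [d2 d20 h2] := dg _ e0; have [d3 d30 h3] := cd_cont dg e0.
exists (Num.min d1 (Num.min d2 d3)) => [|h]; first by rewrite !lt_min d10 d20.
rewrite !le_min => /and3P[k1 k2 k3]; have := h1 h k1; have := h2 h k2; have := h3 h k3.
set f1 := f (z + h); set g1 := g (z + h) => b3 b2 b1.
rewrite (_ : _ - _ - _ = (f1 - f z - h * u) * (g1 - g z) + (f1 - f z - h * u) * g z + h * u * (g1 - g z) + f z * (g1 - g z - h * v)); last by ring.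
apply: le_trans (nrmDl (nrmDl (nrmDl (nrmMl b1 b3) (nrmMl b1 (lexx _))) (nrmMl (lexx _) b3)) (nrmMl (lexx _) b2)) _.
rewrite nrmM; set H := nrm h; have H0 : 0 <= H := nrm_ge0 _ _.
move: em; rewrite /m; move: (nrm_ge0 S u) (nrm_ge0 S (f z)) (nrm_ge0 S (g z)).
move: (nrm u) (nrm (f z)) (nrm (g z)) => x y w x0 y0 w0 em.
apply: (@le_trans _ _ (e * (4 * (x + y + w + 1)) * H)); last exact: ler_wpM2r.
rewrite (_ : _ + _ = (e * (e + w + x + y)) * H); last by ring.
by apply: ler_wpM2r => //; rewrite ler_pM2l//; lra.
Qed.

Lemma cdB (f g : C -> C) z u v : cd f z u -> cd g z v -> cd (fun x => f x - g x) z (u - v).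
Proof.
move=> df dg eps eps0; have e2 : 0 < eps / 2 by rewrite divr_gt0.
have [d1 d10 h1] := df _ e2; have [d2 d20 h2] := dg _ e2.
exists (Num.min d1 d2) => [|h]; first by rewrite lt_min d10.
rewrite le_min => /andP[k1 k2].
rewrite (_ : _ - _ - _ = (f (z + h) - f z - h * u) - (g (z + h) - g z - h * v)); last by ring.
by apply: le_trans (nrmBl (h1 h k1) (h2 h k2)) _; rewrite -mulrDl -splitr.
Qed.

Lemma cd_affine (c a : C) z : cd (fun x => c + x * a) z a.
Proof.
move=> eps eps0; exists 1 => // h _.
by rewrite (_ : _ - _ - _ = 0) ?nrm0 ?mulr_ge0 ?nrm_ge0 ?(ltW eps0)//; ring.
Qed.

Lemma cdV (z : C) : z != 0 -> cd (fun x => x^-1) z (- (z^-1 ^+ 2)).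
Proof.
move=> z0 eps eps0; have n0 := nrm_gt0 z0; set n := nrm z in n0.
exists (Num.min (n / 2) (eps * n ^+ 3 / 2)) => [|h]; first by rewrite lt_min !divr_gt0// mulr_gt0// exprn_gt0.
rewrite le_min => /andP[h1 h2].
have zh : n / 2 <= nrm (z + h) by have := nrm_lowerD S z h; rewrite -/n; lra.
have zh0 : z + h != 0.
  by apply/negP => /eqP e; move: zh; rewrite e nrm0 leNgt divr_gt0.
rewrite (_ : _ - _ - _ = h * (h * ((z + h)^-1 * z^-1 ^+ 2))); last by field; rewrite z0 zh0.
rewrite nrmM mulrC ler_wpM2r ?nrm_ge0// nrmM.
rewrite nrmM nrmV nrmX nrmV -/n.
apply: (@le_trans _ _ (nrm h * ((n / 2)^-1 * n^-1 ^+ 2))).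
  apply: ler_wpM2l; first exact: nrm_ge0.
  apply: ler_wpM2r; first by rewrite exprn_ge0// invr_ge0 ltW.
  by rewrite lef_pV2// posrE; [apply: lt_le_trans zh|]; rewrite divr_gt0.
apply: le_trans (ler_wpM2r _ h2) _; first by rewrite mulr_ge0// ?invr_ge0 ?exprn_ge0 ?invr_ge0 ?divr_ge0 // ltW.
by rewrite le_eqVlt; apply/orP; left; apply/eqP; field; rewrite gt_eqF.
Qed.

Section Estimate.
Variables (f : C -> C) (r M : R) (v : C).
Hypothesis r0 : 0 < r.
Hypothesis df : forall z, nrm z <= 2 * r -> exists u, cd f z u.
Hypothesis fM : forall z, nrm z <= 2 * r -> nrm (f z - f 0) <= M.
Hypothesis dv : cd f 0 v.

(** The region between the two squares is cut into four rectangles that avoid 0: two full columns,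
    then the pieces below and above the small square. [goursat] applies to each. *)
Lemma bint_punctured (g : C -> C) (rho : R) : 0 < rho -> rho <= r ->
  (forall z, z != 0 -> nrm z <= 2 * r -> exists u, cd g z u) ->
  bint g (- r) r (- r) r = bint g (- rho) rho (- rho) rho.
Proof.
move=> p0 pr dg.
have pt0 (s t : R) : (s != 0) || (t != 0) -> zpt s t != 0.
  move=> h; apply/negP => /eqP e; have := co_pt true s t; have := co_pt false s t; rewrite e.
  have z b : co b 0 = 0 by have := @coB _ _ S b 0 0; rewrite !subrr.
  by rewrite !z => t0 s0; move: h; rewrite -t0 -s0 eqxx.
have rect (s1 s2 t1 t2 : R) : - r <= s1 -> s2 <= r -> - r <= t1 -> t2 <= r ->
    [\/ 0 < s1, s2 < 0, 0 < t1 | t2 < 0] -> cdrect g s1 s2 t1 t2.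
  move=> a1 a2 a3 a4 h s t ss tt; apply: dg.
    by apply: pt0; case: h => h; [rewrite (_ : s != 0)|rewrite (_ : s != 0)|rewrite orbC (_ : t != 0)|rewrite orbC (_ : t != 0)] => //; apply/negP => /eqP e; move: ss tt; rewrite e; lra.
  apply: le_trans (nrm_pt _ _) _; have -> : 2 * r = r + r by ring.
  by apply: lerD; rewrite ler_norml; lra.
rewrite (@bint_split_s _ g (- r) (- rho) r); [|lra| |]; last 2 first.
- by move=> s ss; apply: (@cdrect_s _ g (- r) r (- r) (- r)); [apply: rect; rewrite ?lexx//; try lra; apply: Or44; lra|rewrite lexx|].
- by move=> s ss; apply: (@cdrect_s _ g (- r) r r r); [apply: rect; rewrite ?lexx//; try lra; apply: Or43; lra|rewrite lexx|].
rewrite (@bint_split_s _ g (- rho) rho r); [|lra| |]; last 2 first.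
- by move=> s ss; apply: (@cdrect_s _ g (- r) r (- r) (- r)); [apply: rect; rewrite ?lexx//; try lra; apply: Or44; lra|rewrite lexx|lra].
- by move=> s ss; apply: (@cdrect_s _ g (- r) r r r); [apply: rect; rewrite ?lexx//; try lra; apply: Or43; lra|rewrite lexx|lra].
rewrite (@goursat _ g (- r) (- rho)); [|lra|lra|by apply: rect; try lra; apply: Or42; lra].
rewrite (@goursat _ g rho r); [|lra|lra|by apply: rect; try lra; apply: Or41; lra].
rewrite add0r addr0.
rewrite (@bint_split_t _ g (- rho) rho (- r) (- rho)); [|lra| |]; last 2 first.
- by move=> t tt; apply: (@cdrect_t _ g (- rho) (- rho) (- r) r); [apply: rect; try lra; apply: Or42; lra|rewrite lexx|].
- by move=> t tt; apply: (@cdrect_t _ g rho rho (- r) r); [apply: rect; try lra; apply: Or41; lra|rewrite lexx|].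
rewrite (@bint_split_t _ g (- rho) rho (- rho) rho r); [|lra| |]; last 2 first.
- by move=> t tt; apply: (@cdrect_t _ g (- rho) (- rho) (- r) r); [apply: rect; try lra; apply: Or42; lra|rewrite lexx|lra].
- by move=> t tt; apply: (@cdrect_t _ g rho rho (- r) r); [apply: rect; try lra; apply: Or41; lra|rewrite lexx|lra].
rewrite (@goursat _ g (- rho) rho (- r)); [|lra|lra|by apply: rect; try lra; apply: Or44; lra].
rewrite (@goursat _ g (- rho) rho rho r); [|lra|lra|by apply: rect; try lra; apply: Or43; lra].
by rewrite add0r addr0.
Qed.

Lemma edges_punctured (g : C -> C) (rho : R) : 0 < rho -> rho <= r ->
  (forall z, z != 0 -> nrm z <= 2 * r -> exists u, cd g z u) -> edges g (- rho) rho (- rho) rho.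
Proof.
move=> p0 pr dg.
have H (s t : R) : - rho <= s <= rho -> - rho <= t <= rho -> [|| s == - rho, s == rho, t == - rho | t == rho] -> exists u, cd g (zpt s t) u.
  move=> ss tt h; apply: dg.
    apply/negP => /eqP e; have := co_pt true s t; have := co_pt false s t; rewrite e.
    have z b : co b 0 = 0 by have := @coB _ _ S b 0 0; rewrite !subrr.
    by rewrite !z => t0 s0; move: h; rewrite -t0 -s0 => /or4P[] /eqP; lra.
  apply: le_trans (nrm_pt _ _) _; have -> : 2 * r = r + r by ring.
  by apply: lerD; rewrite ler_norml; lra.
split=> x xx.
- by apply: (@cdrect_t _ g (- rho) (- rho) (- rho) rho) => //; [move=> s t ss tt; have -> : s = - rho by lra|by rewrite lexx]; apply: H; rewrite ?eqxx//; lra.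
- by apply: (@cdrect_t _ g rho rho (- rho) rho) => //; [move=> s t ss tt; have -> : s = rho by lra|by rewrite lexx]; apply: H; rewrite ?eqxx ?orbT//; lra.
- by apply: (@cdrect_s _ g (- rho) rho (- rho) (- rho)) => //; [move=> s t ss tt; have -> : t = - rho by lra|by rewrite lexx]; apply: H; rewrite ?eqxx ?orbT//; lra.
- by apply: (@cdrect_s _ g (- rho) rho rho rho) => //; [move=> s t ss tt; have -> : t = rho by lra|by rewrite lexx]; apply: H; rewrite ?eqxx ?orbT//; lra.
Qed.

(* The function [(f z - f 0 - z v) / z^2] is [o(1/z)] at [0], so its integral over the boundary of
   the square vanishes; each side contributes at least 1 to the imaginary part of the integral of [1/z]. *)
Lemma cauchy_estimate : nrm v <= 2 * M / r.
Proof.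
have r0' : 0 < r := r0.
have [->|v0] := eqVneq v 0.
  by rewrite nrm0 divr_ge0 ?(ltW r0)// mulr_ge0//; apply: le_trans (nrm_ge0 S _) (fM (z := 0) _); rewrite nrm0 mulr_ge0// ltW.
have nv0 := nrm_gt0 v0.
pose g z := (f z - (f 0 + z * v)) * (z^-1 * z^-1) * v^-1.
have dg z : z != 0 -> nrm z <= 2 * r -> exists u, cd g z u.
  move=> z0 zr; have [u du] := df zr.
  have k := cdM (cdB du (cd_affine (f 0) v z)) (cdM (cdV z0) (cdV z0)).
  have k2 := cdM k (cd_affine v^-1 0 z); eexists.
  by apply: cd_ext k2 => x; rewrite /= mulr0 addr0.
have B0 : bint g (- r) r (- r) r = 0.
  apply: (@nrm_eq0 _ _ S); apply/eqP; rewrite eq_le nrm_ge0 andbT; apply/ler_addgt0Pr => e e0; rewrite add0r.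
  (* This accuracy makes [g] at most [e / (16 * rho)] on the edges of the square of half side [rho],
     and [bint_affine] multiplies by [16 * rho]. *)
  have ev : 0 < e * nrm v / 32 by rewrite divr_gt0// mulr_gt0.
  have [de de0 hde] := dv ev.
  pose rho := Num.min r (de / 2); have p0 : 0 < rho by rewrite lt_min r0 divr_gt0.
  have pr : rho <= r by rewrite ge_min lexx.
  have pd : 2 * rho <= de by rewrite mulrC -ler_pdivlMr// ge_min lexx orbT.
  rewrite (bint_punctured p0 pr dg).
  apply: le_trans (@bint_affine _ g _ _ _ _ 0 0 0 (e / (16 * rho)) _ _ (edges_punctured p0 pr dg) _) _; [lra|lra| |].
    move=> s t ss tt h; rewrite mulr0 addr0 subr0.
    have zp : rho <= nrm (zpt s t).
      case/or4P: h => /eqP e1.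
      - by apply: le_trans (co_nrm S true _); rewrite co_pt e1 normrN ger0_norm// ltW.
      - by apply: le_trans (co_nrm S true _); rewrite co_pt e1 ger0_norm// ltW.
      - by apply: le_trans (co_nrm S false _); rewrite co_pt e1 normrN ger0_norm// ltW.
      - by apply: le_trans (co_nrm S false _); rewrite co_pt e1 ger0_norm// ltW.
    have zd : nrm (zpt s t) <= 2 * rho.
      apply: le_trans (nrm_pt _ _) _; have -> : 2 * rho = rho + rho by ring.
      by apply: lerD; rewrite ler_norml; lra.
    have n0 : 0 < nrm (zpt s t) by exact: lt_le_trans zp.
    have := hde (zpt s t) (le_trans zd pd); rewrite add0r -addrA -opprD => hh.
    rewrite /g !nrmM !nrmV; set n := nrm (zpt s t) in n0 zp zd hh *; set w := nrm v in nv0 hh *.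
    apply: (@le_trans _ _ (e * w / 32 * n * (n^-1 * n^-1) * w^-1)).
      apply: ler_wpM2r; first by rewrite invr_ge0 ltW.
      by apply: ler_wpM2r => //; rewrite mulr_ge0// invr_ge0 ltW.
    rewrite (_ : _ * _ = e / (32 * n)); last by field; rewrite !gt_eqF.
    rewrite ler_pM2l// lef_pV2 ?posrE ?mulr_gt0//.
    have : 16 * rho <= 16 * n by rewrite ler_pM2l.
    lra.
  rewrite (_ : 4 * _ = e); first by [].
  by field; rewrite gt_eqF.
pose et z := (f z - f 0) * (z^-1 * z^-1) * v^-1.
(* On the boundary [g] is within [K] of [- z^-1]. Along each edge the relevant coordinate of [z^-1]
   has a constant sign and absolute value at least [1 / (2 * r)], so the vanishing of the integral
   forces [K] to be at least that large, which is the estimate. *)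
pose K := M / (r ^+ 2 * nrm v).
have gE z : z != 0 -> g z = et z - z^-1 by move=> z0; rewrite /g /et; field; rewrite z0 v0.
have side (s t : R) b : - r <= s <= r -> - r <= t <= r -> [|| s == - r, s == r, t == - r | t == r] ->
  [/\ `|co b (g (zpt s t)) + co b (zpt s t)^-1| <= K, (zpt s t)^-1 = zpt (s / (s ^+ 2 + t ^+ 2)) (- t / (s ^+ 2 + t ^+ 2)),
     0 < s ^+ 2 + t ^+ 2 & s ^+ 2 + t ^+ 2 <= 2 * r ^+ 2].
  move=> ss tt h.
  have r2 : 0 < r ^+ 2 by rewrite exprn_gt0.
  have s2 : s ^+ 2 <= r ^+ 2 by rewrite !expr2; nra.
  have t2 : t ^+ 2 <= r ^+ 2 by rewrite !expr2; nra.
  have st0 : 0 < s ^+ 2 + t ^+ 2.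
    have := sqr_ge0 s; have := sqr_ge0 t.
    by case/or4P: h => /eqP e1; rewrite e1 ?sqrrN; lra.
  have zp : r <= nrm (zpt s t).
    case/or4P: h => /eqP e1.
    - by apply: le_trans (co_nrm S true _); rewrite co_pt e1 normrN ger0_norm// ltW.
    - by apply: le_trans (co_nrm S true _); rewrite co_pt e1 ger0_norm// ltW.
    - by apply: le_trans (co_nrm S false _); rewrite co_pt e1 normrN ger0_norm// ltW.
    - by apply: le_trans (co_nrm S false _); rewrite co_pt e1 ger0_norm// ltW.
  have z0 : zpt s t != 0 by apply/negP => /eqP e1; move: zp; rewrite e1 nrm0 leNgt r0.
  have zr : nrm (zpt s t) <= 2 * r.
    apply: le_trans (nrm_pt _ _) _; have -> : 2 * r = r + r by ring.
    by apply: lerD; rewrite ler_norml; lra.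
  split => //; [|by rewrite ptV ?gt_eqF|lra].
  rewrite -(co_add S) gE// subrK; apply: le_trans (co_nrm _ _ _) _.
  rewrite /et !nrmM !nrmV; set n := nrm (zpt s t) in zp *.
  have n0 : 0 < n by exact: lt_le_trans zp.
  have -> : K = M * (r^-1 * r^-1) * (nrm v)^-1 by rewrite /K; field; rewrite !gt_eqF.
  apply: ler_wpM2r; first by rewrite invr_ge0 ltW.
  apply: ler_pM; rewrite ?nrm_ge0 ?mulr_ge0 ?invr_ge0 ?(ltW n0)//; first exact: fM.
  by apply: ler_pM; rewrite ?invr_ge0 ?(ltW n0)//; rewrite lef_pV2.
have [e1 e2 e3 e4] := edges_punctured r0 (lexx r) dg.
have rr : - r <= r by lra.
have inv2 (x D : R) : 0 < D -> D <= 2 * r ^+ 2 -> x = r -> 1 / (2 * r) <= x / D.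
  move=> D0 D2 ->; rewrite ler_pdivlMr// mul1r ler_pdivrMl ?mulr_gt0//; by rewrite expr2 in D2; lra.
have sE : 1 / (2 * r) * (r - - r) = 1 by field; rewrite gt_eqF.
have [xL hL qL] := isinc_mvt true (incP rr e1) rr; have [xR hR qR] := isinc_mvt true (incP rr e2) rr.
have [xB hB qB] := isinc_mvt false (incP rr e3) rr; have [xT hT qT] := isinc_mvt false (incP rr e4) rr.
have rin : - r <= r <= r by lra.
have nin : - r <= - r <= r by lra.
have [bL iL pL uL] := side (- r) xL true nin hL ltac:(by rewrite eqxx).
have [bR iR pR uR] := side r xR true rin hR ltac:(by rewrite eqxx orbT).
have [bB iB pB uB] := side xB (- r) false hB nin ltac:(by rewrite eqxx !orbT).
have [bT iT pT uT] := side xT r false hT rin ltac:(by rewrite eqxx !orbT).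
have cpt x y : co true (zpt x y) = x := co_pt true x y.
have cpf x y : co false (zpt x y) = y := co_pt false x y.
rewrite iL cpt in bL; rewrite iR cpt in bR; rewrite iB cpf opprK in bB; rewrite iT cpf in bT.
cbv beta in qL, qR, qB, qT.
have cii z : co false (ii * z) = co true z.
  by case: z => x y; rewrite -[LHS]/(0 * y + 1 * x) mul0r mul1r add0r.
have z0 : co false 0 = 0 by have := @coB _ _ S false 0 0; rewrite !subrr.
have := congr1 (co false) B0; rewrite z0 /bint (co_add S) cii !coB qL qR qB qT.
have kL := inv2 r _ pL uL erefl; have kR := inv2 r _ pR uR erefl.
have kB := inv2 r _ pB uB erefl; have kT := inv2 r _ pT uT erefl.
move: bL bR bB bT kL kR kB kT; rewrite !mulNr.
set DL := r / _; set DR := r / _; set DB := r / _; set DT := r / _.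
set gL := co true (g (zpt (- r) xL)); set gR := co true (g (zpt r xR)).
set gB := co false (g (zpt xB (- r))); set gT := co false (g (zpt xT r)).
move: gL gR gB gT => gL gR gB gT bL bR bB bT kL kR kB kT eq0.
have d0 : 0 < r - - r by lra.
have eq1 : gR - gL + (gB - gT) = 0.
  by apply: (mulIf (lt0r_neq0 d0)); rewrite mul0r -[RHS]eq0; ring.
have K2 : 1 / (2 * r) <= K.
  clear -bL bR bB bT kL kR kB kT eq1.
  move: bL bR bB bT kL kR kB kT eq1; move: DL DR DB DT (1 / (2 * r)) (K) => DL DR DB DT k K'; rewrite !ler_norml => bL bR bB bT *.
  by move: bL bR bB bT => /andP[? ?] /andP[? ?] /andP[? ?] /andP[? ?]; lra.
move: K2; rewrite /K ler_pdivrMr ?mulr_gt0// => K2.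
rewrite ler_pdivlMr// mulrC.
have := K2; rewrite (_ : M / _ * _ = M * 2 / (r * nrm v)); last by field; rewrite !gt_eqF.
rewrite ler_pdivlMr ?mulr_gt0// mul1r; lra.
Qed.
End Estimate.
End Cauchy.

(** * Holomorphic functions of several variables *)

Section Hol.
Context {R : realType} {d : nat}.
Local Notation C := (Cnum R).
Local Notation S := (@complexS R).
Local Notation nrm := (nrm S).
Local Notation nv := (nv S).
Local Notation iota := (iota S).
Local Notation co := (co S).
Local Notation V := 'rV[C]_d.
Local Notation ej j := (delta_mx 0 j : V).
Variable U : set V.
Hypothesis Uop : forall x, U x -> exists2 de : R, 0 < de & forall y, nv (y - x) <= de -> U y.

(** Continuity with complex partial derivatives is a form of holomorphy that reproduces itself under
    differentiation, as [hol_closed] shows. *)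
Definition hol (f : V -> C) (D : 'I_d -> V -> C) :=
  forall x, U x -> contv S f x /\ forall j, pd S f j x (D j x).

Lemma pd_slice f j (x : V) (z u : C) : pd S f j (x + z *: ej j) u -> cd (fun z => f (x + z *: ej j)) z u.
Proof.
move=> h eps eps0; have [de de0 hde] := h _ eps0; exists de => // k /hde.
by rewrite scalerDl addrA.
Qed.

Lemma nv_ej j (z : C) : nv (z *: ej j) = nrm z.
Proof.
apply/eqP; rewrite eq_le; apply/andP; split.
  apply: nv_le => [|i]; first exact: nrm_ge0.
  rewrite !mxE eqxx andTb; case: (i == j); first by rewrite mulr1.
  by rewrite mulr0; apply: le_trans (nrm_ge0 S z); rewrite le_eqVlt; apply/orP; left; apply/eqP; exact: nrm0.
by apply: le_trans (le_nv _ _ j); rewrite !mxE !eqxx mulr1.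
Qed.

Lemma hol_shiftB f D (k : V) (U' : set V) : hol f D -> (forall x, U' x -> U x /\ U (x + k)) ->
  forall x, U' x -> contv S (fun y => f (y + k) - f y) x /\ forall j, pd S (fun y => f (y + k) - f y) j x (D j (x + k) - D j x).
Proof.
move=> hf hU' x /hU'[Ux Uk]; have [c1 p1] := hf _ Ux; have [c2 p2] := hf _ Uk; split=> [eps eps0|j eps eps0].
all: have e2 : 0 < eps / 2 by rewrite divr_gt0.
- have [d1 d10 h1] := c1 _ e2; have [d2 d20 h2] := c2 _ e2.
  exists (Num.min d1 d2) => [|y]; first by rewrite lt_min d10.
  rewrite le_min => /andP[k1 k2].
  have b2 := h2 (y + k); rewrite opprD addrACA subrr addr0 in b2.
  rewrite (_ : _ - _ = (f (y + k) - f (x + k)) - (f y - f x)); last by ring.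
  by rewrite [eps]splitr; exact: nrmBl (b2 k2) (h1 _ k1).
- have [d1 d10 h1] := p1 j _ e2; have [d2 d20 h2] := p2 j _ e2.
  exists (Num.min d1 d2) => [|h]; first by rewrite lt_min d10.
  rewrite le_min => /andP[k1 k2].
  have b2 := h2 h k2; rewrite (addrAC x) in b2.
  rewrite (_ : _ - _ - _ = (f (x + h *: ej j + k) - f (x + k) - h * D j (x + k)) - (f (x + h *: ej j) - f x - h * D j x)); last by ring.
  by rewrite [eps]splitr mulrDl; exact: nrmBl b2 (h1 _ k1).
Qed.

Lemma nv_trans (x y z : V) (a b : R) : nv (x - y) <= a -> nv (y - z) <= b -> nv (x - z) <= a + b.
Proof.
by move=> h1 h2; rewrite -(subrK y x) -addrA; apply: le_trans (nvD _ _ _) _; exact: lerD.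
Qed.

Lemma hol_unif f D (x0 : V) (rho : R) (eps : R) : hol f D -> (forall y, nv (y - x0) <= rho -> U y) -> 0 < eps ->
  exists2 eta : R, 0 < eta & forall y z, nv (y - x0) <= rho -> nv (z - x0) <= rho -> nv (z - y) <= eta -> nrm (f z - f y) <= eps.
Proof.
move=> hf hU eps0.
have [y yr|eta eta0 h] := @contv_unif _ _ S d rho (fun y => f (x0 + y)) eps _ eps0.
  have Uy : U (x0 + y) by apply: hU; rewrite addrC addKr.
  have [c _] := hf _ Uy.
  by move=> e e0; have [de de0 hd] := c e e0; exists de => // y' hy; apply: hd; rewrite opprD addrACA subrr add0r.
exists eta => // y z yr zr zy; have := h (y - x0) (z - x0) yr zr; rewrite opprB addrA subrK => /(_ zy).
by rewrite ![x0 + _]addrC !subrK.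
Qed.

(** [D j x - D j x0] is the derivative at 0 of a slice of [f (y + (x - x0)) - f y], which is small
    by uniform continuity of [f]; Cauchy's estimate passes the smallness to the derivative. *)
Lemma hol_deriv_cont f D j x0 : hol f D -> U x0 -> contv S (D j) x0.
Proof.
move=> hf Ux eps eps0; have [rho rho0 hU] := Uop Ux.
pose r := rho / 4; have r0 : 0 < r by rewrite divr_gt0.
have rE : rho = 4 * r by rewrite /r; field.
have e' : 0 < eps * r / 4 by rewrite divr_gt0// mulr_gt0.
have [eta eta0 h] := hol_unif hf hU e'.
exists (Num.min eta r) => // [|x]; first by rewrite lt_min eta0.
rewrite le_min => /andP[k1 k2].
have bx y : nv (y - x0) <= 2 * r -> nv (y - x0) <= rho /\ nv (y + (x - x0) - x0) <= rho.
  move=> yr; split; first by apply: le_trans yr _; rewrite rE; lra.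
  apply: (@le_trans _ _ (r + 2 * r)); last by rewrite rE; lra.
  apply: (@nv_trans _ y) => //; by rewrite addrC addKr.
have hs := @hol_shiftB f D (x - x0) [set y | nv (y - x0) <= 2 * r] hf (fun y hy => conj (hU _ (bx y hy).1) (hU _ (bx y hy).2)).
have xx : x0 + (x - x0) = x by rewrite addrC subrK.
rewrite -{1}xx.
have hs' z : nrm z <= 2 * r -> nv (x0 + z *: ej j - x0) <= 2 * r by move=> zr; rewrite addrC addKr nv_ej.
have -> : eps = 2 * (eps * r / 4 + eps * r / 4) / r by field; rewrite gt_eqF.
have gM y : nv (y - x0) <= 2 * r -> nrm (f (y + (x - x0)) - f y) <= eps * r / 4.
  by move=> /bx[y1 y2]; apply: h => //; rewrite addrC addKr.
apply: (@cauchy_estimate _ (fun z => f (x0 + z *: ej j + (x - x0)) - f (x0 + z *: ej j))) => //.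
- by move=> z zr; have [_ /(_ j) p] := hs _ (hs' z zr); eexists; exact: (pd_slice (f := fun y => f (y + (x - x0)) - f y) p).
- by move=> z zr; apply: nrmBl; apply: gM; apply: hs' => //; rewrite nrm0 mulr_ge0// ltW.
- apply: (pd_slice (f := fun y => f (y + (x - x0)) - f y)); rewrite scale0r addr0; apply: (hs _ _).2.
  by rewrite /= subrr nv0 mulr_ge0// ltW.
Qed.

(** The derivative is integrated along the segment and compared with the constant [u]; the 2 again
    counts real coordinates. *)
Lemma hol_mean f D j (x : V) (h u : C) (E : R) : hol f D -> (forall t : R, 0 <= t <= 1 -> U (x + (iota t * h) *: ej j)) ->
  (forall t : R, 0 <= t <= 1 -> nrm (D j (x + (iota t * h) *: ej j) - u) <= E) ->
  nrm (f (x + h *: ej j) - f x - h * u) <= 2 * E * nrm h.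
Proof.
move=> hf hU hE.
have i1 : isinc (fun t => h * D j (x + (iota t * h) *: ej j)) 0 1 (f (x + h *: ej j) - f x).
  exists (fun t => f (x + (iota t * h) *: ej j)) => [c t tt|]; last by rewrite rmorph0 rmorph1 mul0r mul1r scale0r addr0.
  apply: is_derive_eps => eps eps0.
  have [_ /(_ j)/pd_slice p] := hf _ (hU t tt).
  have n1 : 0 < nrm h + 1 by rewrite ltr_wpDl ?nrm_ge0.
  have e' : 0 < eps / (nrm h + 1) by rewrite divr_gt0.
  have [de de0 hde] := p _ e'; exists (de / (nrm h + 1)) => [|k kk]; first by rewrite divr_gt0.
  have nk : nrm (iota k * h) = `|k| * nrm h by rewrite nrmM nrm_iota.
  have := hde (iota k * h); rewrite nk => H.
  rewrite -(co_scale S) -!coB; apply: le_trans (co_nrm _ _ _) _.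
  rewrite rmorphD mulrDl mulrA; apply: le_trans (H _) _.
    move: kk; rewrite ler_pdivlMr// => kk; apply: le_trans kk; apply: ler_wpM2l => //; lra.
  rewrite -mulrA ler_wpM2l ?(ltW eps0)// mulrC ler_pdivrMr//.
  by rewrite ler_wpM2l// lerDl.
have i2 := isinc_affine (h * u) 0 0 1.
have := isinc_close (E := nrm h * E) i1 i2 ler01.
rewrite mul0r addr0 subr0 rmorph1 !mulr1 => H.
rewrite -mulrA [E * _]mulrC; apply: H => t tt.
by rewrite mulr0 addr0 -mulrBr nrmM ler_wpM2l ?nrm_ge0 ?hE.
Qed.

(** Uniformity in the base point comes from the continuity of [D i]. It is this uniform convergence
    that Cauchy's estimate converts into convergence of derivatives. *)
Lemma hol_quotient f D i (x0 : V) (r eps : R) : hol f D -> 0 < r -> (forall y, nv (y - x0) <= 4 * r -> U y) -> 0 < eps ->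
  exists2 eta : R, 0 < eta & forall y h, nv (y - x0) <= 2 * r -> nrm h <= eta -> nrm (f (y + h *: ej i) - f y - h * D i y) <= eps * nrm h.
Proof.
move=> hf r0 hU eps0; have e2 : 0 < eps / 2 by rewrite divr_gt0.
have [y yr|eta eta0 he] := @contv_unif _ _ S d (3 * r) (fun y => D i (x0 + y)) (eps / 2) _ e2.
  have c := @hol_deriv_cont f D i (x0 + y) hf (hU (x0 + y) _).
  have c' : contv S (D i) (x0 + y) by apply: c; rewrite addrC addKr; apply: le_trans yr _; rewrite ler_pM2r// ler_nat.
  by move=> e e0; have [de de0 hd] := c' e e0; exists de => // y' hy; apply: hd; rewrite opprD addrACA subrr add0r.
exists (Num.min eta r) => [|y h yr]; first by rewrite lt_min eta0.
rewrite le_min => /andP[h1 h2].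
have nt (t : R) : 0 <= t <= 1 -> nrm (iota t * h) <= nrm h.
  by move=> /andP[t0 t1]; rewrite nrmM nrm_iota ger0_norm// ler_piMl ?nrm_ge0.
have bt (t : R) : 0 <= t <= 1 -> nv (y + (iota t * h) *: ej i - x0) <= 3 * r.
  move=> tt; have -> : 3 * r = r + 2 * r by ring.
  apply: (@nv_trans _ y) => //; rewrite addrC addKr nv_ej; exact: le_trans (nt t tt) h2.
have := @hol_mean f D i y h (D i y) (eps / 2) hf; rewrite [2 * _]mulrC divfK ?pnatr_eq0//; apply=> t tt.
  by apply: hU; apply: le_trans (bt t tt) _; rewrite ler_pM2r// ler_nat.
have y3 : nv (y - x0) <= 3 * r by apply: le_trans yr _; rewrite ler_pM2r// ler_nat.
have := he (y - x0) (y + (iota t * h) *: ej i - x0) y3 (bt t tt); rewrite opprB addrA subrK [y + _]addrC addrK nv_ej.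
move=> /(_ (le_trans (nt t tt) h1)).
by rewrite ![x0 + _]addrC !subrK [_ + y]addrC.
Qed.

(* The difference quotients of [f] in direction [i] converge uniformly to [D i], so by Cauchy's
   estimate their derivatives in direction [j] form a Cauchy family. *)
Lemma hol_deriv_pd f D i j (x0 : V) : hol f D -> U x0 -> exists v, pd S (D j) i x0 v.
Proof.
move=> hf Ux; have [rho rho0 hU'] := Uop Ux.
pose r := rho / 4; have r0 : 0 < r by rewrite divr_gt0.
have hU y : nv (y - x0) <= 4 * r -> U y by move=> h; apply: hU'; apply: le_trans h _; rewrite /r mulrC divfK.
pose Q (h : C) := h^-1 * (D j (x0 + h *: ej i) - D j x0).
have cauchy (eps : R) : 0 < eps -> exists2 eta : R, 0 < eta & forall h k : C, h != 0 -> k != 0 -> nrm h <= eta -> nrm k <= eta -> nrm (Q h - Q k) <= eps.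
  move=> eps0; have e' : 0 < eps * r / 8 by rewrite divr_gt0// mulr_gt0.
  have [eta eta0 he] := hol_quotient i hf r0 hU e'.
  exists (Num.min eta r) => [|h k h0 k0]; first by rewrite lt_min eta0.
  rewrite !le_min => /andP[h1 h2] /andP[k1 k2].
  have bU y : nv (y - x0) <= 2 * r -> forall z, nrm z <= r -> U (y + z *: ej i).
    move=> yr z zr; apply: hU; apply: (@le_trans _ _ (r + 2 * r)); last by have := r0; lra.
    by apply: (@nv_trans _ y) => //; rewrite addrC addKr nv_ej.
  have bU0 y : nv (y - x0) <= 2 * r -> U y by move=> yr; apply: hU; apply: le_trans yr _; rewrite ler_pM2r// ler_nat.
  pose B := [set y : V | nv (y - x0) <= 2 * r].
  have sh z : nrm z <= r -> _ := fun zr => @hol_shiftB f D (z *: ej i) B hf (fun y hy => conj (bU0 y hy) (bU y hy z zr)).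
  pose g y := (f (y + h *: ej i) - f y) * h^-1 - (f (y + k *: ej i) - f y) * k^-1.
  have gM y : B y -> nrm (g y) <= eps * r / 8 + eps * r / 8.
    move=> yr; rewrite (_ : g y = (f (y + h *: ej i) - f y - h * D i y) * h^-1 - (f (y + k *: ej i) - f y - k * D i y) * k^-1); last first.
      by rewrite /g; field; rewrite h0 k0.
    have aux z : z != 0 -> nrm z <= eta -> nrm ((f (y + z *: ej i) - f y - z * D i y) * z^-1) <= eps * r / 8.
      by move=> z0 ze; rewrite nrmM nrmV ler_pdivrMr ?nrm_gt0//; exact: he.
    by apply: nrmBl; exact: aux.
  have dg (z : C) : nrm z <= 2 * r -> cd (fun z => g (x0 + z *: ej j)) z
      ((D j (x0 + z *: ej j + h *: ej i) - D j (x0 + z *: ej j)) * h^-1 - (D j (x0 + z *: ej j + k *: ej i) - D j (x0 + z *: ej j)) * k^-1).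
    move=> zr; have By : B (x0 + z *: ej j) by rewrite /B /= addrC addKr nv_ej.
    have s1 := pd_slice ((sh h h2 _ By).2 j); have s2 := pd_slice ((sh k k2 _ By).2 j).
    have c1 := cdM s1 (cd_affine h^-1 0 z); have c2 := cdM s2 (cd_affine k^-1 0 z).
    have := cdB c1 c2; rewrite !mulr0 !addr0 => c; apply: cd_ext c => w; by rewrite /g !mulr0 !addr0.
  have z2 : nrm (0 : C) <= 2 * r by rewrite nrm0 mulr_ge0// ltW.
  have dg0 := dg 0 z2; rewrite scale0r addr0 in dg0.
  have -> : eps = 2 * ((eps * r / 8 + eps * r / 8) + (eps * r / 8 + eps * r / 8)) / r by field; rewrite gt_eqF.
  rewrite /Q ![_^-1 * _]mulrC; apply: (@cauchy_estimate _ (fun z => g (x0 + z *: ej j))) => //.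
  - by move=> z zr; eexists; exact: dg.
  - by move=> z zr; apply: nrmBl; apply: gM; rewrite /B /= addrC addKr nv_ej.
have /choice[et het] : forall n : nat, exists eta : R, 0 < eta /\ forall h k : C, h != 0 -> k != 0 -> nrm h <= eta -> nrm k <= eta -> nrm (Q h - Q k) <= 1 / 2 ^+ n.
  by move=> n; have [|eta eta0 h] := cauchy (1 / 2 ^+ n); [rewrite divr_gt0// exprn_gt0|exists eta].
(* Increments decrease along the Cauchy moduli, so that the quotients [Q] converge at the rate asked
   by [nrm_complete]. *)
pose hn := fix hn n : R := if n is m.+1 then Num.min (hn m) (et m.+1) else et 0%N.
have hn0 n : 0 < hn n by elim: n => [|n ih] /=; [exact: (het 0).1|rewrite lt_min ih (het _).1].
have hnle n : hn n <= et n by case: n => [|n] //=; rewrite ge_min lexx orbT.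
have hnS n : hn n.+1 <= hn n by rewrite /= ge_min lexx.
have nh n : nrm (iota (hn n)) = hn n by rewrite nrm_iota ger0_norm// ltW.
have ih0 n : iota (hn n) != 0 by rewrite fmorph_eq0 gt_eqF.
have [|v hv] := @nrm_complete _ _ S (fun n => Q (iota (hn n))) 1.
  move=> n; apply: (het n).2; rewrite ?nh//; exact: le_trans (hnS n) (hnle n).
exists v => eps eps0.
pose cB : R := #|BB S|%:R * (2 * 1) + 1.
have cB0 : 0 <= #|BB S|%:R * (2 * 1) :> R by rewrite mulr1 mulr_ge0// ler0n.
have cB1 : 0 < cB by rewrite /cB ltr_wpDl.
have [n hn2] := exp2_large (cB / eps).
exists (hn n) => // h hh.
have [->|h0] := eqVneq h 0; first by rewrite scale0r addr0 subrr mul0r subrr nrm0 mulr0.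
rewrite (_ : _ - _ = h * (Q h - v)); last by rewrite /Q mulrBr mulVKf.
rewrite nrmM mulrC ler_wpM2r ?nrm_ge0//.
rewrite (_ : Q h - v = (Q h - Q (iota (hn n))) - (v - Q (iota (hn n)))); last by ring.
have q1 : nrm (Q h - Q (iota (hn n))) <= 1 / 2 ^+ n by apply: (het n).2; rewrite ?nh// (le_trans hh).
apply: le_trans (nrmBl q1 (hv n)) _; rewrite -mulrDl [1 + _]addrC -/cB.
have p2 : (0 : R) < 2 ^+ n by rewrite exprn_gt0.
by rewrite ler_pdivrMr// -ler_pdivrMl// mulrC.
Qed.

Lemma hol_closed f D : hol f D -> exists E : 'I_d -> 'I_d -> V -> C, forall j, hol (D j) (E j).
Proof.
move=> hf.
have /choice[E hE] : forall ijx : 'I_d * 'I_d * V, exists v, U ijx.2 -> pd S (D ijx.1.1) ijx.1.2 ijx.2 v.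
  move=> [[j i] x] /=; have [Ux|nU] := pselect (U x); last by exists 0.
  by have [v hv] := hol_deriv_pd i j hf Ux; exists v.
exists (fun j i x => E (j, i, x)) => j x Ux; split; first exact: hol_deriv_cont hf Ux.
by move=> i; exact: (hE (j, i, x)).
Qed.
End Hol.

(** * The complex case *)

Section ComplexCase.
Context {R : realType} {d : nat}.
Local Notation C := (Cnum R).
Local Notation S := (@complexS R).
Local Notation nrm := (nrm S).
Local Notation nv := (nv S).
Local Notation V := 'rV[C]_d.
Variable U : set V.

Lemma pd_derivable (f : V -> V) j x (v : 'I_d -> C) : (forall l, pd S (fun y => f y 0 l) j x (v l)) ->
  derivable f x (unit_dir j).
Proof.
move=> h; apply: (cvgP (\row_l v l)) => A /(nbhs_nv S)[eps eps0 hA].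
have /choice[de hde] : forall l, exists de : R, 0 < de /\ forall h : C, nrm h <= de ->
    nrm (f (x + h *: delta_mx 0 j) 0 l - f x 0 l - h * v l) <= eps * nrm h.
  by move=> l; have [de de0 hd] := h l _ eps0; exists de.
pose m := \big[Num.min/1]_l de l.
have m0 : 0 < m by rewrite /m; elim/big_ind: _ => // [a b a0 b0|l _]; [rewrite lt_min a0|exact: (hde l).1].
exists (iota S m); first exact: (iota_gt0 S m0).
move=> k kb k0; have kb' : `|0 - k| < iota S m := kb.
rewrite sub0r normrN (normE S) in kb'.
change (A (k^-1 *: ((f \o shift x) (k *: unit_dir j) - f x))); apply: hA.
have km : nrm k <= m by move: (ltW kb'); rewrite iota_le.
have nk : 0 < nrm k by exact: nrm_gt0.
apply: nv_le => [|l]; first exact: ltW.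
have kl : nrm k <= de l by apply: le_trans km _; exact: bigmin_le_cond.
have H := (hde l).2 k kl; rewrite !mxE.
rewrite (_ : _ - v l = k^-1 * (f (x + k *: delta_mx 0 j) 0 l - f x 0 l - k * v l)).
  by rewrite nrmM nrmV mulrC ler_pdivrMr.
by rewrite [RHS]mulrBr mulKf//= [k *: _ + x]addrC.
Qed.

Definition vhol (f : V -> V) := forall l, hol U (fun y => f y 0 l) (fun j y => pderiv j f y 0 l).

Lemma holomorphic_vhol f : holomorphic_on U f -> vhol f.
Proof.
move=> hf l x Ux; have df := hf x Ux; split.
  by apply: continuous_contv; exact: differentiable_continuous.
by move=> j; apply: derivable_pd; exact: diff_derivable.
Qed.

Hypothesis Uop : open U.

(** [hol_closed] only asserts that second partial derivatives exist for each component;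
    [pd_derivable] assembles them into derivability of the vector, which identifies them with the
    values of [pderiv]. *)
Lemma vhol_pderiv f j : vhol f -> vhol (pderiv j f).
Proof.
move=> hf.
have Uo x : U x -> exists2 de : R, 0 < de & forall y, nv (y - x) <= de -> U y.
  by move=> Ux; apply/(nbhs_nv S); exact: open_nbhs_nbhs.
have /choice[E hE] : forall l, exists E : 'I_d -> V -> C, hol U (fun y => pderiv j f y 0 l) E.
  by move=> l; have [E hE] := hol_closed Uo (hf l); exists (E j); exact: hE.
move=> l x Ux; split; first exact: (hE l x Ux).1.
move=> i; apply: derivable_pd; apply: (@pd_derivable _ _ _ (fun l => E l i x)) => l'.
exact: (hE l' x Ux).2.
Qed.

Lemma vhol_multi f be : vhol f -> vhol (multi_deriv be f).
Proof.
have it n i g : vhol g -> vhol (iter n (pderiv i) g).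
  by elim: n => [h|n ih h]; [exact: h|rewrite iterS; apply: vhol_pderiv; exact: (ih h)].
by move=> hf; rewrite /multi_deriv; elim: (enum _) => [|i s ih]; [exact: hf|exact: (it (be i) i _ ih)].
Qed.
End ComplexCase.

Theorem complex_case (R : realType) (dT : measure_display) (T : measurableType dT)
    (P : probability T R) (q d : nat) (U : set 'rV[Cnum R]_d) (F : T -> 'rV[Cnum R]_d -> 'rV[Cnum R]_d) :
  open U -> gaussian_field_C P U F -> {ae P, forall w, holomorphic_on U (F w)} ->
  (forall x, U x -> nondegenerate_vec P (fun ajb : multi_index d q.+1 * 'I_d * bool =>
             fun w => re_im ajb.2 (multi_deriv (mi_fun ajb.1.1) (F w) x 0 ajb.1.2))) ->
  forall K : set 'rV[Cnum R]_d, compact K -> K `<=` U -> (\int[P]_w (nzeros (R := R) (F w) K ^+ q.+1) < +oo)%E.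
Proof.
move=> Uo gF [N [mN PN hN]] nd K cK KU.
pose Ft w : 'rV[Cnum R]_d -> 'rV[Cnum R]_d := if w \in N then fun=> 0 else F w.
have hF w : holomorphic_on U (Ft w).
  rewrite /Ft; case: (boolP (w \in N)) => [_|wN]; first by move=> x _; exact: differentiable_cst.
  by apply: contrapT => h; move: wN; rewrite notin_setE; apply; exact: hN.
have hb w be := vhol_multi Uo be (holomorphic_vhol (hF w)).
apply: (@global_bound _ T R P (Cnum R) (@complexS R) d q U F (fun w be x l => multi_deriv be (Ft w) x 0 l) N Uo mN PN _ _ _ _
  (fun x i w => re_im i.2 (multi_deriv (mi_fun i.1.1) (F w) x 0 i.1.2)) _ _ K cK KU).
- by move=> n x j b c hx; exact: (gF n x j b c hx).
- by move=> w x l Ux; rewrite multi_deriv0 /Ft; case: ifP => // _; rewrite mxE.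
- by move=> w be l x bq Ux; exact: (hb w be l x Ux).1.
- by move=> w be j l x bq hbe Ux; rewrite (multi_deriv_incr _ hbe); exact: (hb w be l x Ux).2.
- by move=> x i w Ux Nw; rewrite /Ft memNset.
- exact: nd.
Qed.

Theorem theorem1 (R : realType) (dT : measure_display) (T : measurableType dT)
    (P : probability T R) (p d : nat) (hp : (0 < p)%N) (hd : (0 < d)%N) :
  (* real case *)
  (forall (U : set 'rV[R]_d) (F : T -> 'rV[R]_d -> 'rV[R]_d),
     open U ->
     gaussian_field_R P U F ->
     {ae P, forall w, is_Ck p U (F w)} ->
     (forall x, U x ->
        nondegenerate_vec P
          (fun aj : multi_index d p * 'I_d =>
             fun w => multi_deriv (mi_fun aj.1) (F w) x 0 aj.2)) ->
     forall K : set 'rV[R]_d, compact K -> K `<=` U ->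
       (\int[P]_w (nzeros (R := R) (F w) K ^+ p) < +oo)%E)
  /\
  (* complex case *)
  (forall (U : set 'rV[Cnum R]_d) (F : T -> 'rV[Cnum R]_d -> 'rV[Cnum R]_d),
     open U ->
     gaussian_field_C P U F ->
     {ae P, forall w, holomorphic_on U (F w)} ->
     (forall x, U x ->
        nondegenerate_vec P
          (fun ajb : multi_index d p * 'I_d * bool =>
             fun w => re_im ajb.2 (multi_deriv (mi_fun ajb.1.1) (F w) x 0 ajb.1.2))) ->
     forall K : set 'rV[Cnum R]_d, compact K -> K `<=` U ->
       (\int[P]_w (nzeros (R := R) (F w) K ^+ p) < +oo)%E).
Proof.
case: p hp => // q _; split=> U F; [exact: real_case|exact: complex_case].
Qed.
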